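(* Let $T\in Path(\mu^-,\mu^+)$ be a stair-shaped transport path, where $\mu^-=\sum_{i=1}^M m_i'\delta_{x_i}$ and $\mu^+=\sum_{j=1}^N m_j\delta_{y_j}$ are finite atomic measures of equal mass on $X$, $M,N\in\mathbb{N}\cup\{\infty\}$. Then there exist decompositions $$\mu^-=\mu_1^-+\mu_2^-,\qquad \mu^+=\mu_1^++\mu_2^+,\qquad T=T_1+T_2$$ such that: (a) for each $i=1,2$, $T_i$ is a subcurrent of $T$ and $T_i\in Path(\mu_i^-,\mu_i^+)$; (b) there exist transport maps $\varphi\in Map(\mu_1^-,\mu_1^+)$ and $\psi\in Map(\mu_2^+,\mu_2^-)$ such that both $(T_1,\varphi)$ and $(-T_2,\psi)$ are compatible.
   Context: $X\subset\mathbb{R}^m$ is compact and convex. $x_i\in X$ are pairwise distinct, $y_j\in X$ are pairwise distinct, $m_i',m_j>0$, and $\sum_{i=1}^M m_i'=\sum_{j=1}^N m_j<\infty$. A rectifiable 1-current $T=\underline{\underline{\tau}}(W,\theta,\xi)$ in $\mathbb{R}^m$ is $T(\omega)=\int_W\langle\omega(x),\xi(x)\rangle\theta(x)\,d\mathcal{H}^1(x)$ for smooth compactly supported 1-forms $\omega$, where $W$ is $\mathcal{H}^1$-measurable and countably 1-rectifiable, $\theta>0$ is locally $\mathcal{H}^1$-integrable, and $\xi$ is an $\mathcal{H}^1$-measurable unit vector field spanning the approximate tangent line of $W$ a.e. Its boundary is $\partial T(f)=T(df)$, and $\mathbf{M}$ denotes mass. $T$ is normal if $\mathbf{M}(T)+\mathbf{M}(\partial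 T)<\infty$. $S$ is a subcurrent of $T$ if $\mathbf{M}(T-S)+\mathbf{M}(S)=\mathbf{M}(T)$. For finite measures $\mu,\nu$ on $X$ of equal mass: $Path(\mu,\nu)$ is the set of rectifiable 1-currents $T$ with $\partial T=\nu-\mu$ (transport paths); $Map(\mu,\nu)$ is the set of maps $\varphi$ with $\varphi_\#\mu=\nu$; $Plan(\mu,\nu)$ is the set of Borel measures on $X\times X$ with marginals $\mu$ and $\nu$. $\Gamma$ is the space of 1-Lipschitz curves $\gamma:[0,\infty)\to\mathbb{R}^m$ that are eventually constant; $p_0(\gamma)=\gamma(0)$, $p_\infty(\gamma)=\lim_{t\to\infty}\gamma(t)$. With $t_0(\gamma)=\sup\{t:\gamma\text{ constant on }[0,t]\}$ and $t_\infty(\gamma)=\inf\{t:\gamma\text{ constant on }[t,\infty)\}$, $\gamma$ is simple if $\gamma(s)\ne\gamma(t)$ for all $t_0(\gamma)\le s<t\le t_\infty(\gamma)$. For simple $\gamma$, $I_\gamma=\underline{\underline{\tau}}(\mathrm{Im}(\gamma),\gamma'/|\gamma'|,1)$ is the unit-multiplicity 1-current carried by the image of $\gamma$, oriented by $\gamma$. $\Gamma_{x,y}=\{\gamma\in\Gamma:p_0(\gamma)=x,\ p_\infty(\gamma)=y\}$. A good decomposition of a normal 1-current $T$ is a finite positive measure $\eta$ on $\Gamma$, supported on non-constant simple curves, with $T=\int_\Gamma I_\gamma\,d\eta(\gamma)$, $\mathbf{M}(T)=\int_\Gamma\mathbf{M}(I_\gamma)\,d\eta=\int_\Gamma\mathcal{H}^1(\mathrm{Im}(\gamma))\,d\eta$,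 and $\mathbf{M}(\partial T)=\int_\Gamma\mathbf{M}(\partial I_\gamma)\,d\eta=2\eta(\Gamma)$. An $M\times N$ matrix $A$ with non-negative entries is stair-shaped if there exist non-decreasing sequences of positive integers $(r_k)_{k=1}^{M+N-1}$, $(c_k)_{k=1}^{M+N-1}$ with $r_k\le M$, $c_k\le N$, $r_k+c_k=k+1$ for every $k$, such that all entries of $A$ not in the positions $(r_k,c_k)$ are zero (infinite sequences if $M$ or $N$ is infinite). If $\eta$ is a finite measure on $\Gamma$ with $(p_0)_\#\eta=\mu^-$ and $(p_\infty)_\#\eta=\mu^+$, its representing matrix is $[\eta(\Gamma_{x_i,y_j})]_{i,j}$; $\eta$ is stair-shaped if this matrix is. $T\in Path(\mu^-,\mu^+)$ is stair-shaped if it has a stair-shaped good decomposition. Compatibility: for $T\in Path(\mu,\nu)$ and $\pi\in Plan(\mu,\nu)$, $(T,\pi)$ is compatible if there is a finite Borel measure $\eta$ on $\Gamma$ (concentrated on simple curves, so that $I_\gamma$ is defined) with $T=\int_\Gamma I_\gamma\,d\eta$ and $\pi=\int_\Gamma\delta_{(p_0(\gamma),p_\infty(\gamma))}\,d\eta$. For $\varphi\in Map(\mu,\nu)$, $(T,\varphi)$ is compatible if $(T,\pi_\varphi)$ is compatible, where $\pi_\varphi=(\mathrm{id}\times\varphi)_\#\mu$. *)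

(* Defs.v *)
From HB Require Import structures.
From mathcomp Require Import all_boot all_order all_algebra.
From mathcomp Require Import all_classical all_reals all_analysis.

Set Implicit Arguments.
Unset Strict Implicit.
Unset Printing Implicit Defensive.
Import Order.TTheory GRing.Theory Num.Theory.
Import numFieldNormedType.Exports.
Local Open Scope classical_set_scope.
Local Open Scope ring_scope.

Section Euclidean.
Context {R : realType} {m : nat}.
Local Notation V := 'rV[R]_m.

(* The library norm on 'rV[R]_m is the sup norm; it induces the same topology
   as the Euclidean norm below, which is the one lengths and masses refer to. *)
Definition dotp (u v : V) : R := \sum_i u 0 i * v 0 i.
Definition enorm (u : V) : R := Num.sqrt (dotp u u).

(* The added 0 makes the diameter of the empty set 0 instead of -oo. *)
Definition diam (A : set V) : \bar R :=
  ereal_sup (0%E |` [set (enorm (x - y))%:E | x in A & y in A]).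

Definition hausdorff1_delta (d : R) (A : set V) : \bar R :=
  ereal_inf [set (\sum_(k <oo) diam (F k))%E | F in
    [set F : (set V)^nat |
       A `<=` \bigcup_k F k /\ forall k, (diam (F k) <= d%:E)%E]].

Definition hausdorff1 (A : set V) : \bar R :=
  ereal_sup [set hausdorff1_delta d A | d in [set d : R | 0 < d]].

Lemma diam_ge0 A : (0 <= diam A)%E.
Proof. by apply: ereal_sup_ubound; left. Qed.

Lemma diam0 : diam set0 = 0%E.
Proof.
apply/eqP; rewrite eq_le diam_ge0 andbT; apply: ge_ereal_sup => z.
by case=> [->//|[x []]].
Qed.

Lemma hausdorff1_delta_ge0 d A : (0 <= hausdorff1_delta d A)%E.
Proof.
apply: le_ereal_inf_tmp => _ [F _ <-].
by apply: nneseries_ge0 => n _ _; exact: diam_ge0.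
Qed.

Lemma hausdorff1_delta0 d : 0 < d -> hausdorff1_delta d set0 = 0%E.
Proof.
move=> d0; apply/eqP; rewrite eq_le hausdorff1_delta_ge0 andbT.
apply: ereal_inf_lbound; exists (fun=> set0).
  by split=> // k; rewrite diam0 lee_fin ltW.
by rewrite eseries0// => n _ _; exact: diam0.
Qed.

Lemma le_hausdorff1_delta d :
  {homo hausdorff1_delta d : A B / A `<=` B >-> (A <= B)%E}.
Proof.
move=> A B AB; apply/ereal_inf_le_tmp => _ [F [BF dF] <-].
by exists F => //; split => //; exact: subset_trans BF.
Qed.

Lemma hausdorff1_delta_sigma_subadditive d : 0 < d ->
  sigma_subadditive (hausdorff1_delta d).
Proof.
move=> d0 A; have [[i ioo]|] := pselect (exists i, hausdorff1_delta d (A i) = +oo%E).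
  rewrite (eseries_pinfty _ _ ioo) ?leey// => n _.
  by rewrite -ltNye (lt_le_trans _ (hausdorff1_delta_ge0 _ _)).
rewrite -forallNE => Aoo.
suff add2e (e : {posnum R}) : (hausdorff1_delta d (\bigcup_n A n) <=
    \sum_(i <oo) hausdorff1_delta d (A i) + e%:num%:E)%E.
  by apply/lee_addgt0Pr => _/posnumP[].
rewrite (le_trans _ (epsilon_trick _ _ _))//; last first.
  by move=> n; exact: hausdorff1_delta_ge0.
pose P n (B : (set V)^nat) :=
  (A n `<=` \bigcup_k B k /\ forall k, (diam (B k) <= d%:E)%E) /\
  (\sum_(k <oo) diam (B k) <= hausdorff1_delta d (A n) +
     (e%:num / (2 ^ n.+1)%:R)%:E)%E.
have [G PG] : {G : ((set V)^nat)^nat & forall n, P n (G n)}.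
  apply: (@choice _ _ P) => n; rewrite /P /hausdorff1_delta.
  set S := (X in ereal_inf X); move infS : (ereal_inf S) => iS.
  case: iS infS => [r Sr|Soo|Soo].
  - have en1 : (0 < e%:num / (2 ^ n.+1)%:R)%R by [].
    have /(lb_ereal_inf_adherent en1) : ereal_inf S \is a fin_num by rewrite Sr.
    move=> [x [B [AnB dB] muBx] xS].
    by exists B; split => //; rewrite muBx -Sr; exact/ltW.
  - by have := Aoo n; rewrite /hausdorff1_delta -/S Soo.
  - suff : lbound S 0%E by move/le_ereal_inf_tmp; rewrite Soo.
    by move=> /= _ [B _ <-]; apply: nneseries_ge0 => *; exact: diam_ge0.
have G_ge0 x : (0 <= (diam \o uncurry G) x)%E by exact: diam_ge0.
apply: (@le_trans _ _ (\esum_(i in setT) (diam \o uncurry G) i)%E).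
  rewrite /hausdorff1_delta; apply: ereal_inf_lbound => /=.
  have /card_esym/ppcard_eqP[f] := card_nat2.
  exists (uncurry G \o f).
    split => [|i]; last by rewrite /= /uncurry; case: (f i) => a b; exact: (PG a).1.2.
    apply: (@subset_trans _ (\bigcup_n \bigcup_k G n k)) => [t [i _]|].
      by move=> /((PG i).1.1) -[j _ ?]; exists i => //; exists j.
    move=> t [i _ [j _ Bijt]]; exists (f^-1%FUN (i, j)) => //=.
    by rewrite invK ?inE.
  rewrite -(esum_pred_image (diam \o uncurry G) _ xpredT) ?[fun=> _]set_true//.
  by rewrite image_eq.
rewrite (_ : esum _ _ = (\sum_(i <oo) \sum_(j <oo) diam (G i j))%E); last first.
  pose J : nat -> set (nat * nat) := fun i => [set (i, j) | j in setT].
  rewrite (_ : setT = \bigcup_k J k); last first.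
    by rewrite predeqE => -[a b]; split => // _; exists a => //; exists b.
  rewrite esum_bigcupT /=; last 2 first.
    - apply/trivIsetP => i j _ _ ij.
      rewrite predeqE => -[n k] /=; split => //= -[] [_] _ [<-{n} _].
      by move=> [m' _] [] /esym/eqP; rewrite (negbTE ij).
    - by move=> /= [n k]; exact: diam_ge0.
  rewrite -(image_id [set: nat]) -fun_true esum_pred_image//; last first.
    by move=> n _; apply: esum_ge0 => ? _; exact: diam_ge0.
  apply: eq_eseriesr => /= j _.
  rewrite -(esum_pred_image (diam \o uncurry G) (pair j) predT)//=; last 2 first.
  - by move=> ? _; exact: diam_ge0.
  - by move=> ? ? _ _; exact: (@can_inj _ _ _ snd).
  by congr esum; rewrite predeqE => -[a b]; split; move=> [i _ <-]; exists i.
apply: lee_lim.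
- apply: is_cvg_nneseries => n *.
  by apply: nneseries_ge0 => k *; exact: (G_ge0 (n, k)).
- by apply: is_cvg_nneseries => n *; apply: adde_ge0 => //; exact: hausdorff1_delta_ge0.
- by near=> n; apply: lee_sum => i _; exact: (PG i).2.
Unshelve. all: by end_near. Qed.

Let hausdorff1_set0 : hausdorff1 set0 = 0%E.
Proof.
apply/eqP; rewrite eq_le; apply/andP; split.
  by apply: ge_ereal_sup => _ [d /= d0 <-]; rewrite hausdorff1_delta0.
apply: (@le_trans _ _ (hausdorff1_delta 1 set0)).
  exact: hausdorff1_delta_ge0.
by apply: ereal_sup_ubound; exists 1 => //=.
Qed.

Let hausdorff1_ge0 A : (0 <= hausdorff1 A)%E.
Proof.
apply: (@le_trans _ _ (hausdorff1_delta 1 A)).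
  exact: hausdorff1_delta_ge0.
by apply: ereal_sup_ubound; exists 1 => //=.
Qed.

Let le_hausdorff1 : {homo hausdorff1 : A B / A `<=` B >-> (A <= B)%E}.
Proof.
move=> A B AB; apply: ge_ereal_sup => _ [d /= d0 <-].
apply: (le_trans (@le_hausdorff1_delta d _ _ AB)).
by apply: ereal_sup_ubound; exists d.
Qed.

Let hausdorff1_sigma_subadditive : sigma_subadditive hausdorff1.
Proof.
move=> F; apply: ge_ereal_sup => _ [d /= d0 <-].
apply: (le_trans (hausdorff1_delta_sigma_subadditive d0 F)).
apply: lee_nneseries => [k _ _|k _]; first exact: hausdorff1_delta_ge0.
by apply: ereal_sup_ubound; exists d.
Qed.

HB.instance Definition _ := isOuterMeasure.Build R V hausdorff1
  hausdorff1_set0 hausdorff1_ge0 le_hausdorff1 hausdorff1_sigma_subadditive.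

End Euclidean.

Section Currents.
Context (R : realType) (m : nat).
Local Notation V := 'rV[R]_m.

(* 'rV[R]_m with the sigma-algebra of H^1-measurable sets, and H^1 on it. *)
Definition H1outer : {outer_measure set V -> \bar R} := @hausdorff1 R m.
Definition H1type := caratheodory_type H1outer.
HB.instance Definition _ := Measurable.on H1type.
Definition H1 : {measure set H1type -> \bar R} :=
  (H1outer : set (caratheodory_type H1outer) -> \bar R).

Definition Rn : Type := g_sigma_algebraType (@open V).
HB.instance Definition _ := Measurable.on Rn.

Definition partial (i : 'I_m) (f : V -> R) : V -> R :=
  fun x => 'D_(delta_mx 0 i) f x.

Fixpoint Ck (k : nat) (f : V -> R) : Prop :=
  continuous f /\
  if k is k'.+1 then
    forall i, (forall x, derivable f x (delta_mx 0 i)) /\ Ck k' (partial i f)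
  else True.

Definition smooth (f : V -> R) : Prop := forall k, Ck k f.

Record testfun := TestFun {
  testfun_val :> V -> R;
  testfun_smooth : smooth testfun_val;
  testfun_supp : compact (closure [set x | testfun_val x != 0]) }.

(* The 1-form sum_i w_i dx_i is encoded by its row of coefficients. *)
Record testform := TestForm {
  testform_val :> V -> V;
  testform_smooth : forall i, smooth (fun x => testform_val x 0 i);
  testform_supp : compact (closure [set x | testform_val x != 0]) }.

Section differential.
Variable f : testfun.

Let df (x : V) : V := \row_i partial i f x.

Let df_smooth i : smooth (fun x => df x 0 i).
Proof.
move=> k; have -> : (fun x => df x 0 i) = partial i f.
  by apply/funext => x; rewrite mxE.
by have [_ /(_ i) []] := testfun_smooth f k.+1.
Qed.

Let df_supp : compact (closure [set x | df x != 0]).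
Proof.
suff dfS : [set x | df x != 0] `<=` closure [set x | testfun_val f x != 0].
  apply: (subclosed_compact _ (@testfun_supp f)); first exact: closed_closure.
  by rewrite [X in _ `<=` X](closure_id _).1; [exact: closure_subset|exact: closed_closure].
move=> x /= dfx; apply: contrapT => xf; move/eqP: dfx; apply.
apply/rowP => i; rewrite !mxE /partial.
rewrite (@near_eq_derive _ _ _ _ (cst 0)) ?derive_cst//.
have : nbhs x (~` closure [set x | testfun_val f x != 0]).
  by apply: open_nbhs_nbhs; split => //; exact/closed_openC/closed_closure.
apply: filterS => y yf; apply/eqP/negPn/negP => fy.
by apply: yf; exact: subset_closure.
Qed.

Definition differential : testform := TestForm df_smooth df_supp.

End differential.

Definition current0 := testfun -> R.
Definition current1 := testform -> R.

Definition boundary (T : current1) : current0 := fun f => T (differential f).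

Definition mass0 (S : current0) : \bar R :=
  ereal_sup [set (S f)%:E | f in [set f : testfun | forall x, `|f x| <= 1]].

Definition mass1 (T : current1) : \bar R :=
  ereal_sup [set (T w)%:E | w in [set w : testform | forall x, enorm (w x) <= 1]].

Definition normal_current (T : current1) : Prop :=
  (mass1 T + mass0 (boundary T) < +oo)%E.

Definition subcurrent (S T : current1) : Prop :=
  (mass1 (T \- S)%R + mass1 S = mass1 T)%E.

Definition countably_1rectifiable (W : set V) : Prop :=
  exists (Z : set V) (g : nat -> R -> V),
    [/\ hausdorff1 Z = 0%E,
        forall k, exists L : R, forall s t, enorm (g k t - g k s) <= L * `|t - s|
      & W `<=` Z `|` \bigcup_k range (g k)].

(* The line spanned by v is the approximate tangent line at x of W with the
   weight t, in the sense of blow-ups: the rescalings by l of the measure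
   t H^1 restricted to W, centered at x, converge to t(x) H^1 restricted to the
   line, when tested on continuous functions with compact support. *)
Definition approx_tangent_line (W : set V) (t : V -> R) (x v : V) : Prop :=
  forall f : V -> R, continuous f -> compact (closure [set y | f y != 0]) ->
    (l^-1 * \int[H1]_(y in W) (f (l^-1 *: (y - x)) * t y)) @[l --> 0^'+] -->
    t x * \int[H1]_(y in range (fun s : R => s *: v)) f y.

Definition tau (W : set V) (t : V -> R) (xi : V -> V) : current1 :=
  fun w => \int[H1]_(x in W) (dotp (w x) (xi x) * t x).

Definition rectifiable_current (T : current1) : Prop :=
  exists (W : set V) (t : V -> R) (xi : V -> V),
    [/\ measurable (W : set H1type) /\ countably_1rectifiable W,
        (forall x, W x -> 0 < t x) /\
        (forall K : set V, compact K -> H1.-integrable (W `&` K) (EFin \o t)),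
        measurable_fun (W : set H1type) (xi : H1type -> Rn) /\
        (forall x, W x -> enorm (xi x) = 1),
        {ae H1, forall x, W x -> approx_tangent_line W t x (xi x)}
      & T = tau W t xi].

(* A curve g : [0, +oo[ -> R^m is encoded by its extension to R which is
   constant on ]-oo, 0]. *)
Record curve := Curve {
  curve_val :> R -> V;
  curve_neg : forall t, t <= 0 -> curve_val t = curve_val 0;
  curve_lip : forall s t, 0 <= s -> 0 <= t ->
    enorm (curve_val t - curve_val s) <= `|t - s|;
  curve_eventually_cst : exists t0, forall t, t0 <= t -> curve_val t = curve_val t0 }.

HB.instance Definition _ := gen_eqMixin curve.
HB.instance Definition _ := gen_choiceMixin curve.

Lemma cst_curve_lip (s t : R) : 0 <= s -> 0 <= t ->
  enorm (cst (0 : V) t - cst 0 s) <= `|t - s|.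
Proof.
move=> _ _; rewrite /enorm /dotp big1 ?sqrtr0// => i _.
by rewrite subrr mxE mul0r.
Qed.

HB.instance Definition _ := isPointed.Build curve
  (@Curve (cst 0) (fun t _ => erefl) cst_curve_lip
    (ex_intro _ 0 (fun t _ => erefl))).

(* Borel sets of the topology of uniform convergence on compact sets. *)
Definition Gamma : Type := g_sigma_algebraType
  [set curve_val @^-1` U | U in (@open {family compact, R -> V})].
HB.instance Definition _ := Measurable.on Gamma.

Definition p0 (g : curve) : Rn := g 0.
Definition pinf (g : curve) : Rn := lim (g t @[t --> +oo]).

Definition Gamma_between (x y : V) : set Gamma :=
  [set g : curve | p0 g = x /\ pinf g = y].

Definition curve_image (g : curve) : set V := [set g t | t in [set t | 0 <= t]].

(* Extended-real valued: t0 is +oo on constant curves. *)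
Definition t0 (g : curve) : \bar R :=
  ereal_sup [set t%:E | t in
    [set t | 0 <= t /\ forall s, 0 <= s -> s <= t -> g s = g 0]].
Definition tinf (g : curve) : \bar R :=
  ereal_inf [set t%:E | t in [set t | 0 <= t /\ forall s, t <= s -> g s = g t]].

Definition simple (g : curve) : Prop :=
  forall s t : R, (t0 g <= s%:E)%E -> s < t -> (t%:E <= tinf g)%E -> g s <> g t.

Definition nonconstant (g : curve) : Prop := exists2 t, 0 <= t & g t <> g 0.

(* g'/|g'| as a vector field on the image of g: on a simple curve the parameter
   of a point is unique, except possibly at the two endpoints. *)
Definition unit_tangent (g : curve) (x : V) : V :=
  let t := xget 0 [set t | 0 <= t /\ g t = x] in
  (enorm (derive1 g t))^-1 *: derive1 g t.

(* Only meaningful on simple curves; set to 0 elsewhere. *)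
Definition curve_current (g : curve) : current1 :=
  if `[< simple g >] then tau (curve_image g) (cst 1) (unit_tangent g)
  else fun=> 0.

(* T = \int I_g d eta(g), tested on each 1-form; integrability rules out the
   junk value of the library integral. *)
Definition is_current_integral (T : current1)
    (eta : {finite_measure set Gamma -> \bar R}) : Prop :=
  forall w : testform,
    eta.-integrable setT (fun g : Gamma => (curve_current g w)%:E) /\
    T w = \int[eta]_g curve_current g w.

Definition good_decomposition (T : current1)
    (eta : {finite_measure set Gamma -> \bar R}) : Prop :=
  [/\ normal_current T,
      {ae eta, forall g : Gamma, simple g /\ nonconstant g},
      is_current_integral T eta,
      (mass1 T = \int[eta]_g mass1 (curve_current g))%E /\
      (mass1 T = \int[eta]_g hausdorff1 (curve_image g))%E
    & (mass0 (boundary T) = \int[eta]_g mass0 (boundary (curve_current g)))%E /\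
      (mass0 (boundary T) = 2%:E * eta setT)%E].

(* M in N u {oo}, with None for oo; index sets are {i | i < M}, from 0. *)
Definition below (M : option nat) (i : nat) : bool :=
  if M is Some n then (i < n)%N else true.

Definition stair_step (M N : option nat) (k : nat) : bool :=
  if (M, N) is (Some a, Some b) then (k.+1 < a + b)%N else true.

(* All indices (rows, columns and steps) are shifted to start from 0, so that
   r_k + c_k = k + 1 for 1 <= k <= M + N - 1 becomes r k + c k = k for
   0 <= k < M + N - 1. *)
Definition stair_shaped_matrix (M N : option nat) (A : nat -> nat -> \bar R) :=
  exists r c : nat -> nat,
    [/\ forall k, stair_step M N k -> below M (r k) /\ below N (c k),
        forall k, stair_step M N k -> (r k + c k = k)%N,
        forall k, stair_step M N k.+1 ->
          (r k <= r k.+1)%N /\ (c k <= c k.+1)%N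
      & forall i j, below M i -> below N j ->
          (forall k, stair_step M N k -> (i, j) <> (r k, c k)) -> A i j = 0%E].

Definition finite_Borel := {finite_measure set Rn -> \bar R}.

Definition is_atomic (mu : finite_Borel) (M : option nat) (a : nat -> R)
    (x : nat -> V) : Prop :=
  forall A : set Rn, measurable A ->
    mu A = (\sum_(i <oo | below M i) (a i)%:E * \d_(x i : Rn) A)%E.

Section on_X.
Variable X : set V.

Definition concentrated (mu : finite_Borel) : Prop := mu (~` X) = 0%E.

Definition transport_path (mu nu : finite_Borel) (T : current1) : Prop :=
  [/\ concentrated mu, concentrated nu, mu setT = nu setT,
      rectifiable_current T
    & forall f : testfun,
        boundary T f = \int[nu]_x f x - \int[mu]_x f x].

(* Borel maps X -> X, encoded by Borel maps of R^m preserving X. *)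
Definition transport_map (mu nu : finite_Borel) (phi : V -> V) : Prop :=
  [/\ measurable_fun setT (phi : Rn -> Rn), phi @` X `<=` X
    & forall B : set Rn, measurable B ->
        pushforward mu (phi : Rn -> Rn) B = nu B].

Definition stair_shaped_path (M N : option nat) (x y : nat -> V)
    (mu nu : finite_Borel) (T : current1) : Prop :=
  transport_path mu nu T /\
  exists eta : {finite_measure set Gamma -> \bar R},
    [/\ good_decomposition T eta,
        forall B : set Rn, measurable B ->
          pushforward eta (p0 : Gamma -> Rn) B = mu B,
        forall B : set Rn, measurable B ->
          pushforward eta (pinf : Gamma -> Rn) B = nu B
      & stair_shaped_matrix M N (fun i j => eta (Gamma_between (x i) (y j)))].

End on_X.

Definition compatible (T : current1) (pi : set (Rn * Rn) -> \bar R) : Prop :=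
  exists eta : {finite_measure set Gamma -> \bar R},
    [/\ {ae eta, forall g : Gamma, simple g},
        is_current_integral T eta
      & forall B : set (Rn * Rn), measurable B ->
          pi B = (\int[eta]_g \d_((p0 g, pinf g) : Rn * Rn) B)%E].

Definition graph_plan (mu : finite_Borel) (phi : V -> V) :
    set (Rn * Rn) -> \bar R :=
  pushforward mu ((fun x => (x, phi x)) : Rn -> Rn * Rn).

Definition compatible_map (mu : finite_Borel) (T : current1) (phi : V -> V) :
    Prop :=
  compatible T (graph_plan mu phi).

End Currents.

(* Main.v *)
Require Import Defs.
From HB Require Import structures.
From mathcomp Require Import all_boot all_order all_algebra.
From mathcomp Require Import all_classical all_reals all_analysis.
From mathcomp Require Import measurable_realfun simple_functions ring lra.
Import Order.TTheory GRing.Theory Num.Theory.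
Import numFieldNormedType.Exports.
Set Implicit Arguments.
Unset Strict Implicit.
Unset Printing Implicit Defensive.
Local Open Scope classical_set_scope.
Local Open Scope ring_scope.

(** Let [eta] be a stair-shaped good decomposition of [T].  Almost every curve
runs from some [x (r k)] to some [y (c k)], where [(r k, c k)] is a step of the
staircase.  A step moves on to the next row or to the next column, so it is the
last step of its row or the last step of its column.  Let [A] be the set of the
curves of the steps of the first kind.  Distinct steps of this kind lie in
distinct rows, so on [A] the source of a curve determines its target; on the
complement of [A] the target determines the source.  These two dependences are
the maps [phi] and [psi], and restricting [eta] to [A] and to its complement
gives [T1] and [T2], together with their marginals.  Compatibility holds by
construction for [T1]; for [- T2] the curves are reversed.

What remains is geometry.

The curves of a good decomposition superpose without loss of mass.  Testing [T1]
and [T2] with two different forms, one gets at most the integral of the masses of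
the curves, which is the mass of [T]; hence the masses of [T1] and [T2] add up to
that of [T] ([part_mass]) and both are subcurrents.

They have the right boundaries because a simple curve carries the line integral
of forms ([curve_current_line]), whose boundary is the difference of the Dirac
masses at its endpoints ([boundary_curve]).  This needs the almost everywhere
derivative of a Lipschitz function ([lipschitz_ftc]), obtained from a
Radon-Nikodym density, and the area formula for arcs ([arc_integral]).

That they are rectifiable is the longest point ([rectifiable_split]).  Write [T]
as [(W, theta, xi)].  Since no mass is lost, [T1] is dominated by the measure
[theta H^1], hence is represented by a bounded vector density [v]
([dominated_functional_density]); the absence of cancellation with [T2] gives
[|v| + |xi - v| <= 1 = |xi|], so that [v = rho xi] with a nonnegative function
[rho] ([split_tau]).  Thus [T1] lives on the part of [W] where [rho] is positive
and has multiplicity [rho theta].  It has the same approximate tangents as [T],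
because [rho] is approximately continuous almost everywhere.  The latter follows
from a weak-type inequality for [H^1], which is proved with maximal dyadic cubes
and so works for measures which are not doubling ([weak_type],
[density_null]). *)

(** * Measures *)

Section image_measure.
Local Open Scope ereal_scope.
Context d d' (T : measurableType d) (T' : measurableType d') (R : realType).
Variables (mu : {finite_measure set T -> \bar R}) (f : T -> T').
Hypothesis mf : measurable_fun setT f.

(** The image of a finite measure; the measurability of [f] is an argument so
that the result is a finite measure by construction. *)
Definition image_measure (_ : measurable_fun setT f) : set T' -> \bar R :=
  pushforward mu f.

Let im : {measure set T' -> \bar R} :=
  measure_function_pushforward__canonical__measure_function_Measure mu mf.

HB.instance Definition _ := Measure.copy (image_measure mf) im.

Let im_fin : fin_num_fun (image_measure mf).
Proof.
move=> E mE; apply: fin_num_measure.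
by rewrite -[X in measurable X]setTI; exact: mf.
Qed.

HB.instance Definition _ :=
  Measure_isFinite.Build _ _ _ (image_measure mf) im_fin.

Lemma integrable_image (h : T' -> \bar R) : measurable_fun setT h ->
  mu.-integrable setT (h \o f) -> (image_measure mf).-integrable setT h.
Proof.
by move=> mh ih; exact: (@integrable_pushforward _ _ _ _ _ _ mf mu setT).
Qed.

Lemma integral_image (h : T' -> \bar R) : measurable_fun setT h ->
  mu.-integrable setT (h \o f) ->
  \int[image_measure mf]_y h y = \int[mu]_x h (f x).
Proof.
by move=> mh ih; exact: (@integral_pushforward _ _ _ _ _ _ mf mu setT).
Qed.

End image_measure.

Section restriction.
Local Open Scope ereal_scope.
Context d (T : measurableType d) (R : realType).
Variables (mu : {measure set T -> \bar R}) (D : set T) (mD : measurable D).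
Hypothesis Doo : mu D < +oo.

Let nu : {finite_measure set T -> \bar R} := mfrestr mD Doo.

Let nuE A : A `<=` D -> nu A = mu A.
Proof. by move=> AD; rewrite /nu /= /mfrestr /mrestr setIidl. Qed.

Let nuCD : nu (~` D) = 0.
Proof. by rewrite /nu /= /mfrestr /mrestr setICl measure0. Qed.

(** The complement of [D] is null for the restriction. *)
Lemma ge0_integral_mfrestr (f : T -> \bar R) : measurable_fun setT f ->
  (forall x, 0 <= f x) -> \int[mfrestr mD Doo]_x f x = \int[mu]_(x in D) f x.
Proof.
move=> mf f0.
rewrite (@ge0_negligible_integral _ _ _ nu setT (~` D))//; last first.
  exact: measurableC.
by rewrite setTD setCK; apply: eq_measure_integral => A mA AD; exact: nuE.
Qed.

Lemma integrable_mfrestr (f : T -> \bar R) : measurable_fun setT f ->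
  mu.-integrable D f -> (mfrestr mD Doo).-integrable setT f.
Proof.
move=> mf /integrableP[_ foo]; apply/integrableP; split => //.
by rewrite ge0_integral_mfrestr//; exact: measurableT_comp.
Qed.

Lemma integral_mfrestr (f : T -> \bar R) : measurable_fun setT f ->
  mu.-integrable D f -> \int[mfrestr mD Doo]_x f x = \int[mu]_(x in D) f x.
Proof.
move=> mf fD; rewrite (@negligible_integral _ _ _ nu setT (~` D))//.
- by rewrite setTD setCK; apply: eq_measure_integral => A mA AD; exact: nuE.
- exact: measurableC.
- exact: integrable_mfrestr.
Qed.

End restriction.

(** * Euclidean geometry and lengths *)
Section euclid.
Context {R : realType} {m : nat}.
Local Notation V := 'rV[R]_m.
Implicit Types u v w : V.

Lemma dotpC u v : dotp u v = dotp v u.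
Proof. by apply: eq_bigr => i _; rewrite mulrC. Qed.

Lemma dotpDl u v w : dotp (u + v) w = dotp u w + dotp v w.
Proof. by rewrite -big_split; apply: eq_bigr => i _; rewrite mxE mulrDl. Qed.

Lemma dotpZl a u w : dotp (a *: u) w = a * dotp u w.
Proof. by rewrite mulr_sumr; apply: eq_bigr => i _; rewrite mxE mulrA. Qed.

Lemma dotpNl u w : dotp (- u) w = - dotp u w.
Proof. by rewrite -scaleN1r dotpZl mulN1r. Qed.

Lemma dotpBl u v w : dotp (u - v) w = dotp u w - dotp v w.
Proof. by rewrite dotpDl dotpNl. Qed.

Lemma dotpDr u v w : dotp w (u + v) = dotp w u + dotp w v.
Proof. by rewrite dotpC dotpDl !(dotpC _ w). Qed.

Lemma dotpZr a u w : dotp w (a *: u) = a * dotp w u.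
Proof. by rewrite dotpC dotpZl dotpC. Qed.

Lemma dotpNr u w : dotp w (- u) = - dotp w u.
Proof. by rewrite dotpC dotpNl dotpC. Qed.

Lemma dotpBr u v w : dotp w (u - v) = dotp w u - dotp w v.
Proof. by rewrite dotpDr dotpNr. Qed.

Lemma dotp0l u : dotp 0 u = 0.
Proof. by rewrite /dotp big1// => i _; rewrite mxE mul0r. Qed.

Lemma dotp_ge0 u : 0 <= dotp u u.
Proof. by apply: sumr_ge0 => i _; rewrite -expr2 sqr_ge0. Qed.

Lemma enorm_ge0 u : 0 <= enorm u.
Proof. exact: sqrtr_ge0. Qed.

Lemma sqr_enorm u : enorm u ^+ 2 = dotp u u.
Proof. by rewrite sqr_sqrtr// dotp_ge0. Qed.

Lemma dotp_eq0 u : dotp u u = 0 -> u = 0.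
Proof.
move=> /eqP; rewrite psumr_eq0 => [/allP u0|i _]; last by rewrite -expr2 sqr_ge0.
apply/rowP => i; rewrite mxE; apply/eqP.
by have := u0 i (mem_index_enum i); rewrite -expr2 sqrf_eq0.
Qed.

Lemma enorm0 : enorm (0 : V) = 0.
Proof. by rewrite /enorm dotp0l sqrtr0. Qed.

Lemma enorm_eq0 u : enorm u = 0 -> u = 0.
Proof. by move=> u0; apply: dotp_eq0; rewrite -sqr_enorm u0 expr0n. Qed.

Lemma enormZ a u : enorm (a *: u) = `|a| * enorm u.
Proof.
by rewrite /enorm dotpZl dotpZr mulrA -expr2 sqrtrM ?sqr_ge0// sqrtr_sqr.
Qed.

Lemma enormN u : enorm (- u) = enorm u.
Proof. by rewrite -scaleN1r enormZ normrN1 mul1r. Qed.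

Lemma enormC u v : enorm (u - v) = enorm (v - u).
Proof. by rewrite -enormN opprB. Qed.

Lemma dotp_le u v : dotp u v <= enorm u * enorm v.
Proof.
have [u0|u0] := eqVneq (enorm u) 0.
  by rewrite (enorm_eq0 u0) dotp0l enorm0 mul0r.
have [v0|v0] := eqVneq (enorm v) 0.
  by rewrite (enorm_eq0 v0) dotpC dotp0l enorm0 mulr0.
have u1 : 0 < enorm u by rewrite lt_def u0 enorm_ge0.
have v1 : 0 < enorm v by rewrite lt_def v0 enorm_ge0.
have := dotp_ge0 (enorm v *: u - enorm u *: v).
rewrite dotpBl !dotpBr !dotpZl !dotpZr -!sqr_enorm (dotpC v u).
have -> : enorm v * (enorm v * enorm u ^+ 2) -
  enorm v * (enorm u * dotp u v) -
  (enorm u * (enorm v * dotp u v) - enorm u * (enorm u * enorm v ^+ 2)) =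
  2 * (enorm u * enorm v) * (enorm u * enorm v - dotp u v) by ring.
by rewrite pmulr_rge0 ?subr_ge0// !mulr_gt0.
Qed.

Lemma normr_dotp_le u v : `|dotp u v| <= enorm u * enorm v.
Proof.
by rewrite ler_norml dotp_le andbT lerNl -dotpNl (le_trans (dotp_le _ _))// enormN.
Qed.

Lemma ler_enormD u v : enorm (u + v) <= enorm u + enorm v.
Proof.
rewrite -(@ler_pXn2r _ 2)// ?nnegrE ?addr_ge0 ?enorm_ge0//.
rewrite sqr_enorm dotpDl !dotpDr sqrrD !sqr_enorm (dotpC v u).
have := dotp_le u v; lra.
Qed.

Lemma ler_enormB u v w : enorm (u - w) <= enorm (u - v) + enorm (v - w).
Proof. by rewrite (le_trans _ (ler_enormD _ _))// addrA subrK. Qed.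

Lemma coord_le_enorm u i : `|u 0 i| <= enorm u.
Proof.
rewrite -(@ler_pXn2r _ 2)// ?nnegrE ?enorm_ge0// sqr_enorm /dotp (bigD1 i)//=.
rewrite real_normK ?num_real// -expr2 lerDl; apply: sumr_ge0 => j _.
by rewrite -expr2 sqr_ge0.
Qed.

Lemma coord_le_norm u i : `|u 0 i| <= `|u|.
Proof.
rewrite [leRHS]mx_normrE.
exact: (@le_bigmax _ _ _ _ (fun i : 'I_1 * 'I_m => `|u i.1 i.2|) (0, i)).
Qed.

Lemma norm_le_coord u c : 0 <= c -> (forall i, `|u 0 i| <= c) -> `|u| <= c.
Proof.
move=> c0 uc; rewrite [leLHS]mx_normrE; apply: bigmax_le => // -[i j] _ /=.
by rewrite ord1.
Qed.

Lemma norm_le_enorm u : `|u| <= enorm u.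
Proof. by apply: norm_le_coord (enorm_ge0 _) _ => i; exact: coord_le_enorm. Qed.

Lemma enorm_le_norm u : enorm u <= m%:R * `|u|.
Proof.
have -> : u = \sum_i u 0 i *: 'e_i by exact: row_sum_delta.
apply: (@le_trans _ _ (\sum_i `|u 0 i|)); last first.
  rewrite -row_sum_delta (le_trans (ler_sum _ (fun i _ => coord_le_norm u i)))//.
  by rewrite sumr_const card_ord mulr_natl.
rewrite (@big_morph _ _ (fun v => v) 0 +%R 0 +%R)//.
elim/big_ind2 : _ => [|x a y b xa yb|i _]; first by rewrite enorm0.
  by rewrite (le_trans (ler_enormD _ _))// lerD.
rewrite enormZ ler_piMr//.
have -> : enorm ('e_i : V) = 1; last by [].
rewrite /enorm /dotp (bigD1 i)//= big1 => [|j ji]; rewrite !mxE ?eqxx/=.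
  by rewrite mulr1 addr0 sqrtr1.
by rewrite (negbTE ji) mul0r.
Qed.

End euclid.

Section hausdorff_basics.
Context {R : realType} {m : nat}.
Local Notation V := 'rV[R]_m.
Local Notation Hd := (@hausdorff1_delta R m).
Local Notation H := (@hausdorff1 R m).
Implicit Types (A B : set V).

Lemma le_diam A x y : A x -> A y -> ((enorm (x - y))%:E <= diam A)%E.
Proof. by move=> Ax Ay; apply: ereal_sup_ubound; right; exists x => //; exists y. Qed.

Lemma diam_le A c : (0 <= c)%E ->
  (forall x y, A x -> A y -> ((enorm (x - y))%:E <= c)%E) -> (diam A <= c)%E.
Proof.
move=> c0 Ac; apply: ge_ereal_sup => _ [->//|[x Ax [y Ay <-]]]; exact: Ac.
Qed.

Lemma diamS A B : A `<=` B -> (diam A <= diam B)%E.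
Proof. by move=> AB; apply: diam_le (diam_ge0 _) _ => x y /AB ? /AB ?; exact: le_diam. Qed.

Lemma Hd_le d A (F : (set V)^nat) : A `<=` \bigcup_k F k ->
  (forall k, (diam (F k) <= d%:E)%E) -> (Hd d A <= \sum_(k <oo) diam (F k))%E.
Proof. by move=> AF Fd; apply: ereal_inf_lbound; exists F. Qed.

Lemma Hd_le_H d A : 0 < d -> (Hd d A <= H A)%E.
Proof. by move=> d0; apply: ereal_sup_ubound; exists d. Qed.

Lemma H_le A c : (forall d, 0 < d -> (Hd d A <= c)%E) -> (H A <= c)%E.
Proof. by move=> Ac; apply: ge_ereal_sup => _ [d d0 <-]; exact: Ac. Qed.

Lemma H_ge0 A : (0 <= H A)%E.
Proof. exact: outer_measure_ge0. Qed.

Lemma le_H A B : A `<=` B -> (H A <= H B)%E.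
Proof. by move=> AB; apply: le_outer_measure. Qed.

Lemma H0S A B : A `<=` B -> H B = 0%E -> H A = 0%E.
Proof. by move=> AB B0; apply/eqP; rewrite eq_le H_ge0 -B0 le_H. Qed.

Lemma H_set1 (x : V) : H [set x] = 0%E.
Proof.
apply/eqP; rewrite eq_le H_ge0 andbT; apply: H_le => d d0.
have x0 : (diam [set x] <= 0)%E.
  by apply: diam_le => // y z -> ->; rewrite subrr enorm0.
pose F k := if k is 0%N then [set x] else (set0 : set V).
have F0 k : diam (F k) = 0%E.
  by case: k => [|k] /=; [apply/eqP; rewrite eq_le x0 diam_ge0|rewrite diam0].
rewrite (le_trans (@Hd_le d _ F _ _))//.
- by move=> y ->; exists 0%N.
- by move=> k; rewrite F0 lee_fin ltW.
- by rewrite eseries0// => k _ _; rewrite F0.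
Qed.

Lemma H_bigcup0 (F : (set V)^nat) : (forall n, H (F n) = 0%E) ->
  H (\bigcup_n F n) = 0%E.
Proof.
move=> F0; apply/eqP; rewrite eq_le H_ge0 andbT.
rewrite (le_trans (outer_measure_sigma_subadditive [the {outer_measure set V -> \bar R} of H] F))//.
by rewrite eseries0// => n _ _; exact: F0.
Qed.

Lemma H_U0 A B : H A = 0%E -> H B = 0%E -> H (A `|` B) = 0%E.
Proof.
move=> A0 B0; rewrite -bigcup2E; by apply: H_bigcup0 => -[|[|n]]//=.
Qed.

(** [H^1] is a metric outer measure: a set of small diameter cannot meet two
sets which are at positive distance, so that a cover of their union is the sum
of a cover of each of them. *)
Lemma H_separated A B (d : R) : 0 < d ->
  (forall x y, A x -> B y -> d <= enorm (x - y)) -> (H A + H B <= H (A `|` B))%E.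
Proof.
move=> d0 dAB.
have key (e1 e2 : R) : 0 < e1 -> 0 < e2 -> (Hd e1 A + Hd e2 B <= H (A `|` B))%E.
  move=> e10 e20; pose e := Num.min (Num.min e1 e2) (d / 2).
  have e0 : 0 < e by rewrite !lt_min e10 e20 divr_gt0.
  apply: (le_trans _ (Hd_le_H _ e0)).
  apply: le_ereal_inf_tmp => _ [F [ABF Fe] <-].
  apply: (@le_trans _ _ (\sum_(k <oo) diam (F k `&` A) +
                         \sum_(k <oo) diam (F k `&` B))%E).
    have FE C (c : R) : C `<=` A `|` B -> e <= c ->
        (Hd c C <= \sum_(k <oo) diam (F k `&` C))%E.
      move=> CAB ec; apply: Hd_le => [x Cx|k].
        by have [k _ Fkx] := ABF _ (CAB _ Cx); exists k.
      rewrite (le_trans (diamS (@subIsetl _ _ _)))// (le_trans (Fe k))//.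
    by apply: leeD; apply: FE => //; rewrite /e !ge_min lexx ?orbT.
  rewrite -nneseriesD//; try by move=> ? _ _; exact: diam_ge0.
  apply: lee_nneseries => [k _ _|k _]; first by rewrite adde_ge0// diam_ge0.
  have [[x [Fx Ax]]|noA] := pselect (exists x, F k x /\ A x); last first.
    rewrite (_ : F k `&` A = set0) ?diam0 ?add0e ?diamS//.
    by rewrite -subset0 => x [Fx Ax]; apply: noA; exists x.
  have [[y [Fy By]]|noB] := pselect (exists x, F k x /\ B x); last first.
    rewrite (_ : F k `&` B = set0) ?diam0 ?adde0 ?diamS//.
    by rewrite -subset0 => y [Fy By]; apply: noB; exists y.
  have := le_trans (le_diam Fx Fy) (Fe k); rewrite lee_fin => xye.
  have : d <= d / 2.
    by rewrite (le_trans (dAB _ _ Ax By))// (le_trans xye)// /e ge_min lexx orbT.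
  by move=> dd; exfalso; move: d0 dd; lra.
have [->|ABoo] := eqVneq (H (A `|` B)) +oo%E; first exact: leey.
have fin C : C `<=` A `|` B -> H C \is a fin_num.
  by move=> CAB; rewrite ge0_fin_numE ?H_ge0// (le_lt_trans (le_H CAB))// ltey.
rewrite -leeBrDr ?fin//; apply: H_le => e1 e10.
rewrite leeBrDr ?fin// addeC -leeBrDr.
  apply: H_le => e2 e20; rewrite leeBrDr; last first.
    rewrite ge0_fin_numE ?hausdorff1_delta_ge0//.
    by rewrite (le_lt_trans (Hd_le_H A e10))// -ge0_fin_numE ?fin// H_ge0.
  by rewrite addeC; exact: key.
rewrite ge0_fin_numE ?hausdorff1_delta_ge0//.
by rewrite (le_lt_trans (Hd_le_H A e10))// -ge0_fin_numE ?fin// H_ge0.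
Qed.

Local Notation away C n := [set x : V | forall c, C c -> n.+1%:R^-1 <= enorm (x - c)].

(** Caratheodory's criterion.  The points of [X] away from the closed set [C]
increase to [X `\` C]; the successive layers, taken every other one, are at
positive distance of one another, so that their total [H^1] measure is finite
and the last layers contribute little. *)
Lemma closed_H_caratheodory (C : set V) : closed C ->
  caratheodory_measurable (@hausdorff1 R m) C.
Proof.
move=> clC; apply: le_caratheodory_measurable => X /=.
have [->|Xoo] := eqVneq (H X) +oo%E; first exact: leey.
have finX : H X \is a fin_num by rewrite ge0_fin_numE ?H_ge0// ltey.
pose A n := X `&` away C n.
have Amono n k : (n <= k)%N -> A n `<=` A k.
  move=> nk x [Xx xn]; split => // c Cc; apply: le_trans (xn c Cc).
  by rewrite lef_pV2 ?posrE// ler_nat.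
pose D n := A n.+1 `\` A n.
have UA n : X `&` ~` C `<=` A n `|` \bigcup_k D (n + k)%N.
  move=> x [Xx Cx]; have [[k Akx]|noA] := pselect (exists k, A k x); last first.
    exfalso; apply: Cx; rewrite (closure_id C).1// => B /nbhs_ballP[e /= e0 eB].
    apply: contrapT => CB; apply: noA; exists (Num.truncn e^-1); split => // c Cc.
    rewrite leNgt; apply/negP => xc; apply: CB; exists c; split => //; apply: eB.
    rewrite -ball_normE /= (le_lt_trans (norm_le_enorm _))// (lt_trans xc)//.
    by rewrite invf_plt ?posrE// truncnS_gt.
  have [|nx] := pselect (A n x); first by left.
  right; elim: k Akx => [|k IH] Akx.
    by exfalso; apply: nx; exact: Amono Akx.
  have [/IH//|nAk] := pselect (A k x).
  have nk : (n <= k)%N.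
    by rewrite leqNgt; apply/negP => kn; apply: nx; exact: Amono Akx.
  by exists (k - n)%N => //; rewrite subnKC.
have sepD n : (H (A n) + H (D n.+1) <= H (A n.+2))%E.
  have d0 : 0 < n.+1%:R^-1 - n.+2%:R^-1 :> R.
    by rewrite subr_gt0 ltf_pV2 ?posrE// ltr_nat.
  apply: (le_trans (H_separated d0 _)) => [x y [_ xn] [[Xy _] yn]|]; last first.
    by apply: le_H => x [/Amono|[]//]; apply; rewrite -addn2 leq_addr.
  have /existsNP[c /not_implyP[Cc /negP]] : ~ away C n.+1 y by move=> ?; exact: yn.
  rewrite -ltNge => yc; have := xn _ Cc; have := ler_enormB x y c; move: yc.
  by move: (n.+1%:R^-1 : R) (n.+2%:R^-1 : R) => p q; lra.
have step p : forall n, (\sum_(0 <= k < n) H (D (p + k.*2).+1) <= H X)%E.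
  move=> n; apply: (@le_trans _ _ (H (A (p + n.*2)%N))); last first.
    by apply: le_H; exact: subIsetl.
  elim: n => [|k IH]; first by rewrite big_nil H_ge0.
  rewrite big_nat_recr; last exact: leq0n.
  rewrite doubleS !addnS.
  exact: le_trans (leeD2r _ IH) (sepD (p + k.*2)%N).
have sumD : (\sum_(k <oo) H (D k.+1) < +oo)%E.
  apply: (@le_lt_trans _ _ (H X + H X)%E); last by rewrite lte_add_pinfty// ltey.
  apply: lime_le; first by apply: is_cvg_nneseries => ? _ _; exact: H_ge0.
  apply: nearW => n; apply: (@le_trans _ _ (\sum_(0 <= k < n.*2) H (D k.+1))%E).
    by apply: lee_sum_nneg_natr => // *; [exact: H_ge0|rewrite -addnn leq_addr].
  apply: le_trans (leeD (step 0%N n) (step 1%N n)).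
  rewrite -big_split/=; elim: n => [|n IH]; first by rewrite !big_nil.
  by rewrite doubleS !big_nat_recr//= -addeA leeD.
have tailD := nneseries_tail_cvg sumD (fun _ _ => H_ge0 _).
rewrite -[leRHS]adde0.
have cvgX : (H X + \sum_(n <= k <oo) H (D k.+1))%E @[n --> \oo] --> (H X + 0)%E.
  by apply: cvgeD; [exact: fin_num_adde_defr|exact: cvg_cst|exact: tailD].
apply: (cvge_to_ge cvgX); apply: nearW => n.
have n0 : 0 < n.+2%:R^-1 :> R by rewrite invr_gt0.
have sepC : (H (X `&` C) + H (A n.+1) <= H X)%E.
  apply: (le_trans (H_separated n0 _)) => [x y [_ Cx] [_ /(_ x Cx)]|].
    by rewrite enormC.
  by apply: le_H => x [[]|[]].
apply: le_trans (leeD2r _ sepC); rewrite -addeA leeD2l//.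
have DH := outer_measure_sigma_subadditive_tail
  [the {outer_measure set V -> \bar R} of H] n (fun k => D k.+1).
apply: (@le_trans _ _ (H (A n.+1 `|` \bigcup_(k in ~` `I_n) D k.+1))).
  apply: le_H => x /(UA n.+1)[|[k _ Dk]]; first by left.
  by right; exists (n + k)%N => //=; rewrite ltnNge leq_addr.
by rewrite (le_trans (outer_measureU2 _ _ _))// leeD2l.
Qed.

Lemma open_H_caratheodory (U : set V) : open U ->
  caratheodory_measurable (@hausdorff1 R m) U.
Proof.
move=> oU; rewrite -(setCK U); apply: caratheodory_measurable_setC.
exact/closed_H_caratheodory/open_closedC.
Qed.

End hausdorff_basics.

Section borel.
Context {R : realType} {m : nat}.
Local Notation V := 'rV[R]_m.
Local Notation H := (@hausdorff1 R m).

Lemma Borel_H1 (B : set (Rn R m)) : measurable B -> measurable (B : set (H1type R m)).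
Proof.
move=> mB; apply: (mB (measurable : set (set (H1type R m)))); split.
  exact: sigma_algebra_measurable.
by move=> U oU; exact: open_H_caratheodory.
Qed.

Lemma id_H1_Rn : measurable_fun setT (id : H1type R m -> Rn R m).
Proof. by move=> _ B mB; rewrite setTI; exact: Borel_H1. Qed.

Lemma open_Rn (U : set V) : open U -> measurable (U : set (Rn R m)).
Proof. by move=> oU; exact: sub_sigma_algebra. Qed.

Lemma closed_Rn (U : set V) : closed U -> measurable (U : set (Rn R m)).
Proof.
move=> cU; rewrite -(setCK U).
by apply: (@measurableC _ (Rn R m)); apply: open_Rn; exact: closed_openC.
Qed.

Lemma continuous_Rn (f : V -> R) : continuous f ->
  measurable_fun setT (f : Rn R m -> R).
Proof.
move=> cf; apply: (measurability _ (RGenOpens.measurableE R)) => _ [_ [a [b ->] <-]].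
rewrite setTI; apply: open_Rn; move/continuousP : cf; apply.
exact: interval_open.
Qed.

Lemma measurable_H1 (d : measure_display) (T : measurableType d) (f : V -> T) :
  measurable_fun setT (f : Rn R m -> T) -> measurable_fun setT (f : H1type R m -> T).
Proof. by move=> mf; exact: (measurableT_comp mf id_H1_Rn). Qed.

End borel.

Section hausdorff_more.
Context {R : realType} {m : nat}.
Local Notation V := 'rV[R]_m.
Local Notation Hd := (@hausdorff1_delta R m).
Local Notation H := (@hausdorff1 R m).

Lemma diam_closure (A : set V) : (diam (closure A) <= diam A)%E.
Proof.
apply: diam_le (diam_ge0 _) _ => x y Ax Ay.
have [->|Aoo] := eqVneq (diam A) +oo%E; first exact: leey.
have Afin : diam A \is a fin_num by rewrite ge0_fin_numE ?diam_ge0// ltey.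
apply/lee_addgt0Pr => e e0.
pose d := e / (2 * m.+1%:R).
have d0 : 0 < d by rewrite divr_gt0// mulr_gt0.
have app z : closure A z -> exists2 z', A z' & enorm (z - z') <= e / 2.
  move=> /(_ _ (nbhsx_ballx z d d0))[z' [Az']]; rewrite -ball_normE /= => zz'.
  exists z' => //; rewrite (le_trans (enorm_le_norm _))//.
  have -> : e / 2 = m.+1%:R * d 
    by rewrite /d invfM [RHS]mulrC -!mulrA mulVf ?mulr1// pnatr_eq0.
  by apply: ler_pM => //; [rewrite ler_nat|exact: ltW].
have [x' Ax' xx'] := app _ Ax; have [y' Ay' yy'] := app _ Ay.
rewrite -(fineK Afin) -EFinD lee_fin.
have : enorm (x' - y') <= fine (diam A) by rewrite -lee_fin fineK// le_diam.
have := ler_enormB x x' y; have := ler_enormB x' y' y.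
by rewrite (enormC y' y); move: xx' yy'; lra.
Qed.

Lemma le_Hd_delta (A : set V) (d1 d2 : R) : d1 <= d2 -> (Hd d2 A <= Hd d1 A)%E.
Proof.
move=> d12; apply: ereal_inf_le_tmp => _ [F [AF Fd] <-]; exists F => //.
by split=> // k; rewrite (le_trans (Fd k)).
Qed.

(** Covers may be taken closed, hence a countable intersection of covers is a
Borel set. *)
Lemma Borel_hull (A : set V) :
  exists B : set (Rn R m), [/\ measurable B, A `<=` B & H B = H A].
Proof.
have [Aoo|Aoo] := eqVneq (H A) +oo%E.
  exists setT; split => //; apply/eqP; rewrite Aoo -leye_eq -Aoo.
  exact: le_H.
have Afin : H A \is a fin_num by rewrite ge0_fin_numE ?H_ge0// ltey.
have cov n : exists F : (set V)^nat, [/\ A `<=` \bigcup_k F k,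
    forall k, (diam (F k) <= (n.+1%:R^-1)%:E)%E &
    (\sum_(k <oo) diam (F k) <= H A + (n.+1%:R^-1)%:E)%E].
  have n0 : 0 < n.+1%:R^-1 :> R by rewrite invr_gt0.
  have Hdfin : Hd n.+1%:R^-1 A \is a fin_num.
    rewrite ge0_fin_numE ?hausdorff1_delta_ge0//.
    by rewrite (le_lt_trans (Hd_le_H A n0))// ltey.
  have [_ [F [AF Fn] <-] Flt] := lb_ereal_inf_adherent n0 Hdfin.
  by exists F; split => //; rewrite (le_trans (ltW Flt))// leeD2r// Hd_le_H.
have [F FP] := choice cov.
pose B : set (Rn R m) := \bigcap_n \bigcup_k closure (F n k).
have AB : A `<=` B.
  move=> x Ax n _; have [/(_ _ Ax)[k _ Fx] _ _] := FP n.
  by exists k => //; exact: subset_closure.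
exists B; split => //.
  apply: bigcapT_measurable => n; apply: bigcupT_measurable => k.
  by apply: closed_Rn; exact: closed_closure.
apply/eqP; rewrite eq_le (le_H AB) andbT; apply: H_le => d d0.
apply/lee_addgt0Pr => e e0.
pose n := Num.truncn (Num.min d e)^-1.
have de0 : 0 < Num.min d e by rewrite lt_min d0.
have : n.+1%:R^-1 <= Num.min d e.
  by rewrite invf_ple ?posrE// ltW// truncnS_gt.
rewrite le_min => /andP[nd ne].
have [_ Fn FS] := FP n.
apply: (le_trans (le_Hd_delta _ nd)).
apply: (le_trans (@Hd_le _ _ _ _ (fun k => closure (F n k)) _ _)).
- by move=> x /(_ n Logic.I).
- by move=> k; rewrite (le_trans (diam_closure _)).
- apply: (@le_trans _ _ (H A + (n.+1%:R^-1)%:E)%E); last by rewrite leeD2l// lee_fin.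
  apply: (le_trans _ FS).
  by apply: lee_nneseries => [k _ _|k _]; [exact: diam_ge0|exact: diam_closure].
Qed.

(** Projecting onto the line through the endpoints reduces the claim to the
Lebesgue measure of an interval. *)
Lemma enorm_le_H (g : R -> V) (a b : R) : a <= b ->
  (forall s t, enorm (g t - g s) <= `|t - s|) ->
  ((enorm (g b - g a))%:E <= H (g @` `[a, b]%classic))%E.
Proof.
move=> ab lg; set u := g b - g a; set L := enorm u.
have [->|L0] := eqVneq L 0; first exact: H_ge0.
have {}L0 : 0 < L by rewrite lt_def L0 enorm_ge0.
apply: (le_trans _ (Hd_le_H _ ltr01)); apply: le_ereal_inf_tmp => _ [F [gF F1] <-].
pose p (x : V) := dotp (x - g a) u / L.
have plip x y : p x - p y <= enorm (x - y).
  rewrite /p -mulrBl -dotpBl opprB addrA subrK ler_pdivrMr//; exact: dotp_le.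
have cp : continuous (p \o g).
  move=> t; apply/cvgrPdist_le => /= e e0; near=> s.
  apply: (@le_trans _ _ `|t - s|); last by near: s; exact: cvgr_dist_le.
  rewrite ler_norml (le_trans (plip _ _))// andbT lerNl opprB.
  by rewrite (le_trans (plip _ _))// distrC.
have pF k : exists c : R, p @` (F k) `<=` `[c, c + fine (diam (F k))]%classic.
  have [[x0 Fx0]|F0] := pselect (F k !=set0); last first.
    by exists 0 => y [x Fx _]; exfalso; apply: F0; exists x.
  have dF x y : F k x -> F k y -> p x - p y <= fine (diam (F k)).
    move=> Fx Fy; rewrite (le_trans (plip _ _))// -lee_fin fineK ?le_diam//.
    by rewrite ge0_fin_numE ?diam_ge0// (le_lt_trans (F1 k))// ltry.
  have hp : has_inf (p @` F k).
    split; first by exists (p x0), x0.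
    by exists (p x0 - fine (diam (F k))) => _ [x Fx <-]; rewrite lerBlDr -lerBlDl dF.
  exists (inf (p @` F k)) => _ [x Fx <-] /=; rewrite in_itv /=; apply/andP; split.
    by apply: inf_lbound; [case: hp|exists x].
  rewrite -lerBlDr; apply: lb_le_inf; first by case: hp.
  by move=> _ [y Fy <-]; rewrite lerBlDr -lerBlDl dF.
have [c cF] := choice pF.
have p0 : p (g a) = 0 by rewrite /p subrr dotp0l mul0r.
have pL : p (g b) = L by rewrite /p -/u -sqr_enorm expr2 -mulrA divff ?mulr1// gt_eqF.
pose I k : set R := `[c k, c k + fine (diam (F k))]%classic.
have LI : `[0, L]%classic `<=` \bigcup_k I k.
  move=> y; rewrite /= in_itv /= => /andP[y0 yL].
  have [] := @IVT R (p \o g) a b y ab; first exact: continuous_subspaceT.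
    by rewrite /= p0 pL ge_min y0 le_max yL orbT.
  move=> t tab <-; have [|k _ Fk] := gF (g t); first by exists t.
  by exists k => //; apply: cF; exists (g t).
have : (lebesgue_measure (`[0%R, L]%classic : set R) <=
    \sum_(k <oo) lebesgue_measure (I k))%E.
  by apply: (@measure_sigma_subadditive _ _ _ (@lebesgue_measure R)) LI => [k|];
    exact: measurable_itv.
rewrite lebesgue_measure_itv /= lte_fin L0 -EFinB subr0 => /le_trans; apply.
apply: lee_nneseries => // k _.
rewrite lebesgue_measure_itv /= lte_fin ltrDl.
case: ifPn => _; last exact: diam_ge0.
rewrite -EFinD addrAC subrr add0r fineK//.
by rewrite ge0_fin_numE ?diam_ge0// (le_lt_trans (F1 k))// ltry.
Unshelve. all: by end_near. Qed.

(** Cutting [a, b] into small pieces gives covers whose diameters are controlled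
by the increments of [phi]. *)
Lemma H_curve_le (g : R -> V) (phi : R -> R) (a b : R) : a <= b ->
  (forall s t, a <= s -> s <= t -> t <= b -> enorm (g t - g s) <= phi t - phi s) ->
  (forall s t, a <= s -> s <= t -> t <= b -> enorm (g t - g s) <= t - s) ->
  (H (g @` `[a, b]%classic) <= (phi b - phi a)%:E)%E.
Proof.
move=> ab gphi lg; apply: H_le => d d0.
pose n := (Num.truncn ((b - a) / d)).+1.
pose h := (b - a) / n%:R.
have n0 : 0 < n%:R :> R by [].
have h0 : 0 <= h by rewrite divr_ge0 ?subr_ge0// ltW.
have hd : h <= d.
  rewrite /h ler_pdivrMr// mulrC -ler_pdivrMr// ltW//; exact: truncnS_gt.
pose t k := a + k%:R * h.
have tn : t n = b by rewrite /t /h mulrC divfK ?subrKC// gt_eqF.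
have ta k : a <= t k by rewrite lerDl mulr_ge0.
have tS k : t k <= t k.+1 by rewrite lerD2l ler_wpM2r// ler_nat.
have tmono k l : (k <= l)%N -> t k <= t l.
  by move=> kl; rewrite lerD2l ler_wpM2r// ler_nat.
pose F k : set V := if (k < n)%N then g @` `[t k, t k.+1]%classic else set0.
have dF k (psi : R -> R) : (k < n)%N ->
    (forall s t, a <= s -> s <= t -> t <= b -> enorm (g t - g s) <= psi t - psi s) ->
    (diam (F k) <= (psi (t k.+1) - psi (t k))%:E)%E.
  move=> kn gpsi; have tb : t k.+1 <= b by rewrite -tn tmono.
  have psi_mono s r : a <= s -> s <= r -> r <= b -> psi s <= psi r.
    by move=> ? ? ?; rewrite -subr_ge0 (le_trans (enorm_ge0 _) (gpsi _ _ _ _ _)).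
  apply: diam_le => [|x y]; first by rewrite lee_fin subr_ge0 psi_mono.
  rewrite /F kn => -[s + <-] [r + <-]; rewrite /= !in_itv /= => /andP[ks sk] /andP[kr rk].
  rewrite lee_fin; wlog sr : s r ks sk kr rk / r <= s.
    by move=> wlg; have [|/ltW] := leP r s; [exact: wlg|rewrite enormC; exact: wlg].
  rewrite (le_trans (gpsi r s _ _ _))//.
  - exact: le_trans (ta k) kr.
  - exact: le_trans sk tb.
  rewrite lerB ?psi_mono//; first exact: le_trans (ta k) ks.
  exact: le_trans rk tb.
have Fcov : g @` `[a, b]%classic `<=` \bigcup_k F k.
  move=> _ [s + <-]; rewrite /= in_itv /= => /andP[as_ sb].
  have [sb'|sb'] := eqVneq s b.
    exists n.-1 => //; rewrite /F ltnSn; exists b; last by rewrite sb'.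
    have tn1 : t n.-1.+1 = b by exact: tn.
    by rewrite /= in_itv/= tn1 lexx andbT -[leRHS]tn1 tS.
  have hgt : 0 < h.
    by rewrite divr_gt0// subr_gt0 (le_lt_trans as_)// lt_neqAle sb'.
  pose k := Num.truncn ((s - a) / h).
  have /andP[k1 k2] : k%:R <= (s - a) / h < k.+1%:R.
    by apply: truncn_itv; rewrite divr_ge0// subr_ge0.
  have ks : t k <= s by rewrite /t -lerBrDl -ler_pdivlMr.
  have sk : s <= t k.+1 by rewrite /t -lerBlDl -ler_pdivrMr// ltW.
  exists k => //; rewrite /F ifT; first by exists s => //; rewrite /= in_itv /= ks.
  rewrite ltnNge; apply/negP => nk; have := le_trans (tmono _ _ nk) ks.
  by rewrite tn leNgt lt_neqAle sb' sb.
apply: (le_trans (Hd_le Fcov _)) => [k|].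
  have [kn|nk] := ltnP k n; last by rewrite /F ltnNge nk diam0 lee_fin ltW.
  apply: (@le_trans _ _ (t k.+1 - t k)%:E).
    exact: (dF k id).
  by rewrite lee_fin /t opprD addrACA subrr add0r -mulrBl -natrB// subSnn mul1r.
rewrite (@nneseries_split _ _ 0%N n) => [|k _]; last exact: diam_ge0.
rewrite add0n [X in (_ + X)%E]eseries0 ?adde0 => [|k nk _]; last first.
  by rewrite /F ltnNge nk diam0.
apply: (@le_trans _ _ (\sum_(0 <= k < n) (phi (t k.+1) - phi (t k))%:E)%E).
  by rewrite !big_mkord; apply: lee_sum => k _; apply: dF.
by rewrite sumEFin telescope_sumr// tn /t mul0r addr0.
Qed.

(** A Lebesgue-null set is covered by intervals of small total length. *)
Lemma H_image_null (g : R -> V) (N : set R) :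
  (forall s t, enorm (g t - g s) <= `|t - s|) ->
  (@lebesgue_measure R).-negligible N -> H (g @` N) = 0%E.
Proof.
move=> lg [A [mA A0 NA]]; apply: (@H0S _ _ _ (g @` A)).
  by move=> _ [t /NA ? <-]; exists t.
apply/eqP; rewrite eq_le H_ge0 andbT; apply: H_le => d d0.
apply/lee_addgt0Pr => e e0; rewrite add0e.
have de0 : 0 < Num.min d e by rewrite lt_min d0.
have A0' : mu_ext (wlength idfun) A = 0%E by [].
have Afin : mu_ext (wlength idfun) A \is a fin_num by rewrite A0'.
have [_ [F [mF AF] <-]] := lb_ereal_inf_adherent de0 Afin.
rewrite -/(mu_ext _ _) A0' add0e => Fde.
have dgF k : (diam (g @` F k) <= wlength idfun (F k))%E.
  have /ocitvP[->|[[x y] /= xy ->]] := mF k; first by rewrite image_set0 diam0 wlength0.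
  rewrite wlength_itv_bnd ?(ltW xy)//; apply: diam_le.
    by rewrite lee_fin subr_ge0 ltW.
  move=> _ _ [s + <-] [r + <-]; rewrite /= !in_itv /= => /andP[xs sy] /andP[xr ry].
  rewrite lee_fin (le_trans (lg _ _))// ler_norml; move: (ltW xs) (ltW xr) => ? ?.
  by apply/andP; split; lra.
have sumF : (\sum_(k <oo) diam (g @` F k) <= (Num.min d e)%:E)%E.
  apply: le_trans (ltW Fde); apply: lee_nneseries => [k _ _|k _] //.
  exact: diam_ge0.
apply: (@le_trans _ _ (\sum_(k <oo) diam (g @` F k))%E).
  apply: Hd_le => [_ [t /AF[k _ Ft] <-]|k]; first by exists k => //; exists t.
  have : (diam (g @` F k) <= \sum_(k <oo) diam (g @` F k))%E.
    apply: le_trans (nneseries_lim_ge k.+1 _); last by move=> *; exact: diam_ge0.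
    rewrite big_nat_recr//= leeDr// sume_ge0// => *; exact: diam_ge0.
  move=> /le_trans; apply; apply: (le_trans sumF).
  by rewrite lee_fin ge_min lexx.
by apply: (le_trans sumF); rewrite lee_fin ge_min lexx orbT.
Qed.

End hausdorff_more.

(** * Lipschitz functions and arcs *)
Section lipschitz_ftc.
Context {R : realType}.
Local Notation mu := (@lebesgue_measure R).

Lemma is_derive_shifted (F G : R -> R) (c a b d x : R) : a < x -> x < b ->
  (forall y, a < y -> y < b -> G y = F y + y - c) ->
  derivable G x 1 -> derive1 G x = d -> is_derive x 1 F (d - 1).
Proof.
move=> ax xb GE dG Gx.
have dG1 : is_derive x 1 G d by apply: DeriveDef => //; rewrite -derive1E.
apply: (@near_eq_is_derive _ _ _ (G - id + cst c)).
  near=> y; rewrite (_ : (G - id + cst c) y = G y - y + c)// GE.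
  - by rewrite addrAC subrK addrK.
  - by near: y; exact: lt_nbhsr.
  - by near: y; exact: lt_nbhsl.
by rewrite -[X in is_derive _ _ _ X]addr0; apply: is_deriveD.
Unshelve. all: by end_near. Qed.

Section cumulative.
Variable F : R -> R.
Hypothesis lipF : forall s t, `|F t - F s| <= `|t - s|.

Let incr (x : R) := F x + x.
Let decr (x : R) := x - F x.

Lemma lip_continuous : continuous F.
Proof.
move=> t; apply/cvgrPdist_le => /= e e0; near=> s.
by apply: (le_trans (lipF _ _)); near: s; exact: cvgr_dist_le.
Unshelve. all: by end_near. Qed.

Let incr_nd : {homo incr : x y / x <= y}.
Proof.
move=> x y xy; have := lipF x y; rewrite (ger0_norm (_ : 0 <= y - x)) ?subr_ge0//.
by rewrite ler_norml /incr => /andP[]; lra.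
Qed.

Let decr_nd : {homo decr : x y / x <= y}.
Proof.
move=> x y xy; have := lipF x y; rewrite (ger0_norm (_ : 0 <= y - x)) ?subr_ge0//.
by rewrite ler_norml /decr => /andP[]; lra.
Qed.

Let incr_rc : right_continuous incr.
Proof.
apply/right_continuousW => x; apply: continuousD; first exact: lip_continuous.
exact: cvg_id.
Qed.

Let decr_rc : right_continuous decr.
Proof.
apply/right_continuousW => x; apply: continuousB; last exact: lip_continuous.
exact: cvg_id.
Qed.

HB.instance Definition _ := isCumulative.Build R _ R incr incr_nd incr_rc.
HB.instance Definition _ := isCumulative.Build R _ R decr decr_nd decr_rc.

Let muH : {measure set (measurableTypeR R) -> \bar R} := lebesgue_stieltjes_measure incr.
Let muK : {measure set (measurableTypeR R) -> \bar R} := lebesgue_stieltjes_measure decr.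

Let ls_ocitv (f : cumulative R R) a b : a <= b ->
  lebesgue_stieltjes_measure f `]a, b]%classic = (f b - f a)%:E.
Proof.
move=> ab; rewrite /lebesgue_stieltjes_measure /measure_extension/=.
rewrite measurable_mu_extE/= ?wlength_itv_bnd//; exact: is_ocitv.
Qed.

Let half_ge0 : 0 <= 2^-1 :> R. Proof. by rewrite invr_ge0. Qed.

Let half_measure : {measure set (measurableTypeR R) -> \bar R} :=
  mscale (NngNum half_ge0) (measure_add muH muK).

Let half_measureE A : half_measure A = ((2^-1)%:E * (muH A + muK A))%E.
Proof. by congr (_ * _)%E; exact: measure_addE. Qed.

Let lebesgue_half A : measurable A -> mu A = ((2^-1)%:E * (muH A + muK A))%E.
Proof.
rewrite -half_measureE; move: A; apply: lebesgue_measure_unique.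
move=> X /ocitvP[->|[[x y] /= xy ->]]; first by rewrite !measure0.
rewrite half_measureE.
have -> : muH `]x, y]%classic = (incr y - incr x)%:E by apply: ls_ocitv; exact: ltW.
have -> : muK `]x, y]%classic = (decr y - decr x)%:E by apply: ls_ocitv; exact: ltW.
have -> : mu `]x, y]%classic = (y - x)%:E by apply: ls_ocitv; exact: ltW.
by rewrite -EFinD -EFinM /incr /decr /=; congr (_%:E); field.
Qed.

Let muH_dom : muH `<< mu.
Proof.
apply/null_content_dominatesP => A mA A0.
have : ((2^-1)%:E * (muH A + muK A))%E = 0%E by rewrite -lebesgue_half.
move=> /eqP; rewrite mule_eq0 eqe invr_eq0 pnatr_eq0/=.
by rewrite padde_eq0// => /andP[/eqP].
Qed.

(** Lebesgue differentiation of the Radon-Nikodym density of the Stieltjes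
measure of the nondecreasing function [F x + x]. *)
Lemma lipschitz_ftc_ae (a b : R) : a < b ->
  exists h : R -> R, [/\ measurable_fun setT h,
    mu.-integrable setT (EFin \o h),
    {ae mu, forall x, a < x -> x < b -> is_derive x 1 F (h x - 1)} &
    forall s t, a <= s -> s <= t -> t <= b ->
      F t - F s = \int[mu]_(x in `]s, t]) h x - (t - s)].
Proof.
move=> ab; have mD : measurable (`]a, b]%classic : set (measurableTypeR R)).
  exact: (measurable_itv `]a, b]).
have Doo : (muH `]a, b]%classic < +oo)%E by rewrite [X in (X < _)%E](ls_ocitv _ (ltW ab)) ltry.
pose nu : {finite_measure set (measurableTypeR R) -> \bar R} := mfrestr mD Doo.
have numu : nu `<< mu.
  apply/null_content_dominatesP => A mA A0.
  rewrite /nu /= /mfrestr /mrestr.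
  apply/eqP; rewrite eq_le measure_ge0 andbT.
  move/null_content_dominatesP : muH_dom => /(_ A mA A0) <-.
  by rewrite le_measure ?inE//; exact: measurableI.
have [f [f0 ffin intf fE]] := radon_nikodym_sigma_finite numu.
pose h : R -> R := fine \o f.
have fh : f = EFin \o h by apply/funext => x; rewrite /= fineK.
have mh : measurable_fun setT h.
  by apply/measurable_EFinP; rewrite -fh; exact: measurable_int intf.
have inth : mu.-integrable setT (EFin \o h) by rewrite -fh.
have nuE s t : a <= s -> s <= t -> t <= b -> \int[mu]_(x in `]s, t]) h x = incr t - incr s.
  move=> as_ st tb; rewrite /Rintegral -/(comp EFin h) -fh -fE//.
  rewrite /nu /= /mfrestr /mrestr (_ : _ `&` _ = `]s, t]%classic).
    by rewrite [X in fine X](ls_ocitv _ st).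
  apply/seteqP; split=> x /=; first by case.
  rewrite !in_itv /= => /andP[sx xt].
  by rewrite sx xt (le_lt_trans as_ sx) (le_trans xt tb).
have nuE0 : nu `]-oo, a]%classic = 0%E.
  rewrite /nu /= /mfrestr /mrestr (_ : _ `&` _ = set0) ?measure0//.
  apply/seteqP; split=> x //=; rewrite !in_itv /= => -[xa /andP[ax _]].
  by have := lt_le_trans ax xa; rewrite ltxx.
exists h; split => //; last first.
  by move=> s t as_ st tb; rewrite nuE// /incr; lra.
have loc : locally_integrable setT h.
  apply: open_integrable_locally => //; exact: openT.
have intS y : mu.-integrable `]-oo, y] (EFin \o h).
  exact: integrableS inth.
have := FTC1Ny intS loc.
apply: filterS; first exact: (ae_filter_ringOfSetsType mu).
move=> x /= [dG Gx] ax xb.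
set G := fun y => \int[mu]_(t in `]-oo, y]) h t in dG Gx.
have GE y : a < y -> y < b -> G y = incr y - incr a.
  move=> ay yb; rewrite -nuE ?(ltW ay)// ?(ltW yb)// /G.
  have -> : `]-oo, y]%classic = `]-oo, a]%classic `|` `]a, y]%classic :> set R.
    by rewrite -itv_bndbnd_setU//= bnd_simp ltW.
  rewrite Rintegral_setU//.
  - by rewrite {1}/Rintegral -/(comp EFin h) -fh -fE// nuE0 add0r.
  - by apply: (integrableS measurableT _ _ inth) => //; exact: measurableU.
  - apply/disj_setPRL => z /=; rewrite !in_itv /= => /andP[az _].
    by apply/negP; rewrite -ltNge.
by apply: (@is_derive_shifted F G (incr a) a b).
Qed.

(** The slope of [F x + x] is that of [F] plus one. *)
Lemma lipschitz_ftc (a b : R) : a < b ->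
  exists k : R -> R, [/\ measurable_fun setT k,
    mu.-integrable setT (EFin \o k),
    {ae mu, forall x, a < x -> x < b -> is_derive x 1 F (k x)} &
    forall s t, a <= s -> s <= t -> t <= b ->
      F t - F s = \int[mu]_(x in `]s, t]) k x].
Proof.
move=> ab; have [h [mh ih dh hE]] := lipschitz_ftc_ae ab.
pose k := (h \- cst 1) \_ `]a, b]%classic.
have ik : mu.-integrable `]a, b] (EFin \o (h \- cst 1)).
  apply: (@integrableB _ _ _ mu _ _ (EFin \o h) (cst 1%:E)) => //.
    exact: integrableS ih.
  apply: measurable_bounded_integrable => //.
    by rewrite /= lebesgue_measure_itv/= lte_fin ab -EFinB ltry.
  by exists 1; split=> // M M1 x _ /=; rewrite normr1 ltW.
have ikT : mu.-integrable setT (EFin \o k).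
  have /integrable_mkcond := ik.
  by rewrite restrict_EFin; apply; exact: (measurable_itv `]a, b]).
exists k; split => //.
- by apply/measurable_restrict => //; apply/measurable_funTS/measurable_funB.
- apply: filterS dh; first exact: (ae_filter_ringOfSetsType mu).
  move=> x + ax xb => /(_ ax xb); rewrite /k patchE mem_set//=.
  by rewrite in_itv/= ax ltW.
move=> s t as_ st tb; rewrite hE//.
transitivity (\int[mu]_(x in `]s, t]) (h x - 1)); last first.
  apply: eq_Rintegral => x; rewrite inE/= in_itv/= => /andP[sx xt].
  by rewrite /k patchE mem_set//= in_itv/= (le_lt_trans as_ sx) (le_trans xt tb).
have i1 : mu.-integrable `]s, t] (EFin \o cst 1).
  apply: measurable_bounded_integrable => //.
    rewrite /= lebesgue_measure_itv/= lte_fin; case: ifP => // _.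
    by rewrite -EFinB ltry.
  by exists 1; split=> // M M1 x _ /=; rewrite normr1 ltW.
have ihst : mu.-integrable `]s, t] (EFin \o h) by exact: integrableS ih.
rewrite [RHS](RintegralB _ ihst i1)//.
congr (_ - _); rewrite Rintegral_cst//= lebesgue_measure_itv/= lte_fin.
case: ltgtP st => // [st _|-> _]; last by rewrite subrr mulr0.
by rewrite -EFinB mul1r.
Qed.

End cumulative.

Section vector.
Context {m : nat}.
Local Notation V := 'rV[R]_m.

Lemma is_derive_rV (g : R -> V) (t : R) (d : V) :
  (forall i, is_derive t 1 (fun s => g s 0 i) (d 0 i)) -> is_derive t 1 g d.
Proof.
move=> gd; have dg : derivable g t 1.
  by apply/derivable_mxP => i j; rewrite ord1; have [] := gd j.
apply: DeriveDef => //; rewrite derive_mx//; apply/rowP => j; rewrite !mxE.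
by have [] := gd j.
Qed.

Lemma is_derive_coord (g : R -> V) (t : R) (d : V) i :
  is_derive t 1 g d -> is_derive t 1 (fun s => g s 0 i) (d 0 i).
Proof.
move=> [dg <-]; apply: DeriveDef.
  by move/derivable_mxP : dg; apply.
by rewrite derive_mx// mxE.
Qed.

Lemma lipschitz_ftc_vec (g : R -> V) (a b : R) : a < b ->
  (forall s t, enorm (g t - g s) <= `|t - s|) ->
  exists G : R -> V, [/\ forall i, measurable_fun setT (fun t => G t 0 i),
    forall i, mu.-integrable setT (fun t => (G t 0 i)%:E),
    {ae mu, forall x, a < x -> x < b -> is_derive x 1 g (G x)} &
    forall s t i, a <= s -> s <= t -> t <= b ->
      g t 0 i - g s 0 i = \int[mu]_(x in `]s, t]) G x 0 i].
Proof.
move=> ab lg.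
have lgi i s t : `|g t 0 i - g s 0 i| <= `|t - s|.
  by apply: le_trans (lg s t); have := coord_le_enorm (g t - g s) i; rewrite !mxE.
have [k kP] := choice (fun i => lipschitz_ftc (lgi i) ab).
exists (fun t => \row_i k i t); split=> [i|i||s t i as_ st tb].
- by under eq_fun do rewrite mxE; have [] := kP i.
- by under eq_fun do rewrite mxE; have [] := kP i.
- have : {ae mu, forall x, forall i, a < x -> x < b ->
      is_derive x 1 (fun s => g s 0 i) (k i x)}.
    suff : \forall x \ae mu, forall i, i \in enum 'I_m -> a < x -> x < b ->
      is_derive x 1 (fun s => g s 0 i) (k i x).
      apply: filterS; first exact: (ae_filter_ringOfSetsType mu).
      by move=> x + i; apply; rewrite mem_enum.
    elim: (enum 'I_m) => [|i s IH].
      by apply: aeW => x i; rewrite in_nil.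
    have [_ _ + _] := kP i.
    apply: filterS2 IH; first exact: (ae_filter_ringOfSetsType mu).
    by move=> x IH ki j; rewrite inE => /predU1P[->|/IH].
  apply: filterS; first exact: (ae_filter_ringOfSetsType mu).
  by move=> x dx ax xb; apply: is_derive_rV => i; rewrite mxE; exact: dx.
- have [_ _ _ ->//] := kP i; apply: eq_Rintegral => x _; by rewrite mxE.
Qed.

End vector.
End lipschitz_ftc.

Section curve_basics.
Context {R : realType} {m : nat}.
Local Notation V := 'rV[R]_m.
Local Notation H := (@hausdorff1 R m).
Implicit Types g : curve R m.

Lemma curve_le0 g t : t <= 0 -> g t = g 0.
Proof. exact: curve_neg. Qed.

Lemma curve_lipT g s t : enorm (g t - g s) <= `|t - s|.
Proof.
have [s0|s0] := leP 0 s; have [t0|t0] := leP 0 t.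
- exact: curve_lip.
- rewrite (curve_le0 g (ltW t0)); apply: (le_trans (curve_lip g _ _)) => //.
  rewrite sub0r normrN ger0_norm// ltr0_norm ?subr_lt0 ?(lt_le_trans t0)//.
  by rewrite opprB lerDl oppr_ge0 ltW.
- rewrite (curve_le0 g (ltW s0)); apply: (le_trans (curve_lip g _ _)) => //.
  rewrite subr0 ger0_norm// ger0_norm ?subr_ge0 ?(le_trans (ltW s0))//.
  by rewrite lerDl oppr_ge0 ltW.
- by rewrite (curve_le0 g (ltW s0)) (curve_le0 g (ltW t0)) subrr enorm0.
Qed.

Lemma enorm_lip_continuous (g : R -> V) :
  (forall s t, enorm (g t - g s) <= `|t - s|) -> continuous g.
Proof.
move=> lg t; apply/cvgrPdist_le => /= e e0; near=> s.
apply: (@le_trans _ _ `|t - s|); last by near: s; exact: cvgr_dist_le.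
by rewrite (le_trans (norm_le_enorm _)).
Unshelve. all: by end_near. Qed.

Lemma curve_continuous g : continuous g.
Proof. exact/enorm_lip_continuous/curve_lipT. Qed.

Lemma curve_end g : exists2 T : R, 0 < T & forall t, T <= t -> g t = g T.
Proof.
have [T gT] := curve_eventually_cst g; exists (Num.max T 1).
  by rewrite lt_max ltr01 orbT.
by move=> t; rewrite ge_max => /andP[Tt _]; rewrite gT// [RHS]gT// le_max lexx.
Qed.

Lemma pinfE g T : (forall t, T <= t -> g t = g T) -> pinf g = g T.
Proof.
move=> gT; suff : lim (g t @[t --> +oo]) = g T :> V by [].
apply/cvg_lim; first exact: norm_hausdorff.
apply: cvg_near_cst; near=> t; apply: gT.
by near: t; apply: nbhs_pinfty_ge; exact: num_real.
Unshelve. all: by end_near. Qed.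

Lemma enorm_continuous : continuous (@enorm R m).
Proof.
move=> u; apply/(@cvgrPdist_le _ _ _ (nbhs u)) => e e0.
pose d := e / m.+1%:R; have d0 : 0 < d by rewrite divr_gt0.
near=> v; apply: (@le_trans _ _ (m.+1%:R * `|u - v|)).
  have H : `|enorm u - enorm v| <= enorm (u - v).
    rewrite ler_norml.
    have := ler_enormD (u - v) v; have := ler_enormD (v - u) u.
    by rewrite !subrK (enormC v u) => ? ?; apply/andP; split; lra.
  rewrite (le_trans H)// (le_trans (enorm_le_norm _))// ler_wpM2r// ler_nat//.
rewrite mulrC -ler_pdivlMr//; near: v; exact: cvgr_dist_le.
Unshelve. all: by end_near. Qed.

(** A simple curve is either constant, or it waits until [A], runs injectively
until [B], and then stops. *)
Lemma simple_arc g : simple g -> nonconstant g ->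
  exists A B : R, [/\ 0 <= A, A < B, forall t, t <= A -> g t = g A,
    forall t, B <= t -> g t = g B &
    forall s t, A <= s -> s < t -> t <= B -> g s <> g t].
Proof.
move=> sg [t1 t1ge gt1].
pose S := [set t : R | 0 <= t /\ forall s, 0 <= s -> s <= t -> g s = g 0].
pose S' := [set t : R | 0 <= t /\ forall s, t <= s -> g s = g t].
have St1 s : S s -> s <= t1.
  move=> [s0 gs]; rewrite leNgt; apply/negP => t1s; apply: gt1.
  exact: gs _ t1ge (ltW t1s).
have S0 : S 0.
  by split=> // s s0 s0'; congr (g _); apply/eqP; rewrite eq_le s0'.
have supS : has_sup S by split; [exists 0|exists t1 => s; exact: St1].
have [T T0 gT] := curve_end g.
have ST : S' T by split; [exact: ltW|].
have infS : has_inf S' by split; [exists T|exists 0 => s []].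
pose A := sup S; pose B := inf S'.
have A0 : 0 <= A by exact: ub_le_sup supS.2 _ S0.
have t0E : t0 g = A%:E.
  by rewrite /t0 ereal_sup_EFin//; case: supS.
have tinfE : tinf g = B%:E by rewrite /tinf ereal_inf_EFin//; case: infS.
have gA t : t < A -> g t = g 0.
  have [t0 _|t0 tA] := leP t 0; first exact: curve_le0.
  have At0 : 0 < A - t by rewrite subr_gt0.
  have [s [_ Ss] ts] := sup_adherent At0 supS.
  by apply: Ss; [exact: ltW|move: ts; rewrite subKr => /ltW].
have gB t : B < t -> g t = g T.
  move=> Bt; have Bt0 : 0 < t - B by rewrite subr_gt0.
  have [s [s0 Ss] ts] := inf_adherent Bt0 infS.
  have st : s <= t by move: ts; rewrite subrKC => /ltW.
  by rewrite Ss//; have [sT|/ltW Ts] := leP s T; [rewrite -(Ss _ sT)|rewrite gT].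
have gA' : g A = g 0.
  have cA : g t @[t --> A^'-] --> g A by exact/cvg_at_left_filter/curve_continuous.
  have c0 : g t @[t --> A^'-] --> g 0.
    apply: cvg_near_cst; near=> t; apply: gA.
    by near: t; exact: nbhs_left_lt.
  exact: (cvg_unique _ cA c0).
have gB' : g B = g T.
  have cB : g t @[t --> B^'+] --> g B by exact/cvg_at_right_filter/curve_continuous.
  have c0 : g t @[t --> B^'+] --> g T.
    apply: cvg_near_cst; near=> t; apply: gB.
    by near: t; exact: nbhs_right_gt.
  exact: (cvg_unique _ cB c0).
exists A, B; split => //.
- rewrite ltNge; apply/negP => BA.
  have gle t : t <= A -> g t = g 0.
    by rewrite le_eqVlt => /predU1P[->//|]; exact: gA.
  have gge t : B <= t -> g t = g T.
    by rewrite le_eqVlt => /predU1P[<-//|]; exact: gB.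
  apply: gt1; have [/gle//|/ltW At1] := leP t1 A.
  by rewrite (gge _ (le_trans BA At1)) -(gge A BA) gA'.
- by move=> t; rewrite gA' le_eqVlt => /predU1P[->//|]; exact: gA.
- by move=> t; rewrite gB' le_eqVlt => /predU1P[<-//|]; exact: gB.
- by move=> s t As st tB; apply: sg => //; rewrite ?t0E ?tinfE lee_fin.
Unshelve. all: by end_near. Qed.

End curve_basics.

Section vector_functions.
Context {R : realType} {m : nat} d (T : measurableType d).
Local Notation V := 'rV[R]_m.

Lemma measurable_dotp (D : set T) (u v : T -> V) :
  (forall i, measurable_fun D (fun t => u t 0 i)) ->
  (forall i, measurable_fun D (fun t => v t 0 i)) ->
  measurable_fun D (fun t => dotp (u t) (v t)).
Proof. by move=> mu mv; apply: measurable_sum => i; exact: measurable_funM. Qed.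

Lemma measurable_enorm (D : set T) (u : T -> V) :
  (forall i, measurable_fun D (fun t => u t 0 i)) ->
  measurable_fun D (fun t => enorm (u t)).
Proof.
move=> mu; apply: (@measurableT_comp _ _ _ _ _ _ (@Num.sqrt R)).
  by apply: continuous_measurable_fun; exact: sqrt_continuous.
exact: measurable_dotp.
Qed.

Lemma enorm_le_sum (u : V) : enorm u <= \sum_i `|u 0 i|.
Proof.
rewrite {1}(_ : u = \sum_i u 0 i *: 'e_i); last exact: row_sum_delta.
elim/big_ind2 : _ => [|x a y b xa yb|i _]; first by rewrite enorm0.
  by rewrite (le_trans (ler_enormD _ _))// lerD.
rewrite enormZ ler_piMr//.
have -> : enorm ('e_i : V) = 1; last by [].
rewrite /enorm /dotp (bigD1 i)//= big1 => [|j ji]; rewrite !mxE ?eqxx/=.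
  by rewrite mulr1 addr0 sqrtr1.
by rewrite (negbTE ji) mul0r.
Qed.

Lemma integrable_enorm (mu : {measure set T -> \bar R}) (D : set T) (u : T -> V) :
  measurable D ->
  (forall i, mu.-integrable D (fun t => (u t 0 i)%:E)) ->
  mu.-integrable D (fun t => (enorm (u t))%:E).
Proof.
move=> mD iu; apply: (@le_integrable _ _ _ mu _ mD _
  (fun t => \sum_(i < m) `|(u t 0 i)%:E|)%E) => //.
- apply/measurable_EFinP; apply: measurable_enorm => i.
  by apply/measurable_EFinP; exact: measurable_int (iu i).
- move=> t _; rewrite gee0_abs ?lee_fin ?enorm_ge0//.
  rewrite (le_trans _ (lee_abs _))// sumEFin lee_fin; exact: enorm_le_sum.
- by apply: integrable_sum => // i _; exact: integrable_abse.
Qed.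

Lemma Rintegral_sum (mu : {measure set T -> \bar R}) (D : set T) I (r : seq I)
    (f : I -> T -> R) : measurable D ->
  (forall i, mu.-integrable D (EFin \o f i)) ->
  \int[mu]_(x in D) (\sum_(i <- r) f i x) = \sum_(i <- r) \int[mu]_(x in D) f i x.
Proof.
move=> mD fi; elim: r => [|i r IH].
  under eq_Rintegral do rewrite big_nil.
  by rewrite big_nil /Rintegral integral0.
under eq_Rintegral do rewrite big_cons.
rewrite big_cons RintegralD//; first by rewrite IH.
rewrite (_ : EFin \o _ = fun x => (\sum_(j <- r) (EFin \o f j) x)%E).
  exact: integrable_sum.
by apply/funext => x /=; rewrite sumEFin.
Qed.

Lemma Rintegral_dotp (mu : {measure set T -> \bar R}) (D : set T) (u : V) (v : T -> V) :
  measurable D -> (forall i, mu.-integrable D (fun t => (v t 0 i)%:E)) ->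
  \int[mu]_(x in D) dotp u (v x) = \sum_i u 0 i * \int[mu]_(x in D) v x 0 i.
Proof.
move=> mD iv; rewrite Rintegral_sum//; last first.
  by move=> i; apply: (@integrableZl _ _ _ mu _ mD (u 0 i) _ (iv i)).
by apply: eq_bigr => i _; rewrite RintegralZl//; exact: iv.
Qed.

(** A bounded vector field paired with an integrable one. *)
Lemma integrable_dotp (mu : {measure set T -> \bar R}) (D : set T) (u v : T -> V) (C : R) :
  measurable D ->
  (forall i, measurable_fun D (fun t => u t 0 i)) ->
  (forall t, D t -> enorm (u t) <= C) ->
  (forall i, mu.-integrable D (fun t => (v t 0 i)%:E)) ->
  mu.-integrable D (fun t => (dotp (u t) (v t))%:E).
Proof.
move=> mD mu_ uC iv.
apply: (@le_integrable _ _ _ mu _ mD _ (fun t => C%:E * (enorm (v t))%:E)%E) => //.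
- apply/measurable_EFinP; apply: measurable_dotp => // i.
  by apply/measurable_EFinP; exact: measurable_int (iv i).
- move=> t Dt; rewrite -EFinM !abse_EFin lee_fin (le_trans (normr_dotp_le _ _))//.
  rewrite [leRHS]normrM (ger0_norm (enorm_ge0 _)) ler_wpM2r ?enorm_ge0//.
  by rewrite (le_trans (uC _ Dt))// ler_norm.
- by apply: integrableZl => //; exact: integrable_enorm.
Qed.

End vector_functions.

(** Comparison of the difference quotients from the right. *)
Lemma derive_dominates {R : realType} {m : nat} (F : R -> R) (g : R -> 'rV[R]_m)
    (x B r : R) (d : 'rV[R]_m) : x < B ->
  is_derive x 1 F r -> is_derive x 1 g d ->
  (forall y, x < y -> y < B -> enorm (g y - g x) <= F y - F x) -> enorm d <= r.
Proof.
move=> xB [Fr rE] [gd dE] gF.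
have right (f : R -> R) (l : R) : f h @[h --> 0^'] --> l -> f h @[h --> 0^'+] --> l.
  move=> fl; apply: cvg_trans fl => P; rewrite /nbhs/= /at_right /dnbhs /within /=.
  by apply: filterS => y Py y0; apply: Py; rewrite gt_eqF.
have cF : h^-1 *: (F (h *: 1 + x) - F x) @[h --> 0^'] --> r by rewrite -rE; exact: Fr.
have cg : h^-1 *: (g (h *: 1 + x) - g x) @[h --> 0^'] --> d by rewrite -dE; exact: gd.
have cn : enorm (h^-1 *: (g (h *: 1 + x) - g x)) @[h --> 0^'] --> enorm d.
  by apply: continuous_cvg cg; exact: enorm_continuous.
apply: (ler_cvg_to (right _ _ cn) (right _ _ cF)); near=> h.
have h0 : 0 < h by [].
rewrite enormZ ger0_norm ?invr_ge0 ?(ltW h0)// ler_wpM2l ?invr_ge0 ?(ltW h0)//.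
rewrite scaler1 gF ?ltrDr// -ltrBrDr.
by near: h; apply: nbhs_right_lt; rewrite subr_gt0.
Unshelve. all: by end_near. Qed.

(** The area formula for an injective Lipschitz arc.  The image of [H^1] by the
inverse of the arc is absolutely continuous; its density is at least [|g'|]
because an arc is longer than its chord, and has total mass at most the integral
of [|g'|]. *)
Section arc.
Context {R : realType} {m : nat}.
Local Notation V := 'rV[R]_m.
Local Notation H := (@hausdorff1 R m).
Local Notation mu := (@lebesgue_measure R).
Variables (g : R -> V) (A B : R).
Hypothesis AB : A < B.
Hypothesis lg : forall s t, enorm (g t - g s) <= `|t - s|.
Hypothesis ig : forall s t, A <= s -> s < t -> t <= B -> g s <> g t.

Let Im := g @` `[A, B]%classic.

Lemma arc_inj s t : A <= s -> s <= B -> A <= t -> t <= B -> g s = g t -> s = t.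
Proof.
move=> As sB At tB gst; case: (ltgtP s t) => // st; exfalso.
  exact: (ig As st tB).
exact: (ig At st sB).
Qed.

Lemma arc_closed (s t : R) : measurable ((g @` `[s, t]%classic) : set (H1type R m)).
Proof.
apply: Borel_H1; apply: closed_Rn; apply: compact_closed; first exact: norm_hausdorff.
apply: continuous_compact; last exact: segment_compact.
exact/continuous_subspaceT/enorm_lip_continuous.
Qed.

Lemma measurable_arc : measurable (Im : set (H1type R m)). Proof. exact: arc_closed. Qed.
Let mIm := measurable_arc.

Definition arc_inv (x : V) : R := xget 0 [set t | A <= t /\ t <= B /\ g t = x].
Local Notation Q := arc_inv.

Lemma arc_invK t : A <= t -> t <= B -> Q (g t) = t.
Proof.
move=> At tB; rewrite /arc_inv; case: xgetP => [s _ [As [sB gs]]|/(_ t)].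
  exact: arc_inj.
by move=> /not_andP[|/not_andP[]].
Qed.

Let QK := arc_invK.

Lemma arc_invP x : Im x -> [/\ A <= Q x, Q x <= B & g (Q x) = x].
Proof.
by move=> [t /=]; rewrite in_itv/= => /andP[At tB] <-; rewrite QK.
Qed.

Let QP := arc_invP.

Let mQ : measurable_fun (Im : set (H1type R m)) (Q : H1type R m -> measurableTypeR R).
Proof.
apply: (measurability _ (RGenCInfty.measurableE R)) => _ [_ [r ->] <-].
rewrite (_ : _ `&` _ = g @` `[Num.max A r, B]%classic); first exact: arc_closed.
apply/seteqP; split=> [x [/QP[AQ QB gQ]]|_ [t + <-]] /=.
  rewrite in_itv /= andbT => rQ; exists (Q x) => //.
  by rewrite in_itv/= ge_max AQ rQ QB.
rewrite /= in_itv/= ge_max => /andP[/andP[At rt] tB].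
by split; [exists t => //; rewrite /= in_itv/= At|rewrite QK// in_itv/= rt].
Qed.

Let mQT : measurable_fun setT (Q : H1type R m -> measurableTypeR R).
Proof.
rewrite -(setvU Im); apply/measurable_funU => //; first exact: measurableC.
split; last exact: mQ.
apply: (@eq_measurable_fun _ _ (H1type R m) (measurableTypeR R) _ (cst 0)); last first.
  exact: measurable_cst.
move=> x; rewrite inE => nIx; rewrite /arc_inv; case: xgetP => // t _ [At [tB gt]].
by exfalso; apply: nIx; exists t => //; rewrite /= in_itv/= At tB.
Qed.

Let HImB : (H Im <= (B - A)%:E)%E.
Proof.
apply: (@H_curve_le _ _ g id) => [|s t _ st _|s t _ st _]; first exact: ltW.
- by rewrite (le_trans (lg _ _))// ger0_norm// subr_ge0.
- by rewrite (le_trans (lg _ _))// ger0_norm// subr_ge0.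
Qed.

Let HImoo : (H1 R m Im < +oo)%E.
Proof. by apply: le_lt_trans HImB _; rewrite ltry. Qed.

Let H1Im : {finite_measure set (H1type R m) -> \bar R} := mfrestr mIm HImoo.

Let nu : {finite_measure set (measurableTypeR R) -> \bar R} := image_measure H1Im mQT.

Let nuE (E : set R) : nu E = H (g @` (`[A, B]%classic `&` E)).
Proof.
transitivity (H (Q @^-1` E `&` Im)); first by [].
congr H; apply/seteqP; split=> [x [Ex Ix]|_ [t [+ Et] <-]].
  have [AQ QB gQ] := QP Ix; exists (Q x) => //; split.
    by rewrite /= in_itv/= AQ QB.
  by [].
rewrite /= in_itv/= => /andP[At tB]; have It : Im (g t).
  by exists t => //; rewrite /= in_itv/= At tB.
by split => //; rewrite /= QK.
Qed.

Let nu_itv s t : A <= s -> s <= t -> t <= B -> nu `]s, t]%classic = H (g @` `[s, t]%classic).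
Proof.
move=> As st tB; rewrite nuE; apply/eqP; rewrite eq_le; apply/andP; split.
  apply: le_H => _ [r [_ +] <-]; rewrite /= in_itv/= => /andP[sr rt].
  by exists r => //; rewrite /= in_itv/= (ltW sr) rt.
apply: (@le_trans _ _ (H (g @` (`[A, B]%classic `&` `]s, t]%classic) `|` [set g s]))).
  apply: le_H => _ [r + <-]; rewrite /= in_itv/= => /andP[sr rt].
  move: sr; rewrite le_eqVlt => /predU1P[<-|sr]; first by right.
  left; exists r => //; rewrite /= !in_itv/= sr rt; split => //.
  by rewrite (le_trans As (ltW sr)) (le_trans rt tB).
by rewrite (le_trans (outer_measureU2 _ _ _))// [X in (_ + X)%E]H_set1 adde0.
Qed.

Let numu : nu `<< mu.
Proof.
apply/null_content_dominatesP => N mN N0; rewrite nuE.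
apply: H_image_null => //; by exists N; split => // t [].
Qed.

Variable G : R -> V.
Hypothesis mG : forall i, measurable_fun setT (fun t => G t 0 i).
Hypothesis iG : forall i, mu.-integrable setT (fun t => (G t 0 i)%:E).
Hypothesis dG : {ae mu, forall x, A < x -> x < B -> is_derive x 1 g (G x)}.
Hypothesis ftcG : forall s t i, A <= s -> s <= t -> t <= B ->
  g t 0 i - g s 0 i = \int[mu]_(x in `]s, t]) G x 0 i.

Let nG t := enorm (G t).

Let m_nG : measurable_fun setT nG.
Proof. exact: measurable_enorm. Qed.

Let i_nG : mu.-integrable setT (EFin \o nG).
Proof. exact: integrable_enorm. Qed.

Let chord s t : A <= s -> s <= t -> t <= B ->
  enorm (g t - g s) <= \int[mu]_(x in `]s, t]) nG x.
Proof.
move=> As st tB; set u := g t - g s.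
have [->|u0] := eqVneq (enorm u) 0.
  by apply: Rintegral_ge0 => x _; exact: enorm_ge0.
have {}u0 : 0 < enorm u by rewrite lt_def u0 enorm_ge0.
rewrite -(ler_pM2l u0) -expr2 sqr_enorm.
have iGst i : mu.-integrable `]s, t] (fun t => (G t 0 i)%:E) by exact: integrableS (iG i).
have mst : measurable (`]s, t]%classic : set (measurableTypeR R)).
  exact: (measurable_itv `]s, t]).
have -> : dotp u u = \int[mu]_(x in `]s, t]) dotp u (G x).
  rewrite Rintegral_dotp//; apply: eq_bigr => i _.
  by rewrite -ftcG// /u !mxE.
have inGst : mu.-integrable `]s, t] (EFin \o nG) by exact: integrableS i_nG.
rewrite -RintegralZl//; apply: le_Rintegral => //.
- apply: (@integrable_dotp _ _ _ _ mu _ (cst u) _ (enorm u)) => // i.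
- exact: (@integrableZl _ _ _ mu _ mst (enorm u) _ inGst).
- by move=> x _; exact: dotp_le.
Qed.

Let split_nG s t : A <= s -> s <= t ->
  \int[mu]_(x in `]A, t]) nG x - \int[mu]_(x in `]A, s]) nG x = \int[mu]_(x in `]s, t]) nG x.
Proof.
move=> As st.
have -> : `]A, t]%classic = `]A, s]%classic `|` `]s, t]%classic :> set R.
  by rewrite -itv_bndbnd_setU//= bnd_simp.
rewrite Rintegral_setU//; first by rewrite addrAC subrr add0r.
- by apply: (integrableS measurableT _ _ i_nG) => //; apply: measurableU;
    exact: measurable_itv.
- apply/disj_setPRL => z /=; rewrite !in_itv /= => /andP[az _].
  by apply/negP; rewrite negb_and -!ltNge az orbT.
Qed.

(** [H_curve_le], applied to the integral of the speed, bounds the length from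
above. *)
Let nu_le : (nu `]A, B]%classic <= (\int[mu]_(x in `]A, B]) nG x)%:E)%E.
Proof.
rewrite nu_itv//; last exact: ltW.
have := @H_curve_le _ _ g (fun t => \int[mu]_(x in `]A, t]) nG x) A B (ltW AB).
rewrite (_ : `]A, A]%classic = set0) ?Rintegral_set0 ?subr0; last first.
  by rewrite set_itvoc0.
apply=> s t As st tB.
  by rewrite split_nG//; exact: chord.
by rewrite (le_trans (lg _ _))// ger0_norm// subr_ge0.
Qed.

Let rho : R -> R := fine \o Radon_Nikodym (charge_of_finite_measure nu) mu.

Let nuc : charge_of_finite_measure nu `<< mu.
Proof. exact: numu. Qed.

Let rhoE : Radon_Nikodym (charge_of_finite_measure nu) mu = EFin \o rho.
Proof. by apply/funext => x; rewrite /rho /= fineK// Radon_Nikodym_fin_num. Qed.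

Let i_rho : mu.-integrable setT (EFin \o rho).
Proof. by rewrite -rhoE; exact: Radon_Nikodym_integrable. Qed.

Let m_rho : measurable_fun setT rho.
Proof. by apply/measurable_EFinP; exact: measurable_int i_rho. Qed.

Let nu_rho E : measurable E -> nu E = (\int[mu]_(x in E) (rho x)%:E)%E.
Proof.
by move=> mE; have := Radon_Nikodym_integral nuc mE; rewrite rhoE.
Qed.

(** An arc is longer than its chord: at a point where the length from the start
of the arc and the arc itself are differentiable, the derivative of the length
is at least the speed. *)
Let rho_ge : {ae mu, forall x, A < x -> x < B -> nG x <= rho x}.
Proof.
have loc : locally_integrable setT rho.
  by apply: open_integrable_locally => //; exact: openT.
have intS y : mu.-integrable `]-oo, y] (EFin \o rho).
  exact: integrableS i_rho.
have := FTC1Ny intS loc.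
set F := fun x => \int[mu]_(t in `]-oo, x]) rho t.
have FE x y : A <= x -> x <= y -> y <= B ->
    enorm (g y - g x) <= F y - F x.
  move=> Ax xy yB.
  have -> : F y - F x = fine (nu `]x, y]%classic).
    rewrite nu_rho//.
    rewrite /F; have -> : `]-oo, y]%classic = `]-oo, x]%classic `|` `]x, y]%classic :> set R.
      by rewrite -itv_bndbnd_setU//= bnd_simp.
    rewrite Rintegral_setU//; first by rewrite addrAC subrr add0r.
    - by apply: (integrableS measurableT _ _ i_rho) => //; apply: measurableU;
        exact: measurable_itv.
    - apply/disj_setPRL => z /=; rewrite !in_itv /= => /andP[xz _].
      by apply/negP; rewrite -ltNge.
  rewrite -lee_fin fineK ?fin_num_measure//.
  by rewrite nu_itv//; exact: enorm_le_H.
move: dG => dG'.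
apply: filterS2 dG'; first exact: (ae_filter_ringOfSetsType mu).
move=> x dgx [dF Fx] Ax xB.
have dF1 : is_derive x 1 F (rho x).
  by apply: DeriveDef; [exact: dF|rewrite -derive1E; exact: Fx].
apply: (derive_dominates xB dF1 (dgx Ax xB)) => y xy yB.
by apply: FE; [exact: ltW|exact: ltW|exact: ltW].
Qed.

(** The density is at least the speed and its integral is at most that of the
speed. *)
Let rho_nG : ae_eq mu `]A, B]%classic (EFin \o rho) (EFin \o nG).
Proof.
set D : set (measurableTypeR R) := `]A, B]%classic.
have mD : measurable D by exact: (measurable_itv `]A, B]).
have iDr : mu.-integrable D (EFin \o rho) by exact: integrableS i_rho.
have iDn : mu.-integrable D (EFin \o nG) by exact: integrableS i_nG.
pose f x := (rho x - nG x)%:E.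
have iD : mu.-integrable D f by exact: (integrableB mD iDr iDn).
have mf : measurable_fun D f by exact: measurable_int iD.
have maf : measurable_fun D (fun x => `|f x|%E) by exact: measurableT_comp.
have notB : {ae mu, forall x, x <> B}.
  exists [set B]; split; [exact: measurable_set1|exact: lebesgue_measure_set1|].
  by move=> x /= /contrapT.
have ge0 : ae_eq mu D (fun x => `|f x|%E) f.
  move: rho_ge => rho_ge'.
  apply: filterS2 notB rho_ge'; first exact: (ae_filter_ringOfSetsType mu).
  move=> x xB + Dx; move: Dx; rewrite /D /= in_itv/= => /andP[Ax].
  rewrite le_eqVlt => /predU1P[//|xB'] /(_ Ax xB') rn.
  by rewrite /f /= ger0_norm// subr_ge0.
have : (\int[mu]_(x in D) `|f x| = 0)%E.
  apply/eqP; rewrite eq_le integral_ge0// andbT.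
  have -> : (\int[mu]_(x in D) `|f x| = \int[mu]_(x in D) f x)%E.
    by apply: ae_eq_integral.
  have -> := integralB mD iDr iDn.
  rewrite sube_le0 -nu_rho//.
  rewrite (le_trans nu_le)// /Rintegral fineK//.
  exact: integrable_fin_num iDn.
move/(ae_eq_integral_abs _ mD mf) => aef.
apply: (@filterS _ _ (ae_filter_ringOfSetsType mu) _ _ _ aef).
by move=> x /= + Dx => /(_ Dx) -[] /eqP; rewrite subr_eq0 => /eqP ->.
Qed.

(** Area formula: the image under [g] of [|g'| dt] is [H^1] on the arc. *)
Lemma arc_integral (phi : R -> R) (C : R) : measurable_fun setT phi ->
  (forall t, `|phi t| <= C) ->
  (H1 R m).-integrable Im (fun x => (phi (Q x))%:E) /\
  \int[H1 R m]_(x in Im) phi (Q x) = \int[mu]_(t in `]A, B]) (phi t * nG t).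
Proof.
move=> mphi phiC.
have mphiQ : measurable_fun setT (fun x : H1type R m => phi (Q x)).
  exact: (measurableT_comp mphi mQT).
have iphiQ : (H1 R m).-integrable Im (fun x => (phi (Q x))%:E).
  apply: (measurable_bounded_integrable mIm HImoo); first exact: measurable_funTS.
  exists C; split; first exact: num_real.
  by move=> M CM x _; exact: le_trans (phiC _) (ltW CM).
split; first exact: iphiQ.
have mphiE : measurable_fun setT (EFin \o phi : measurableTypeR R -> \bar R).
  exact/measurable_EFinP.
have mphiQE : measurable_fun setT ((EFin \o phi) \o Q : H1type R m -> \bar R).
  exact/measurable_EFinP.
have iH : H1Im.-integrable setT ((EFin \o phi) \o Q).
  exact: (integrable_mfrestr mIm HImoo mphiQE iphiQ).
have e1 := integral_mfrestr mIm HImoo mphiQE iphiQ.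
have e2 := integral_image mQT mphiE iH.
congr fine; apply: (etrans (esym e1)); apply: (etrans (esym e2)).
have inu : nu.-integrable setT (EFin \o phi) by exact: integrable_image.
have nuC : nu (~` `]A, B]%classic) = 0%E.
  rewrite nuE; apply: (@H0S _ _ _ [set g A]); last exact: H_set1.
  move=> _ [t [+ +] <-]; rewrite /= !in_itv/= => /andP[At tB] /negP.
  rewrite negb_and -!leNgt -ltNge ltNge tB orbF => tA.
  by congr g; apply/eqP; rewrite eq_le tA.
have mAB : measurable (`]A, B]%classic : set (measurableTypeR R)).
  exact: (measurable_itv `]A, B]).
have e3 : (\int[nu]_y (EFin \o phi) y = \int[nu]_(y in `]A, B]) (EFin \o phi) y)%E.
  have e := negligible_integral (measurableC mAB) measurableT inu nuC.
  by rewrite setTD setCK in e.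
apply: (etrans e3).
have inuAB : nu.-integrable `]A, B] (EFin \o phi) by exact: integrableS inu.
have e4 := Radon_Nikodym_change_of_variables numu mAB inuAB.
apply: (etrans (esym e4)).
apply: ae_eq_integral.
- exact: mAB.
- rewrite rhoE; apply/measurable_EFinP.
  exact: (measurable_funM (measurable_funTS mphi) (measurable_funTS m_rho)).
- apply/measurable_EFinP.
  exact: (measurable_funM (measurable_funTS mphi) (measurable_funTS m_nG)).
- apply: (@filterS _ _ (ae_filter_ringOfSetsType mu) _ _ _ rho_nG).
  move=> x /= rx Dx; have [rxE] := rx Dx.
  by rewrite rhoE /= rxE.
Qed.

Definition arc_tangent (x : V) : V := (enorm (G (Q x)))^-1 *: G (Q x).

Let N t : V := (enorm (G t))^-1 *: G t.

Let enormN1 t : enorm (N t) <= 1.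
Proof.
rewrite /N enormZ ger0_norm ?invr_ge0 ?enorm_ge0//.
have [->|G0] := eqVneq (enorm (G t)) 0; first by rewrite mulr0.
by rewrite mulVf.
Qed.

Let NnG t : nG t *: N t = G t.
Proof.
rewrite /N scalerA; have [/enorm_eq0->|G0] := eqVneq (nG t) 0; first by rewrite !scaler0.
by rewrite mulfV// scale1r.
Qed.

Lemma arc_form (w : V -> V) (C : R) :
  (forall i, continuous (fun x => w x 0 i)) -> (forall x, enorm (w x) <= C) ->
  (H1 R m).-integrable Im (fun x => (dotp (w x) (arc_tangent x))%:E) /\
  \int[H1 R m]_(x in Im) dotp (w x) (arc_tangent x) =
  \int[mu]_(t in `]A, B]) dotp (w (g t)) (G t).
Proof.
move=> cw wC; pose phi t := dotp (w (g t)) (N t).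
have mphi : measurable_fun setT phi.
  apply: measurable_dotp => i.
    apply: continuous_measurable_fun => t; apply: continuous_comp (cw i _).
    exact: enorm_lip_continuous lg t.
  under eq_fun do rewrite /N mxE.
  apply: measurable_funM => //.
  rewrite (_ : (fun t => (nG t)^-1) = (fun t => nG t `^ (-1))).
    exact: (measurableT_comp (measurable_powR (-1)) m_nG).
  by apply/funext => t; rewrite powR_inv1// enorm_ge0.
have phiC t : `|phi t| <= C.
  rewrite (le_trans (normr_dotp_le _ _))// -[leRHS]mulr1 ler_pM ?enorm_ge0//.
have phiQ x : Im x -> phi (Q x) = dotp (w x) (arc_tangent x).
  by move=> /QP[_ _ gQ]; rewrite /phi gQ.
have [iphi phiE] := arc_integral mphi phiC.
split.
  apply: eq_integrable iphi; first exact: mIm.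
  by move=> x; rewrite inE => Ix; rewrite phiQ.
transitivity (\int[H1 R m]_(x in Im) phi (Q x)).
  by apply: eq_Rintegral => x; rewrite inE => Ix; rewrite phiQ.
rewrite phiE; apply: eq_Rintegral => t _.
by rewrite /phi mulrC -dotpZr NnG.
Qed.

End arc.

Section fields.
Context {R : realType} {m : nat}.
Local Notation V := 'rV[R]_m.

Lemma Ck_continuous k (f : V -> R) : Ck k f -> continuous f.
Proof. by case: k => [|k] []. Qed.

Lemma smooth_continuous (f : V -> R) : smooth f -> continuous f.
Proof. by move=> /(_ 0%N) /Ck_continuous. Qed.

Lemma testform_continuous (w : testform R m) i : continuous (fun x => w x 0 i).
Proof. exact/smooth_continuous/testform_smooth. Qed.

Lemma rV_continuous (w : V -> V) : (forall i, continuous (fun x => w x 0 i)) ->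
  continuous w.
Proof.
move=> cw x; apply/(@cvgrPdist_le _ _ _ (nbhs x)) => e e0.
have h i : \forall y \near x, `|w x 0 i - w y 0 i| <= e.
  by have /cvgrPdist_le := cw i x; apply.
near=> y; apply: norm_le_coord (ltW e0) _ => i; rewrite !mxE.
by move: i; near: y; apply: filter_forall => i; exact: h.
Unshelve. all: by end_near. Qed.

Lemma compact_support_bounded (w : V -> V) : continuous w ->
  compact (closure [set x | w x != 0]) -> exists C, forall x, enorm (w x) <= C.
Proof.
move=> cw cS.
have cn : continuous (fun x => enorm (w x)).
  by move=> x; apply: continuous_comp; [exact: cw|exact: enorm_continuous].
have : compact ((fun x => enorm (w x)) @` closure [set x | w x != 0]).
  by apply: continuous_compact => //; exact: continuous_subspaceT.
move=> /compact_bounded[M [_ /(_ (M + 1))]]; rewrite ltrDl => /(_ ltr01) MB.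
exists (Num.max 0 (M + 1)) => x; rewrite le_max.
have [->|wx] := eqVneq (w x) 0; first by rewrite enorm0 lexx.
apply/orP; right; apply: le_trans (ler_norm _) _; apply: MB.
by exists x => //; exact: subset_closure.
Qed.

Lemma testform_bounded (w : testform R m) : exists C, forall x, enorm (w x) <= C.
Proof.
by apply: compact_support_bounded; [apply: rV_continuous; exact: testform_continuous|exact: testform_supp].
Qed.

End fields.

(** * Currents carried by simple curves *)
Section simple_curves.
Context {R : realType} {m : nat}.
Local Notation V := 'rV[R]_m.
Local Notation H := (@hausdorff1 R m).
Local Notation mu := (@lebesgue_measure R).

(** The data of a simple curve: between the times [A] and [B] it is an injective
arc with velocity [G]. *)
Record arc_of (g : curve R m) (A B : R) (G : R -> V) : Prop := ArcOf {
  arc_A_ge0 : 0 <= A;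
  arc_AB : A < B;
  arc_before : forall t, t <= A -> g t = g A;
  arc_after : forall t, B <= t -> g t = g B;
  arc_injective : forall s t, A <= s -> s < t -> t <= B -> g s <> g t;
  arc_m : forall i, measurable_fun setT (fun t => G t 0 i);
  arc_int : forall i, mu.-integrable setT (fun t => (G t 0 i)%:E);
  arc_derive : {ae mu, forall x, A < x -> x < B -> is_derive x 1 g (G x)};
  arc_ftc : forall s t i, A <= s -> s <= t -> t <= B ->
    g t 0 i - g s 0 i = \int[mu]_(x in `]s, t]) G x 0 i }.

Lemma simple_arc_of g : simple g -> nonconstant g -> exists A B G, arc_of g A B G.
Proof.
move=> sg ng; have [A [B [A0 AB gA gB ig]]] := simple_arc sg ng.
have [G [mG iG dG fG]] := lipschitz_ftc_vec AB (curve_lipT g).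
by exists A, B, G.
Qed.

Section arc_facts.
Variables (g : curve R m) (A B : R) (G : R -> V).
Hypothesis gAB : arc_of g A B G.

Lemma curve_imageE : curve_image g = g @` `[A, B]%classic.
Proof.
apply/seteqP; split => [_ [t t0 <-]|_ [t + <-]]; last first.
  rewrite /= in_itv/= => /andP[At _]; exists t => //=.
  exact: le_trans (arc_A_ge0 gAB) At.
have AB := arc_AB gAB.
have [tA|/ltW At] := leP t A.
  by exists A; [rewrite /= in_itv/= lexx ltW|rewrite (arc_before gAB tA)].
have [Bt|/ltW tB] := leP B t.
  by exists B; [rewrite /= in_itv/= lexx ltW|rewrite (arc_after gAB Bt)].
by exists t => //; rewrite /= in_itv/= At.
Qed.

(** The points where the curve is not differentiable, and its endpoints, form
an [H^1]-null set; the other points have a unique parameter. *)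
Lemma arc_regular : exists Z : set V, H Z = 0%E /\
  forall x, curve_image g x -> ~ Z x -> exists t,
    [/\ A < t, t < B, g t = x, is_derive t 1 g (G t) &
      forall s, g s = x -> s = t].
Proof.
have [D [mD D0 DG]] := arc_derive gAB.
exists (g @` D `|` [set g A] `|` [set g B]); split.
  apply: H_U0; [apply: H_U0|]; [|exact: H_set1|exact: H_set1].
  by apply: (H_image_null (curve_lipT g)); exists D; split.
rewrite curve_imageE => x [t + <-] nZ; rewrite /= in_itv/= => /andP[At tB].
have tA : A < t.
  rewrite lt_neqAle At andbT; apply/eqP => tA; apply: nZ; left; right.
  by rewrite tA.
have Bt : t < B.
  rewrite lt_neqAle tB andbT; apply/eqP => Bt; apply: nZ; right.
  by rewrite Bt.
exists t; split => //.
  apply: contrapT => ndt; apply: nZ; left; left; exists t => //.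
  by apply: DG => /= /(_ tA Bt).
have ig s r : A <= s -> s < r -> r <= B -> g s <> g r := @arc_injective _ _ _ _ gAB s r.
move=> s gst; have [sA|/ltW As] := leP s A.
  exfalso; apply: (ig A t (lexx _) tA tB).
  by rewrite -gst (arc_before gAB sA).
have [Bs|/ltW sB] := leP B s.
  exfalso; apply: (ig t B At Bt (lexx _)).
  by rewrite -gst (arc_after gAB Bs).
case: (ltgtP s t) => // st; exfalso.
  exact: (ig s t As st tB).
exact: (ig t s At st sB).
Qed.

Lemma unit_tangentE (x : V) t : 0 <= t -> g t = x -> (forall s, g s = x -> s = t) ->
  is_derive t 1 g (G t) -> unit_tangent g x = (enorm (G t))^-1 *: G t.
Proof.
move=> t0 gt ut [dgt gtE]; rewrite /unit_tangent.
have -> : xget 0 [set t | 0 <= t /\ g t = x] = t.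
  by case: xgetP => [s _ [_ /ut//]|/(_ t)]; case.
by rewrite derive1E gtE.
Qed.

Lemma unit_tangent_arc : exists Z : set V, H Z = 0%E /\
  forall x, curve_image g x -> ~ Z x -> unit_tangent g x = arc_tangent g A B G x.
Proof.
have [Z [Z0 ZP]] := arc_regular; exists Z; split=> // x gx nZ.
have [t [At tB gt dt ut]] := ZP _ gx nZ.
rewrite (@unit_tangentE x t)//; last exact: le_trans (arc_A_ge0 gAB) (ltW At).
rewrite /arc_tangent -gt arc_invK//; try exact: ltW; last exact: arc_injective gAB.
Qed.

End arc_facts.

Lemma unit_tangent_le1 g (x : V) : enorm (unit_tangent g x) <= 1.
Proof.
rewrite /unit_tangent; set v := derive1 _ _.
rewrite enormZ ger0_norm ?invr_ge0 ?enorm_ge0//.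
have [->|G0] := eqVneq (enorm v) 0; first by rewrite mulr0.
by rewrite mulVf.
Qed.

Lemma H1_null_measurable (Z : set V) : H Z = 0%E -> measurable (Z : set (H1type R m)).
Proof.
move=> Z0; apply: le_caratheodory_measurable => X /=.
rewrite [X in (X + _)%E](_ : _ = 0%E) ?add0e ?le_outer_measure//.
exact: (H0S (@subIsetr _ _ _)).
Qed.

Lemma H1_null_ae (Z : set V) (P : V -> Prop) : H Z = 0%E ->
  (forall x, ~ Z x -> P x) -> {ae H1 R m, forall x, P x}.
Proof.
move=> Z0 ZP; exists Z; split; [exact: H1_null_measurable|exact: Z0|].
by move=> x /= nPx; apply: contrapT => /ZP.
Qed.

Lemma measurable_null (Z : set V) (f : V -> R) : H Z = 0%E ->
  measurable_fun (Z : set (H1type R m)) (f : H1type R m -> R).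
Proof. by move=> Z0 _ B mB; apply: H1_null_measurable; exact: (H0S (@subIsetl _ _ _)). Qed.

Lemma measurable_curve_image g : simple g ->
  measurable (curve_image g : set (H1type R m)) /\ (H (curve_image g) < +oo)%E.
Proof.
move=> sg; have [ng|cg] := pselect (nonconstant g); last first.
  have -> : curve_image g = [set g 0].
    apply/seteqP; split => [_ [t t0 <-]|_ ->]; last by exists 0 => //=.
    by apply: contrapT => gt; apply: cg; exists t.
  by split; [apply: H1_null_measurable|]; rewrite H_set1.
have [A [B [G gAB]]] := simple_arc_of sg ng.
rewrite (curve_imageE gAB); split; first exact: arc_closed (curve_lipT g) _ _.
have AB := ltW (arc_AB gAB).
apply: (@le_lt_trans _ _ (B - A)%:E); last by rewrite ltry.
by apply: (@H_curve_le _ _ g id) => // s t _ st _;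
  rewrite (le_trans (curve_lipT _ _ _))// ger0_norm// subr_ge0.
Qed.

Lemma arc_form_test (g : curve R m) A B G (w : testform R m) : arc_of g A B G ->
  (H1 R m).-integrable (g @` `[A, B]%classic)
    (fun x => (dotp (w x) (arc_tangent g A B G x))%:E) /\
  \int[H1 R m]_(x in g @` `[A, B]%classic) dotp (w x) (arc_tangent g A B G x) =
  \int[mu]_(t in `]A, B]) dotp (w (g t)) (G t).
Proof.
move=> gAB; have [C wC] := testform_bounded w.
exact: (arc_form (arc_AB gAB) (curve_lipT g) (arc_injective gAB)
  (arc_m gAB) (arc_int gAB) (arc_derive gAB) (arc_ftc gAB)
  (fun i => @testform_continuous _ _ w i) wC).
Qed.

Lemma integrable_curve (g : curve R m) (w : testform R m) : simple g ->
  (H1 R m).-integrable (curve_image g)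
    (fun x => (dotp (w x) (unit_tangent g x))%:E).
Proof.
move=> sg; have [mI Ioo'] := measurable_curve_image sg.
have Ioo : (H1 R m (curve_image g) < +oo)%E by exact: Ioo'.
have [C wC] := testform_bounded w.
apply: (measurable_bounded_integrable mI Ioo); last first.
  exists C; split; first exact: num_real.
  move=> M CM x _; apply: (le_trans (normr_dotp_le _ _)).
  rewrite -[leRHS]mulr1 ler_pM ?enorm_ge0 ?unit_tangent_le1//.
  exact: le_trans (wC _) (ltW CM).
have [ng|cg] := pselect (nonconstant g); last first.
  apply: measurable_null.
  rewrite (_ : curve_image g = [set g 0]) ?H_set1//.
  apply/seteqP; split => [_ [t t0 <-]|_ ->]; last by exists 0 => //=.
  by apply: contrapT => gt; apply: cg; exists t.
have [A [B [G gAB]]] := simple_arc_of sg ng.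
have [Z [Z0 ZP]] := unit_tangent_arc gAB.
have [iw _] := arc_form_test w gAB.
have ae1 : ae_eq (H1 R m) (curve_image g)
    (fun x => (dotp (w x) (arc_tangent g A B G x))%:E)
    (fun x => (dotp (w x) (unit_tangent g x))%:E).
  by apply: (H1_null_ae Z0) => x nZ gx; rewrite ZP.
apply/measurable_EFinP.
apply: (ae_measurable_fun (@measure_is_complete_caratheodory _ _ _) ae1).
by rewrite (curve_imageE gAB); exact: measurable_int iw.
Qed.

Lemma curve_currentE (g : curve R m) (w : testform R m) : simple g ->
  curve_current g w = \int[H1 R m]_(x in curve_image g) dotp (w x) (unit_tangent g x).
Proof.
move=> sg; rewrite /curve_current asboolT// /tau.
by apply: eq_Rintegral => x _; rewrite mulr1.
Qed.

(** Along the arc the unit tangent has the direction of the velocity, so that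
the area formula removes the normalisation. *)
Lemma curve_current_line (g : curve R m) A B G (w : testform R m) :
  simple g -> arc_of g A B G ->
  curve_current g w = \int[mu]_(t in `]A, B]) dotp (w (g t)) (G t).
Proof.
move=> sg gAB; rewrite curve_currentE//.
have [iw <-] := arc_form_test w gAB.
have [Z [Z0 ZP]] := unit_tangent_arc gAB.
have [mI _] := measurable_curve_image sg.
rewrite /Rintegral -(curve_imageE gAB); congr fine; apply: ae_eq_integral.
- exact: mI.
- exact: measurable_int (integrable_curve w sg).
- by rewrite (curve_imageE gAB); exact: measurable_int iw.
- by apply: (H1_null_ae Z0) => x nZ gx; rewrite ZP.
Qed.

Lemma curve_currentD (g : curve R m) (w1 w2 w : testform R m) :
  (forall x, w x = w1 x + w2 x) ->
  curve_current g w = curve_current g w1 + curve_current g w2.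
Proof.
move=> wE; have [sg|nsg] := pselect (simple g); last first.
  by rewrite /curve_current asboolF// addr0.
have [mI _] := measurable_curve_image sg.
rewrite !curve_currentE//.
rewrite -(RintegralD mI (integrable_curve w1 sg) (integrable_curve w2 sg)).
by apply: eq_Rintegral => x _; rewrite wE dotpDl.
Qed.

Lemma curve_currentZ (g : curve R m) (c : R) (w1 w : testform R m) :
  (forall x, w x = c *: w1 x) -> curve_current g w = c * curve_current g w1.
Proof.
move=> wE; have [sg|nsg] := pselect (simple g); last first.
  by rewrite /curve_current asboolF// mulr0.
have [mI _] := measurable_curve_image sg.
rewrite !curve_currentE//.
rewrite -(RintegralZl c mI (integrable_curve w1 sg)).
by apply: eq_Rintegral => x _; rewrite wE dotpZl.
Qed.

End simple_curves.

Section chain_rule.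
Context {R : realType} {m : nat}.
Local Notation V := 'rV[R]_m.
Local Notation mu := (@lebesgue_measure R).

Lemma Ck_derivable k (f : V -> R) i x : Ck k.+1 f -> derivable f x (delta_mx 0 i).
Proof. by move=> [_ /(_ i)[]]. Qed.

Lemma Ck_partial k (f : V -> R) i : Ck k.+1 f -> Ck k (partial i f).
Proof. by move=> [_ /(_ i)[]]. Qed.

Lemma is_derive_line (f : V -> R) (z e : V) (s : R) :
  derivable f (z + s *: e) e ->
  is_derive s 1 (fun r => f (z + r *: e)) ('D_e f (z + s *: e)).
Proof.
move=> df; have E : (fun h : R => h^-1 *: (f (z + (h *: 1 + s) *: e) - f (z + s *: e)))
   = (fun h : R => h^-1 *: (f (h *: e + (z + s *: e)) - f (z + s *: e))).
  by apply/funext => h; rewrite scaler1 scalerDl addrCA.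
by apply: DeriveDef; rewrite /derivable /derive E.
Qed.

(** Moving one coordinate at a time reduces the increment of [f] to the mean
value theorem on segments parallel to the axes. *)
Lemma C1_mean_value (f : V -> R) (x y : V) : Ck 1 f ->
  exists xi : 'I_m -> V, (forall i, `|xi i - x| <= `|y - x|) /\
    f y - f x = \sum_i partial i f (xi i) * (y 0 i - x 0 i).
Proof.
move=> cf; pose z (k : nat) : V := \row_j (if (j < k)%N then y 0 j else x 0 j).
have z0 : z 0%N = x by apply/rowP => j; rewrite mxE.
have zm : z m = y by apply/rowP => j; rewrite mxE ltn_ord.
have step (i : 'I_m) : exists c, (`|c - x| <= `|y - x|) /\
    f (z i.+1) - f (z i) = partial i f c * (y 0 i - x 0 i).
  set d := y 0 i - x 0 i.
  pose e : V := delta_mx 0 i.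
  have zS : z i.+1 = z i + d *: e.
    apply/rowP => j; rewrite !mxE eqxx /= ltnS leq_eqVlt.
    have [ij|/eqP ij] := eqVneq (j : nat) i.
      have -> : j = i by exact: val_inj.
      by rewrite ltnn eqxx mulr1 /d addrC subrK.
    by rewrite (_ : j == i = false) ?mulr0 ?addr0//; apply/eqP => ji; apply: ij; rewrite ji.
  have zc (c : R) : `|c| <= `|d| -> `|z i + c *: e - x| <= `|y - x|.
    move=> cd; apply: norm_le_coord => // j; rewrite !mxE eqxx /=.
    case: ltngtP => [ji|ij|/val_inj ->].
    - rewrite (_ : j == i = false) ?mulr0 ?addr0; last by apply/eqP => E; rewrite E ltnn in ji.
      by have := coord_le_norm (y - x) j; rewrite !mxE.
    - rewrite (_ : j == i = false) ?mulr0 ?addr0; last by apply/eqP => E; rewrite E ltnn in ij.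
      by rewrite subrr normr0.
    - rewrite eqxx mulr1 addrAC subrr add0r (le_trans cd)//.
      by have := coord_le_norm (y - x) i; rewrite !mxE.
  pose h (r : R) := f (z i + r *: e).
  have dh (r : R) : is_derive r 1 h (partial i f (z i + r *: e)).
    by apply: is_derive_line; exact: Ck_derivable cf.
  have ch : continuous h.
    move=> r; apply: differentiable_continuous; apply/derivable1_diffP.
    by have [] := dh r.
  have [d0|d0] := leP 0 d.
    have [c + hd] := MVT_segment d0 (fun r _ => dh r) (continuous_subspaceT ch).
    rewrite in_itv/= => /andP[c0 cd]; exists (z i + c *: e); split.
      by apply: zc; rewrite !ger0_norm.
    by move: hd; rewrite /h scale0r addr0 subr0 -zS.
  have [c + hd] := MVT_segment (ltW d0) (fun r _ => dh r) (continuous_subspaceT ch).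
  rewrite in_itv/= => /andP[c0 cd]; exists (z i + c *: e); split.
    by apply: zc; rewrite (ltr0_norm d0) ler0_norm// lerN2.
  move: hd; rewrite /h scale0r addr0 sub0r -zS => hd.
  by rewrite -[LHS]opprB hd mulrN opprK.
have [xi xiP] := choice step.
exists xi; split; first by move=> i; have [] := xiP i.
transitivity (\sum_(0 <= k < m) (f (z k.+1) - f (z k))).
  by rewrite telescope_sumr// zm z0.
by rewrite big_mkord; apply: eq_bigr => i _; have [] := xiP i.
Qed.

Lemma is_derive_C1_comp (f : V -> R) (g : R -> V) (t : R) (d : V) : Ck 1 f ->
  is_derive t 1 g d ->
  is_derive t 1 (f \o g) (\sum_i partial i f (g t) * d 0 i).
Proof.
move=> cf gd; have [xi xiP] := choice (fun h : R => C1_mean_value (g t) (g (h *: 1 + t)) cf).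
have [dg gE] := gd.
have cg : g (h *: 1 + t) @[h --> 0^'] --> g t.
  have c0 : h *: 1 + t @[h --> (0:R)^'] --> t.
    apply/cvgrPdist_le => e e0; near=> h.
    rewrite scaler1 distrC addrK; near: h; exact: dnbhs0_le.
  apply: continuous_cvg c0.
  by apply: differentiable_continuous; apply/derivable1_diffP.
have cxi i : partial i f (xi h i) @[h --> 0^'] --> partial i f (g t).
  have cx : xi h i @[h --> 0^'] --> g t.
    apply/cvgrPdist_le => e e0; near=> h.
    have [/(_ i) xih _] := xiP h; rewrite distrC (le_trans xih)// distrC.
    by near: h; move/cvgrPdist_le : cg; apply.
  apply: continuous_cvg cx.
  by have /Ck_continuous := Ck_partial i cf; apply.
have cdg i : h^-1 * (g (h *: 1 + t) 0 i - g t 0 i) @[h --> 0^'] --> d 0 i.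
  by have [dgi <-] := is_derive_coord i gd; exact: dgi.
have cq : (h^-1 *: ((f \o g) (h *: 1 + t) - (f \o g) t)) @[h --> 0^'] -->
    \sum_i partial i f (g t) * d 0 i.
  have -> : (fun h : R => h^-1 *: ((f \o g) (h *: 1 + t) - (f \o g) t)) =
      (fun h : R => \sum_i partial i f (xi h i) * (h^-1 * (g (h *: 1 + t) 0 i - g t 0 i))).
    apply/funext => h; rewrite /comp; have [_ ->] := xiP h.
    rewrite [LHS]mulr_sumr; apply: eq_bigr => i _; exact: mulrCA.
  elim: (index_enum _) => [|i r IH].
    by under eq_fun do rewrite big_nil; rewrite big_nil; exact: cvg_cst.
  under eq_fun do rewrite big_cons.
  by rewrite big_cons; apply: cvgD IH; apply: cvgM.
apply: DeriveDef; first by apply/cvg_ex; eexists; exact: cq.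
by apply/cvg_lim.
Unshelve. all: by end_near. Qed.

Lemma testfun_lipschitz (f : testfun R m) : exists2 C : R, 0 < C &
  forall x y, `|f y - f x| <= C * enorm (y - x).
Proof.
have [C fC] := testform_bounded (differential f).
have C0 : 0 <= C by exact: le_trans (enorm_ge0 _) (fC 0).
exists (m%:R * C + 1) => [|x y]; first by rewrite ltr_wpDl ?mulr_ge0.
have [xi [_ ->]] := C1_mean_value x y (testfun_smooth f 1).
rewrite (le_trans (ler_norm_sum _ _ _))//.
apply: (@le_trans _ _ (\sum_(i < m) C * enorm (y - x))).
  apply: ler_sum => i _; rewrite normrM ler_pM//.
    apply: le_trans (fC (xi i)).
    by have := coord_le_enorm (differential f (xi i)) i; rewrite /= mxE.
  by have := coord_le_enorm (y - x) i; rewrite !mxE.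
rewrite sumr_const card_ord mulrDl mul1r -mulrA mulr_natl lerDl; exact: enorm_ge0.
Qed.

(** The integrand of the line integral of [df] is the derivative of [f \o g]. *)
Lemma boundary_curve (g : curve R m) (f : testfun R m) : simple g -> nonconstant g ->
  boundary (curve_current g) f = f (pinf g) - f (p0 g).
Proof.
move=> sg ng; have [A [B [G gAB]]] := simple_arc_of sg ng.
have AB := arc_AB gAB.
have -> : pinf g = g B by apply: pinfE; exact: arc_after gAB.
have -> : p0 g = g A by rewrite /p0 (arc_before gAB (arc_A_ge0 gAB)).
rewrite /boundary (curve_current_line _ sg gAB).
have [C C0 fC] := testfun_lipschitz f.
pose F t := f (g t) / C.
have lF s t : `|F t - F s| <= `|t - s|.
  rewrite /F -mulrBl normrM [`|C^-1|]gtr0_norm ?invr_gt0// ler_pdivrMr// mulrC.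
  by rewrite (le_trans (fC _ _))// ler_pM2l// curve_lipT.
have [k [mk ik dk kE]] := lipschitz_ftc lF AB.
transitivity (\int[mu]_(t in `]A, B]) (C * k t)); last first.
  rewrite RintegralZl//; last exact: integrableS ik.
  rewrite -kE// ?ltW// /F -mulrBl mulrC divfK//; exact: lt0r_neq0.
have iw : mu.-integrable `]A, B] (fun t => (dotp (differential f (g t)) (G t))%:E).
  have [D wD] := testform_bounded (differential f).
  apply: (@integrable_dotp _ _ _ _ mu _ (fun t => differential f (g t)) G D).
  - exact: (measurable_itv `]A, B]).
  - move=> i; apply: measurable_funTS; apply: continuous_measurable_fun => t.
    exact: (@continuous_comp _ _ _ g (fun x => differential f x 0 i) t
      (@curve_continuous _ _ g t) (@testform_continuous _ _ (differential f) i _)).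
  - by move=> t _; exact: wD.
  - by move=> i; exact: integrableS (arc_int gAB i).
rewrite /Rintegral; congr fine; apply: ae_eq_integral.
- exact: (measurable_itv `]A, B]).
- exact: measurable_int iw.
- apply/measurable_EFinP; apply: measurable_funM => //; exact: measurable_funTS.
have notB : {ae mu, forall x, x <> B}.
  exists [set B]; split; [exact: measurable_set1|exact: lebesgue_measure_set1|].
  by move=> x /= /contrapT.
have dG := arc_derive gAB.
apply: (@filterS3 _ _ (ae_filter_ringOfSetsType mu) _ _ _ _ _ notB dk dG) => t tB kt Gt.
rewrite /= in_itv/= => /andP[At]; rewrite le_eqVlt => /predU1P[//|Bt].
have {}kt := kt At Bt; have {}Gt := Gt At Bt.
have ft := is_derive_C1_comp (testfun_smooth f 1) Gt.
congr (_%:E); rewrite /dotp.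
have -> : k t = 'D_1 F t by have [_ ->] := kt.
have [dfg fgE] := ft.
have -> : F = C^-1 *: (f \o g).
  by apply/funext => s; rewrite /F mulrC.
rewrite deriveZ; last exact: dfg.
rewrite fgE [X in C * X](_ : _ = C^-1 * \sum_i partial i f (g t) * G t 0 i)//.
rewrite mulrA mulfV ?mul1r; last exact: lt0r_neq0.
by apply: eq_bigr => i _; rewrite mxE.
Qed.

End chain_rule.

(** * Measurability on the space of curves *)

Section gamma.
Context {R : realType} {m : nat}.
Local Notation V := 'rV[R]_m.
Local Notation H := (@hausdorff1 R m).
Local Notation F := {family compact, R -> V}.

(** The space of curves carries the topology of locally uniform convergence, so
that continuous functionals are measurable. *)
Lemma Gamma_open (U : set F) : open U ->
  measurable ((@curve_val R m @^-1` U) : set (Gamma R m)).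
Proof. by move=> oU; apply: sub_sigma_algebra; exists U. Qed.

Lemma open_preimage_family (T : uniformType) (Phi : F -> T) : continuous Phi ->
  forall U : set T, open U -> open (Phi @^-1` U).
Proof. by move=> /continuousP. Qed.

Lemma eval_continuous (t : R) : continuous (fun f : F => f t : V).
Proof.
move=> f; apply/(@cvgrPdist_lt _ _ _ (nbhs f)) => e e0.
have := @fam_nbhs R V compact [set t] [set uv | `|uv.1 - uv.2| < e] f.
have -> : [set g : F | forall y, [set t] y -> [set uv | `|uv.1 - uv.2| < e] (f y, g y)]
    = [set g : F | `|f t - g t| < e].
  by apply/seteqP; split => g /=; [apply|move=> fg _ ->].
apply; last exact: compact_set1.
have := @entourage_ball R V (PosNum e0).
by apply: filterS => -[u v] /=; rewrite -ball_normE.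
Qed.

Lemma measurable_eval (t : R) : measurable_fun setT (fun g : Gamma R m => g t : Rn R m).
Proof.
apply: (@measurability _ _ (Gamma R m) (Rn R m) setT _ (@open V)) => // _ [U oU <-]; rewrite setTI.
have -> : (fun g : Gamma R m => g t : Rn R m) @^-1` U =
  @curve_val R m @^-1` ((fun f : F => f t : V) @^-1` U) by [].
apply: Gamma_open; apply: open_preimage_family oU; exact: eval_continuous.
Qed.

Lemma measurable_coord i : measurable_fun setT (fun x : Rn R m => x 0 i : R).
Proof. by apply: continuous_Rn; exact: coord_continuous. Qed.

Lemma measurable_eval_coord (t : R) i :
  measurable_fun setT (fun g : Gamma R m => g t 0 i : R).
Proof. exact: (measurableT_comp (measurable_coord i) (measurable_eval t)). Qed.

Lemma measurable_p0 : measurable_fun setT (@p0 R m : Gamma R m -> Rn R m).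
Proof. exact: measurable_eval. Qed.

Lemma pinf_nat (g : curve R m) : exists n : nat, forall t, n%:R <= t -> g t = pinf g.
Proof.
have [T T0 gT] := curve_end g; exists (Num.truncn T).+1 => t nt.
have Tt : T <= t by apply: le_trans nt; rewrite ltW// truncnS_gt.
by rewrite (pinfE gT) gT.
Qed.

(** The endpoint is the limit of the values at integer times. *)
Lemma measurable_pinf : measurable_fun setT (@pinf R m : Gamma R m -> Rn R m).
Proof.
apply: (@measurability _ _ (Gamma R m) (Rn R m) setT _ (@open V)) => // _ [U oU <-]; rewrite setTI.
have -> : (@pinf R m : Gamma R m -> Rn R m) @^-1` U =
    \bigcup_n \bigcap_(k in [set k | (n <= k)%N])
      ((fun g : Gamma R m => g k%:R : Rn R m) @^-1` U).
  apply/seteqP; split => [g Ug|g [n _ nU]].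
    have [n gn] := pinf_nat g; exists n => // k /= nk.
    by rewrite gn ?ler_nat.
  have [k gk] := pinf_nat g.
  have := nU (maxn n k) (leq_maxl _ _).
  by rewrite /= gk// ler_nat leq_maxr.
apply: bigcupT_measurable => n; apply: bigcap_measurableType => k _.
by rewrite -[X in measurable X]setTI; apply: measurable_eval => //; exact: open_Rn.
Qed.

Lemma measurable_set1_Rn (x : V) : measurable ([set x] : set (Rn R m)).
Proof.
apply: closed_Rn; apply: accessible_closed_set1; apply: hausdorff_accessible.
exact: norm_hausdorff.
Qed.

Lemma measurable_Gamma_between (x y : V) : measurable (Gamma_between x y).
Proof.
have -> : Gamma_between x y =
    ((@p0 R m : Gamma R m -> Rn R m) @^-1` [set x]) `&`
    ((@pinf R m : Gamma R m -> Rn R m) @^-1` [set y]) by [].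
apply: measurableI; rewrite -[X in measurable X]setTI.
  exact: measurable_p0 (measurable_set1_Rn x).
exact: measurable_pinf (measurable_set1_Rn y).
Qed.

(** ** Reversing curves *)

(** A time, taken integer for the sake of measurability, after which the curve
has stopped. *)
Definition stopped (n : nat) (g : curve R m) := forall t, n%:R <= t -> g t = g n%:R.

Lemma ex_stopped g : exists n, `[< stopped n g >].
Proof.
have [n gn] := pinf_nat g; exists n; apply/asboolP => t nt.
by rewrite !gn.
Qed.

Definition stop_time (g : curve R m) : nat := ex_minn (ex_stopped g).

Lemma stop_timeP g : stopped (stop_time g) g.
Proof. by rewrite /stop_time; case: ex_minnP => n /asboolP. Qed.

Lemma stop_timeE n g : stop_time g = n <->
  stopped n g /\ forall k, (k < n)%N -> ~ stopped k g.
Proof.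
split=> [<-|[sn nk]].
  split=> [|k]; first exact: stop_timeP.
  rewrite /stop_time; case: ex_minnP => l _ lmin kl sk.
  by have := lmin k; rewrite leqNgt kl => /(_ (asboolT sk)).
rewrite /stop_time; case: ex_minnP => l /asboolP sl lmin.
apply/eqP; rewrite eqn_leq (lmin _ (asboolT sn)) leqNgt.
by apply/negP => /nk; apply.
Qed.

Lemma measurable_eq_eval s t : measurable ([set g : curve R m | g s = g t] : set (Gamma R m)).
Proof.
have mst : measurable_fun setT (fun g : Gamma R m => enorm (g s - g t : V)).
  apply: measurable_enorm => i.
  rewrite (_ : (fun g : Gamma R m => _) = fun g : Gamma R m => g s 0 i - g t 0 i).
    by apply: measurable_funB; exact: measurable_eval_coord.
  by apply/funext => g; rewrite !mxE.
have -> : [set g : curve R m | g s = g t] =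
    (fun g : Gamma R m => enorm (g s - g t : V)) @^-1` [set 0].
  apply/seteqP; split => g /=; first by move=> ->; rewrite subrr enorm0.
  by move/enorm_eq0/eqP; rewrite subr_eq0 => /eqP.
by rewrite -[X in measurable X]setTI; exact: mst.
Qed.

Lemma measurable_stopped n : measurable ([set g | stopped n g] : set (Gamma R m)).
Proof.
pose S (q : rat) : set (Gamma R m) :=
  [set g : curve R m | n%:R <= ratr q :> R -> g (ratr q) = g n%:R].
have -> : [set g | stopped n g] = \bigcap_q S q.
  apply/seteqP; split => [g sg q _ nq|g Sg t nt]; first exact: sg.
  apply: contrapT => gtn; pose e := enorm (g t - g n%:R).
  have e0 : 0 < e.
    rewrite lt_def enorm_ge0 andbT; apply/eqP => /enorm_eq0/eqP.
    by rewrite subr_eq0 => /eqP.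
  have te : t < t + e by rewrite ltrDl.
  have [q] := rat_in_itvoo te; rewrite in_itv/= => /andP[tq qt].
  have := curve_lipT g t (ratr q); rewrite (Sg q)//; last exact: le_trans nt (ltW tq).
  by rewrite enormC -/e ger0_norm ?subr_ge0 ?(ltW tq)// leNgt ltrBlDl qt.
have mS := measurable_eq_eval.
rewrite -[X in measurable X]setCK setC_bigcap; apply: measurableC.
apply: bigcupT_measurable_rat => q; apply: measurableC.
rewrite /S; have [nq|nq] := boolP (n%:R <= ratr q :> R).
  rewrite (_ : [set g | _] = [set g : curve R m | g (ratr q) = g n%:R]); first exact: mS.
  by apply/seteqP; split => g /=; [apply|move=> ->].
rewrite (_ : [set g | _] = setT); first exact: measurableT.
by apply/seteqP; split => g.
Qed.

(** The time until which the curve waits, taken integer as well. *)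
Definition started (n : nat) (g : curve R m) := forall t, t <= n%:R -> g t = g 0.

Lemma startedW n k g : (n <= k)%N -> started k g -> started n g.
Proof. by move=> nk sk t tn; apply: sk; apply: le_trans tn _; rewrite ler_nat. Qed.

Lemma stoppedW n k g : (n <= k)%N -> stopped n g -> stopped k g.
Proof.
move=> nk sn t kt; have nk' : n%:R <= k%:R :> R by rewrite ler_nat.
by rewrite (sn t) ?(sn k%:R)//; exact: le_trans kt.
Qed.

Lemma ex_started g : nonconstant g -> exists n, ~~ `[< started n.+1 g >].
Proof.
move=> [t t0 gt]; exists (Num.trunc t); apply/asboolP => st; apply: gt.
by apply: st; exact/ltW/truncnS_gt.
Qed.

Definition start_time (g : curve R m) : nat :=
  if pselect (nonconstant g) is left ng then ex_minn (ex_started ng) else 0%N.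

Lemma started0 g : started 0 g. Proof. by move=> t; exact: curve_le0. Qed.

Lemma start_timeP g n : nonconstant g -> started n g -> ~ started n.+1 g -> start_time g = n.
Proof.
move=> ng sn nsn; rewrite /start_time; case: pselect => // ng'.
case: ex_minnP => k /asboolP nk kmin; apply/eqP; rewrite eqn_leq kmin ?asboolF//=.
by rewrite leqNgt; apply/negP => kn; apply: nk; exact: startedW kn sn.
Qed.

Lemma start_time_started g : nonconstant g ->
  started (start_time g) g /\ ~ started (start_time g).+1 g.
Proof.
move=> ng; rewrite /start_time; case: pselect => // ng'; case: ex_minnP => k /asboolP nk kmin.
split=> //; case: k nk kmin => [|k] nk kmin; first exact: started0.
by apply: contrapT => sk; have := kmin k; rewrite asboolF// => /(_ isT); rewrite ltnn.
Qed.

Lemma measurable_started n : measurable ([set g | started n g] : set (Gamma R m)).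
Proof.
have -> : [set g | started n g] = \bigcap_(q : rat)
    [set g : curve R m | ratr q <= n%:R :> R -> g (ratr q) = g 0].
  apply/seteqP; split => [g sg q _ nq|g Sg t nt]; first exact: sg.
  apply: contrapT => gtn; pose e := enorm (g t - g 0).
  have e0 : 0 < e.
    rewrite lt_def enorm_ge0 andbT; apply/eqP => /enorm_eq0/eqP.
    by rewrite subr_eq0 => /eqP.
  have te : t - e < t by rewrite ltrBlDr ltrDl.
  have [q] := rat_in_itvoo te; rewrite in_itv/= => /andP[qt tq].
  have := curve_lipT g (ratr q) t; rewrite (Sg q)//; last exact: le_trans (ltW tq) nt.
  by rewrite -/e ger0_norm ?subr_ge0 ?(ltW tq)// leNgt ltrBlDl -ltrBlDr qt.
have mS s t : measurable ([set g : curve R m | g s = g t] : set (Gamma R m)).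
  exact: measurable_eq_eval.
rewrite -[X in measurable X]setCK setC_bigcap; apply: measurableC.
apply: bigcupT_measurable_rat => q; apply: measurableC.
have [nq|nq] := boolP (ratr q <= n%:R :> R).
  rewrite (_ : [set g | _] = [set g : curve R m | g (ratr q) = g 0]); first exact: mS.
  by apply/seteqP; split => g /=; [apply|move=> ->].
rewrite (_ : [set g | _] = setT); first exact: measurableT.
by apply/seteqP; split => g.
Qed.

Lemma measurable_constant : measurable ([set g | ~ nonconstant g] : set (Gamma R m)).
Proof.
have -> : [set g | ~ nonconstant g] = \bigcap_n [set g : curve R m | started n g].
  apply/seteqP; split => [g cg n _ t _|g sg [t t0]].
    have [t0|/ltW t0] := leP t 0; first exact: curve_le0.
    by apply: contrapT => gt; apply: cg; exists t.
  by apply; apply: (sg (Num.trunc t).+1 Logic.I); exact/ltW/truncnS_gt.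
apply: bigcap_measurableType => n _; exact: measurable_started.
Qed.

Lemma measurable_start_time n : measurable ([set g | start_time g = n] : set (Gamma R m)).
Proof.
have -> : [set g | start_time g = n] =
    ([set g | ~ nonconstant g] `&` [set g | n = 0%N]) `|`
    (~` [set g | ~ nonconstant g] `&` ([set g | started n g] `&` ~` [set g | started n.+1 g])).
  apply/seteqP; split => [g /= sg|g /= [[cg n0]|[/contrapT ng [sn nsn]]]].
  - have [ng|cg] := pselect (nonconstant g); [right|left].
      by split; [apply|have := start_time_started ng; rewrite sg].
    by split => //; rewrite -sg /start_time; case: pselect.
  - by rewrite n0 /start_time; case: pselect.
  - exact: start_timeP.
have mc := measurable_constant; have ms := measurable_started.
apply: measurableU; apply: measurableI => //.
- have [->|n0] := eqVneq n 0%N.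
    by rewrite (_ : [set g | _] = setT); [exact: measurableT|apply/seteqP; split].
  rewrite (_ : [set g | _] = set0); first exact: measurable0.
  by apply/seteqP; split => // g /= E; rewrite E in n0.
- exact: measurableC.
- by apply: measurableI => //; exact: measurableC.
Qed.

(** The time around which a curve is reversed.  Counting the waiting time twice
makes the reversal an involution. *)
Definition turn_time (g : curve R m) : nat := (start_time g + stop_time g)%N.

Lemma turn_timeP g : stopped (turn_time g) g.
Proof. exact: (@stoppedW (stop_time g) _ g (leq_addl _ _) (@stop_timeP g)). Qed.

Lemma measurable_turn_time n : measurable ([set g | turn_time g = n] : set (Gamma R m)).
Proof.
have ms k : measurable ([set g | stop_time g = k] : set (Gamma R m)).
  have -> : [set g : Gamma R m | stop_time g = k] =
      [set g | stopped k g] `&` \bigcap_(l in [set l | (l < k)%N]) ~` [set g | stopped l g].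
    by apply/seteqP; split => g /= /stop_timeE.
  apply: measurableI; first exact: measurable_stopped.
  apply: bigcap_measurableType.
  by move=> l _; apply: measurableC; exact: measurable_stopped.
have -> : [set g | turn_time g = n] = \bigcup_k (if (k <= n)%N then
    [set g | start_time g = k] `&` [set g | stop_time g = (n - k)%N] else set0).
  apply/seteqP; split => [g /= <-|g [k _]]; last first.
    by case: ifP => // kn [/= sk tk]; rewrite /turn_time sk tk subnKC.
  by exists (start_time g) => //; rewrite /turn_time leq_addr; split => //=; rewrite addKn.
apply: bigcupT_measurable => k; case: ifP => _; last exact: measurable0.
by apply: measurableI; [exact: measurable_start_time|exact: ms].
Qed.

Definition rev_clock (n : nat) (t : R) : R := n%:R - Num.max t 0.

Let rev_fun (g : curve R m) (t : R) : V := g (rev_clock (turn_time g) t).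

Let rev_neg g t : t <= 0 -> rev_fun g t = rev_fun g 0.
Proof. by move=> t0; rewrite /rev_fun /rev_clock (max_r t0) maxxx. Qed.

Let rev_lip g s t : 0 <= s -> 0 <= t -> enorm (rev_fun g t - rev_fun g s) <= `|t - s|.
Proof.
move=> s0 t0; rewrite /rev_fun (le_trans (curve_lipT _ _ _))//.
rewrite /rev_clock !max_l//.
have -> : (turn_time g)%:R - t - ((turn_time g)%:R - s) = s - t by ring.
by rewrite distrC.
Qed.

Let rev_cst g : exists t0, forall t, t0 <= t -> rev_fun g t = rev_fun g t0.
Proof.
exists (turn_time g)%:R => t nt; rewrite /rev_fun /rev_clock.
have n0 : 0 <= (turn_time g)%:R :> R by [].
rewrite !max_l//; last exact: le_trans nt.
by rewrite !curve_le0// ?subrr// subr_le0.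
Qed.

Definition rev_curve (g : curve R m) : curve R m :=
  Curve (@rev_neg g) (@rev_lip g) (rev_cst g).

Lemma rev_curveE g t : 0 <= t -> rev_curve g t = g ((turn_time g)%:R - t).
Proof. by move=> t0; rewrite /= /rev_fun /rev_clock max_l. Qed.

Lemma rev_p0 g : p0 (rev_curve g) = pinf g.
Proof.
rewrite /p0 rev_curveE// subr0; apply/esym/pinfE; exact: turn_timeP.
Qed.

Lemma rev_stopped g t : (turn_time g)%:R <= t -> rev_curve g t = g 0.
Proof.
move=> nt; rewrite rev_curveE; last exact: le_trans nt.
by rewrite curve_le0// subr_le0.
Qed.

Lemma rev_pinf g : pinf (rev_curve g) = p0 g.
Proof.
rewrite (@pinfE _ _ (rev_curve g) (turn_time g)%:R); last first.
  by move=> t nt; rewrite !rev_stopped.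
by rewrite rev_stopped.
Qed.

Lemma rev_clock_continuous n : continuous (rev_clock n).
Proof.
apply: lip_continuous => s t; rewrite /rev_clock ler_norml.
have := ler_norm (t - s); have := ler_norm (s - t); rewrite (distrC s t).
move: `|t - s| => d; rewrite !maxEle.
by case: (leP t 0); case: (leP s 0) => ? ? ? ?; apply/andP; split; lra.
Qed.

Lemma precomp_continuous (h : R -> R) : continuous h ->
  continuous (fun f : F => (f \o h : F)).
Proof.
move=> ch f.
have FF : Filter ((fun f : F => (f \o h : F)) @ nbhs f) by exact: fmap_filter.
apply: (iffRL (@fam_cvgP R V compact _ (f \o h) FF)) => A cA P /uniform_nbhs[E [entE EP]].
have chA : compact (h @` A).
  by apply: continuous_compact => //; exact: continuous_subspaceT.
have := @fam_nbhs R V compact (h @` A) E f entE chA.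
by apply: filterS => g gE; apply: EP => y Ay /=; apply: gE; exists y.
Qed.

(** On each of the countably many sets where the turning time is a given integer,
reversal is the continuous precomposition with a clock. *)
Lemma measurable_rev : measurable_fun setT (rev_curve : Gamma R m -> Gamma R m).
Proof.
apply: (@measurability _ _ (Gamma R m) (Gamma R m) setT _ [set @curve_val R m @^-1` U | U in (@open F)]) => //.
move=> _ [_ [U oU <-] <-]; rewrite setTI.
have -> : (rev_curve : Gamma R m -> Gamma R m) @^-1` (@curve_val R m @^-1` U) =
  \bigcup_n ([set g : Gamma R m | turn_time g = n] `&`
     (@curve_val R m @^-1` ((fun f : F => (f \o rev_clock n : F)) @^-1` U))).
  apply/seteqP; split => [g Ug|g [n _ [/= sg Ug]]].
    by exists (turn_time g).
  by rewrite -sg in Ug.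
apply: bigcupT_measurable => n; apply: measurableI.
  exact: measurable_turn_time.
apply: Gamma_open; move: oU; apply: open_preimage_family.
exact/precomp_continuous/rev_clock_continuous.
Qed.

Lemma rev_image g : curve_image (rev_curve g) = curve_image g.
Proof.
apply/seteqP; split => [_ [t t0 <-]|_ [t t0 <-]].
  rewrite rev_curveE//; have [nt|/ltW tn] := leP ((turn_time g)%:R - t) 0.
    by exists 0 => //=; apply/esym/curve_le0.
  by exists ((turn_time g)%:R - t).
have [tn|nt] := leP t (turn_time g)%:R.
  exists ((turn_time g)%:R - t); first by rewrite /= subr_ge0.
  by rewrite rev_curveE ?subr_ge0// subKr.
exists 0; first exact: lexx.
by rewrite rev_curveE// subr0; apply/esym/turn_timeP/ltW.
Qed.

Lemma rev_nonconstant g : nonconstant (rev_curve g) -> nonconstant g.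
Proof.
move=> [t t0 gt]; apply: contrapT => ng.
have g0 s : 0 <= s -> g s = g 0.
  by move=> s0; apply: contrapT => gs; apply: ng; exists s.
have rI s : (rev_curve g s = g 0).
  rewrite /= /rev_fun; have [|/ltW s0] := leP (rev_clock (turn_time g) s) 0.
    exact: curve_le0.
  exact: g0.
by apply: gt; rewrite !rI.
Qed.

Lemma arc_turn_time g A B G : arc_of g A B G -> B <= (turn_time g)%:R.
Proof.
move=> gAB; rewrite leNgt; apply/negP => nB.
have AB := arc_AB gAB; set n := (turn_time g)%:R in nB *.
have mB : Num.max A n < B by rewrite gt_max AB.
have Am : A <= Num.max A n by rewrite le_max lexx.
apply: (arc_injective gAB Am mB (lexx _)).
have sn t : n <= t -> g t = g n by exact: turn_timeP.
by rewrite sn ?le_max ?lexx ?orbT// (sn B)// ltW.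
Qed.

Lemma rev_simple g : simple g -> simple (rev_curve g).
Proof.
move=> sg s t.
have t0P r : 0 <= r -> (forall q, 0 <= q -> q <= r -> rev_curve g q = rev_curve g 0) ->
    (t0 (rev_curve g) <= s%:E)%E -> r <= s.
  move=> r0 rP; rewrite -lee_fin; apply: le_trans.
  by apply: ereal_sup_ubound; exists r.
have tinfP r : 0 <= r -> (forall q, r <= q -> rev_curve g q = rev_curve g r) ->
    (t%:E <= tinf (rev_curve g))%E -> t <= r.
  move=> r0 rP; rewrite -lee_fin => /le_trans; apply.
  by apply: ereal_inf_lbound; exists r.
have s0P : (t0 (rev_curve g) <= s%:E)%E -> 0 <= s.
  by apply: t0P => // q q0 q0'; congr (rev_curve g _); apply/eqP; rewrite eq_le q0'.
move=> ts st tt; have s0 := s0P ts.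
have [ng|cg] := pselect (nonconstant g); last first.
  have : s + 1 <= s.
    apply: t0P ts; first exact: addr_ge0.
    move=> q q0 _; apply: contrapT => gq; apply: cg.
    by apply: rev_nonconstant; exists q.
  by rewrite gerDl ler10.
have [A [B [G gAB]]] := simple_arc_of sg ng.
have nB := arc_turn_time gAB; set n := (turn_time g)%:R in nB.
have sB : n - s <= B.
  rewrite lerBlDr -lerBlDl; apply: t0P ts; first by rewrite subr_ge0.
  move=> q q0; rewrite lerBrDr -lerBrDl => qn.
  rewrite !rev_curveE// subr0 -/n (arc_after gAB qn).
  by apply/esym/(arc_after gAB).
have An : A <= n by exact: le_trans (ltW (arc_AB gAB)) nB.
have nt : A <= n - t.
  rewrite lerBrDr -lerBrDl; apply: tinfP tt; first by rewrite subr_ge0.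
  move=> q nq; have q0 : 0 <= q by apply: le_trans nq; rewrite subr_ge0.
  rewrite !rev_curveE// ?subr_ge0// -/n subKr.
  by apply: (arc_before gAB); rewrite lerBlDr -lerBlDl.
rewrite !rev_curveE//; last exact: le_trans (ltW st).
by apply/nesym/(arc_injective gAB) => //; rewrite ltrD2l ltrN2.
Qed.

(** The image is the same and the unit tangent changes its sign, since the
velocity does. *)
Lemma rev_current g (w : testform R m) : simple g ->
  curve_current (rev_curve g) w = - curve_current g w.
Proof.
move=> sg; have srg := rev_simple sg.
rewrite !curve_currentE// rev_image.
have [mI _] := measurable_curve_image sg.
have iw := integrable_curve w sg.
have iw' := integrable_curve w srg; rewrite rev_image in iw'.
suff [Z [Z0 ZP]] : exists Z : set V, H Z = 0%E /\ forall x, curve_image g x -> ~ Z x ->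
    unit_tangent (rev_curve g) x = - unit_tangent g x.
  rewrite -[RHS]mulN1r -(RintegralZl _ mI iw) /Rintegral; congr fine.
  apply: ae_eq_integral.
  - exact: mI.
  - exact: measurable_int iw'.
  - apply/measurable_EFinP; apply: measurable_funM; first exact: measurable_cst.
    exact/measurable_EFinP/(measurable_int _ iw).
  - by apply: (H1_null_ae Z0) => x nZ gx; rewrite ZP// dotpC dotpNl dotpC mulN1r.
have [ng|cg] := pselect (nonconstant g); last first.
  exists (curve_image g); split; last by move=> x gx /(_ gx).
  rewrite (_ : curve_image g = [set g 0]) ?H_set1//.
  apply/seteqP; split => [_ [t t0 <-]|_ ->]; last by exists 0 => //=.
  by apply: contrapT => gt; apply: cg; exists t.
have [A [B [G gAB]]] := simple_arc_of sg ng.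
have [Z [Z0 ZP]] := arc_regular gAB; exists Z; split => // x gx nZ.
have [t [At tB gt dt ut]] := ZP _ gx nZ.
have nB := arc_turn_time gAB; set n := (turn_time g)%:R in nB.
have tn : t < n by exact: lt_le_trans tB nB.
have t0 : 0 <= t by exact: le_trans (arc_A_ge0 gAB) (ltW At).
have urt s : rev_curve g s = x -> s = n - t.
  have [s0|/ltW s0] := leP s 0.
    rewrite (curve_le0 _ s0) rev_curveE// subr0 => /ut nt.
    by move: tn; rewrite -nt ltxx.
  by rewrite rev_curveE// => /ut <-; rewrite subKr.
have dgn : is_derive (n - t) 1 (fun s => g (n - s) : V) (- G t).
  apply: is_derive_rV => i; rewrite mxE.
  have dh : is_derive (n - t) 1 (fun s => n - s) (-1 : R).
    have := @is_deriveB _ _ _ (cst n) id (n - t) 1 0 1 (is_derive_cst _ _ _) (is_derive_id _ _).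
    by rewrite sub0r.
  have dgi : is_derive (n - (n - t)) 1 (fun s => g s 0 i) (G t 0 i).
    by rewrite subKr; exact: is_derive_coord.
  have := @is_derive1_comp _ (fun s => g s 0 i) (fun s => n - s) _ _ _ dgi dh.
  by rewrite mulrN1.
have drt : is_derive (n - t) 1 (rev_curve g : R -> V) (- G t).
  apply: near_eq_is_derive dgn; near=> s; rewrite rev_curveE//.
  by apply: ltW; near: s; apply: lt_nbhsr; rewrite subr_gt0.
have tn0 : 0 <= n - t by rewrite subr_ge0 ltW.
have rt : rev_curve g (n - t) = x by rewrite rev_curveE// subKr.
rewrite (unit_tangentE t0 gt ut dt) (@unit_tangentE R m (rev_curve g) (fun=> - G t) x (n - t) tn0 rt urt drt).
by rewrite enormN scalerN.
Unshelve. all: by end_near. Qed.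

Lemma curve_eq (g h : curve R m) : (forall t, g t = h t) -> g = h.
Proof.
case: g h => [g g1 g2 g3] [h h1 h2 h3] /= gh; have E : g = h by exact/funext.
by rewrite -E in h1 h2 h3 *; congr Curve; exact: Prop_irrelevance.
Qed.

Lemma rev_turn_time g : nonconstant g -> turn_time (rev_curve g) = turn_time g.
Proof.
move=> ng; have [sp nsp] := start_time_started ng.
have [sq nsq] := (stop_timeE (stop_time g) g).1 erefl.
set p := start_time g in sp nsp *; set q := stop_time g in sq nsq *.
have pq : (p < q)%N.
  rewrite ltnNge; apply/negP => qp; have [t t0 gt] := ng; apply: gt.
  have gp : g p%:R = g 0 by exact: sp.
  have qp' : q%:R <= p%:R :> R by rewrite ler_nat.
  have [tp|/ltW pt] := leP t p%:R; first exact: sp.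
  by rewrite -gp (sq p%:R)// (sq t)// (le_trans qp').
have N : turn_time g = (p + q)%N by [].
have rE t : 0 <= t -> rev_curve g t = g ((p + q)%:R - t).
  by move=> t0; rewrite rev_curveE.
have gN : g (p + q)%:R = g q%:R by apply: sq; rewrite ler_nat leq_addl.
have r0 : rev_curve g 0 = g q%:R by rewrite rE// subr0.
have nr : nonconstant (rev_curve g).
  apply: contrapT => cr; apply: nsp => t _.
  have cst s : 0 <= s -> rev_curve g s = g q%:R.
    by move=> s0; rewrite -r0; apply: contrapT => gs; apply: cr; exists s.
  have g0 : g 0 = g q%:R by rewrite -(cst (p + q)%:R)// rE// subrr.
  have [t0|/ltW t0] := leP t 0; first exact: curve_le0.
  have [tN|/ltW Nt] := leP t (p + q)%:R.
    by rewrite g0 -(cst ((p + q)%:R - t)) ?subr_ge0// rE ?subr_ge0// subKr.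
  by rewrite g0; apply: sq; apply: le_trans Nt; rewrite ler_nat leq_addl.
have started_rev s : (s <= p + q)%N -> started s (rev_curve g) <-> stopped (p + q - s) g.
  move=> sN; have sN' : s%:R <= (p + q)%:R :> R by rewrite ler_nat.
  split=> [st t|st t ts].
    rewrite natrB// => ts.
    have gs : g ((p + q)%:R - s%:R) = g q%:R by rewrite -rE// st.
    have [tN|/ltW Nt] := leP t (p + q)%:R; last first.
      by rewrite gs; apply: sq; apply: le_trans Nt; rewrite ler_nat leq_addl.
    rewrite gs -[t in LHS](subKr (p + q)%:R) -rE ?subr_ge0// st ?r0//.
    by rewrite lerBlDr -lerBlDl.
  have [t0|/ltW t0] := leP t 0; first exact: curve_le0.
  rewrite r0 rE// -gN; have := st (p + q)%:R; rewrite natrB// => ->; last by rewrite lerBlDr lerDl.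
  by rewrite -natrB// st// natrB// lerD2l lerN2.
have stopped_rev s : (s <= p + q)%N -> stopped s (rev_curve g) <-> started (p + q - s) g.
  move=> sN; have sN' : s%:R <= (p + q)%:R :> R by rewrite ler_nat.
  split=> [st t|st t ts].
    rewrite natrB// => ts.
    have gs : g ((p + q)%:R - s%:R) = g 0.
      rewrite -rE// -(st (p + q)%:R)// rE// subrr//.
    have [t0|/ltW t0] := leP t 0; first exact: curve_le0.
    rewrite -[t in LHS](subKr (p + q)%:R) -rE; last first.
      by rewrite subr_ge0 (le_trans ts)// lerBlDr lerDl.
    by rewrite st ?rE//; rewrite lerBrDr -lerBrDl.
  have t0 : 0 <= t by exact: le_trans ts.
  rewrite !rE//; have := st ((p + q)%:R - s%:R); rewrite natrB// => ->//.
  by apply: st; rewrite natrB// lerD2l lerN2.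
rewrite /turn_time -/p -/q; congr (_ + _)%N.
  apply: start_timeP => //.
    by apply/started_rev; rewrite ?leq_addr// addKn.
  move=> /started_rev; rewrite addnC ltn_addr// => /(_ isT).
  have -> : (q + p - p.+1 = q.-1)%N by rewrite subnS addnK.
  by apply: nsq; rewrite prednK//; exact: leq_trans pq.
apply/stop_timeE; split.
  by apply/stopped_rev; rewrite ?leq_addl// addnK.
move=> k kq /stopped_rev; rewrite ltnW ?ltn_addl// => /(_ isT) sk; apply: nsp.
apply: startedW sk; rewrite -addnBA ?(ltnW kq)// -addn1 leq_add2l subn_gt0//.
Qed.

Lemma rev_curveK g : rev_curve (rev_curve g) = g.
Proof.
have [ng|cg] := pselect (nonconstant g); last first.
  have ch0 (h : curve R m) : ~ nonconstant h -> forall t, h t = h 0.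
    move=> ch t; have [t0|/ltW t0] := leP t 0; first exact: curve_le0.
    by apply: contrapT => ht; apply: ch; exists t.
  apply: curve_eq => t; rewrite (ch0 _ cg) ch0; last first.
    by move=> /rev_nonconstant/rev_nonconstant.
  have cr : ~ nonconstant (rev_curve g) by move/rev_nonconstant.
  by rewrite rev_curveE// (ch0 _ cr) rev_curveE// (ch0 _ cg).
apply: curve_eq => t; have [t0|/ltW t0] := leP t 0; last first.
  rewrite rev_curveE// rev_turn_time//; have [tN|/ltW Nt] := leP t (turn_time g)%:R.
    by rewrite rev_curveE ?subr_ge0// subKr.
  rewrite curve_le0 ?subr_le0// rev_curveE// subr0; apply/esym/turn_timeP => //.
rewrite (curve_le0 _ t0) (curve_le0 g t0) rev_curveE// rev_turn_time// subr0.
by rewrite rev_curveE// subrr.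
Qed.

End gamma.

(** * Test functions *)

Section flat.
Context {R : realType}.

(** The functions [p(1/s) exp(-1/s)], extended by 0 to [s <= 0], form a class
which is stable under differentiation. *)
Definition flat (p : {poly R}) (s : R) : R :=
  if 0 < s then p.[s^-1] * expR (- s^-1) else 0.

Lemma flat_bound p : exists C, forall s, `|flat p s| <= C * s ^+ 2.
Proof.
exists (\sum_(i < size p) `|p`_i| * (i.+2)`!%:R) => s; rewrite /flat.
case: ltP => s0; last first.
  rewrite normr0 mulr_ge0 ?sqr_ge0//; apply: sumr_ge0 => i _.
  by rewrite mulr_ge0.
have si : 0 < s^-1 by rewrite invr_gt0.
rewrite normrM (gtr0_norm (expR_gt0 _)) horner_coef expRN.
rewrite ler_pdivrMr ?expR_gt0//.
apply: (le_trans (ler_norm_sum _ _ _)); rewrite !mulr_suml.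
apply: ler_sum => i _; rewrite normrM -!mulrA ler_wpM2l// normrX gtr0_norm//.
have := @expR_ge1Dxn _ s^-1 i.+1 (ltW si).
move=> h.
have h' : s^-1 ^+ i.+2 / (i.+2)`!%:R <= expR s^-1 by apply: le_trans h; rewrite lerDr.
move: h'; rewrite ler_pdivrMr ?ltr0n ?fact_gt0// => h'.
have -> : s^-1 ^+ i = s ^+ 2 * s^-1 ^+ i.+2.
  by rewrite !(exprS s^-1); move: (s^-1 ^+ i) => z; field; rewrite gt_eqF.
by rewrite [leRHS](_ : _ = s ^+ 2 * ((i.+2)`!%:R * expR s^-1)) ?ler_pM2l ?exprn_gt0 1?mulrC//; ring.
Qed.

Lemma is_derive_flat p s : is_derive s (1 : R) (flat p) (flat ('X^2 * (p - p^`())%R) s).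
Proof.
rewrite {2}/flat; have [s0|s0|<-] := ltgtP 0 s.
- have ds := @is_deriveV R id s 1 1 (lt0r_neq0 s0) (is_derive_id _ _).
  have dp := @is_derive1_comp R (horner p) (fun x => x^-1) s _ _ (is_derive_poly _ _) ds.
  have de := @is_derive1_comp R expR (fun x => - x^-1) s _ _ (is_derive_expR _) (is_deriveN ds).
  have dd := is_deriveM dp de.
  apply: (@near_eq_is_derive _ _ _ ((horner p \o (fun x => x^-1)) * (expR \o (fun x => - x^-1)))).
    by near=> r; rewrite /flat ifT//; near: r; exact: lt_nbhsr.
  apply: is_derive_eq; rewrite /= !hornerE /GRing.scale/= -exprVn.
  ring.
- apply: (@near_eq_is_derive _ _ _ (cst 0)).
    near=> r; rewrite /flat ifF//; apply/negbTE; rewrite -leNgt ltW//.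
    by near: r; exact: lt_nbhsl.
- have [C Cp] := flat_bound p.
  have p0 : flat p 0 = 0 by rewrite /flat ltxx.
  have cv : h^-1 *: (flat p (h *: 1 + 0) - flat p 0) @[h --> 0^'] --> (0 : R).
    apply/cvgr0Pnorm_le => e e0; near=> h.
    have h0 : h != 0 by near: h; exact: nbhs_dnbhs_neq.
    rewrite p0 subr0 addr0 /GRing.scale/= mulr1 normrM normfV.
    rewrite ler_pdivrMl ?normr_gt0//; apply: (le_trans (Cp _)).
    rewrite (_ : h ^+ 2 = `|h| * `|h|); last by rewrite -expr2 real_normK ?num_real.
    rewrite mulrA mulrC ler_wpM2l//.
    apply: (@le_trans _ _ ((`|C| + 1) * `|h|)).
      by rewrite ler_wpM2r// (le_trans (ler_norm _))// lerDl.
    rewrite mulrC -ler_pdivlMr ?ltr_wpDl//.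
    by near: h; apply: dnbhs0_le; rewrite divr_gt0// ltr_wpDl.
  by apply: DeriveDef; [apply/cvg_ex; exists 0|exact: cvg_lim cv].
Unshelve. all: by end_near. Qed.

Lemma flat_ge0 s : 0 <= flat 1 s.
Proof. by rewrite /flat; case: ifP => // _; rewrite hornerC mul1r expR_ge0. Qed.

Lemma flat_le1 s : flat 1 s <= 1.
Proof.
rewrite /flat; case: ifP => // s0; rewrite hornerC mul1r expR_le1.
by rewrite oppr_le0 invr_ge0 ltW.
Qed.

Lemma flat_gt0 s : (0 < flat 1 s) = (0 < s).
Proof. by rewrite /flat; case: ifP => _; rewrite ?ltxx// hornerC mul1r expR_gt0. Qed.

End flat.

Section smooth_functions.
Context {R : realType} {m : nat}.
Local Notation V := 'rV[R]_m.

Lemma CkW k (f : V -> R) : Ck k.+1 f -> Ck k f.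
Proof.
elim: k f => [|k IH] f [cf df]; first by split.
by split=> // i; have [dfi cdf] := df i; split=> //; exact: IH.
Qed.

Lemma Ck_cst k c : Ck k (cst c : V -> R).
Proof.
elim: k c => [|k IH] c; first by split=> // x; exact: cst_continuous.
split=> [x|i]; first exact: cst_continuous.
split=> [x|]; first exact: derivable_cst.
rewrite (_ : partial i _ = cst 0); first exact: IH.
by apply/funext => x; rewrite /partial derive_cst.
Qed.

Lemma CkD k (f g : V -> R) : Ck k f -> Ck k g -> Ck k (f \+ g).
Proof.
elim: k f g => [|k IH] f g.
  by move=> [cf _] [cg _]; split=> // x; exact: (continuousD (cf x) (cg x)).
move=> [cf df] [cg dg]; split=> [x|i]; first by exact: (continuousD (cf x) (cg x)).
have [[dfi cfi] [dgi cgi]] := (df i, dg i).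
split=> [x|]; first exact: derivableD.
rewrite (_ : partial i _ = partial i f \+ partial i g); first exact: IH.
by apply/funext => x; rewrite /partial deriveD.
Qed.

Lemma CkM k (f g : V -> R) : Ck k f -> Ck k g -> Ck k (f \* g).
Proof.
elim: k f g => [|k IH] f g.
  by move=> [cf _] [cg _]; split=> // x; exact: (continuousM (cf x) (cg x)).
move=> Cf Cg; have [cf df] := Cf; have [cg dg] := Cg.
split=> [x|i]; first by exact: (continuousM (cf x) (cg x)).
have [[dfi cfi] [dgi cgi]] := (df i, dg i).
split=> [x|]; first exact: derivableM.
rewrite (_ : partial i _ = (f \* partial i g) \+ (g \* partial i f)).
  by apply: CkD; apply: IH => //; exact: CkW.
by apply/funext => x; rewrite /partial deriveM.
Qed.

Lemma smooth_cst c : smooth (cst c : V -> R).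
Proof. by move=> k; exact: Ck_cst. Qed.

Lemma smoothD (f g : V -> R) : smooth f -> smooth g -> smooth (f \+ g).
Proof. by move=> sf sg k; exact: CkD. Qed.

Lemma smoothM (f g : V -> R) : smooth f -> smooth g -> smooth (f \* g).
Proof. by move=> sf sg k; exact: CkM. Qed.

Lemma smoothZ (f : V -> R) c : smooth f -> smooth (fun x => c * f x).
Proof. by move=> sf; exact: (smoothM (smooth_cst c) sf). Qed.

Lemma smoothX (f : V -> R) n : smooth f -> smooth (fun x => f x ^+ n).
Proof.
move=> sf; elim: n => [|n IH].
  by rewrite (_ : (fun x => _) = cst 1); [exact: smooth_cst|apply/funext].
rewrite (_ : (fun x => _) = f \* (fun x => f x ^+ n)); first exact: smoothM.
by apply/funext => x; rewrite exprS.
Qed.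

Lemma smooth_prod (I : Type) (s : seq I) (f : I -> V -> R) :
  (forall i, smooth (f i)) -> smooth (fun x => \prod_(i <- s) f i x).
Proof.
move=> sf; elim: s => [|i s IH].
  rewrite (_ : (fun x => _) = cst 1); first exact: smooth_cst.
  by apply/funext => x; rewrite big_nil.
rewrite (_ : (fun x => _) = f i \* (fun x => \prod_(i <- s) f i x)); first exact: smoothM.
by apply/funext => x; rewrite big_cons.
Qed.

Lemma flat_coord_continuous p (i : 'I_m) (a c : R) :
  continuous (fun x : V => flat p (a * x 0 i + c)).
Proof.
move=> x; apply: (@continuous_comp _ _ _ (fun x : V => a * x 0 i + c) (flat p)).
  have ca : {for x, continuous (fun x : V => a * x 0 i)}.
    exact: (continuousM (@cst_continuous _ _ a x) (@coord_continuous _ _ _ 0 i x)).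
  exact: (continuousD ca (@cst_continuous _ _ c x)).
apply/differentiable_continuous/derivable1_diffP.
by have [] := is_derive_flat p (a * x 0 i + c).
Qed.

Lemma smooth_flat (i : 'I_m) (a c : R) : smooth (fun x : V => flat 1 (a * x 0 i + c)).
Proof.
move=> k; move: 1 => p; elim: k p => [|k IH] p.
  by split=> //; exact: flat_coord_continuous.
split=> [|j]; first exact: flat_coord_continuous.
have dd x : is_derive x (delta_mx 0 j) (fun x : V => flat p (a * x 0 i + c))
    (a * (i == j)%:R * flat ('X^2 * (p - p^`())) (a * x 0 i + c)).
  have E : (fun h : R => h^-1 *: (flat p (a * (h *: delta_mx 0 j + x : V) 0 i + c) -
        flat p (a * x 0 i + c))) =
     (fun h : R => h^-1 *: ((flat p \o (fun h => a * (i == j)%:R * h + (a * x 0 i + c))) (h *: 1 + 0) -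
        (flat p \o (fun h => a * (i == j)%:R * h + (a * x 0 i + c))) 0)).
    apply/funext => h; congr (_ *: (flat p _ - flat p _)); rewrite ?mxE ?eqxx /=.
      rewrite addr0 /GRing.scale/= mulr1 mulrDr addrA; congr (_ + _ + _).
      by rewrite -mulrA (mulrC h).
    by rewrite mulr0 add0r.
  have de : is_derive (0 : R) 1 (fun h => a * (i == j)%:R * h + (a * x 0 i + c)) (a * (i == j)%:R).
    by apply: is_derive_eq; rewrite addr0 /GRing.scale/= mulr1.
  have df : is_derive (a * (i == j)%:R * 0 + (a * x 0 i + c)) 1 (flat p)
      (flat ('X^2 * (p - p^`())) (a * x 0 i + c)).
    by rewrite mulr0 add0r; exact: is_derive_flat.
  have [d1 d2] := @is_derive1_comp R (flat p)
    (fun h => a * (i == j)%:R * h + (a * x 0 i + c)) 0 _ _ df de.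
  apply: DeriveDef; first by rewrite /derivable E; exact: d1.
  by rewrite /derive E [RHS]mulrC; exact: d2.
split=> [x|]; first by have [] := dd x.
rewrite (_ : partial j _ = (fun x => cst (a * (i == j)%:R) x * flat ('X^2 * (p - p^`())) (a * x 0 i + c))).
  by apply: CkM; [exact: Ck_cst|exact: IH].
by apply/funext => x; rewrite /partial; have [_ ->] := dd x.
Qed.

End smooth_functions.

Section test_functions.
Context {R : realType} {m : nat}.
Local Notation V := 'rV[R]_m.

Definition test (f : V -> R) := smooth f /\ compact (closure [set x | f x != 0]).

Lemma compact_support_sub (P Q : V -> Prop) :
  (forall x, P x -> Q x) -> compact (closure [set x | Q x]) ->
  compact (closure [set x | P x]).
Proof.
move=> PQ cQ; apply: (subclosed_compact _ cQ); first exact: closed_closure.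
exact: closure_subset.
Qed.

Lemma testM (f g : V -> R) : smooth f -> test g -> test (fun x => f x * g x).
Proof.
move=> sf [sg cg]; split; first exact: smoothM.
apply: (compact_support_sub _ cg) => x.
by apply: contraNN => /eqP ->; rewrite mulr0.
Qed.

Lemma testZ c (f : V -> R) : test f -> test (fun x => c * f x).
Proof. by apply: testM; exact: smooth_cst. Qed.

Lemma compact_support_cup (P Q S : V -> Prop) : (forall x, S x -> P x \/ Q x) ->
  compact (closure [set x | P x]) -> compact (closure [set x | Q x]) ->
  compact (closure [set x | S x]).
Proof.
move=> SPQ cP cQ.
have cPQ : compact (closure [set x | P x \/ Q x]).
  rewrite (_ : [set x | P x \/ Q x] = [set x | P x] `|` [set x | Q x])//.
  rewrite closureU.
  have := @bigsetU_compact V bool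
    (fun b => if b then closure [set x | P x] else closure [set x | Q x])
    [:: true; false] xpredT.
  by rewrite !big_cons big_nil setU0; apply; case.
exact: (compact_support_sub SPQ).
Qed.

Lemma testD (f g : V -> R) : test f -> test g -> test (fun x => f x + g x).
Proof.
move=> [sf cf] [sg cg]; split; first exact: smoothD.
apply: (compact_support_cup _ cf cg) => x fg.
have [fx|] := eqVneq (f x) 0; last by left.
by right; move: fg; rewrite fx add0r.
Qed.

Lemma test_form (w : testform R m) i : test (fun x => w x 0 i).
Proof.
split; first exact: testform_smooth.
apply: (compact_support_sub _ (@testform_supp _ _ w)) => x.
by apply: contraNN => /eqP ->; rewrite mxE.
Qed.

Lemma formZ (f : V -> R) (w : testform R m) : smooth f ->
  exists w' : testform R m, forall x, w' x = f x *: w x.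
Proof.
move=> sf; have s i : smooth (fun x => (f x *: w x) 0 i).
  rewrite (_ : (fun x => _) = fun x => f x * w x 0 i).
    by apply: smoothM => //; exact: testform_smooth.
  by apply/funext => x; rewrite mxE.
have c : compact (closure [set x | f x *: w x != 0]).
  apply: (compact_support_sub _ (@testform_supp _ _ w)) => x.
  by apply: contraNN => /eqP ->; rewrite scaler0.
by exists (TestForm s c).
Qed.

Lemma formD (w1 w2 : testform R m) :
  exists w : testform R m, forall x, w x = w1 x + w2 x.
Proof.
have s i : smooth (fun x => (w1 x + w2 x) 0 i).
  rewrite (_ : (fun x => _) = fun x => w1 x 0 i + w2 x 0 i).
    by apply: smoothD; exact: testform_smooth.
  by apply/funext => x; rewrite mxE.
have c : compact (closure [set x | w1 x + w2 x != 0]).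
  apply: (compact_support_cup _ (@testform_supp _ _ w1) (@testform_supp _ _ w2)) => x w12.
  have [w1x|] := eqVneq (w1 x) 0; last by left.
  by right; move: w12; rewrite w1x add0r.
by exists (TestForm s c).
Qed.

Lemma form_test (f : V -> R) (u : V) : test f ->
  exists w : testform R m, forall x, w x = f x *: u.
Proof.
move=> [sf cf]; have s i : smooth (fun x => (f x *: u) 0 i).
  rewrite (_ : (fun x => _) = fun x => u 0 i * f x); first exact: smoothZ.
  by apply/funext => x; rewrite mxE mulrC.
have c : compact (closure [set x | f x *: u != 0]).
  apply: (compact_support_sub _ cf) => x.
  by apply: contraNN => /eqP ->; rewrite scale0r.
by exists (TestForm s c).
Qed.

Definition box (a b : V) : set V := [set x | forall i, a 0 i < x 0 i < b 0 i].

Definition bump (a b x : V) : R :=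
  \prod_(i < m) (flat 1 (1 * x 0 i + - a 0 i) * flat 1 (-1 * x 0 i + b 0 i)).

Lemma bump_smooth a b : smooth (bump a b).
Proof. by apply: smooth_prod => i; apply: smoothM; exact: smooth_flat. Qed.

Lemma bump_ge0 a b x : 0 <= bump a b x.
Proof. by apply: prodr_ge0 => i _; rewrite mulr_ge0 ?flat_ge0. Qed.

Lemma bump_le1 a b x : bump a b x <= 1.
Proof.
apply: prodr_ile1 => i _; rewrite mulr_ge0 ?flat_ge0//=.
by rewrite mulr_ile1 ?flat_ge0 ?flat_le1.
Qed.

Lemma bump_gt0 a b x : box a b x -> 0 < bump a b x.
Proof.
move=> abx; apply: prodr_gt0 => i _; have /andP[ax xb] := abx i.
by rewrite mulr_gt0// flat_gt0 ?mul1r ?subr_gt0// mulN1r addrC subr_gt0.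
Qed.

Lemma bump_out a b x : ~ box a b x -> bump a b x = 0.
Proof.
move=> nabx; apply/eqP/negPn/negP => b0; apply: nabx => i.
have : 0 < bump a b x by rewrite lt_neqAle eq_sym b0 bump_ge0.
rewrite /bump (bigD1 i)//= -mulrA => b1.
have f1 : 0 < flat 1 (1 * x 0 i + - a 0 i).
  rewrite lt_neqAle flat_ge0 andbT eq_sym; apply/eqP => f0.
  by move: b1; rewrite f0 mul0r ltxx.
have f2 : 0 < flat 1 (-1 * x 0 i + b 0 i).
  rewrite lt_neqAle flat_ge0 andbT eq_sym; apply/eqP => f0.
  by move: b1; rewrite f0 mul0r mulr0 ltxx.
by move: f1 f2; rewrite !flat_gt0 mul1r subr_gt0 mulN1r addrC subr_gt0 => -> ->.
Qed.

Lemma box_compact a b : compact (closure (box a b)).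
Proof.
apply: (@subclosed_compact _ _ [set v : V | forall i, `[a 0 i, b 0 i]%classic (v 0 i)]).
- exact: closed_closure.
- by apply: (@rV_compact R m (fun i => `[a 0 i, b 0 i]%classic)) => i; exact: segment_compact.
have c : closed [set v : V | forall i, `[a 0 i, b 0 i]%classic (v 0 i)].
  apply: compact_closed; first exact: norm_hausdorff.
  by apply: (@rV_compact R m (fun i => `[a 0 i, b 0 i]%classic)) => i; exact: segment_compact.
rewrite [X in _ `<=` X](closure_id _).1//; apply: closure_subset => x abx i /=.
by have /andP[ax xb] := abx i; rewrite in_itv/= !ltW.
Qed.

Lemma test_sub (f : V -> R) a b : smooth f -> (forall x, ~ box a b x -> f x = 0) -> test f.
Proof.
move=> sf f0; split=> //; apply: (@compact_support_sub (fun x => f x != 0) (box a b) _ (@box_compact a b)) => x fx.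
by apply: contrapT => /f0 fx0; rewrite fx0 eqxx in fx.
Qed.

Lemma bump_test a b : test (bump a b).
Proof. by apply: (@test_sub _ a b (bump_smooth a b)) => x; exact: bump_out. Qed.

(** Smooth approximations from below of the indicator function of a box. *)
Definition plateau a b n (x : V) : R := 1 - (1 - bump a b x) ^+ n.

Lemma plateau_test a b n : test (plateau a b n).
Proof.
apply: (@test_sub _ a b) => [|x nx]; last first.
  by rewrite /plateau bump_out// subr0 expr1n subrr.
rewrite (_ : plateau a b n = cst 1 \+ (fun x => -1 * ((cst 1 \+ (fun x => -1 * bump a b x)) x) ^+ n)).
  apply: smoothD; [exact: smooth_cst|apply/smoothZ/smoothX].
  by apply: smoothD; [exact: smooth_cst|exact/smoothZ/bump_smooth].
by apply/funext => x; rewrite /plateau/= !mulN1r.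
Qed.

Lemma plateau_ge0 a b n x : 0 <= plateau a b n x.
Proof.
rewrite subr_ge0 exprn_ile1 ?subr_ge0 ?bump_le1// lerBlDl lerDr.
exact: bump_ge0.
Qed.

Lemma plateau_le1 a b n x : plateau a b n x <= 1.
Proof. by rewrite lerBlDr lerDl exprn_ge0// subr_ge0 bump_le1. Qed.

Lemma plateau_cvg a b x : plateau a b n x @[n --> \oo] --> (\1_(box a b) x : R).
Proof.
rewrite indicE; have [abx|nabx] := boolP (x \in box a b); last first.
  apply: cvg_near_cst; near=> n; move: nabx; rewrite notin_setE => nabx.
  by rewrite /plateau bump_out// subr0 expr1n subrr.
rewrite -[X in _ --> X]subr0 /plateau; apply: cvgB; first exact: cvg_cst.
apply: cvg_expr; have := bump_gt0 (set_mem abx); have := bump_le1 a b x => b1 b0.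
by rewrite ger0_norm ?subr_ge0// ltrBlDr ltrDl.
Unshelve. all: by end_near. Qed.

(** A multiple of the bump of a box, larger by 1 on all sides than one which
contains the support of [f].  There every factor of the bump is at least
[exp (-1)], so that the constant does not depend on the support. *)
Lemma ex_cutoff : exists2 C : R, 0 <= C & forall f, test f -> exists2 h, test h &
  forall x, 0 <= h x <= C /\ (f x != 0 -> 1 <= h x).
Proof.
pose e0 : R := (expR (-1) * expR (-1)) ^+ m.
have e00 : 0 < e0 by rewrite exprn_gt0// mulr_gt0// expR_gt0.
exists e0^-1 => [|f [sf cf]]; first by rewrite invr_ge0 ltW.
have [B Bf] : exists B, forall x, f x != 0 -> `|x| <= B.
  have [M [_ /(_ (M + 1))]] := compact_bounded cf.
  rewrite ltrDl => /(_ ltr01) MB; exists (M + 1) => x fx; apply: MB.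
  exact: subset_closure.
pose a : V := const_mx (- (B + 1)); pose b : V := const_mx (B + 1).
exists (fun x => e0^-1 * bump a b x); first exact/testZ/bump_test.
move=> x; split.
  by rewrite mulr_ge0 ?invr_ge0 ?(ltW e00) ?bump_ge0//= ler_piMr ?invr_ge0 ?(ltW e00)// bump_le1.
move=> /Bf xB; rewrite ler_pdivlMl// mulr1 /e0 /bump -[X in _ ^+ X]card_ord -prodr_const.
apply: ler_prod => i _; rewrite mulr_ge0 ?expR_ge0//= !mxE opprK mul1r mulN1r.
have fl (s : R) : 1 <= s -> expR (-1) <= flat 1 s.
  move=> s1; have s0 : 0 < s by exact: lt_le_trans s1.
  by rewrite /flat s0 hornerC mul1r ler_expR lerN2 invf_le1.
have := le_trans (coord_le_norm x i) xB; rewrite ler_norml => /andP[xB1 xB2].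
by rewrite ler_pM ?expR_ge0//; apply: fl; lra.
Qed.

End test_functions.

(** * Densities and dominated functionals *)

Section measurable_induction.
Context d (T : measurableType d) (R : realType).
Import HBNNSimple.

(** Nonnegative measurable functions are increasing limits of simple functions. *)
Lemma measurable_fun_ind (Q : (T -> R) -> Prop) :
  (forall E, measurable E -> Q (\1_E)) ->
  (forall (c : R) (f : T -> R), 0 <= c -> measurable_fun setT f -> (forall x, 0 <= f x) -> Q f ->
    Q (fun x => c * f x)) ->
  (forall f g : T -> R, measurable_fun setT f -> measurable_fun setT g ->
    (forall x, 0 <= f x) -> (forall x, 0 <= g x) -> Q f -> Q g ->
    Q (fun x => f x + g x)) ->
  (forall (F : nat -> T -> R) (f : T -> R), (forall n, measurable_fun setT (F n)) ->
    measurable_fun setT f -> (forall n x, 0 <= F n x) ->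
    (forall x, {homo F ^~ x : n k / (n <= k)%N >-> n <= k}) ->
    (forall n x, F n x <= f x) ->
    (forall x, F n x @[n --> \oo] --> f x) -> (forall n, Q (F n)) -> Q f) ->
  forall f : T -> R, measurable_fun setT f -> (forall x, 0 <= f x) -> Q f.
Proof.
move=> Q1 QZ QD QL f mf f0.
have Qs (h : {nnsfun T >-> R}) : Q h.
  pose F y x : R := y * \1_(h @^-1` [set y]) x.
  have hE : (h : T -> R) = fun x => \sum_(y <- finmap.enum_fset (fset_set (range h))) F y x.
    by apply/funext => x; rewrite {1}(fimfunE h x) fsbig_finite.
  have y0 y : y \in finmap.enum_fset (fset_set (range h)) -> 0 <= y.
    by rewrite in_fset_set// inE => -[x _ <-].
  rewrite hE; move: y0; elim: (finmap.enum_fset _) => [|y s IH] y0.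
    rewrite (_ : (fun x => _) = (\1_set0 : T -> R)); first exact: Q1.
    by apply/funext => x; rewrite big_nil indic0.
  have yy0 : 0 <= y by apply: y0; rewrite inE eqxx.
  have sy0 z : z \in s -> 0 <= z by move=> zs; apply: y0; rewrite inE zs orbT.
  have mF z : measurable_fun setT (F z).
    apply: measurable_funM; first exact: measurable_cst.
    by apply: measurable_indic; rewrite -[X in measurable X]setTI; exact: measurable_funP.
  rewrite (_ : (fun x => _) = fun x => F y x + \sum_(z <- s) F z x); last first.
    by apply/funext => x; rewrite big_cons.
  apply: QD => //.
  - by apply: measurable_sum.
  - by move=> x; rewrite mulr_ge0// indicE.
  - by move=> x; rewrite big_seq; apply: sumr_ge0 => z zs; apply: mulr_ge0; [exact: sy0|rewrite indicE].
  - have my : measurable (h @^-1` [set y]).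
      by rewrite -[X in measurable X]setTI; exact: measurable_funP.
    apply: QZ; [exact: yy0|exact: measurable_indic| |exact: Q1].
    by move=> x; rewrite indicE.
  - exact: IH.
have mF : measurable_fun setT (EFin \o f) by exact/measurable_EFinP.
pose F n : T -> R := nnsfun_approx measurableT mF n.
apply: (QL F f _ mf) => [n|n x|x n k nk|n x|x|n].
- exact: measurable_funP.
- exact: fun_ge0.
- by have /lefP := nd_nnsfun_approx measurableT mF nk; exact.
- rewrite -lee_fin /F nnsfun_approxE; apply: le_approx => // y _.
  by rewrite /= lee_fin.
- have := @cvg_nnsfun_approx _ _ _ _ measurableT _ mF (fun y _ => _) x Logic.I.
  by move=> /(_ (fun y => f0 y)) /fine_cvgP[].
- exact: Qs.
Qed.

End measurable_induction.

Section density.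
Local Open Scope ereal_scope.
Context d (T : measurableType d) (R : realType).
Variables (mu : {measure set T -> \bar R}) (t : T -> R).
Hypotheses (mt : measurable_fun setT t) (t0 : forall x, (0 <= t x)%R).

Definition density (_ : measurable_fun setT t) (_ : forall x, (0 <= t x)%R)
  (A : set T) : \bar R := \int[mu]_(x in A) (t x)%:E.

Let density0 : density mt t0 set0 = 0. Proof. exact: integral_set0. Qed.

Let density_ge0 A : 0 <= density mt t0 A.
Proof. by apply: integral_ge0 => x _; rewrite lee_fin. Qed.

Let density_sigma_additive : semi_sigma_additive (density mt t0).
Proof.
move=> F mF tF _; rewrite /density ge0_integral_bigcup//.
- by apply: is_cvg_nneseries => n _ _; exact: density_ge0.
- by apply/measurable_funTS/measurable_EFinP.
- by move=> x _; rewrite lee_fin.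
Qed.

HB.instance Definition _ := isMeasure.Build _ _ _ (density mt t0)
  density0 density_ge0 density_sigma_additive.

Lemma densityE A : density mt t0 A = \int[mu]_(x in A) (t x)%:E.
Proof. by []. Qed.

Lemma ge0_integral_density (f : T -> R) : measurable_fun setT f ->
  (forall x, (0 <= f x)%R) ->
  \int[density mt t0]_x (f x)%:E = \int[mu]_x (f x * t x)%:E.
Proof.
move: f; apply: measurable_fun_ind => [E mE|c f c0 mf f0 IH|f g mf mg f0 g0 If Ig|F f mF mf F0 ndF Ff cF IH].
- rewrite integral_indic// setIT; apply: (etrans (densityE E)); rewrite integral_mkcond.
  apply: eq_integral => x _; rewrite patchE indicE.
  by case: ifP => xE; rewrite ?mul1r ?mul0r.
- transitivity (c%:E * \int[density mt t0]_x (f x)%:E).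
    transitivity (\int[density mt t0]_x (c%:E * (f x)%:E)); first exact: eq_integral.
    apply: ge0_integralZl_EFin => //; first by move=> x _; rewrite lee_fin.
    exact/measurable_EFinP.
  rewrite IH; apply: esym; transitivity (\int[mu]_x (c%:E * (f x * t x)%:E)).
    by apply: eq_integral => x _; rewrite -EFinM mulrA.
  apply: ge0_integralZl_EFin => //.
  + by move=> x _; rewrite lee_fin mulr_ge0.
  + by apply/measurable_EFinP; exact: measurable_funM.
- transitivity (\int[density mt t0]_x (f x)%:E + \int[density mt t0]_x (g x)%:E).
    transitivity (\int[density mt t0]_x ((f x)%:E + (g x)%:E)); first exact: eq_integral.
    by apply: ge0_integralD => // [x _||x _|]; rewrite ?lee_fin//; exact/measurable_EFinP.
  rewrite If Ig; apply: esym.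
  transitivity (\int[mu]_x ((f x * t x)%:E + (g x * t x)%:E)).
    by apply: eq_integral => x _; rewrite -EFinD mulrDl.
  apply: ge0_integralD => //.
  + by move=> x _; rewrite lee_fin mulr_ge0.
  + by apply/measurable_EFinP; exact: measurable_funM.
  + by move=> x _; rewrite lee_fin mulr_ge0.
  + by apply/measurable_EFinP; exact: measurable_funM.
- have fE x : (f x)%:E = limn (fun n => (F n x)%:E).
    by apply/esym/cvg_lim => //; apply: cvg_EFin; [exact: nearW|exact: cF].
  have ftE x : (f x * t x)%:E = limn (fun n => (F n x * t x)%:E).
    apply/esym/cvg_lim => //; apply: cvg_EFin; first exact: nearW.
    exact: cvgMl.
  transitivity (\int[density mt t0]_x (limn (fun n => (F n x)%:E))).
    by apply: eq_integral => x _; exact: fE.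
  transitivity (\int[mu]_x (limn (fun n => (F n x * t x)%:E))); last first.
    by apply: eq_integral => x _; apply/esym/ftE.
  transitivity (limn (fun n => \int[density mt t0]_x (F n x)%:E)).
    apply: monotone_convergence => //.
    + by move=> n; apply/measurable_EFinP.
    + by move=> n x _; rewrite lee_fin.
    + by move=> x _ n k nk; rewrite lee_fin ndF.
  rewrite (_ : (fun n => _) = fun n => \int[mu]_x (F n x * t x)%:E); last exact/funext.
  apply: esym; apply: monotone_convergence => //.
  + by move=> n; apply/measurable_EFinP; exact: measurable_funM.
  + by move=> n x _; rewrite lee_fin mulr_ge0.
  + by move=> x _ n k nk; rewrite lee_fin ler_wpM2r// ndF.
Qed.

Lemma integrable_density (f : T -> R) : measurable_fun setT f ->
  mu.-integrable setT (fun x => (f x * t x)%:E) ->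
  (density mt t0).-integrable setT (EFin \o f).
Proof.
move=> mf /integrableP[_ foo]; apply/integrableP; split; first exact/measurable_EFinP.
apply: le_lt_trans foo; rewrite le_eqVlt; apply/orP; left; apply/eqP.
apply: (etrans (@ge0_integral_density (fun x => `|f x|%R) _ _)) => //.
  exact: measurableT_comp.
by apply: eq_integral => x _ /=; rewrite normrM (ger0_norm (t0 x)).
Qed.

Lemma integral_density (f : T -> R) : measurable_fun setT f ->
  mu.-integrable setT (fun x => (f x * t x)%:E) ->
  (\int[density mt t0]_x f x = \int[mu]_x (f x * t x))%R.
Proof.
move=> mf ift; have idf := integrable_density mf ift.
rewrite /Rintegral; congr fine.
rewrite integralE [RHS]integralE; congr (_ - _).
- transitivity (\int[density mt t0]_x (Num.max (f x) 0)%:E).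
    by apply: eq_integral => x _; rewrite funeposE /= EFin_max.
  apply: (etrans (@ge0_integral_density (fun x => Num.max (f x) 0)%R _ _)).
  + exact: measurable_maxr.
  + by move=> x; rewrite le_max lexx orbT.
  apply: eq_integral => x _; rewrite funeposE -EFin_max; congr (_%:E).
  by rewrite maxr_pMl// mul0r.
- transitivity (\int[density mt t0]_x (Num.max (- f x) 0)%:E).
    by apply: eq_integral => x _; rewrite funenegE /= EFin_max.
  apply: (etrans (@ge0_integral_density (fun x => Num.max (- f x) 0)%R _ _)).
  + by apply: measurable_maxr => //; exact: measurableT_comp.
  + by move=> x; rewrite le_max lexx orbT.
  apply: eq_integral => x _; rewrite funenegE -EFinN -EFin_max; congr (_%:E).
  by rewrite maxr_pMl// mul0r mulNr.
Qed.

End density.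

Section bounded_functions.
Context d (T : measurableType d) (R : realType).
Variable nu : {finite_measure set T -> \bar R}.

(** Bounded measurable functions, the integrands of finite measures. *)
Definition bm (f : T -> R) := measurable_fun setT f /\ exists C, forall x, `|f x| <= C.

Let Tm := @measurableT d T.

Lemma bm_int f : bm f -> nu.-integrable setT (EFin \o f).
Proof.
move=> [mf [C Cf]]; apply: measurable_bounded_integrable => //.
  by rewrite ltey_eq fin_num_measure.
exists C; split; first exact: num_real.
by move=> M CM x _; exact: le_trans (ltW CM).
Qed.

Lemma bm_cst c : bm (cst c).
Proof. by split=> //; exists `|c|. Qed.

Lemma bm_indic E : measurable E -> bm (\1_E).
Proof.
move=> mE; split; first exact: measurable_indic.
by exists 1 => x; rewrite indicE ger0_norm// lern1 leq_b1.
Qed.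

Lemma bmD f g : bm f -> bm g -> bm (fun x => f x + g x).
Proof.
move=> [mf [C Cf]] [mg [K Kg]]; split; first exact: measurable_funD.
by exists (C + K) => x; rewrite (le_trans (ler_normD _ _))// lerD.
Qed.

Lemma bmM f g : bm f -> bm g -> bm (fun x => f x * g x).
Proof.
move=> [mf [C Cf]] [mg [K Kg]]; split; first exact: measurable_funM.
by exists (C * K) => x; rewrite normrM ler_pM.
Qed.

Lemma bmZ c f : bm f -> bm (fun x => c * f x).
Proof. by apply: bmM; exact: bm_cst. Qed.

Lemma bmB f g : bm f -> bm g -> bm (fun x => f x - g x).
Proof.
move=> bf bg; rewrite (_ : (fun x => _) = fun x => f x + (-1) * g x).
  by apply: bmD => //; exact: bmZ.
by apply/funext => x; rewrite mulN1r.
Qed.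

Lemma bm_norm f : bm f -> bm (fun x => `|f x|).
Proof.
move=> [mf [C Cf]]; split; first exact: measurableT_comp.
by exists C => x; rewrite normr_id.
Qed.

Lemma bm_sqr f : bm f -> bm (fun x => f x ^+ 2).
Proof. by move=> bf; exact: bmM. Qed.

Lemma bm_sum (I : Type) (s : seq I) (f : I -> T -> R) :
  (forall i, bm (f i)) -> bm (fun x => \sum_(i <- s) f i x).
Proof.
move=> bf; elim: s => [|i s IH].
  by rewrite (_ : (fun x => _) = cst 0); [exact: bm_cst|apply/funext => x; rewrite big_nil].
rewrite (_ : (fun x => _) = fun x => f i x + \sum_(i <- s) f i x); first exact: bmD.
by apply/funext => x; rewrite big_cons.
Qed.

Definition rint (f : T -> R) := \int[nu]_x f x.

Lemma rintD f g : bm f -> bm g -> rint (fun x => f x + g x) = rint f + rint g.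
Proof. by move=> bf bg; apply: RintegralD => //; exact: bm_int. Qed.

Lemma rintB f g : bm f -> bm g -> rint (fun x => f x - g x) = rint f - rint g.
Proof. by move=> bf bg; apply: RintegralB => //; exact: bm_int. Qed.

Lemma rintZ c f : bm f -> rint (fun x => c * f x) = c * rint f.
Proof. by move=> bf; apply: RintegralZl => //; exact: bm_int. Qed.

Lemma rint_ge0 f : (forall x, 0 <= f x) -> 0 <= rint f.
Proof. by move=> f0; apply: Rintegral_ge0. Qed.

Lemma rint_le f g : bm f -> bm g -> (forall x, f x <= g x) -> rint f <= rint g.
Proof. by move=> bf bg fg; apply: le_Rintegral => //; exact: bm_int. Qed.

Lemma rint_norm f : bm f -> `|rint f| <= rint (fun x => `|f x|).
Proof. by move=> bf; apply: le_normr_Rintegral => //; exact: bm_int. Qed.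

Lemma rint_sum (J : Type) (s : seq J) (f : J -> T -> R) : (forall i, bm (f i)) ->
  rint (fun x => \sum_(i <- s) f i x) = \sum_(i <- s) rint (f i).
Proof.
move=> bf; elim: s => [|i s IH].
  rewrite big_nil (_ : (fun x => _) = fun x => 0 * cst 0 x); last first.
    by apply/funext => x; rewrite big_nil mul0r.
  by rewrite rintZ ?mul0r//; exact: bm_cst.
rewrite big_cons -IH -rintD//; last exact: bm_sum.
by congr rint; apply/funext => x; rewrite big_cons.
Qed.

Lemma rint_indic E : measurable E -> rint (\1_E) = fine (nu E).
Proof. by move=> mE; rewrite /rint /Rintegral integral_indic// setIT. Qed.

Lemma rint_cvg (F : nat -> T -> R) (f : T -> R) (C : R) : (forall n, measurable_fun setT (F n)) ->
  measurable_fun setT f -> (forall n x, `|F n x| <= C) ->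
  (forall x, F n x @[n --> \oo] --> f x) -> rint (F n) @[n --> \oo] --> rint f.
Proof.
move=> mF mf FC Ff.
have bC := bm_int (bm_cst C).
have fF x : (fun n => (F n x)%:E) @ \oo --> (f x)%:E.
  by apply: cvg_EFin; [exact: nearW|exact: Ff].
have [] := @dominated_convergence _ _ _ nu _ Tm (fun n x => (F n x)%:E) (EFin \o f)
  (EFin \o cst C).
- by move=> n; exact/measurable_EFinP.
- exact/measurable_EFinP.
- by apply: aeW => x _; exact: fF.
- exact: bC.
- by apply: aeW => x n _ /=; rewrite lee_fin.
move=> fi _ cF; apply: fine_cvg; rewrite /rint /Rintegral fineK//.
exact: integrable_fin_num.
Qed.

Lemma null_of_int_le0 f : bm f -> rint (fun x => \1_[set x | 0 < f x] x * f x) <= 0 ->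
  nu [set x | 0 < f x] = 0%E.
Proof.
move=> bf; set E := [set x | 0 < f x] => IE.
have mE : measurable E.
  have [mf _] := bf; rewrite -[X in measurable X]setTI (_ : E = f @^-1` `]0, +oo[%classic).
    exact: mf.
  by apply/seteqP; split => x /=; rewrite in_itv/= andbT.
have bEf : bm (fun x => \1_E x * f x) by apply: bmM => //; exact: bm_indic.
have Ef0 x : 0 <= \1_E x * f x.
  by rewrite indicE; have [/set_mem/ltW Ex|_] := boolP (x \in E); rewrite ?mul1r ?mul0r.
have i0 : (\int[nu]_x `|(\1_E x * f x)%:E| = 0)%E.
  transitivity (\int[nu]_x (\1_E x * f x)%:E)%E.
    by apply: eq_integral => x _; rewrite gee0_abs ?lee_fin.
  have fi : (\int[nu]_x (\1_E x * f x)%:E \is a fin_num)%E.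
    by apply: integrable_fin_num => //; exact: bm_int bEf.
  rewrite -(fineK fi); congr (_%:E); apply/eqP; rewrite eq_le; apply/andP; split.
    exact: IE.
  exact: rint_ge0.
have [mEf _] := bEf.
have := (ae_eq_integral_abs nu Tm ((measurable_EFinP _ _).2 mEf)).1 i0.
move=> [N [mN N0 sN]]; apply: (subset_measure0 mE mN) => // x Ex; apply: sN => /= /(_ Logic.I).
by rewrite indicE mem_set// mul1r => -[f0]; move: Ex; rewrite /E /= f0 ltxx.
Qed.

End bounded_functions.

(** The Daniell integral of a dominated functional.  A functional on a class [D] of test functions which is dominated by the
integral is represented by a bounded density.  The class is dense in the sense
that it approximates indicator functions; it need not be a lattice, and the
modulus of a function is replaced by a quadratic upper bound [hypot]. *)
Section daniell.
Context d (T : measurableType d) (R : realType).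
Variable nu : {finite_measure set T -> \bar R}.
Variable D : (T -> R) -> Prop.
Hypothesis Dbm : forall f, D f -> bm f.
Hypothesis DD : forall f g, D f -> D g -> D (fun x => f x + g x).
Hypothesis DZ : forall c f, D f -> D (fun x => c * f x).
Hypothesis DM : forall f g, D f -> D g -> D (fun x => f x * g x).
Hypothesis Dcut : exists2 C : R, 0 <= C & forall f, D f -> exists2 h, D h &
  forall x, 0 <= h x <= C /\ (f x != 0 -> 1 <= h x).
Hypothesis Ddense : forall E, measurable E -> forall e, 0 < e -> exists f,
  [/\ D f, forall x, 0 <= f x <= 1 & rint nu (fun x => `|f x - \1_E x|) <= e].
Variable L : (T -> R) -> R.
Hypothesis LD : forall f g, D f -> D g -> L (fun x => f x + g x) = L f + L g.
Hypothesis LZ : forall c f, D f -> L (fun x => c * f x) = c * L f.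
Hypothesis Lle : forall f, D f -> (forall x, 0 <= f x) -> `|L f| <= rint nu f.

Local Notation J := (rint nu).
Let P f := L f + J f.

Let DB f g : D f -> D g -> D (fun x => f x - g x).
Proof.
move=> Df Dg; rewrite (_ : (fun x => _) = fun x => f x + (-1) * g x).
  by apply: DD => //; exact: DZ.
by apply/funext => x; rewrite mulN1r.
Qed.

Let PD f g : D f -> D g -> P (fun x => f x + g x) = P f + P g.
Proof. by move=> Df Dg; rewrite /P LD// (rintD nu (Dbm Df) (Dbm Dg)) addrACA. Qed.

Let PZ c f : D f -> P (fun x => c * f x) = c * P f.
Proof. by move=> Df; rewrite /P LZ// (rintZ nu c (Dbm Df)) mulrDr. Qed.

Let PB f g : D f -> D g -> P (fun x => f x - g x) = P f - P g.
Proof.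
move=> Df Dg; rewrite (_ : (fun x => _) = fun x => f x + (-1) * g x).
  by rewrite PD ?PZ ?mulN1r//; exact: DZ.
by apply/funext => x; rewrite mulN1r.
Qed.

Let P_ge0 f : D f -> (forall x, 0 <= f x) -> 0 <= P f.
Proof. by move=> Df f0; have := Lle Df f0; rewrite ler_norml -lerBlDr sub0r => /andP[]. Qed.

Let P_le f : D f -> (forall x, 0 <= f x) -> P f <= 2 * J f.
Proof.
move=> Df f0; have := Lle Df f0; rewrite ler_norml => /andP[_].
by rewrite /P mulr_natl mulr2n lerD2r.
Qed.

Let P_maj f g : D f -> D g -> (forall x, `|f x| <= g x) -> `|P f| <= 2 * J g.
Proof.
move=> Df Dg fg.
have g0 x : 0 <= g x by exact: le_trans (normr_ge0 _) (fg x).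
have p1 : 0 <= P (fun x => g x + f x).
  apply: P_ge0 => [|x]; first exact: DD.
  by have := fg x; rewrite ler_norml; lra.
have p2 : 0 <= P (fun x => g x - f x).
  apply: P_ge0 => [|x]; first exact: DB.
  by rewrite subr_ge0 (le_trans (ler_norm _)).
apply: le_trans (P_le Dg g0).
by move: p1 p2; rewrite PD// PB// ler_norml; lra.
Qed.

(** Continuity for the quadratic mean, by the arithmetic-geometric inequality. *)
Let P_cont e : 0 < e -> exists2 del, 0 < del & forall f, D f ->
  J (fun x => f x ^+ 2) <= del -> `|P f| <= e.
Proof.
move=> e0; have [C C0 Ccut] := Dcut.
pose K := C * fine (nu setT).
have K0 : 0 <= K by rewrite mulr_ge0// fine_ge0.
pose s := e / (K + 1).
have s0 : 0 < s by rewrite divr_gt0// ltr_wpDl.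
exists (s * s) => [|f Df fs]; first by rewrite mulr_gt0.
have [h Dh hP] := Ccut _ Df.
have Df2 : D (fun x => f x ^+ 2) by exact: DM.
pose g x := 2^-1 * (s^-1 * f x ^+ 2 + s * h x).
have Dg : D g by apply/DZ/DD; exact: DZ.
have fg x : `|f x| <= g x.
  have [h0 h1] := hP x; have [fx0|/h1 {}h1] := eqVneq (f x) 0.
    rewrite /g fx0 normr0 expr0n mulr0 add0r mulr_ge0// mulr_ge0// ?(ltW s0)//.
    by case/andP : h0.
  rewrite /g ler_pdivlMl// -(ler_pM2l s0) mulrDr mulVKf ?gt_eqF//.
  have : s * s <= s * (s * h x) by rewrite ler_pM2l// ler_peMr// ltW.
  have := sqr_ge0 (`|f x| - s); rewrite sqrrB real_normK ?num_real//.
  rewrite -mulr_natr expr2; nra.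
apply: (le_trans (P_maj Df Dg fg)).
have Jh : J h <= K.
  have -> : K = J (cst C) by rewrite /rint Rintegral_cst.
  by apply: rint_le => [||x]; [exact: Dbm|exact: bm_cst|have [/andP[]] := hP x].
rewrite rintZ; last by apply/Dbm/DD; exact: DZ.
rewrite mulrA divff// mul1r rintD; [|by apply/Dbm/DZ|by apply/Dbm/DZ].
rewrite !rintZ; [|exact: Dbm|exact: Dbm].
have j1 : s^-1 * rint nu (fun x => f x ^+ 2) <= s by rewrite ler_pdivrMl.
have j2 : s * rint nu h <= s * K by rewrite ler_pM2l.
apply: (@le_trans _ _ (s * (K + 1))); first by lra.
by rewrite /s divfK// gt_eqF// ltr_wpDl.
Qed.

Let sq (f g : T -> R) x := (f x - g x : R) ^+ 2.

Let bm_sq f g : bm f -> bm g -> bm (sq f g).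
Proof. by move=> bf bg; apply: bm_sqr; exact: bmB. Qed.

(** [ext phi c]: the continuous extension of [P] takes the value [c] at [phi]. *)
Let ext phi c := bm phi /\ forall e, 0 < e -> exists g,
  [/\ D g, J (sq g phi) <= e & `|P g - c| <= e].

Let ext_uniq phi c c' : ext phi c -> ext phi c' -> c = c'.
Proof.
move=> [bphi H] [_ H']; apply/eqP; rewrite -subr_eq0 -normr_le0; apply/ler_addgt0Pr => e e0.
have [del del0 Pdel] := P_cont (divr_gt0 e0 (ltr0n R 3)).
pose r := Num.min (e / 3) (del / 4).
have r0 : 0 < r by rewrite lt_min !divr_gt0.
have [g [Dg gphi gc]] := H _ r0; have [g' [Dg' gphi' gc']] := H' _ r0.
have r1 : r <= e / 3 by rewrite ge_min lexx.
have r2 : r <= del / 4 by rewrite ge_min lexx orbT.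
have bg := Dbm Dg; have bg' := Dbm Dg'.
have Pgg : `|P g - P g'| <= e / 3.
  rewrite -PB//; apply: Pdel; first exact: DB.
  apply: (@le_trans _ _ (J (fun x => 2 * (sq g phi x + sq g' phi x)))).
    apply: rint_le => [||x]; first by apply/bm_sqr/bmB.
      by apply/bmZ/bmD; exact: bm_sq.
    rewrite /sq; have := sqr_ge0 ((g x - phi x) + (g' x - phi x)); nra.
  rewrite rintZ; last by apply: bmD; exact: bm_sq.
  rewrite rintD; [|exact: bm_sq|exact: bm_sq]; rewrite -/J; lra.
rewrite add0r; have -> : c - c' = - (P g - c) + (P g - P g') + (P g' - c') by ring.
apply: (le_trans (ler_normD _ _)); apply: (le_trans (lerD (ler_normD _ _) (lexx _))).
rewrite normrN; lra.
Qed.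

Let ext_D f : D f -> ext f (P f).
Proof.
move=> Df; split; first exact: Dbm.
move=> e e0; exists f; rewrite subrr normr0; split => //; last exact: ltW.
rewrite (_ : sq f f = fun x => 0 * cst 0 x); last first.
  by apply/funext => x; rewrite /sq subrr expr0n mul0r.
by rewrite rintZ ?mul0r ?ltW//; exact: bm_cst.
Qed.

Let extD f g c c' : ext f c -> ext g c' -> ext (fun x => f x + g x) (c + c').
Proof.
move=> [bf Hf] [bg Hg]; split; first exact: bmD.
move=> e e0; have e40 : 0 < e / 4 by rewrite divr_gt0.
have [f' [Df' ff' fc]] := Hf _ e40; have [g' [Dg' gg' gc]] := Hg _ e40.
have bf' := Dbm Df'; have bg' := Dbm Dg'.
exists (fun x => f' x + g' x); split; first exact: DD.
  apply: (@le_trans _ _ (J (fun x => 2 * (sq f' f x + sq g' g x)))).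
    apply: rint_le => [||x]; first by apply/bm_sq; exact: bmD.
      by apply/bmZ/bmD; exact: bm_sq.
    rewrite /sq; have := sqr_ge0 ((f' x - f x) - (g' x - g x)); nra.
  rewrite rintZ; last by apply: bmD; exact: bm_sq.
  rewrite rintD; [|exact: bm_sq|exact: bm_sq]; rewrite -/J; lra.
rewrite PD// (_ : _ - _ = (P f' - c) + (P g' - c')); last by ring.
by apply: (le_trans (ler_normD _ _)); lra.
Qed.

Let extZ a f c : ext f c -> ext (fun x => a * f x) (a * c).
Proof.
move=> [bf Hf]; split; first exact: bmZ.
move=> e e0; pose K := Num.max (a ^+ 2) `|a| + 1.
have K1 : a ^+ 2 <= K by rewrite ler_wpDr// le_max lexx.
have K2 : `|a| <= K by rewrite ler_wpDr// le_max lexx orbT.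
have K0 : 0 < K by rewrite ltr_wpDl// le_max normr_ge0 orbT.
have eK : 0 < e / K by rewrite divr_gt0.
have [f' [Df' ff' fc]] := Hf _ eK; have bf' := Dbm Df'.
exists (fun x => a * f' x); split; first exact: DZ.
  rewrite (_ : sq _ _ = fun x => a ^+ 2 * sq f' f x); last first.
    by apply/funext => x; rewrite /sq -mulrBr exprMn.
  rewrite rintZ; last exact: bm_sq.
  apply: (@le_trans _ _ (K * (e / K))); last by rewrite mulrC divfK// gt_eqF.
  by rewrite ler_pM// ?sqr_ge0//; apply: rint_ge0 => x; exact: sqr_ge0.
rewrite PZ// -mulrBr normrM.
apply: (@le_trans _ _ (K * (e / K))); last by rewrite mulrC divfK// gt_eqF.
by rewrite ler_pM.
Qed.

(** The values of [P] along an approximation of the indicator function are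
bounded, so that they accumulate somewhere. *)
Let ext_indic E : measurable E -> exists2 c, ext (\1_E) c & 0 <= c <= 2 * fine (nu E).
Proof.
move=> mE; have bE := bm_indic R mE.
have /choice[F FP] (n : nat) : exists f : T -> R, [/\ D f, forall x, 0 <= f x <= 1 &
    J (fun x => `|f x - \1_E x|) <= n.+1%:R^-1].
  by apply: Ddense => //; rewrite invr_gt0.
have DF n : D (F n) by have [] := FP n.
have F01 n x : 0 <= F n x <= 1 by have [_ /(_ x)] := FP n.
have Fsq n : J (sq (F n) \1_E) <= n.+1%:R^-1.
  have [_ _] := FP n; apply: le_trans; apply: rint_le => [||x].
  - by apply: bm_sq => //; exact: Dbm.
  - by apply/bm_norm/bmB => //; exact: Dbm.
  rewrite /sq -real_normK ?num_real// expr2 ler_piMr//.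
  have := F01 n x; rewrite ler_norml indicE.
  by case: (x \in E) => /= /andP[? ?]; apply/andP; split; lra.
have JF n : J (F n) <= fine (nu E) + n.+1%:R^-1.
  have [_ _] := FP n; rewrite -lerBlDl; apply: le_trans.
  rewrite -rint_indic// -rintB//; last exact: Dbm.
  apply: le_trans (ler_norm _) (rint_norm _ _).
  by apply: bmB => //; exact: Dbm.
have PF n : 0 <= P (F n) <= 2 * fine (nu E) + 2 * n.+1%:R^-1.
  rewrite P_ge0//=; last by move=> x; have /andP[] := F01 n x.
  apply: (le_trans (P_le (DF n) _)); first by move=> x; have /andP[] := F01 n x.
  by rewrite -mulrDr ler_pM2l.
have n1 (n : nat) : n.+1%:R^-1 <= 1 :> R by rewrite invf_le1 ?ler1n.
have cpt : compact `[0 : R, 2 * fine (nu E) + 2]%classic by exact: segment_compact.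
have FA : ((fun n => P (F n)) @ \oo) `[0 : R, 2 * fine (nu E) + 2]%classic.
  exists 0%N => // n _; rewrite /= in_itv/=; have /andP[-> Pn] := PF n.
  by apply: (le_trans Pn); rewrite lerD2l ler_piMr.
have [c [_ clc]] := cpt ((fun n => P (F n)) @ \oo) _ FA.
have near_c e : 0 < e -> exists n, n.+1%:R^-1 <= e /\ `|P (F n) - c| <= e.
  move=> e0; have [N _ NP] : \forall n \near \oo, n.+1%:R^-1 <= e.
    by have := near_infty_natSinv_lt (PosNum e0); apply: filterS => n /ltW.
  have [] := clc [set P (F n) | n in [set n | (N <= n)%N]] (ball c e).
  - by exists N => // n Nn; exists n.
  - exact: nbhsx_ballx.
  move=> _ [[n /= /NP nE <-]] cn; exists n; split=> //.
  by rewrite distrC ltW.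
exists c.
  split => // e e0; have [n [ne nc]] := near_c _ e0.
  by exists (F n); split=> //; exact: le_trans (Fsq n) ne.
apply/andP; split; apply/ler_addgt0Pr => e e0.
  have [n [_ nc]] := near_c _ e0; have /andP[P0 _] := PF n.
  by move: nc; rewrite ler_norml; lra.
have e40 : 0 < e / 4 by rewrite divr_gt0.
have [n [ne nc]] := near_c _ e40; have /andP[_ P1] := PF n.
by move: ne P1 nc; move: (n.+1%:R^-1) => z; rewrite ler_norml; lra.
Qed.

Definition functional_measure (E : set T) : R :=
  xget 0 [set c | ext \1_E c /\ 0 <= c].
Local Notation lam := functional_measure.

Let lam_ext E : measurable E -> ext \1_E (lam E).
Proof.
move=> mE; rewrite /lam; case: xgetP => [_ _ []//|/=].
by have [c ec /andP[c0 _]] := ext_indic mE => /(_ c) []; split.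
Qed.

Let lam_ge0 E : 0 <= lam E.
Proof. by rewrite /lam; case: xgetP => // c _ []. Qed.

Let lam_le E : measurable E -> lam E <= 2 * fine (nu E).
Proof.
move=> mE; have [c ec /andP[_]] := ext_indic mE.
by rewrite (ext_uniq ec (lam_ext mE)).
Qed.

Let lamU E F : measurable E -> measurable F -> E `&` F = set0 ->
  lam (E `|` F) = lam E + lam F.
Proof.
move=> mE mF EF0; apply: (ext_uniq (lam_ext (measurableU _ _ mE mF))).
rewrite (_ : \1_(E `|` F) = fun x => \1_E x + \1_F x); first exact: extD (lam_ext mE) (lam_ext mF).
apply/funext => x; rewrite !indicE in_setU.
have [xE|xE] := boolP (x \in E); have [xF|xF] := boolP (x \in F); rewrite ?addr0 ?add0r//.
have : (E `&` F) x by split; exact: set_mem.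
by rewrite EF0.
Qed.

Let lam0 : lam set0 = 0.
Proof.
by apply/eqP; rewrite eq_le lam_ge0 andbT (le_trans (lam_le measurable0))// measure0 mulr0.
Qed.

Let lam_sigma_additive : semi_sigma_additive (fun E => (lam E)%:E).
Proof.
move=> F mF tF mU; under eq_fun do rewrite sumEFin.
apply: cvg_EFin; first exact: nearW.
pose U n := \big[setU/set0]_(i < n) F i.
have mUn n : measurable (U n) by exact: bigsetU_measurable.
have lamUn n : \sum_(0 <= i < n) lam (F i) = lam (U n).
  rewrite big_mkord; elim: n => [|n IH]; first by rewrite /U !big_ord0 lam0.
  rewrite /U !big_ord_recr /= IH lamU//; first exact: mUn.
  apply/seteqP; split => // x; rewrite -bigcup_mkord => -[[i /= ni Fi] Fn].
  have /trivIsetP /(_ i n Logic.I Logic.I) := tF; rewrite (ltn_eqF ni) => /(_ isT) E0.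
  have : (F i `&` F n) x by split.
  by rewrite E0.
have Usub n : U n `<=` \bigcup_k F k.
  by rewrite /U -bigcup_mkord => x [i _ Fi]; exists i.
pose Z n := \bigcup_k F k `\` U n.
have mZ n : measurable (Z n) by exact: measurableD.
have lamZ n : lam (U n) = lam (\bigcup_k F k) - lam (Z n).
  have UZ : U n `&` Z n = set0 by apply/seteqP; split => // x [Ux [_ /(_ Ux)]].
  have := lamU (mUn n) (mZ n) UZ; rewrite /Z (setDUK (@Usub n)).
  by move=> ->; rewrite addrK.
have Z0 : 2 * J (\1_(Z n)) @[n --> \oo] --> (0 : R).
  have J0 : J (cst 0) = 0 by rewrite /rint Rintegral_cst// mul0r.
  rewrite -[X in _ --> X](mulr0 2) -J0; apply: cvgMr; apply: (@rint_cvg _ _ _ nu _ _ 1) => //.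
  - by move=> n x; rewrite indicE ger0_norm// lern1 leq_b1.
  - move=> x; apply: cvg_near_cst.
    have [[k _ Fk]|nU] := pselect ((\bigcup_k F k) x); last first.
      by apply: nearW => n; rewrite indicE memNset// => -[].
    exists k.+1 => // n /= kn; rewrite indicE memNset// => -[_]; apply.
    by rewrite /U -bigcup_mkord; exists k.
have Zl0 : lam (Z n) @[n --> \oo] --> (0 : R).
  apply: (squeeze_cvgr _ (cvg_cst 0) Z0); exists 0%N => // n _.
  by rewrite lam_ge0 rint_indic// lam_le.
have := cvgB (@cvg_cst R (lam (\bigcup_k F k)) nat \oo _) Zl0; rewrite subr0 => h.
rewrite (_ : fine \o _ = (fun n => lam (\bigcup_k F k) - lam (Z n))); first exact: h.
by apply/funext => n; rewrite /= lamUn lamZ.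
Qed.

Let lam_measure0 : (lam set0)%:E = 0%E. Proof. by rewrite lam0. Qed.
Let lam_measure_ge0 E : (0 <= (lam E)%:E)%E. Proof. by rewrite lee_fin. Qed.

Definition functional_emeasure (E : set T) : \bar R := (lam E)%:E.

HB.instance Definition _ := isMeasure.Build _ _ _ functional_emeasure
  lam_measure0 lam_measure_ge0 lam_sigma_additive.

Let lam_fin : fin_num_fun functional_emeasure.
Proof. by []. Qed.

HB.instance Definition _ :=
  Measure_isFinite.Build _ _ _ functional_emeasure lam_fin.

Let lam_density : exists k, [/\ bm k, forall x, 0 <= k x <= 2 &
  forall E, measurable E -> lam E = J (fun x => \1_E x * k x)].
Proof.
have dom : functional_emeasure `<< nu.
  apply/null_content_dominatesP => E mE nE; apply/eqP.
  rewrite /functional_emeasure eqe eq_le lam_ge0 andbT.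
  by rewrite (le_trans (lam_le mE))// nE mulr0.
pose h := Radon_Nikodym_SigmaFinite.f functional_emeasure nu.
have h0 x : (0 <= h x)%E by exact: Radon_Nikodym_SigmaFinite.f_ge0.
have hfin x : h x \is a fin_num by exact: Radon_Nikodym_SigmaFinite.f_fin_num.
have ih : nu.-integrable setT h by exact: Radon_Nikodym_SigmaFinite.f_integrable.
have hE E : measurable E -> (lam E)%:E = (\int[nu]_(x in E) h x)%E.
  by move=> mE; exact: (Radon_Nikodym_SigmaFinite.f_integral dom mE).
have mh : measurable_fun setT (fine \o h).
  by apply: measurableT_comp => //; exact: measurable_int ih.
pose f x := Num.min (fine (h x)) 3 - 2.
have bf : bm f.
  split; first by apply: measurable_funB => //; exact: measurable_minr.
  exists 3 => x; rewrite /f ler_norml.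
  by have := fine_ge0 (h0 x); case: (leP (fine (h x)) 3) => ? ?; apply/andP; split; lra.
pose E := [set x | 0 < f x].
have mE : measurable E.
  have [mf _] := bf; rewrite -[X in measurable X]setTI (_ : E = f @^-1` `]0, +oo[%classic).
    exact: mf.
  by apply/seteqP; split => x /=; rewrite in_itv/= andbT.
have E0 : nu E = 0%E.
  apply: (null_of_int_le0 bf); rewrite -/E.
  have -> : rint nu (fun x => \1_E x * f x) =
      rint nu (fun x => \1_E x * Num.min (fine (h x)) 3) - 2 * rint nu (\1_E).
    have bmin : bm (fun x => Num.min (fine (h x)) 3).
      split; first exact: measurable_minr.
      by exists 3 => x; rewrite ger0_norm ?ge_min ?lexx ?orbT// le_min fine_ge0/=.
    rewrite -(rintZ nu 2 (bm_indic R mE)) -rintB; first by congr rint; apply/funext => x; rewrite /f; ring.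
      by apply: bmM => //; exact: bm_indic.
    exact/bmZ/bm_indic.
  rewrite subr_le0 (rint_indic nu mE); apply: le_trans (lam_le mE); rewrite -lee_fin hE//.
  have bmin : bm (fun x => \1_E x * Num.min (fine (h x)) 3).
    apply: bmM; first exact: bm_indic.
    split; first exact: measurable_minr.
    by exists 3 => x; rewrite ger0_norm ?ge_min ?lexx ?orbT// le_min fine_ge0/=.
  rewrite /rint /Rintegral fineK; last first.
    by apply: integrable_fin_num => //; exact: bm_int bmin.
  rewrite [leRHS]integral_mkcond; apply: ge0_le_integral => //.
  - by move=> x _; rewrite lee_fin indicE mulr_ge0// le_min fine_ge0//=.
  - by apply/measurable_EFinP; have [] := bmin.
  - by apply/(measurable_restrictT _ mE)/measurable_funTS; exact: measurable_int ih.
  move=> x _; rewrite patchE indicE; case: ifP => xE; rewrite ?mul0r// mul1r.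
  by rewrite -[leRHS]fineK// lee_fin ge_min lexx.
pose k x := Num.min (fine (h x)) 2.
have k02 x : 0 <= k x <= 2.
  by rewrite /k le_min fine_ge0//= ge_min (lexx 2) orbT andbT.
have bk : bm k.
  split; first exact: measurable_minr.
  by exists 2 => x; have /andP[k0 k2] := k02 x; rewrite ger0_norm.
exists k; split => // A mA; apply: EFin_inj; rewrite hE//.
have bAk : bm (fun x => \1_A x * k x) by apply: bmM => //; exact: bm_indic.
rewrite /rint /Rintegral fineK; last first.
  by apply: integrable_fin_num => //; exact: bm_int bAk.
rewrite [LHS]integral_mkcond.
have m1 : measurable_fun setT (h \_ A).
  by apply/(measurable_restrictT _ mA)/measurable_funTS; exact: measurable_int ih.
have m2 : measurable_fun setT (fun x => (\1_A x * k x)%:E).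
  by apply/measurable_EFinP; have [] := bAk.
suff ae : ae_eq nu setT (h \_ A) (fun x => (\1_A x * k x)%:E).
  exact: (@ae_eq_integral _ _ _ nu setT _ _ measurableT m1 m2 ae).
exists E; split => // x /= nx; rewrite /E /=; apply: contrapT => nE; apply: nx => _.
rewrite patchE indicE; case: ifP => xA; rewrite ?mul0r// mul1r.
rewrite -[LHS]fineK//; congr (_%:E); rewrite /k.
by move: nE; rewrite /f; case: (leP (fine (h x)) 3); case: (leP (fine (h x)) 2) => // h2 h3 []; lra.
Qed.

Lemma dominated_functional_density : exists v : T -> R, [/\ measurable_fun setT v,
  forall x, `|v x| <= 1 & forall f, D f -> L f = rint nu (fun x => f x * v x)].
Proof.
have [k [bk k02 kE]] := lam_density.
have Q (f : T -> R) : measurable_fun setT f -> (forall x, 0 <= f x) ->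
    (exists C, forall x, f x <= C) -> ext f (J (fun x => f x * k x)).
  move: f; apply: measurable_fun_ind => [E mE _|c f c0 mf f0 IH|f g mf mg f0 g0 IHf IHg|F f mF mf F0 ndF Ff cF IH].
  - by rewrite -kE//; exact: lam_ext.
  - move=> [C fC]; have bf : bm f \/ c = 0.
      have [->|cn0] := eqVneq c 0; [by right|left; split => //].
      have cp : 0 < c by rewrite lt_neqAle eq_sym cn0.
      by exists (c^-1 * C) => x; rewrite ger0_norm// ler_pdivlMl.
    case: bf => [bf|cE0].
      rewrite (_ : (fun x => c * f x * k x) = fun x => c * (f x * k x)); last first.
        by apply/funext => x; rewrite mulrA.
      rewrite rintZ; last exact: bmM.
      apply: extZ; apply: IH; have [_ [C' C'P]] := bf; exists C' => x.
      exact: le_trans (ler_norm _) (C'P x).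
    rewrite cE0 (_ : (fun x => 0 * f x) = fun x => 0 * (\1_setT x : R)); last first.
      by apply/funext => x; rewrite !mul0r.
    rewrite (_ : (fun x => 0 * f x * k x) = fun x => 0 * (\1_setT x * k x)); last first.
      by apply/funext => x; rewrite !mul0r.
    rewrite rintZ; last by apply: bmM => //; exact: bm_indic.
    by apply: extZ; rewrite -kE//; exact: lam_ext.
  - move=> [C fC].
    have fC' x : f x <= C by apply: le_trans (fC x); rewrite lerDl.
    have gC' x : g x <= C by apply: le_trans (fC x); rewrite lerDr.
    have bf : bm f by split => //; exists C => x; rewrite ger0_norm.
    have bg : bm g by split => //; exists C => x; rewrite ger0_norm.
    rewrite (_ : (fun x => (f x + g x) * k x) = fun x => f x * k x + g x * k x); last first.
      by apply/funext => x; rewrite mulrDl.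
    rewrite rintD; [|exact: bmM|exact: bmM].
    by apply: extD; [apply: IHf|apply: IHg]; exists C.
  - move=> [C fC].
    have f0 x : 0 <= f x := le_trans (F0 0%N x) (Ff 0%N x).
    have bf : bm f by split => //; exists C => x; rewrite ger0_norm.
    have FC n x : F n x <= C by exact: le_trans (Ff n x) (fC x).
    have bF n : bm (F n) by split => //; exists C => x; rewrite ger0_norm.
    split => // e e0.
    have cJ : J (fun x => F n x * k x) @[n --> \oo] --> J (fun x => f x * k x).
      apply: (@rint_cvg _ _ _ nu _ _ (C * 2)).
      + by move=> n; have [] := bmM (bF n) bk.
      + by have [] := bmM bf bk.
      + move=> n x; have /andP[k0 k2] := k02 x.
        by rewrite ger0_norm ?mulr_ge0// ler_pM.
      + by move=> x; apply: cvgMl; exact: cF.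
    have cS : J (sq (F n) f) @[n --> \oo] --> J (cst 0).
      apply: (@rint_cvg _ _ _ nu _ _ (C ^+ 2)) => //.
      + by move=> n; have [] := bm_sq (bF n) bf.
      + move=> n x; rewrite ger0_norm ?sqr_ge0// /sq -(sqrrN (_ - _)) opprB.
        rewrite ler_pXn2r// ?nnegrE ?subr_ge0//; last exact: le_trans (f0 x) (fC x).
        by rewrite lerBlDr (le_trans (fC x))// lerDl.
      + move=> x; have h : F n x - f x @[n --> \oo] --> (0 : R).
          by rewrite -(subrr (f x)); apply: cvgB; [exact: cF|exact: cvg_cst].
        by have hh := cvgM h h; rewrite mulr0 in hh; exact: hh.
    have J0 : J (cst 0) = 0 by rewrite /rint Rintegral_cst// mul0r.
    rewrite J0 in cS.
    have e40 : 0 < e / 4 by rewrite divr_gt0.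
    have e20 : 0 < e / 2 by rewrite divr_gt0.
    have [n [n1 n2]] : exists n, J (sq (F n) f) <= e / 4 /\
        `|J (fun x => f x * k x) - J (fun x => F n x * k x)| <= e / 2.
      have h1 : \forall n \near \oo, `|0 - J (sq (F n) f)| <= e / 4.
        by move/cvgrPdist_le : cS; exact.
      have h2 : \forall n \near \oo, `|J (fun x => f x * k x) - J (fun x => F n x * k x)| <= e / 2.
        by move/cvgrPdist_le : cJ; exact.
      near \oo => n; exists n; split; last by near: n.
      apply: le_trans (ler_norm _) _; rewrite -normrN -[- _]add0r; by near: n.
    have [_ /(_ _ e40)[g [Dg gF gJ]]] := IH n (ex_intro _ C (FC n)).
    have bg := Dbm Dg.
    exists g; split => //.
      apply: (@le_trans _ _ (J (fun x => 2 * (sq g (F n) x + sq (F n) f x)))).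
        apply: rint_le => [||x]; first exact: bm_sq.
          by apply/bmZ/bmD; exact: bm_sq.
        rewrite /sq; have := sqr_ge0 ((g x - F n x) - (F n x - f x)); nra.
      rewrite rintZ; last by apply: bmD; exact: bm_sq.
      rewrite rintD; [|exact: bm_sq|exact: bm_sq]; lra.
    have -> : P g - J (fun x => f x * k x) = (P g - J (fun x => F n x * k x)) -
      (J (fun x => f x * k x) - J (fun x => F n x * k x)) by ring.
    apply: (le_trans (ler_normB _ _)); lra.
exists (fun x => k x - 1); split.
- by apply: measurable_funB => //; have [] := bk.
- by move=> x; rewrite ler_norml; have /andP[? ?] := k02 x; apply/andP; split; lra.
move=> f Df; have bf := Dbm Df; have [mf [C fC]] := bf.
suff Pf : P f = J (fun x => f x * k x).
  rewrite (_ : (fun x => f x * (k x - 1)) = fun x => f x * k x - f x); last first.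
    by apply/funext => x; ring.
  by rewrite (rintB nu (bmM bf bk) bf) -Pf /P addrK.
have [C0|C0] := leP 0 C; last first.
  have nT (x : T) : False by have := le_lt_trans (le_trans (normr_ge0 _) (fC x)) C0; rewrite ltxx.
  have := ext_D Df; rewrite (_ : (fun x => f x * k x) = fun x => 0 * f x); last first.
    by apply/funext => x; case: (nT x).
  rewrite rintZ// mul0r => _; rewrite (_ : f = fun x => 0 * f x); last first.
    by apply/funext => x; case: (nT x).
  by rewrite PZ// mul0r.
apply: (ext_uniq (ext_D Df)).
have e1 : ext (fun x => f x + C) (J (fun x => (f x + C) * k x)).
  apply: Q.
  - exact: measurable_funD.
  - by move=> x; have := fC x; rewrite ler_norml; lra.
  - by exists (C + C) => x; have := fC x; rewrite ler_norml; lra.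
have e2 : ext (cst C) (J (fun x => C * k x)) by apply: Q => //; exists C.
have := extD e1 (extZ (-1) e2).
rewrite (_ : (fun x => f x + C + -1 * cst C x) = f); last by apply/funext => x /=; ring.
rewrite -rintZ; last exact: bmZ.
rewrite -rintD; [|by apply: bmM => //; apply: bmD => //; exact: bm_cst|by do 2 apply: bmZ].
congr (ext f (J _)); apply/funext => x; ring.
Unshelve. all: by end_near. Qed.

End daniell.

Section dense_positivity.
Context d (T : measurableType d) (R : realType).
Variable nu : {finite_measure set T -> \bar R}.
Variable D : (T -> R) -> Prop.
Hypothesis Dbm : forall f, D f -> bm f.
Hypothesis Ddense : forall E, measurable E -> forall e, 0 < e -> exists f,
  [/\ D f, forall x, 0 <= f x <= 1 & rint nu (fun x => `|f x - \1_E x|) <= e].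

Lemma dense_indic_ge0 (phi : T -> R) : bm phi ->
  (forall f, D f -> (forall x, 0 <= f x) -> 0 <= rint nu (fun x => f x * phi x)) ->
  forall E, measurable E -> 0 <= rint nu (fun x => \1_E x * phi x).
Proof.
move=> bphi H E mE; apply/ler_addgt0Pr => e e0.
have [mphi [C phiC]] := bphi.
have C0 : 0 < `|C| + 1 by rewrite ltr_wpDl.
have [f [Df f01 fE]] := Ddense mE (divr_gt0 e0 C0).
have bf := Dbm Df; have bE := bm_indic R mE.
have h1 := H f Df (fun x => (andP (f01 x)).1).
have bd := bmB bf bE.
have h2 : rint nu (fun x => (f x - \1_E x) * phi x) <= e.
  apply: (le_trans (ler_norm _)); apply: (le_trans (rint_norm nu (bmM bd bphi))).
  apply: (@le_trans _ _ (rint nu (fun x => (`|C| + 1) * `|f x - \1_E x|))).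
    apply: rint_le => [||x]; [exact/bm_norm/bmM|exact/bmZ/bm_norm|].
    rewrite normrM mulrC ler_wpM2r// (le_trans (phiC x))// (le_trans (ler_norm _))//.
    by rewrite lerDl.
  rewrite rintZ; last exact: bm_norm.
  by rewrite -ler_pdivlMl// mulrC.
have -> : rint nu (fun x => \1_E x * phi x) =
    rint nu (fun x => f x * phi x) - rint nu (fun x => (f x - \1_E x) * phi x).
  rewrite -rintB; [|exact: bmM|exact: bmM].
  by congr rint; apply/funext => x; ring.
by move: h1 h2; lra.
Qed.

(** The positivity against test functions passes to indicator functions, in
particular to that of the negativity set of [phi]. *)
Lemma dense_ge0 (phi : T -> R) : bm phi ->
  (forall f, D f -> (forall x, 0 <= f x) -> 0 <= rint nu (fun x => f x * phi x)) ->
  nu [set x | phi x < 0] = 0%E.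
Proof.
move=> bphi H; have bN : bm (fun x => -1 * phi x) by exact: bmZ.
have -> : [set x | phi x < 0] = [set x | 0 < -1 * phi x].
  by apply/seteqP; split => x /=; rewrite mulN1r oppr_gt0.
apply: (null_of_int_le0 bN); set E := [set x | _].
have mE : measurable E.
  have [mf _] := bN; rewrite -[X in measurable X]setTI
    (_ : E = (fun x => -1 * phi x) @^-1` `]0, +oo[%classic); first exact: mf.
  by apply/seteqP; split => x /=; rewrite in_itv/= andbT.
rewrite (_ : (fun x => _) = fun x => -1 * (\1_E x * phi x)); last first.
  by apply/funext => x; ring.
rewrite rintZ ?mulN1r ?oppr_le0; first exact: dense_indic_ge0.
by apply: bmM => //; exact: bm_indic.
Qed.

End dense_positivity.

Section test_density.
Context {R : realType} {m : nat}.
Local Notation V := 'rV[R]_m.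
Local Notation H := (@hausdorff1 R m).
Local Notation HT := (H1type R m).

Lemma continuous_H1 (f : V -> R) : continuous f -> measurable_fun setT (f : HT -> R).
Proof. by move=> cf; apply: measurable_H1; exact: continuous_Rn. Qed.

Lemma bm_test (f : V -> R) : test f -> bm (f : HT -> R).
Proof.
move=> [sf cf]; have cnf := smooth_continuous sf; split; first exact: continuous_H1.
have cI : compact (f @` closure [set x | f x != 0]).
  by apply: continuous_compact => //; exact: continuous_subspaceT.
have [M [_ /(_ (M + 1))]] := compact_bounded cI; rewrite ltrDl => /(_ ltr01) MB.
exists (Num.max 0 (M + 1)) => x; rewrite le_max.
have [->|fx] := eqVneq (f x) 0; first by rewrite normr0 lexx.
by apply/orP; right; apply: MB; exists x => //; exact: subset_closure.
Qed.

Lemma measurable_box (a b : V) : measurable (box a b : set HT).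
Proof.
have mb := continuous_H1 (smooth_continuous (bump_smooth a b)).
rewrite -[X in measurable X]setTI (_ : box a b = bump a b @^-1` `]0, +oo[%classic); first exact: mb.
apply/seteqP; split => x /=; rewrite in_itv/= andbT; first exact: bump_gt0.
by move=> b0; apply: contrapT => /bump_out bx; rewrite bx ltxx in b0.
Qed.

Variable nu : {finite_measure set HT -> \bar R}.

Definition approximable (E : set HT) := forall e, 0 < e -> exists f : V -> R,
  [/\ test f, forall x, 0 <= f x <= 1 & rint nu (fun x => `|f x - \1_E x|) <= e].

Let bd f E : test f -> measurable E -> bm (fun x : HT => `|f x - \1_E x|).
Proof. by move=> tf mE; apply/bm_norm/bmB; [exact: bm_test|exact: bm_indic]. Qed.

Lemma approximable_set0 : approximable set0.
Proof.
move=> e e0; exists (fun x => 0 * bump 0 0 x); split.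
- exact/testZ/bump_test.
- by move=> x; rewrite mul0r lexx ler01.
rewrite (_ : (fun x => _) = fun x : HT => 0 * cst 0 x); last first.
  by apply/funext => x; rewrite indic0 mul0r subr0 normr0 mul0r.
by rewrite rintZ ?mul0r ?ltW//; exact: bm_cst.
Qed.

Lemma approximable_plateau a b e : 0 < e -> exists f : V -> R,
  [/\ test f, forall x, 0 <= f x <= 1, rint nu (fun x => `|f x - \1_(box a b) x|) <= e &
    forall x, ~ box a b x -> f x = 0].
Proof.
move=> e0; have mB := measurable_box a b.
have c : rint nu (fun x => `|plateau a b n x - \1_(box a b) x|) @[n --> \oo] --> rint nu (cst 0).
  apply: (@rint_cvg _ _ _ nu _ _ 1).
  - by move=> n; have [] := bd (plateau_test a b n) mB.
  - exact: measurable_cst.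
  - move=> n x; rewrite normr_id indicE ler_norml.
    have := plateau_ge0 a b n x; have := plateau_le1 a b n x.
    by case: (x \in _) => /= ? ?; apply/andP; split; lra.
  - move=> x; rewrite /= -(normr0 R) -(subrr (\1_(box a b) x)).
    apply: cvg_norm; apply: cvgB; [exact: plateau_cvg|exact: cvg_cst].
have I0 : rint nu (cst 0) = 0 by rewrite /rint Rintegral_cst ?mul0r//; exact: measurableT.
rewrite I0 in c; move/cvgrPdist_le : c => /(_ _ e0)[N _ /(_ N (leqnn N))].
rewrite sub0r normrN => IN; exists (plateau a b N); split.
- exact: plateau_test.
- by move=> x; rewrite plateau_ge0 plateau_le1.
- exact: le_trans (ler_norm _) IN.
- by move=> x nx; rewrite /plateau bump_out// subr0 expr1n subrr.
Qed.

Lemma approximable_box a b : approximable (box a b).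
Proof.
by move=> e /(approximable_plateau a b)[f [tf f01 fe _]]; exists f.
Qed.

Lemma approximable_setU E F : measurable E -> measurable F ->
  approximable E -> approximable F -> approximable (E `|` F).
Proof.
move=> mE mF aE aF e e0; have e2 : 0 < e / 2 by rewrite divr_gt0.
have [f [tf f01 fE]] := aE _ e2; have [g [tg g01 gF]] := aF _ e2.
have th : test (fun x => f x + g x + (-1) * (f x * g x)).
  by apply: testD; [exact: testD|apply: testZ; apply: testM => //; case: tf].
exists (fun x => f x + g x + (-1) * (f x * g x)); split => //.
  by move=> x; have /andP[? ?] := f01 x; have /andP[? ?] := g01 x; apply/andP; split; nra.
apply: (@le_trans _ _ (rint nu (fun x => `|f x - \1_E x| + `|g x - \1_F x|))); last first.
  rewrite rintD; [|exact: bd|exact: bd]; lra.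
apply: rint_le => [||x]; [by apply: bd => //; exact: measurableU|by apply: bmD; exact: bd|].
have /andP[? ?] := f01 x; have /andP[? ?] := g01 x.
have -> : (\1_(E `|` F) x : R) = \1_E x + \1_F x - \1_E x * \1_F x.
  by rewrite !indicE in_setU; case: (x \in E); case: (x \in F) => /=; ring.
set p := \1_E x; set q := \1_F x.
have pq : (p = 0 \/ p = 1) /\ (q = 0 \/ q = 1).
  by rewrite /p /q !indicE; case: (x \in E); case: (x \in F); split; by [left|right].
have -> : f x + g x + -1 * (f x * g x) - (p + q - p * q) =
  (f x - p) * (1 - g x) + (g x - q) * (1 - p) by ring.
apply: (le_trans (ler_normD _ _)); rewrite !normrM; apply: lerD.
  by rewrite ler_piMr// ler_norml; apply/andP; split; lra.
rewrite ler_piMr// ler_norml.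
by case: pq => -[->|->] _; apply/andP; split; lra.
Qed.

Lemma approximable_bigcup (F : nat -> set HT) : (forall n, measurable (F n)) ->
  (forall n, approximable (F n)) -> approximable (\bigcup_n F n).
Proof.
move=> mF aF e e0; pose U n := \big[setU/set0]_(i < n) F i.
have mU n : measurable (U n) by exact: bigsetU_measurable.
have aU n : approximable (U n).
  elim: n => [|n IH]; first by rewrite /U big_ord0; exact: approximable_set0.
  by rewrite /U big_ord_recr; apply: approximable_setU => //; exact: mU.
have mUF : measurable (\bigcup_n F n) by exact: bigcupT_measurable.
have c : rint nu (fun x => `|\1_(U n) x - \1_(\bigcup_n F n) x|) @[n --> \oo] --> rint nu (cst 0).
  have bUF n : bm (fun x => `|\1_(U n) x - \1_(\bigcup_n F n) x| : R).
    by apply/bm_norm/bmB; exact: bm_indic.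
  apply: (@rint_cvg _ _ _ nu _ _ 1).
  - by move=> n; have [] := bUF n.
  - exact: measurable_cst.
  - move=> n x; rewrite normr_id !indicE ler_norml.
    by case: (x \in _); case: (x \in _) => /=; apply/andP; split; lra.
  - move=> x; apply: cvg_near_cst.
    have [[k _ Fk]|nU] := pselect ((\bigcup_k F k) x); last first.
      exists 0%N => // n _; rewrite !indicE !memNset ?subrr ?normr0// => Ux.
      by apply: nU; move: Ux; rewrite /U -bigcup_mkord => -[i _ Fi]; exists i.
    exists k.+1 => // n /= kn; rewrite !indicE !mem_set ?subrr ?normr0//.
      by exists k.
    by rewrite /U -bigcup_mkord; exists k.
have I0 : rint nu (cst 0) = 0 by rewrite /rint Rintegral_cst ?mul0r//; exact: measurableT.
rewrite I0 in c; have e2 : 0 < e / 2 by rewrite divr_gt0.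
move/cvgrPdist_le : c => /(_ _ e2)[N _ /(_ N (leqnn N))]; rewrite sub0r normrN => IN.
have [f [tf f01 fU]] := aU N _ e2; exists f; split => //.
have b1 := bd tf (mU N).
have b2 : bm (fun x => `|\1_(U N) x - \1_(\bigcup_n F n) x| : R).
  by apply/bm_norm/bmB; exact: bm_indic.
apply: (@le_trans _ _ (rint nu (fun x => `|f x - \1_(U N) x| +
    `|\1_(U N) x - \1_(\bigcup_n F n) x|))).
  apply: rint_le => [||x]; [exact: bd|exact: bmD|exact: ler_distD].
rewrite rintD//; have := le_trans (ler_norm _) IN; lra.
Qed.

Lemma approximable_setT : approximable setT.
Proof.
have -> : setT = \bigcup_n (box (const_mx (- n%:R) : V) (const_mx n%:R)).
  apply/seteqP; split => // x _; exists (Num.trunc `|x|).+1 => // i.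
  have := coord_le_norm x i; rewrite !mxE ler_norml => /andP[x1 x2].
  have xt : `|x| < (Num.trunc `|x|).+1%:R by exact: truncnS_gt.
  apply/andP; split; last exact: le_lt_trans x2 xt.
  by apply: lt_le_trans x1; rewrite ltrN2.
apply: approximable_bigcup => n; [exact: measurable_box|exact: approximable_box].
Qed.

Lemma approximable_setC E : measurable E -> approximable E -> approximable (~` E).
Proof.
move=> mE aE e e0; have e2 : 0 < e / 2 by rewrite divr_gt0.
have [f [tf f01 fE]] := aE _ e2; have [g [tg g01 gT]] := approximable_setT e2.
have th : test (fun x => g x + (-1) * (f x * g x)).
  by apply: testD => //; apply: testZ; apply: testM => //; case: tf.
exists (fun x => g x + (-1) * (f x * g x)); split => //.
  by move=> x; have /andP[? ?] := f01 x; have /andP[? ?] := g01 x; apply/andP; split; nra.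
have bT := bd tg (@measurableT _ HT).
apply: (@le_trans _ _ (rint nu (fun x => `|f x - \1_E x| + `|g x - \1_setT x|))); last first.
  rewrite (rintD nu (bd tf mE) bT); lra.
apply: rint_le => [||x]; [exact: (bd th (measurableC mE))|exact: (bmD (bd tf mE) bT)|].
have /andP[? ?] := f01 x; have /andP[? ?] := g01 x.
have -> : (\1_(~` E) x : R) = 1 - \1_E x.
  by rewrite !indicE in_setC; case: (x \in E) => /=; ring.
rewrite indicT; set p := \1_E x.
have pq : p = 0 \/ p = 1 by rewrite /p !indicE; case: (x \in E); by [left|right].
have -> : g x + -1 * (f x * g x) - (1 - p) = - (f x - p) * g x + (g x - 1) * (1 - p) by ring.
apply: (le_trans (ler_normD _ _)); rewrite !normrM normrN; apply: lerD.
  by rewrite ler_piMr// ler_norml; apply/andP; split; lra.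
rewrite ler_piMr// ler_norml.
by case: pq => ->; apply/andP; split; lra.
Qed.

(** Boxes with rational vertices, enumerated. *)
Lemma open_box (U : set V) : open U -> exists F : nat -> set HT,
  (forall n, F n = set0 \/ exists a b, F n = box a b) /\ U = \bigcup_n F n.
Proof.
move=> oU; pose bx (p : 'rV[rat]_m * 'rV[rat]_m) : set V :=
  box (map_mx ratr p.1 : V) (map_mx ratr p.2).
exists (fun n => if unpickle n is Some p then if `[< bx p `<=` U >] then bx p else set0 else set0).
split.
  move=> n; case: (unpickle n) => [p|]; last by left.
  by case: asboolP => _; [right; exists (map_mx ratr p.1), (map_mx ratr p.2)|left].
apply/seteqP; split => [x Ux|x [n _]]; last first.
  by case: (unpickle n) => // p; case: asboolP => // + bpx; exact.
have [e /= e0 eU] : exists2 e : R, 0 < e & ball x e `<=` U.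
  by have /nbhs_ballP[e e0 eU] := open_nbhs_nbhs (conj oU Ux); exists e.
have e2 : 0 < e / 2 by rewrite divr_gt0.
have ex i : exists q : rat, x 0 i - e / 2 < ratr q < x 0 i.
  have h : x 0 i - e / 2 < x 0 i by rewrite ltrBlDr ltrDl.
  by have [q] := rat_in_itvoo h; rewrite in_itv/= => qP; exists q.
have ex' i : exists q : rat, x 0 i < ratr q < x 0 i + e / 2.
  have h : x 0 i < x 0 i + e / 2 by rewrite ltrDl.
  by have [q] := rat_in_itvoo h; rewrite in_itv/= => qP; exists q.
have [q qP] := choice ex; have [r rP] := choice ex'.
pose p := (\row_i q i, \row_i r i) : 'rV[rat]_m * 'rV[rat]_m.
have bpU : bx p `<=` U.
  move=> y yb; apply: eU; rewrite -ball_normE /=.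
  apply: (@le_lt_trans _ _ (e / 2)); last by rewrite ltr_pdivrMr// ltr_pMr// ltr1n.
  apply: norm_le_coord; first exact: ltW.
  move=> i; rewrite !mxE; have := yb i; rewrite !mxE => /andP[? ?].
  have /andP[? ?] := qP i; have /andP[? ?] := rP i.
  by rewrite ler_norml; apply/andP; split; lra.
exists (pickle p) => //; rewrite pickleK asboolT// => i; rewrite !mxE.
by have /andP[_ ->] := qP i; have /andP[-> _] := rP i.
Qed.

(** The approximable sets form a sigma-algebra which contains the boxes. *)
Lemma approximable_Borel (E : set (Rn R m)) : measurable E -> approximable E.
Proof.
move=> mE; suff [] : measurable (E : set HT) /\ approximable E by [].
apply: (mE [set E | measurable (E : set HT) /\ approximable E]); split.
  split; first by split; [exact: measurable0|exact: approximable_set0].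
    move=> A [mA aA]; rewrite setTD; split; first exact: measurableC.
    exact: approximable_setC.
  move=> F FP; split; first by apply: bigcupT_measurable => n; have [] := FP n.
  by apply: approximable_bigcup => n; have [] := FP n.
move=> U /= oU; split; first exact: open_H_caratheodory.
have [F [Fb ->]] := open_box oU.
apply: approximable_bigcup => n; have [->|[a [b ->]]] := Fb n => //.
- exact: measurable_box.
- exact: approximable_set0.
- exact: approximable_box.
Qed.

(** The measurable subsets of a set of sigma-finite length are Borel sets up
to a null set. *)
Lemma rectifiable_Borel (W E : set V) : countably_1rectifiable W ->
  measurable (E : set HT) -> E `<=` W ->
  exists (B : set (Rn R m)) (Z : set V), [/\ measurable B, H Z = 0%E,
    E `<=` B `|` Z & B `<=` E `|` Z].
Proof.
move=> [Z0 [g [HZ0 lg WZ]]] mE EW.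
have [h hP] : exists h : nat -> R -> V, (forall k s t, enorm (h k t - h k s) <= `|t - s|) /\
    forall k, range (g k) `<=` range (h k).
  have ex k : exists h : R -> V, (forall s t, enorm (h t - h s) <= `|t - s|) /\
      range (g k) `<=` range h.
    have [L gL] := lg k; pose K := `|L| + 1.
    have K0 : 0 < K by rewrite ltr_wpDl.
    exists (fun s => g k (s / K)); split => [s t|_ [s _ <-]]; last first.
      by exists (s * K) => //; rewrite mulfK// gt_eqF.
    apply: (le_trans (gL _ _)); rewrite -mulrBl normrM (gtr0_norm (x := K^-1)) ?invr_gt0//.
    rewrite mulrCA ler_piMr// ler_pdivrMr// mul1r /K (le_trans (ler_norm _))// lerDl//.
  have [h hP] := choice ex; exists h.
  by split=> [k s t|k]; have [h1 h2] := hP k; [exact: h1|exact: h2].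
have [lh gh] := hP.
pose Wk k n : set V := h k @` `[- n%:R, n%:R]%classic.
have mWk k n : measurable (Wk k n : set HT) by exact: arc_closed (lh k) _ _.
have fWk k n : (H (Wk k n) < +oo)%E.
  apply: (@le_lt_trans _ _ (n%:R - - n%:R)%:E); last exact: ltry.
  apply: (@H_curve_le _ _ (h k) id); first by apply: (@le_trans _ _ 0); rewrite ?oppr_le0.
  - by move=> s t _ st _; rewrite (le_trans (lh _ _ _))// ger0_norm// subr_ge0.
  - by move=> s t _ st _; rewrite (le_trans (lh _ _ _))// ger0_norm// subr_ge0.
have ex k n : exists B : set (Rn R m), [/\ measurable B, E `&` Wk k n `<=` B &
    H (B `\` (E `&` Wk k n)) = 0%E].
  have [B [mB sB HB]] := Borel_hull (E `&` Wk k n); exists B; split => //.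
  have mEk : measurable (E `&` Wk k n : set HT) by exact: measurableI.
  have fE : H (E `&` Wk k n) \is a fin_num.
    rewrite ge0_fin_numE ?H_ge0//; apply: le_lt_trans (fWk k n).
    by apply: le_H; exact: subIsetr.
  have := mEk B; rewrite (_ : B `&` (E `&` Wk k n) = E `&` Wk k n); last exact: setIidr.
  have -> : H1outer R m B = H (E `&` Wk k n) by exact: HB.
  move=> e; have {}e : H (E `&` Wk k n) = (H (E `&` Wk k n) + H (B `\` (E `&` Wk k n)))%E by exact: e.
  have := H_ge0 (B `\` (E `&` Wk k n)); move: e.
  rewrite -(fineK fE); case: (H (B `\` _)) => [r||] //= [] e.
  by move=> _; congr (_%:E); apply: (addrI (fine (H (E `&` Wk k n)))); rewrite addr0 -e.
have [B BP] := choice (fun k => let: existT f fP := choice (ex k) in ex_intro _ f fP).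
exists (\bigcup_k \bigcup_n B k n),
  (Z0 `|` \bigcup_k \bigcup_n (B k n `\` (E `&` Wk k n))); split.
- apply: bigcupT_measurable => k; apply: bigcupT_measurable => n.
  by have [] := BP k n.
- apply: H_U0 => //; apply: H_bigcup0 => k; apply: H_bigcup0 => n.
  by have [] := BP k n.
- move=> x Ex; have [Zx|[k _ gx]] := WZ x (EW x Ex); first by right; left.
  have [s _ hs] := gh k _ gx; left.
  exists k => //; exists (Num.trunc `|s|).+1 => //.
  have [_ sB _] := BP k (Num.trunc `|s|).+1; apply: sB; split => //; exists s => //.
  by rewrite /= in_itv/= -ler_norml ltW// truncnS_gt.
- move=> x [k _ [n _ Bx]]; have [Ex|nEx] := pselect ((E `&` Wk k n) x).
    by left; case: Ex.
  by right; right; exists k => //; exists n.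
Qed.

Variable W : set V.
Hypothesis mW : measurable (W : set HT).
Hypothesis rW : countably_1rectifiable W.
Hypothesis nu0 : forall Z : set V, H Z = 0%E -> nu Z = 0%E.
Hypothesis nuW : nu (~` W) = 0%E.

(** On a rectifiable set the Caratheodory measurable sets are Borel sets up to
null sets. *)
Lemma test_dense (E : set HT) : measurable E -> approximable E.
Proof.
move=> mE e e0; have mEW : measurable (E `&` W : set HT) by exact: measurableI.
have [B [Z [mB HZ EB BE]]] := rectifiable_Borel rW mEW (@subIsetr _ _ _).
have mB' := Borel_H1 mB.
have [f [tf f01 fB]] := approximable_Borel mB e0.
exists f; split => //; apply: le_trans fB; rewrite le_eqVlt; apply/orP; left; apply/eqP.
have [m1 _] := bd tf mE; have [m2 _] := bd tf mB'.
rewrite /rint /Rintegral; congr fine.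
apply: (@ae_eq_integral _ _ _ nu setT _ _ measurableT).
- exact/measurable_EFinP.
- exact/measurable_EFinP.
have mZ := H1_null_measurable HZ.
exists (Z `|` ~` W); split.
- by apply: measurableU => //; exact: measurableC.
- have z0 : nu (Z : set HT) = 0%E by exact: nu0.
  apply/eqP; rewrite eq_le measure_ge0 andbT.
  have z1 : (nu (~` W : set HT) = 0)%E by exact: nuW.
  have := measureU2 nu mZ (measurableC mW); rewrite [X in (_ <= X + _)%E -> _]z0.
  by rewrite [X in (_ <= _ + X)%E -> _]z1 add0e; exact.
move=> x /= nx; apply: contrapT => /not_orP[nZ nnW]; apply: nx => _.
have Wx : W x by exact: contrapT.
suff -> : (\1_E x : R) = \1_B x by [].
rewrite !indicE; congr (_%:R); congr nat_of_bool; apply/idP/idP => /set_mem xx; apply/mem_set.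
  by have [] := EB x (conj xx Wx).
by have [[]|] := BE x xx.
Qed.

End test_density.

(** * Splitting a rectifiable current without loss of mass *)

Section finite_density.
Context d (T : measurableType d) (R : realType).
Variables (mu : {measure set T -> \bar R}) (t : T -> R).
Hypotheses (mt : measurable_fun setT t) (t0 : forall x, 0 <= t x).
Hypothesis it : mu.-integrable setT (EFin \o t).

Let dens_fin : (density mu mt t0 setT < +oo)%E.
Proof.
move/integrableP : it => [_]; apply: le_lt_trans; rewrite le_eqVlt; apply/orP; left.
by apply/eqP/eq_integral => x _ /=; rewrite ger0_norm.
Qed.

Definition finite_density : {finite_measure set T -> \bar R} :=
  mfrestr measurableT dens_fin.

Lemma finite_densityE A : finite_density A = (\int[mu]_(x in A) (t x)%:E)%E.
Proof. by rewrite /finite_density /= /mfrestr /mrestr setIT. Qed.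

Lemma integrable_bm_density (f : T -> R) : bm f ->
  mu.-integrable setT (fun x => (f x * t x)%:E).
Proof.
move=> [mf [C Cf]].
apply: (@le_integrable _ _ _ mu setT measurableT _ (fun x => (C%:E * (t x)%:E)%E)).
- by apply/measurable_EFinP; exact: measurable_funM.
- move=> x _; rewrite -EFinM lee_fin !normrM (ger0_norm (t0 x)) ler_wpM2r//.
  by rewrite (le_trans (Cf x))// ler_norm.
- exact: integrableZl.
Qed.

Lemma rint_finite_density (f : T -> R) : bm f ->
  rint finite_density f = \int[mu]_x (f x * t x).
Proof.
move=> bf; have ift := integrable_bm_density bf; have [mf _] := bf.
have idf := integrable_density mt t0 mf ift.
rewrite -(integral_density mt t0 mf ift) /rint /Rintegral; congr fine.
apply: (integral_mfrestr measurableT dens_fin) => //.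
exact/measurable_EFinP.
Qed.

End finite_density.

Section linear_currents.
Context {R : realType} {m : nat}.
Local Notation V := 'rV[R]_m.
Local Notation H := (@hausdorff1 R m).
Local Notation HT := (H1type R m).
Local Notation mu := (H1 R m).

Definition current_linear (S : current1 R m) :=
  (forall w1 w2 w : testform R m, (forall x, w x = w1 x + w2 x) -> S w = S w1 + S w2) /\
  (forall c (w1 w : testform R m), (forall x, w x = c *: w1 x) -> S w = c * S w1).

Lemma current_ext (S : current1 R m) (w w' : testform R m) : current_linear S ->
  (forall x, w x = w' x) -> S w = S w'.
Proof. by move=> [_ SZ] ww; rewrite (SZ 1 w' w) ?mul1r// => x; rewrite scale1r. Qed.

Lemma current_zero (S : current1 R m) (w : testform R m) : current_linear S ->
  (forall x, w x = 0) -> S w = 0.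
Proof. by move=> [_ SZ] w0; rewrite (SZ 0 w w) ?mul0r// => x; rewrite scale0r. Qed.

Definition zero_form : testform R m :=
  sval (cid (form_test 0 (bump_test (0 : V) 0))).

Lemma zero_formE x : zero_form x = 0.
Proof. by rewrite /zero_form; case: cid => w /= ->; rewrite scaler0. Qed.

Lemma mass1_ge0 (S : current1 R m) : current_linear S -> (0 <= mass1 S)%E.
Proof.
move=> lS; apply: ereal_sup_ubound; exists zero_form.
  by move=> x; rewrite zero_formE enorm0.
by rewrite (current_zero lS)// => x; exact: zero_formE.
Qed.

Lemma mass1_le (S : current1 R m) (w : testform R m) : (forall x, enorm (w x) <= 1) ->
  ((S w)%:E <= mass1 S)%E.
Proof. by move=> w1; apply: ereal_sup_ubound; exists w. Qed.

Section tau_measure.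
Variables (W : set V) (t : V -> R) (xi : V -> V).
Hypothesis mW : measurable (W : set HT).
Hypothesis rW : countably_1rectifiable W.
Hypothesis t0 : forall x, W x -> 0 < t x.
Hypothesis tloc : forall K : set V, compact K -> mu.-integrable (W `&` K) (EFin \o t).
Hypothesis mxi : measurable_fun (W : set HT) (xi : HT -> Rn R m).
Hypothesis xi1 : forall x, W x -> enorm (xi x) = 1.

Let cube n : set V := [set v | forall i, `[- n%:R, n%:R]%classic (v 0 i)].

Let cube_compact n : compact (cube n).
Proof.
by apply: (@rV_compact R m (fun=> `[- n%:R, n%:R]%classic)) => i; exact: segment_compact.
Qed.

Let mcube n : measurable (cube n : set HT).
Proof. apply: Borel_H1; apply: closed_Rn; apply: compact_closed; first exact: norm_hausdorff.
exact: cube_compact. Qed.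

Let cubeT : W = \bigcup_n (W `&` cube n).
Proof.
apply/seteqP; split => [x Wx|x [n _ []//]]; exists (Num.trunc `|x|).+1 => //; split=> // i.
by rewrite /= in_itv/= -ler_norml (le_trans (coord_le_norm x i))// ltW// truncnS_gt.
Qed.

Definition tW : HT -> R := t \_ W.

Lemma measurable_tW : measurable_fun setT tW.
Proof.
apply/(measurable_restrictT _ mW).
have mB n : measurable_fun (W `&` cube n : set HT) (t : HT -> R).
  by have /measurable_int/measurable_EFinP := tloc (@cube_compact n).
rewrite {1}cubeT; apply/measurable_fun_bigcup => // n.
exact: measurableI.
Qed.

Lemma tW_ge0 x : 0 <= tW x.
Proof. by rewrite /tW patchE; case: ifP => // /set_mem/t0/ltW. Qed.

Definition xiW (x : HT) : V := if x \in W then xi x else 0.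

Lemma xiW_coord i : (fun x => xiW x 0 i) = (fun x => xi x 0 i) \_ W.
Proof. by apply/funext => x; rewrite /xiW patchE; case: ifP => // _; rewrite mxE. Qed.

Lemma enorm_xiW x : enorm (xiW x) <= 1.
Proof. by rewrite /xiW; case: ifP => [/set_mem/xi1->//|_]; rewrite enorm0. Qed.

Lemma bm_xiW i : bm (fun x => xiW x 0 i).
Proof.
split; last first.
  exists 1 => x; exact: le_trans (coord_le_enorm _ _) (enorm_xiW x).
rewrite xiW_coord; apply/(measurable_restrictT _ mW).
have cc : measurable_fun setT (fun x : Rn R m => (x : V) 0 i).
  by apply: continuous_Rn; exact: coord_continuous.
exact: (measurableT_comp cc mxi).
Qed.

Lemma bm_dotp (u v : HT -> V) : (forall i, bm (fun x => u x 0 i)) ->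
  (forall i, bm (fun x => v x 0 i)) -> bm (fun x => dotp (u x) (v x)).
Proof. by move=> bu bv; apply: bm_sum => i; exact: bmM. Qed.

Lemma bm_form (w : testform R m) i : bm (fun x : HT => w x 0 i).
Proof. exact/bm_test/test_form. Qed.

(** On forms supported in [A], only the restriction of the measure to [A] matters. *)
Lemma tau_restr (A : set HT) (mA : measurable A) (w : testform R m) :
  (forall x, ~ A x -> w x = 0) ->
  tau W t xi w = \int[mu]_x (dotp (w x) (xiW x) * (tW \_ A) x).
Proof.
move=> wA; rewrite /tau Rintegral_mkcond; apply: eq_Rintegral => x _.
rewrite /tW /xiW !patchE; case: ifPn => xW; last by rewrite if_same mulr0.
case: ifPn => // xA; rewrite wA ?dotp0l ?mul0r//.
by move: xA; rewrite notin_setE.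
Qed.

Section local.
Variable A : set HT.
Hypothesis mA : measurable A.
Hypothesis iA : mu.-integrable setT (EFin \o (tW \_ A)).

Let mtA : measurable_fun setT (tW \_ A).
Proof. exact/(measurable_restrictT _ mA)/measurable_funTS/measurable_tW. Qed.

Let tA0 x : 0 <= (tW \_ A) x.
Proof. by rewrite patchE; case: ifP => // _; exact: tW_ge0. Qed.

Definition tau_measure : {finite_measure set HT -> \bar R} :=
  finite_density mtA tA0 iA.

Lemma tau_measureE (w : testform R m) : (forall x, ~ A x -> w x = 0) ->
  tau W t xi w = rint tau_measure (fun x => dotp (w x) (xiW x)).
Proof.
move=> wA; rewrite (tau_restr mA wA); apply/esym.
apply: (rint_finite_density mtA tA0 iA).
by apply: bm_dotp => i; [exact: bm_form|exact: bm_xiW].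
Qed.

Lemma tau_measure0 (Z : set V) : H Z = 0%E -> tau_measure Z = 0%E.
Proof.
move=> Z0; have mZ := H1_null_measurable Z0.
apply: (etrans (finite_densityE mtA tA0 iA Z)).
have iZ := @integrableS _ _ _ mu _ _ _ (@measurableT _ HT) mZ (@subsetT _ Z) iA.
have mZ0 : mu Z = 0%E by exact: Z0.
have mfZ := measurable_int _ iZ.
exact: (@null_set_integral _ _ _ mu Z _ mZ mfZ mZ0).
Qed.

Lemma tau_measureW : tau_measure (~` W) = 0%E.
Proof.
apply: (etrans (finite_densityE mtA tA0 iA _)); apply: integral0_eq => x /= nW.
by rewrite patchE /tW patchE (memNset nW) if_same.
Qed.

Lemma tau_measure_dense (E : set HT) : measurable E -> approximable tau_measure E.
Proof. exact: (test_dense mW rW tau_measure0 tau_measureW). Qed.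

End local.

(** A current of finite mass has finite total weight: testing against
approximations of the sign of each coordinate of the orientation bounds the
weight of every cube. *)
Lemma mass_integrable (M : R) : (mass1 (tau W t xi) <= M%:E)%E ->
  mu.-integrable setT (EFin \o tW).
Proof.
move=> TM; pose a n : V := const_mx (- n%:R); pose b n : V := const_mx n%:R.
pose Q n : set HT := box (a n) (b n).
have mQ n : measurable (Q n) by exact: measurable_box.
have Qcube n : Q n `<=` cube n.
  move=> x Qx i; have := Qx i; rewrite !mxE /= in_itv/= => /andP[/ltW -> /ltW ->].
  by [].
have iQ n : mu.-integrable setT (EFin \o (tW \_ (Q n))).
  have h := tloc (@cube_compact n).
  have mWc : measurable (W `&` cube n : set HT) by exact: measurableI.
  have mWQ : measurable (W `&` Q n : set HT) by exact: measurableI.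
  have WQc : W `&` Q n `<=` W `&` cube n by apply: setIS; exact: Qcube.
  have := @integrableS _ _ _ mu _ _ _ mWc mWQ WQc h.
  move=> /(@integrable_mkcond _ _ _ mu _ _ mWQ).1.
  congr (mu.-integrable setT _); apply/funext => x; rewrite /tW /= !patchE in_setI.
  by case: (x \in W); case: (x \in Q n).
pose nu n := tau_measure (mQ n) (iQ n).
have nuQ n : nu n (~` Q n) = 0%E.
  apply: (etrans (finite_densityE _ _ (iQ n) _)); apply: integral0_eq => x /= nQ.
  by rewrite patchE memNset.
have coord n i (E : set HT) (s : R) : measurable E -> `|s| <= 1 ->
    rint (nu n) (fun x => s * (\1_(E `&` Q n) x * xiW x 0 i)) <= M.
  move=> mE s1; apply/ler_addgt0Pr => e e0; have e2 : 0 < e / 2 by rewrite divr_gt0.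
  have [f [tf f01 fE]] := tau_measure_dense (mQ n) (iQ n) mE e2.
  have [g [tg g01 gQ gout]] := @approximable_plateau _ _ (nu n) (a n) (b n) _ e2.
  have tfg : test (fun x => s * (f x * g x)).
    by apply: testZ; apply: testM => //; case: tf.
  have [w wE] := form_test (delta_mx 0 i) tfg.
  have wQ x : ~ Q n x -> w x = 0.
    by move=> /gout gx; rewrite wE gx !mulr0 scale0r.
  have w1 x : enorm (w x) <= 1.
    rewrite wE enormZ !normrM.
    have e1 : enorm (delta_mx 0 i : V) <= 1.
      have dd : dotp (delta_mx 0 i : V) (delta_mx 0 i) = 1.
        rewrite /dotp (bigD1 i)//= big1 ?addr0.
          by rewrite !mxE !eqxx mulr1.
        by move=> j ji; rewrite !mxE (negbTE ji) andbF mulr0.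
      by rewrite /enorm dd sqrtr1.
    have /andP[f0 f1] := f01 x; have /andP[g0 g1] := g01 x.
    rewrite (ger0_norm f0) (ger0_norm g0) -[leRHS]mulr1.
    by apply: ler_pM; rewrite ?enorm_ge0 ?mulr_ge0// mulr_ile1 ?mulr_ge0// mulr_ile1.
  have Tw : tau W t xi w <= M by rewrite -lee_fin (le_trans (mass1_le _ w1)).
  have TwE : tau W t xi w = rint (nu n) (fun x => s * (f x * g x) * xiW x 0 i).
    rewrite (tau_measureE (mQ n) (iQ n) wQ); congr rint; apply/funext => x.
    rewrite wE dotpZl /dotp (bigD1 i)//= big1 ?addr0; first by rewrite !mxE !eqxx mul1r.
    by move=> j ji; rewrite !mxE (negbTE ji) andbF mul0r.
  have bf := bm_test tf; have bg := bm_test tg.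
  have bE := bm_indic R mE; have bQ := bm_indic R (mQ n).
  have bEQ := bm_indic R (measurableI _ _ mE (mQ n)).
  have bx := bm_xiW i.
  have b1 : bm (fun x : HT => s * (f x * g x) * xiW x 0 i).
    exact: (bmM (bmZ s (bmM bf bg)) bx).
  have b2 : bm (fun x => s * (\1_(E `&` Q n) x * xiW x 0 i)).
    exact: (bmZ s (bmM bEQ bx)).
  have b3 : bm (fun x : HT => `|f x - \1_E x|) by exact: (bm_norm (bmB bf bE)).
  have b4 : bm (fun x : HT => `|g x - \1_(Q n) x|) by exact: (bm_norm (bmB bg bQ)).
  have d12 : rint (nu n) (fun x => s * (\1_(E `&` Q n) x * xiW x 0 i)) -
      rint (nu n) (fun x => s * (f x * g x) * xiW x 0 i) <= e.
    rewrite -(rintB (nu n) b2 b1).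
    apply: (@le_trans _ _ (rint (nu n) (fun x => `|f x - \1_E x| + `|g x - \1_(Q n) x|))).
      apply: rint_le => [||x]; [exact: (bmB b2 b1)|exact: (bmD b3 b4)|].
      have /andP[f0 f1] := f01 x; have /andP[g0 g1] := g01 x.
      rewrite (_ : (\1_(E `&` Q n) x : R) = \1_E x * \1_(Q n) x); last first.
        by rewrite !indicE in_setI; case: (x \in E); case: (x \in Q n); rewrite /= ?mulr1 ?mulr0.
      set p := \1_E x; set q := \1_(Q n) x; set z := xiW x 0 i.
      have z1 : `|z| <= 1 by exact: le_trans (coord_le_enorm _ _) (enorm_xiW x).
      have p01 : 0 <= p <= 1 by rewrite /p indicE ler0n lern1 leq_b1.
      have -> : s * (p * q * z) - s * (f x * g x) * z =
        - (s * z * g x) * (f x - p) - (s * z * p) * (g x - q) by ring.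
      apply: (le_trans (ler_norm _)); apply: (le_trans (ler_normB _ _)).
      have /andP[p0 p1] := p01.
      by rewrite !normrM normrN !normrM (ger0_norm g0) (ger0_norm p0); apply: lerD;
        rewrite ler_piMl// !mulr_ile1// mulr_ge0.
    by rewrite (rintD (nu n) b3 b4); lra.
  by move: d12; rewrite -TwE; lra.
have tot n : \int[mu]_x (tW \_ (Q n)) x <= (2 * M) *+ m.
  have bQ := bm_indic R (mQ n).
  have bWQ := bm_indic R (measurableI _ _ mW (mQ n)).
  have bi i : bm (fun x => \1_(Q n) x * `|xiW x 0 i|).
    exact: (bmM bQ (bm_norm (bm_xiW i))).
  have -> : \int[mu]_x (tW \_ (Q n)) x = rint (nu n) (\1_(W `&` Q n)).
    apply/esym; apply: (etrans (rint_finite_density _ _ (iQ n) bWQ)).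
    apply: eq_Rintegral => x _; rewrite /tW !patchE indicE in_setI.
    by case: (x \in W); case: (x \in Q n); rewrite /= ?mul1r ?mul0r.
  apply: (@le_trans _ _ (rint (nu n) (fun x => \sum_i \1_(Q n) x * `|xiW x 0 i|))).
    apply: rint_le => [||x]; [exact: bWQ|exact: bm_sum|].
    rewrite -mulr_sumr !indicE in_setI; have [xQ|_] := boolP (x \in Q n); last first.
      by rewrite andbF mul0r.
    rewrite andbT mul1r; have [xW|_] := boolP (x \in W); last by apply: sumr_ge0.
    rewrite /=; apply: le_trans (enorm_le_sum _).
    by rewrite /xiW xW (xi1 (set_mem xW)).
  rewrite (rint_sum (nu n) _ bi) (le_trans (ler_norm _))// (le_trans (ler_norm_sum _ _ _))//.
  rewrite -[X in _ *+ X]card_ord -sumr_const; apply: ler_sum => i _.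
  rewrite ger0_norm; last first.
    by apply: rint_ge0 => x; rewrite mulr_ge0// indicE.
  have bx := bm_xiW i; have [mx _] := bx.
  pose E1 := [set x : HT | 0 < xiW x 0 i]; pose E2 := [set x : HT | xiW x 0 i < 0].
  have mE1 : measurable E1.
    rewrite -[X in measurable X]setTI (_ : E1 = (fun x => xiW x 0 i) @^-1` `]0, +oo[%classic); first exact: mx.
    by apply/seteqP; split => x /=; rewrite in_itv/= andbT.
  have mE2 : measurable E2.
    rewrite -[X in measurable X]setTI (_ : E2 = (fun x => xiW x 0 i) @^-1` `]-oo, 0[%classic); first exact: mx.
    by apply/seteqP; split => x /=; rewrite in_itv/=.
  have b1 : bm (fun x => 1 * (\1_(E1 `&` Q n) x * xiW x 0 i)).
    exact: (bmZ 1 (bmM (bm_indic R (measurableI _ _ mE1 (mQ n))) bx)).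
  have b2 : bm (fun x => -1 * (\1_(E2 `&` Q n) x * xiW x 0 i)).
    exact: (bmZ (-1) (bmM (bm_indic R (measurableI _ _ mE2 (mQ n))) bx)).
  have -> : (fun x => \1_(Q n) x * `|xiW x 0 i|) = (fun x =>
      1 * (\1_(E1 `&` Q n) x * xiW x 0 i) + -1 * (\1_(E2 `&` Q n) x * xiW x 0 i)).
    apply/funext => x; rewrite !indicE !in_setI.
    have -> : (x \in E1) = (0 < xiW x 0 i) by apply/idP/idP => [/set_mem//|/mem_set].
    have -> : (x \in E2) = (xiW x 0 i < 0) by apply/idP/idP => [/set_mem//|/mem_set].
    move: (xiW x 0 i) => z; case: (x \in Q n); rewrite ?andbT ?andbF /=; last by ring.
    case: (ltgtP 0 z) => z0.
    - by rewrite gtr0_norm//=; ring.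
    - by rewrite ltr0_norm//=; ring.
    - by rewrite -z0 normr0; ring.
  rewrite (rintD (nu n) b1 b2) mulr_natl mulr2n; apply: lerD.
    by apply: coord => //; rewrite normr1.
  by apply: coord => //; rewrite normrN normr1.
have mtQ n : measurable_fun setT (fun x => ((tW \_ (Q n)) x)%:E).
  by have /measurable_int := iQ n.
have tQ0 n x : (0 <= ((tW \_ (Q n)) x)%:E)%E.
  by rewrite lee_fin patchE; case: ifP => // _; exact: tW_ge0.
have ndQ (x : HT) : {homo (fun n => ((tW \_ (Q n)) x)%:E) : n k / (n <= k)%N >-> (n <= k)%E}.
  move=> n k nk; rewrite lee_fin !patchE; case: ifPn => [/set_mem xn|_]; last first.
    by case: ifP => // _; exact: tW_ge0.
  rewrite mem_set// => i; have := xn i; rewrite !mxE => /andP[x1 x2].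
  apply/andP; split; first by apply: le_lt_trans x1; rewrite lerN2 ler_nat.
  by apply: lt_le_trans x2 _; rewrite ler_nat.
have lQ (x : HT) : limn (fun n => ((tW \_ (Q n)) x)%:E) = (tW x)%:E.
  apply: cvg_lim => //; apply: cvg_near_cst; exists (Num.trunc `|x : V|).+1 => // n /= xn.
  rewrite patchE mem_set// => i; rewrite !mxE -ltr_norml.
  apply: (le_lt_trans (coord_le_norm (x : V) i)).
  apply: (@lt_le_trans _ _ (Num.trunc `|x : V|).+1%:R); first exact: truncnS_gt.
  by rewrite ler_nat.
apply/integrableP; split; first exact/measurable_EFinP/measurable_tW.
rewrite (eq_integral (fun x => limn (fun n => ((tW \_ (Q n)) x)%:E))); last first.
  by move=> x _; rewrite lQ /= ger0_norm// tW_ge0.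
apply: (@le_lt_trans _ _ ((2 * M) *+ m)%:E); last exact: ltry.
rewrite (@monotone_convergence _ _ _ mu setT measurableT _ mtQ (fun n x _ => tQ0 n x) (fun x _ => ndQ x)).
apply: lime_le.
  apply: ereal_nondecreasing_is_cvgn => n k nk.
  apply: (@ge0_le_integral _ _ _ mu setT measurableT) => [x _|||x _].
  - exact: tQ0.
  - exact: mtQ.
  - exact: mtQ.
  - exact: ndQ.
apply: nearW => n; apply: le_trans (_ : ((\int[mu]_x (tW \_ (Q n)) x)%:E <= _)%E); last by rewrite lee_fin.
by rewrite /Rintegral fineK//; exact: integrable_fin_num (iQ n).
Qed.

End tau_measure.

End linear_currents.

Section splitting.
Context {R : realType} {m : nat}.
Local Notation V := 'rV[R]_m.
Local Notation H := (@hausdorff1 R m).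
Local Notation HT := (H1type R m).
Local Notation mu := (H1 R m).
Variables (W : set V) (t : V -> R) (xi : V -> V).
Hypothesis mW : measurable (W : set HT).
Hypothesis rW : countably_1rectifiable W.
Hypothesis t0 : forall x, W x -> 0 < t x.
Hypothesis tloc : forall K : set V, compact K -> mu.-integrable (W `&` K) (EFin \o t).
Hypothesis mxi : measurable_fun (W : set HT) (xi : HT -> Rn R m).
Hypothesis xi1 : forall x, W x -> enorm (xi x) = 1.
Local Notation T := (tau W t xi).
Variables T1 T2 : current1 R m.
Hypotheses (l1 : current_linear T1) (l2 : current_linear T2).
Hypothesis TE : forall w, T w = T1 w + T2 w.
Hypothesis massT : (mass1 T < +oo)%E.
Hypothesis mass12 : (mass1 T1 + mass1 T2 <= mass1 T)%E.

Let lT : current_linear T.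
Proof.
split=> [w1 w2 w ww|c w1 w ww].
  by rewrite !TE (l1.1 _ _ _ ww) (l2.1 _ _ _ ww) addrACA.
by rewrite !TE (l1.2 _ _ _ ww) (l2.2 _ _ _ ww) mulrDr.
Qed.

Let finT : mass1 T \is a fin_num.
Proof. by rewrite ge0_fin_numE// mass1_ge0. Qed.

Let fin1 : mass1 T1 \is a fin_num.
Proof.
rewrite ge0_fin_numE ?mass1_ge0//; apply: le_lt_trans massT; apply: le_trans mass12.
by rewrite leeDl// mass1_ge0.
Qed.

Let fin2 : mass1 T2 \is a fin_num.
Proof.
rewrite ge0_fin_numE ?mass1_ge0//; apply: le_lt_trans massT; apply: le_trans mass12.
by rewrite leeDr// mass1_ge0.
Qed.

Let itW : mu.-integrable setT (EFin \o (tW W t \_ setT)).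
Proof.
rewrite patch_setT; apply: (mass_integrable mW rW t0 tloc mxi xi1 (M := fine (mass1 T))).
by rewrite fineK.
Qed.

Let nu := tau_measure mW t0 tloc (@measurableT _ HT) itW.
Let z : HT -> V := xiW W xi.

Let TI (w : testform R m) : T w = rint nu (fun x => dotp (w x) (z x)).
Proof. by apply: tau_measureE => // x /(_ Logic.I). Qed.

Let dense (E : set HT) : measurable E -> approximable nu E.
Proof. exact: tau_measure_dense. Qed.

Let bz i : bm (fun x => z x 0 i). Proof. exact: bm_xiW. Qed.

(** Adding [w] and [w'] to an almost optimal form, damped by [1 - f] to make
room for them, does not gain more than what the damping loses. *)
Let key1 (f : V -> R) (w w' : testform R m) : test f -> (forall x, f x <= 1) ->
  (forall x, enorm (w x) <= f x) -> (forall x, enorm (w' x) <= f x) ->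
  T1 w + T2 w' <= rint nu f.
Proof.
move=> tf f1 wf wf'; apply/ler_addgt0Pr => e e0.
have f0 x : 0 <= f x by exact: le_trans (enorm_ge0 _) (wf x).
have [_ [zeta zeta1 <-] Tz] := ub_ereal_sup_adherent e0 finT.
have sf : smooth (fun x => 1 + -1 * f x).
  by apply: smoothD; [exact: smooth_cst|apply: smoothZ; case: tf].
(* [d = (1 - f) zeta] leaves room for [w] and for [w'], and [fz = f zeta] is what
is lost. *)
have [d dE] := formZ zeta sf.
have [fz fzE] := formZ zeta (proj1 tf).
have [om omE] := formD w d; have [om' omE'] := formD w' d.
have b (v v' : testform R m) : (forall x, v' x = v x + d x) -> (forall x, enorm (v x) <= f x) ->
    forall x, enorm (v' x) <= 1.
  move=> v'E vf x; rewrite v'E (le_trans (ler_enormD _ _))// dE enormZ mulN1r.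
  rewrite ger0_norm ?subr_ge0//.
  have : (1 - f x) * enorm (zeta x) <= (1 - f x) * 1 by rewrite ler_wpM2l ?subr_ge0// zeta1.
  by have := vf x; lra.
have h1 : T1 om <= fine (mass1 T1).
  by rewrite -lee_fin fineK//; apply: mass1_le; exact: b omE wf.
have h2 : T2 om' <= fine (mass1 T2).
  by rewrite -lee_fin fineK//; apply: mass1_le; exact: b omE' wf'.
have h3 : fine (mass1 T1) + fine (mass1 T2) <= fine (mass1 T).
  by rewrite -lee_fin EFinD !fineK.
have h4 : fine (mass1 T) - e < T zeta by rewrite -lte_fin EFinB fineK.
have h5 : T zeta = T d + T fz.
  apply: lT.1 => x; rewrite dE fzE mulN1r -scalerDl subrK scale1r//.
have h6 : T fz <= rint nu f.
  rewrite TI; apply: rint_le => [||x].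
  - by apply: bm_dotp => i; [exact: bm_form|exact: bz].
  - exact: bm_test.
  rewrite fzE dotpZl ler_piMr// (le_trans (dotp_le _ _))// mulr_ile1 ?enorm_ge0//.
  exact: enorm_xiW.
move: h1 h2; rewrite (l1.1 _ _ _ omE) (l2.1 _ _ _ omE').
by have := TE d; move: h3 h4 h5 h6; lra.
Qed.

(** Scaling removes the bound [f <= 1]. *)
Let key (f : V -> R) (w w' : testform R m) : test f ->
  (forall x, enorm (w x) <= f x) -> (forall x, enorm (w' x) <= f x) ->
  T1 w + T2 w' <= rint nu f.
Proof.
move=> tf wf wf'; have bf := bm_test tf; have [_ [C fC]] := bf.
pose K := `|C| + 1; have K0 : 0 < K by rewrite ltr_wpDl.
have Ki : 0 <= K^-1 by rewrite invr_ge0 ltW.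
have fK x : f x <= K.
  rewrite (le_trans (ler_norm _))// (le_trans (fC x))// (le_trans (ler_norm _))//.
  by rewrite lerDl.
have tKf := testZ K^-1 tf.
have [v vE] := formZ w (@smooth_cst R m K^-1).
have [v' vE'] := formZ w' (@smooth_cst R m K^-1).
have h : T1 v + T2 v' <= rint nu (fun x => K^-1 * f x).
  apply: key1 => // x.
  - by rewrite ler_pdivrMl// mulr1.
  - by rewrite vE enormZ ger0_norm// ler_wpM2l.
  - by rewrite vE' enormZ ger0_norm// ler_wpM2l.
move: h; rewrite (l1.2 _ _ _ vE) (l2.2 _ _ _ vE') (rintZ nu _ bf) -mulrDr.
by rewrite ler_pM2l// invr_gt0.
Qed.

Let fe (f : V -> R) (u : V) : testform R m :=
  if pselect (exists w : testform R m, forall x, w x = f x *: u) is left e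
  then sval (cid e) else @zero_form R m.

Let feE f u : test f -> forall x, fe f u x = f x *: u.
Proof.
move=> tf; have [w wE] := form_test u tf.
by rewrite /fe; case: pselect => [e|[]]; [case: cid|exists w].
Qed.

Let bound1 f u : test f -> (forall x, 0 <= f x) -> enorm u <= 1 -> `|T1 (fe f u)| <= rint nu f.
Proof.
move=> tf f0 u1; have E := feE u tf.
have e1 x : enorm (fe f u x) <= f x by rewrite E enormZ ger0_norm// ler_piMr.
have z2 : T2 (@zero_form R m) = 0 by apply: current_zero => // x; exact: zero_formE.
have e0 x : enorm (@zero_form R m x) <= f x by rewrite zero_formE enorm0.
have [v vE] := formZ (fe f u) (@smooth_cst R m (-1)).
have e2 x : enorm (v x) <= f x by rewrite vE enormZ normrN normr1 mul1r.
have h1 := key tf e1 e0; have h2 := key tf e2 e0.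
by move: h1 h2; rewrite z2 (l1.2 _ _ _ vE) ler_norml => *; apply/andP; split; lra.
Qed.

Let ex_v i : exists v : HT -> R, [/\ measurable_fun setT v, forall x, `|v x| <= 1 &
  forall f, test f -> T1 (fe f (delta_mx 0 i)) = rint nu (fun x => f x * v x)].
Proof.
apply: (@dominated_functional_density _ HT R nu test (@bm_test R m) (@testD R m) (@testZ R m)
  (fun f g tf => @testM R m f g (proj1 tf)) (@ex_cutoff R m) dense
  (fun f => T1 (fe f (delta_mx 0 i)))) => [f g tf tg|c f tf|f tf f0].
- by apply: l1.1 => x; rewrite !feE// ?scalerDl//; exact: testD.
- by apply: l1.2 => x; rewrite !feE// ?scalerA//; exact: testZ.
- apply: bound1 => //; rewrite /enorm (_ : dotp _ _ = 1) ?sqrtr1//.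
  rewrite /dotp (bigD1 i)//= big1 ?addr0; first by rewrite !mxE !eqxx mulr1.
  by move=> j ji; rewrite !mxE (negbTE ji) andbF mulr0.
Qed.

Let v_ i := sval (cid (ex_v i)).
Let v (x : HT) : V := \row_i v_ i x.

Let bv i : bm (fun x => v x 0 i).
Proof.
rewrite (_ : (fun x => _) = v_ i); last by apply/funext => x; rewrite mxE.
by rewrite /v_; case: cid => /= w [mw w1 _]; split => //; exists 1.
Qed.

Let v_E i f : test f -> T1 (fe f (delta_mx 0 i)) = rint nu (fun x => f x * v x 0 i).
Proof.
move=> tf; rewrite (_ : (fun x => f x * v x 0 i) = fun x => f x * v_ i x); last first.
  by apply/funext => x; rewrite mxE.
by rewrite /v_; case: cid => /= w [_ _]; exact.
Qed.

(** Coordinatewise, this is the choice of the density of the scalar functional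
[f |-> T1 (f e_i)]. *)
Let T1E (w : testform R m) : T1 w = rint nu (fun x => dotp (w x) (v x)).
Proof.
have ex (s : seq 'I_m) : exists ws : testform R m,
    (forall x, ws x = \sum_(i <- s) w x 0 i *: delta_mx 0 i) /\
    T1 ws = \sum_(i <- s) rint nu (fun x => w x 0 i * v x 0 i).
  elim: s => [|i s [ws [wsE TwsE]]].
    exists (@zero_form R m); rewrite big_nil; split; first by move=> x; rewrite big_nil zero_formE.
    by apply: current_zero => // x; exact: zero_formE.
  have ti := test_form w i.
  have [w2 w2E] := formD (fe (fun x => w x 0 i) (delta_mx 0 i)) ws.
  exists w2; split; first by move=> x; rewrite w2E wsE big_cons feE.
  by rewrite (l1.1 _ _ _ w2E) TwsE big_cons v_E.
have [ws [wsE TwsE]] := ex (index_enum 'I_m).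
rewrite (_ : T1 w = T1 ws); last by apply: current_ext => // x; rewrite wsE -row_sum_delta.
rewrite TwsE -(rint_sum nu); first by congr rint.
by move=> i; apply: bmM; [exact: bm_form|exact: bv].
Qed.

Let ineq (u u' : V) : nu [set x | Num.max (enorm u) (enorm u') - dotp u (v x) -
  dotp u' (z x - v x) < 0] = 0%E.
Proof.
set c : R := Num.max _ _.
have bu (q : V) : bm (fun x : HT => dotp q (v x)).
  by apply: bm_dotp => i; [exact: bm_cst|exact: bv].
have bzv i : bm (fun x => (z x - v x) 0 i).
  rewrite (_ : (fun x => _) = fun x => z x 0 i - v x 0 i); last by apply/funext => x; rewrite !mxE.
  exact: (bmB (bz i) (bv i)).
have bu' (q : V) : bm (fun x : HT => dotp q (z x - v x)).
  by apply: bm_dotp => i; [exact: bm_cst|exact: bzv].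
have bphi : bm (fun x : HT => c - dotp u (v x) - dotp u' (z x - v x)).
  by apply: bmB; [apply: bmB; [exact: bm_cst|exact: bu]|exact: bu'].
suff h f : test f -> (forall x, 0 <= f x) ->
    0 <= rint nu (fun x => f x * (c - dotp u (v x) - dotp u' (z x - v x))).
  exact: (@dense_ge0 _ HT R nu test (@bm_test R m) dense _ bphi h).
move=> tf f0.
have bf := bm_test tf.
have e1 x : enorm (fe f u x) <= c * f x.
  by rewrite feE// enormZ ger0_norm// mulrC ler_wpM2r// le_max lexx.
have e2 x : enorm (fe f u' x) <= c * f x.
  by rewrite feE// enormZ ger0_norm// mulrC ler_wpM2r// le_max lexx orbT.
have := key (testZ c tf) e1 e2; rewrite (rintZ nu c bf).
have -> : T2 (fe f u') = T (fe f u') - T1 (fe f u') by rewrite TE addrAC subrr add0r.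
have E1 q : T1 (fe f q) = rint nu (fun x => f x * dotp q (v x)).
  by rewrite T1E; congr rint; apply/funext => x; rewrite feE// dotpZl.
have E2 : T (fe f u') - T1 (fe f u') = rint nu (fun x => f x * dotp u' (z x - v x)).
  rewrite E1 TI -rintB.
  - by congr rint; apply/funext => x; rewrite feE// dotpZl -mulrBr (dotpC u' (z x - v x)) dotpBl !(dotpC u').
  - by apply: bm_dotp => i; [exact: bm_form|exact: bz].
  - exact: (bmM bf (bu u')).
rewrite E2 E1.
rewrite (_ : (fun x => f x * (c - dotp u (v x) - dotp u' (z x - v x))) =
  fun x => c * f x - f x * dotp u (v x) - f x * dotp u' (z x - v x)); last first.
  by apply/funext => x; ring.
rewrite (rintB nu (bmB (bmZ c bf) (bmM bf (bu u))) (bmM bf (bu' u'))).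
by rewrite (rintB nu (bmZ c bf) (bmM bf (bu u))) (rintZ nu c bf); lra.
Qed.
Let bad (p : 'rV[rat]_m * 'rV[rat]_m) : set HT :=
  let u : V := map_mx ratr p.1 in let u' : V := map_mx ratr p.2 in
  [set x | Num.max (enorm u) (enorm u') - dotp u (v x) - dotp u' (z x - v x) < 0].

Let approx_rat (u : V) e : 0 < e -> exists q : 'rV[rat]_m, enorm (u - map_mx ratr q) <= e.
Proof.
move=> e0; pose d := e / (m%:R + 1).
have d0 : 0 < d by rewrite divr_gt0// ltr_wpDl.
have ex i : exists q : rat, u 0 i < ratr q < u 0 i + d.
  have h : u 0 i < u 0 i + d by rewrite ltrDl.
  by have [q] := rat_in_itvoo h; rewrite in_itv/= => qP; exists q.
have [q qP] := choice ex; exists (\row_i q i).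
rewrite (le_trans (enorm_le_norm _))//.
apply: (@le_trans _ _ (m%:R * d)); last first.
  by rewrite /d mulrCA ler_piMr ?(ltW e0)// ler_pdivrMr ?ltr_wpDl// mul1r lerDl.
rewrite ler_wpM2l//; apply: norm_le_coord; first exact: ltW.
move=> i; rewrite !mxE; have /andP[? ?] := qP i.
by rewrite ler_norml; apply/andP; split; lra.
Qed.

(** Testing with the directions of the two parts forces them both to be
nonnegative multiples of the orientation. *)
Let parallel (a b : V) : enorm (a + b) <= 1 ->
  (forall p : 'rV[rat]_m * 'rV[rat]_m, dotp (map_mx ratr p.1) a + dotp (map_mx ratr p.2) b <=
    Num.max (enorm (map_mx ratr p.1 : V)) (enorm (map_mx ratr p.2 : V))) ->
  enorm a + enorm b <= 1.
Proof.
move=> ab H1; apply/ler_addgt0Pr => e e0.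
pose K := 1 + enorm a + enorm b.
have K0 : 0 < K by rewrite /K -addrA ltr_pwDl// addr_ge0 ?enorm_ge0.
pose d := e / K; have d0 : 0 < d by rewrite divr_gt0.
have dir (c : V) : exists u : V, enorm u <= 1 /\ dotp u c = enorm c.
  have [c0|c0] := eqVneq (enorm c) 0.
    by exists 0; rewrite enorm0 dotp0l c0.
  exists ((enorm c)^-1 *: c); rewrite enormZ ger0_norm ?invr_ge0 ?enorm_ge0// mulVf//; split => //.
  by rewrite dotpZl -sqr_enorm expr2 mulrA mulVf ?mul1r.
have [u [u1 ua]] := dir a; have [u' [u1' ub]] := dir b.
have [q qu] := approx_rat u d0; have [q' qu'] := approx_rat u' d0.
have := H1 (q, q') => /=.
set r : V := map_mx ratr q; set r' : V := map_mx ratr q'.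
have close (s s' c : V) : enorm (s - s') <= d -> dotp s c <= dotp s' c + d * enorm c.
  move=> ss; have := dotp_le (s - s') c; rewrite dotpBl.
  have : enorm (s - s') * enorm c <= d * enorm c by rewrite ler_wpM2r ?enorm_ge0.
  by lra.
have nr (s s' : V) : enorm (s - s') <= d -> enorm s <= 1 -> enorm s' <= 1 + d.
  move=> ss s1; have := ler_enormD s (s' - s); rewrite addrCA subrr addr0 (enormC s' s).
  by lra.
have c1 := close _ _ a qu; have c2 := close _ _ b qu'.
have n1 := nr _ _ qu u1; have n2 := nr _ _ qu' u1'.
have mx1 : Num.max (enorm r) (enorm r') <= 1 + d by rewrite ge_max n1 n2.
have dK : d * (1 + enorm a + enorm b) = e by rewrite /d divfK// gt_eqF.
move: c1 c2 dK; rewrite ua ub -/r -/r' => c1 c2 dK h.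
have := le_trans h mx1; move: dK; rewrite !mulrDr mulr1; lra.
Qed.

Let v_parallel : {ae nu, forall x : HT, W x -> v x = enorm (v x) *: xi x}.
Proof.
pose N := \bigcup_n (if unpickle n is Some p then bad p else set0).
have : nu.-negligible N.
  apply: negligible_bigcup => n; case: (unpickle n) => [p|]; last exact: negligible_set0.
  apply/negligibleP; last exact: ineq.
  rewrite /bad /=; set u : V := map_mx ratr p.1; set u' : V := map_mx ratr p.2.
  set c : R := Num.max _ _.
  have bzv i : bm (fun x => (z x - v x) 0 i).
    rewrite (_ : (fun x => _) = fun x => z x 0 i - v x 0 i); last by apply/funext => x; rewrite !mxE.
    exact: (bmB (bz i) (bv i)).
  have bphi : bm (fun x : HT => c - dotp u (v x) - dotp u' (z x - v x)).
    apply: bmB; [apply: bmB; [exact: bm_cst|]|]; apply: bm_dotp => i.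
    - exact: bm_cst.
    - exact: bv.
    - exact: bm_cst.
    - exact: bzv.
  have [mphi _] := bphi.
  rewrite -[X in measurable X]setTI (_ : [set x | _] = (fun x : HT =>
    c - dotp u (v x) - dotp u' (z x - v x)) @^-1` `]-oo, 0[%classic); first exact: mphi.
  by apply/seteqP; split => x /=; rewrite in_itv/=.
move=> [B [mB B0 NB]]; exists B; split => // x /= nx; apply: NB; apply: contrapT => nN.
apply: nx => Wx.
have zx : z x = xi x by rewrite /z /xiW mem_set.
have h : enorm (v x) + enorm (z x - v x) <= 1.
  apply: parallel => [|p]; first by rewrite subrKC zx xi1.
  rewrite leNgt; apply/negP => lt; apply: nN; exists (pickle p) => //.
  by rewrite pickleK /bad /=; move: lt; lra.
have e1 : enorm (z x - v x) ^+ 2 <= (1 - enorm (v x)) ^+ 2.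
  by rewrite ler_pXn2r// ?nnegrE ?enorm_ge0//; have := enorm_ge0 (z x - v x); lra.
have z1 : dotp (z x) (z x) = 1 by rewrite -sqr_enorm zx xi1// expr1n.
have vz : enorm (v x) <= dotp (v x) (z x).
  move: e1; rewrite sqr_enorm dotpBl !(dotpC _ (z x - v x)) !dotpBl z1 (dotpC (z x) (v x)).
  rewrite -(sqr_enorm (v x)); nra.
rewrite -zx; apply/eqP; rewrite -subr_eq0; apply/eqP/enorm_eq0/eqP.
rewrite -sqrf_eq0 eq_le sqr_ge0 andbT sqr_enorm dotpBl !(dotpC _ (v x - _)) !dotpBl.
rewrite !dotpZl (dotpC (z x) (_ *: _)) !dotpZl z1 (dotpC (v x) (_ *: _)) dotpZl (dotpC (z x)).
rewrite -(sqr_enorm (v x)); have := enorm_ge0 (v x); nra.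
Qed.

(** The density is [rho = |v|]. *)
Lemma split_tau : exists rho : HT -> R, [/\ bm rho, forall x, 0 <= rho x &
  T1 = tau (W `&` [set x | 0 < rho x]) (fun x => rho x * t x) xi].
Proof.
exists (fun x => enorm (v x)); split.
- split; first by apply: measurable_enorm => i; have [] := bv i.
  exists (m%:R * 1) => x; rewrite ger0_norm ?enorm_ge0// (le_trans (enorm_le_norm _))//.
  rewrite ler_wpM2l//; apply: norm_le_coord => // i.
  by rewrite mxE /v_; case: cid => /= w [].
- by move=> x; exact: enorm_ge0.
apply/funext => w; rewrite T1E.
have brho : bm (fun x : HT => enorm (v x)).
  split; first by apply: measurable_enorm => i; have [] := bv i.
  exists (m%:R * 1) => x; rewrite ger0_norm ?enorm_ge0// (le_trans (enorm_le_norm _))//.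
  rewrite ler_wpM2l//; apply: norm_le_coord => // i.
  by rewrite mxE /v_; case: cid => /= w' [].
have b1 : bm (fun x : HT => dotp (w x) (v x)).
  by apply: bm_dotp => i; [exact: bm_form|exact: bv].
have b2 : bm (fun x : HT => dotp (w x) (z x) * enorm (v x)).
  apply: (fun h => bmM h brho).
  by apply: bm_dotp => i; [exact: bm_form|exact: bz].
transitivity (rint nu (fun x => dotp (w x) (z x) * enorm (v x))).
  have [m1 _] := b1; have [m2 _] := b2.
  rewrite /rint /Rintegral; congr fine.
  have em1 := (measurable_EFinP _ _).2 m1; have em2 := (measurable_EFinP _ _).2 m2.
  suff ae : ae_eq nu setT (EFin \o (fun x : HT => dotp (w x) (v x)))
      (EFin \o (fun x => dotp (w x) (z x) * enorm (v x))).
    exact: (@ae_eq_integral _ _ _ nu setT _ _ measurableT em1 em2 ae).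
  have nW : nu.-negligible (~` W).
    apply/negligibleP; first exact: measurableC.
    exact: tau_measureW.
  have := negligibleU nW v_parallel; apply: negligibleS => x /= nx.
  apply: contrapT => /not_orP[/contrapT Wx nP]; apply: nx => _.
  move/contrapT : nP => /(_ Wx) vE; congr (_%:E).
  by rewrite {1}vE dotpC dotpZl mulrC dotpC /z /xiW mem_set.
apply: (etrans (rint_finite_density _ _ itW b2)).
rewrite /tau [RHS]Rintegral_mkcond; apply: eq_Rintegral => x _.
rewrite patch_setT /tW /z /xiW !patchE in_setI.
case: (boolP (x \in W)) => xW /=; last by rewrite mulr0.
have [x0|x0] := boolP (x \in [set x | 0 < enorm (v x)]); first by rewrite mulrA.
suff -> : enorm (v x) = 0 by rewrite mulr0 mul0r.
by apply/eqP; rewrite eq_le enorm_ge0 andbT leNgt; apply: contra x0 => x0; rewrite inE.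
Qed.

Lemma integrable_tW : mu.-integrable setT (EFin \o tW W t).
Proof. by have := itW; rewrite patch_setT. Qed.

End splitting.

(** * Densities with respect to one-dimensional measures *)

Section density_points.
Context {R : realType} {m : nat}.
Local Notation V := 'rV[R]_m.
Local Notation H := (@hausdorff1 R m).
Local Notation HT := (H1type R m).
Local Notation mu := (H1 R m).

Definition cball (x : V) (r : R) : set HT := [set y : V | `|y - x| <= r].

Lemma measurable_cball x r : measurable (cball x r).
Proof.
have c : continuous (fun y : V => `|y - x|).
  move=> y; apply/(@cvgrPdist_le _ _ _ (nbhs y)) => e e0.
  have : nbhs y (ball y e) by exact: nbhsx_ballx.
  apply: filterS => y'; rewrite -ball_normE /= => yy.
  apply: le_trans (ler_dist_dist _ _) _; apply: le_trans (ltW yy).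
  by rewrite opprB addrA subrK.
have mc := continuous_H1 c.
rewrite -[X in measurable X]setTI (_ : cball x r = (fun y : V => `|y - x|) @^-1` `]-oo, r]%classic).
  exact: mc.
by apply/seteqP; split => y; rewrite /cball /= in_itv/=.
Qed.

Definition mesh (k : nat) : R := 2^-1 ^+ k.

Lemma mesh_gt0 k : 0 < mesh k. Proof. by rewrite exprn_gt0. Qed.

Lemma meshS k : mesh k = 2 * mesh k.+1.
Proof. by rewrite /mesh exprS mulrA mulfV ?mul1r. Qed.

Lemma mesh_le k n : (k <= n)%N -> mesh n <= mesh k.
Proof. by move=> kn; rewrite ler_wiXn2l// invf_le1// ler1n. Qed.

Lemma mesh_small e : 0 < e -> exists k, mesh k < e.
Proof.
move=> e0; have : mesh k @[k --> \oo] --> (0 : R).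
  by apply: cvg_expr; rewrite ger0_norm ?invr_ge0// invf_lt1// ltr1n.
move/cvgrPdist_lt => /(_ _ e0)[N _ /(_ N (leqnn N))].
by rewrite sub0r normrN ger0_norm ?ltW ?mesh_gt0// => h; exists N.
Qed.

Lemma mesh_scale r : 0 < r -> r <= 1 -> exists k, mesh k.+1 < r /\ r <= mesh k.
Proof.
move=> r0 r1; have ex : exists k, mesh k.+1 < r.
  have [k kr] := mesh_small r0; exists k; apply: le_lt_trans kr; exact: mesh_le.
exists (ex_minn ex); case: ex_minnP => k kr kmin; split => //.
case: k kr kmin => [|k] kr kmin; first by rewrite /mesh expr0.
by rewrite leNgt; apply/negP => /kmin; rewrite ltnn.
Qed.

Definition dyadic (p : nat * 'rV[int]_m) : set HT :=
  [set x : V | forall i, Num.floor (x 0 i / mesh p.1) = p.2 0 i].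

Lemma dyadicP p (x : V) : dyadic p x -> forall i,
  (p.2 0 i)%:~R * mesh p.1 <= x 0 i /\ x 0 i < (p.2 0 i)%:~R * mesh p.1 + mesh p.1.
Proof.
move=> px i; rewrite -(px i); have k0 := mesh_gt0 p.1.
split; first by rewrite -ler_pdivlMr// floor_le.
have := @floorD1_gt _ (x 0 i / mesh p.1).
by rewrite intrD ltr_pdivrMr// mulrDl mul1r.
Qed.

Lemma dyadic_diam p (x y : V) : dyadic p x -> dyadic p y -> `|x - y| <= mesh p.1.
Proof.
move=> px py; apply: norm_le_coord; first exact/ltW/mesh_gt0.
move=> i; rewrite !mxE; have [x1 x2] := dyadicP px i; have [y1 y2] := dyadicP py i.
by rewrite ler_norml; apply/andP; split; lra.
Qed.

Lemma measurable_dyadic p : measurable (dyadic p).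
Proof.
have -> : dyadic p = \bigcap_(i in [set: 'I_m])
    [set x : V | Num.floor (x 0 i / mesh p.1) = p.2 0 i].
  by apply/seteqP; split => x xp i; [move=> _; exact: xp|exact: xp i Logic.I].
apply: (@fin_bigcap_measurable _ HT) => // i _.
pose I0 := `[(p.2 0 i)%:~R * mesh p.1, (p.2 0 i)%:~R * mesh p.1 + mesh p.1[%classic : set R.
rewrite (_ : [set x | _] = (fun x : V => x 0 i) @^-1` I0).
  have mc : measurable_fun setT ((fun x : V => x 0 i) : HT -> R).
    by apply: continuous_H1; exact: coord_continuous.
  rewrite -[X in measurable X]setTI; apply: (mc (@measurableT _ HT)).
  exact: measurable_itv.
apply/seteqP; split => x /=; rewrite /I0 /= in_itv/=; have k0 := mesh_gt0 p.1.
  move=> <-; apply/andP; split; first by rewrite -ler_pdivlMr// floor_le.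
  have := @floorD1_gt _ (x 0 i / mesh p.1).
  by rewrite intrD ltr_pdivrMr// mulrDl mul1r.
move=> /andP[x1 x2]; apply: floor_def; rewrite ler_pdivlMr// ltr_pdivrMr// x1/=.
by rewrite intrD mulrDl mul1r.
Qed.

Lemma dyadic_sub p p' : (p.1 <= p'.1)%N -> dyadic p `&` dyadic p' !=set0 ->
  dyadic p' `<=` dyadic p.
Proof.
move=> kk [x [px p'x]] y p'y i; rewrite -(px i).
have fl (u v : V) : dyadic p' u -> dyadic p' v ->
    Num.floor (u 0 i / mesh p.1) <= Num.floor (v 0 i / mesh p.1).
  move=> p'u p'v; rewrite leNgt; apply/negP => lt.
  pose n := Num.floor (u 0 i / mesh p.1).
  pose K : R := mesh p.1 / mesh p'.1.
  have KE : K = (2 ^ (p'.1 - p.1))%N%:R.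
    have h : mesh p'.1 = mesh p.1 * mesh (p'.1 - p.1) by rewrite /mesh -exprD subnKC.
    rewrite /K h invfM mulrA mulfV ?gt_eqF ?mesh_gt0// mul1r.
    by rewrite /mesh exprVn invrK natrX.
  have uv : Num.floor (u 0 i / mesh p'.1) = Num.floor (v 0 i / mesh p'.1).
    by rewrite (p'u i) (p'v i).
  have sc (w : V) : w 0 i / mesh p'.1 = K * (w 0 i / mesh p.1).
    by rewrite /K mulrCA mulrAC mulfV ?mul1r ?gt_eqF ?mesh_gt0.
  have K0 : 0 < K by rewrite divr_gt0 ?mesh_gt0.
  have v1 : v 0 i / mesh p.1 < n%:~R by rewrite -floor_lt_int.
  have u1 : n%:~R <= u 0 i / mesh p.1 by exact: floor_le.
  pose N : int := (2 ^ (p'.1 - p.1))%N%:Z * n.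
  have NE : N%:~R = K * n%:~R by rewrite /N intrM KE.
  have h1 : N <= Num.floor (u 0 i / mesh p'.1).
    by rewrite floor_ge_int NE sc ler_pM2l.
  have h2 : Num.floor (v 0 i / mesh p'.1) < N.
    by rewrite floor_lt_int NE sc ltr_pM2l.
  by move: h1; rewrite uv leNgt h2.
by apply: le_anti; rewrite !fl.
Qed.

Lemma dyadic_self k (x : V) : dyadic (k, \row_i Num.floor (x 0 i / mesh k)) x.
Proof. by move=> i; rewrite mxE. Qed.

Section weak_type.
Variable nu : {finite_measure set HT -> \bar R}.
Variables (F : set HT) (U S : set V) (s : R).
Hypothesis mF : measurable F.
Hypothesis oU : open U.
Hypothesis s0 : 0 < s.
Hypothesis SU : S `<=` U.
Hypothesis Sr : forall x, S x -> forall d, 0 < d -> exists r, [/\ 0 < r, r < d &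
  s * r < fine (nu (F `&` cball x r))].

Let c := s / (2 * (3 ^ m)%:R).

Let c0 : 0 < c. Proof. by rewrite divr_gt0// mulr_gt0// ltr0n expn_gt0. Qed.

Let good (p : nat * 'rV[int]_m) : Prop :=
  c * mesh p.1 <= fine (nu (F `&` dyadic p)) /\ dyadic p `<=` U.

(** A ball which carries much mass is covered by [3 ^ m] cubes of the same scale,
one of which carries much mass too. *)
Let good_near k0 x : S x -> exists p, [/\ (k0 <= p.1)%N, good p & exists2 y : V, dyadic p y &
  `|x - y| <= 2 * mesh p.1].
Proof.
move=> Sx; have [e /= e0 eU] : exists2 e : R, 0 < e & ball x e `<=` U.
  by have /nbhs_ballP[e e0 eU] := open_nbhs_nbhs (conj oU (SU Sx)); exists e.
have d0 : 0 < Num.min (e / 4) (mesh k0) by rewrite lt_min mesh_gt0 divr_gt0.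
have [r [r0 + rs]] := Sr Sx d0; rewrite lt_min => /andP[re rk].
have r1 : r <= 1.
  by apply: le_trans (ltW rk) _; rewrite -[leRHS](expr0 (2^-1 : R)); exact: (@mesh_le 0).
have [k [kr rk']] := mesh_scale r0 r1.
have k0k : (k0 <= k)%N.
  rewrite leqNgt; apply/negP => kk0; have := mesh_le kk0.
  by rewrite leNgt => /negP; apply; exact: lt_trans kr rk.
have mk := mesh_gt0 k.
pose idx (h : {ffun 'I_m -> 'I_3}) : 'rV[int]_m :=
  \row_i (Num.floor (x 0 i / mesh k) + (h i : nat)%:Z - 1).
have near h (y : V) : dyadic (k, idx h) y -> `|x - y| <= 2 * mesh k.
  move=> yh; apply: norm_le_coord; first by rewrite mulr_ge0// ltW.
  move=> i; have [] := dyadicP yh i; rewrite /= !mxE => y1 y2.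
  have [] := dyadicP (dyadic_self k x) i; rewrite /= !mxE => x1 x2.
  have hi : 0 <= ((h i : nat)%:R : R) <= 2.
    by rewrite ler0n/= (ler_nat R (h i) 2) -ltnS ltn_ord.
  move: y1 y2 x1 x2; rewrite !intrD mulrN1z -pmulrn.
  move: (Num.floor _)%:~R hi => z; move: (_%:R) => q /andP[q0 q2].
  have q0m : 0 <= q * mesh k by rewrite mulr_ge0// ltW.
  have q2m : q * mesh k <= 2 * mesh k by rewrite ler_pM2r.
  rewrite !mulrDl mulN1r => *; rewrite ler_norml; apply/andP; split; lra.
have sub h : dyadic (k, idx h) `<=` U.
  move=> y yh; apply: eU; rewrite -ball_normE /=; apply: le_lt_trans (near _ _ yh) _.
  by rewrite meshS mulrA; move: kr re; lra.
have cov (y : V) : cball x r y -> exists h, dyadic (k, idx h) y.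
  move=> xy; have yi i : `|y 0 i - x 0 i| <= mesh k.
    by have := coord_le_norm (y - x) i; rewrite !mxE => /le_trans; apply; exact: le_trans xy rk'.
  have ex i : exists j : 'I_3, Num.floor (y 0 i / mesh k) =
      Num.floor (x 0 i / mesh k) + (j : nat)%:Z - 1.
    set a := y 0 i / mesh k; set b := x 0 i / mesh k.
    have ab : `|a - b| <= 1.
      rewrite -mulrBl normrM (gtr0_norm (x := (mesh k)^-1)) ?invr_gt0//.
      by rewrite ler_pdivrMr// mul1r.
    have [a1 a2] := andP (floor_itv a); have [b1 b2] := andP (floor_itv b).
    move: ab; rewrite ler_norml => /andP[ab1 ab2].
    have f1 : Num.floor b - 1 <= Num.floor a.
      rewrite floor_ge_int intrB; lra.
    have f2 : Num.floor a < Num.floor b + 2.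
      rewrite floor_lt_int intrD; move: b2; rewrite intrD; lra.
    pose j := absz (Num.floor a - Num.floor b + 1).
    have jE : j%:Z = Num.floor a - Num.floor b + 1 by rewrite /j gez0_abs// addrAC subr_ge0 -lerBlDr.
    have j3 : (j < 3)%N by rewrite -ltz_nat jE addrAC ltrBlDl -ltrBrDr -addrA.
    by exists (Ordinal j3); rewrite /= jE; ring.
  have [h hP] := choice ex; exists (finfun h) => i.
  by rewrite /= mxE ffunE hP.
have mc := measurable_cball x r.
have mD h : measurable (F `&` dyadic (k, idx h)).
  by apply: measurableI => //; exact: measurable_dyadic.
have [h hP] : exists h, s * r / (3 ^ m)%:R <= fine (nu (F `&` dyadic (k, idx h))).
  apply: contrapT => nh.
  have lt h : fine (nu (F `&` dyadic (k, idx h))) <= s * r / (3 ^ m)%:R.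
    by rewrite leNgt; apply/negP => lt; apply: nh; exists h; exact: ltW.
  have : fine (nu (F `&` cball x r)) <= s * r; last by rewrite leNgt rs.
  rewrite -rint_indic; last exact: measurableI.
  apply: (@le_trans _ _ (rint nu (fun y => \sum_h \1_(F `&` dyadic (k, idx h)) y))).
    apply: rint_le => [||y].
    - by apply: bm_indic; exact: measurableI.
    - by apply: bm_sum => h; exact: bm_indic.
    rewrite indicE; have [/set_mem[Fy /cov[h hy]]|_] := boolP (_ \in _); last exact: sumr_ge0.
    rewrite (bigD1 h)//= [X in X + _]indicE mem_set; last by split.
    by rewrite lerDl; apply: sumr_ge0.
  rewrite (rint_sum nu); last by move=> h; exact: bm_indic.
  apply: (@le_trans _ _ (\sum_(h : {ffun 'I_m -> 'I_3}) s * r / (3 ^ m)%:R)).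
    by apply: ler_sum => h _; rewrite rint_indic.
  rewrite sumr_const card_ffun !card_ord -[leLHS]mulr_natr divfK// pnatr_eq0 expn_eq0.
exists (k, idx h); split => //.
  split => //=; apply: le_trans hP; rewrite /c meshS.
  have e3 : s / (2 * (3 ^ m)%:R) * (2 * mesh k.+1) = s * mesh k.+1 / (3 ^ m)%:R.
    by field; rewrite pnatr_eq0 expn_eq0.
  by rewrite e3 ler_pM2r ?invr_gt0 ?ltr0n ?expn_gt0// ler_pM2l// ltW.
have [y yh] : dyadic (k, idx h) !=set0.
  apply/set0P/eqP => D0; move: hP; rewrite D0 setI0 measure0 /=.
  by rewrite leNgt divr_gt0 ?mulr_gt0// ltr0n expn_gt0.
by exists y => //; exact: near yh.
Qed.

(** Among the good cubes finer than a given scale the maximal ones are disjoint,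
and their enlargements cover [S].  The lengths of these enlargements are
controlled by the masses of the disjoint cubes, which all lie in [U]; no doubling
condition is involved. *)
Lemma weak_type : (H S <= (10 * m%:R * (3 ^ m)%:R / s * fine (nu (F `&` U)))%:E)%E.
Proof.
apply: H_le => d d0.
have K0 : 0 < 5 * m%:R + 1 :> R by rewrite ltr_wpDl.
have [k0 k0d] := mesh_small (divr_gt0 d0 K0).
pose maxl p := [/\ (k0 <= p.1)%N, good p & forall q, (k0 <= q.1 < p.1)%N -> good q ->
  ~ (dyadic p `<=` dyadic q)].
have ex_max p : (k0 <= p.1)%N -> good p -> exists q, [/\ maxl q, (q.1 <= p.1)%N & dyadic p `<=` dyadic q].
  have [n] := ubnP p.1; elim: n p => // n IH p pn kp gp.
  have [mp|nmp] := pselect (maxl p).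
    by exists p; split; [exact: mp|exact: leqnn|exact: subset_refl].
  have [q [/andP[kq qp] gq pq]] : exists q, [/\ (k0 <= q.1 < p.1)%N, good q & dyadic p `<=` dyadic q].
    apply: contrapT => nq; apply: nmp; split; [exact: kp|exact: gp|].
    by move=> q kq gq pq; apply: nq; exists q; split; [exact: kq|exact: gq|exact: pq].
  have [|q' [mq' q'q qq']] := IH q _ kq gq; first by rewrite (leq_trans qp).
  exists q'; split; [exact: mq'|exact: leq_trans q'q (ltnW qp)|exact: subset_trans pq qq'].
pose nbd (p : nat * 'rV[int]_m) : set V :=
  [set x | exists2 y : V, dyadic p y & `|x - y| <= 2 * mesh p.1].
pose sel (A : nat * 'rV[int]_m -> set V) n : set V :=
  if unpickle n is Some p then if `[< maxl p /\ pickle p = n >] then A p else set0 else set0.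
have selP (A : nat * 'rV[int]_m -> set V) n : sel A n = set0 \/
    exists p, [/\ maxl p, pickle p = n & sel A n = A p].
  rewrite /sel; case E : (unpickle n) => [p|]; last by left.
  by case: asboolP => [[mp pn]|_]; [right; exists p|left].
have selE (A : nat * 'rV[int]_m -> set V) p : maxl p -> sel A (pickle p) = A p.
  by move=> mp; rewrite /sel pickleK asboolT.
have nbd_diam p : (diam (nbd p) <= (5 * m%:R * mesh p.1)%:E)%E.
  have mp := mesh_gt0 p.1.
  apply: diam_le; first by rewrite lee_fin !mulr_ge0// ltW.
  move=> x x' [y py xy] [y' py' xy']; rewrite lee_fin (le_trans (enorm_le_norm _))//.
  rewrite (mulrC 5) -mulrA ler_wpM2l//.
  have := dyadic_diam py py'; have := ler_distD y x x'; have := ler_distD y' y x'.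
  by rewrite (distrC y' x'); move: xy xy'; lra.
have nbd_le p : maxl p -> (diam (nbd p) <= (10 * m%:R * (3 ^ m)%:R / s)%:E * nu (F `&` dyadic p))%E.
  move=> [_ [gp _] _]; apply: (le_trans (nbd_diam p)).
  rewrite -[X in (_ * X)%E]fineK ?fin_num_measure//; last first.
    by apply: measurableI => //; exact: measurable_dyadic.
  rewrite -EFinM lee_fin.
  have -> : 10 * m%:R * (3 ^ m)%:R / s = 5 * m%:R / c.
    rewrite /c; field; rewrite ?pnatr_eq0 ?expn_eq0 ?gt_eqF//.
  rewrite -(mulrA _ c^-1); apply: ler_wpM2l; first by rewrite mulr_ge0.
  by rewrite ler_pdivlMl.
have cov : S `<=` \bigcup_n sel nbd n.
  move=> x Sx; have [p [kp gp [y py xy]]] := good_near k0 Sx.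
  have [q [mq qp pq]] := ex_max p kp gp.
  exists (pickle q) => //; rewrite selE//; exists y; first exact: pq.
  by apply: (le_trans xy); rewrite ler_pM2l// mesh_le.
have small n : (diam (sel nbd n) <= d%:E)%E.
  have [->|[p [[kp _ _] _ ->]]] := selP nbd n.
    by apply: diam_le; rewrite ?lee_fin ?(ltW d0).
  apply: (le_trans (nbd_diam p)); rewrite lee_fin.
  apply: (@le_trans _ _ ((5 * m%:R + 1) * mesh k0)).
    apply: ler_pM; [by rewrite mulr_ge0|exact/ltW/mesh_gt0|by rewrite lerDl|exact: mesh_le].
  by rewrite mulrC -ler_pdivlMr// ltW.
apply: (le_trans (Hd_le cov small)).
pose B n : set HT := F `&` sel dyadic n.
have mB n : measurable (B n).
  apply: measurableI => //; have [->|[p [_ _ ->]]] := selP dyadic n; first exact: measurable0.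
  exact: measurable_dyadic.
have tB : trivIset setT B.
  apply/trivIsetP => i j _ _ ij; apply/seteqP; split => // x [[_ xi] [_ xj]].
  have [iE|[p [mp pi pE]]] := selP dyadic i; first by rewrite iE in xi.
  have [jE|[q [mq qj qE]]] := selP dyadic j; first by rewrite jE in xj.
  rewrite pE in xi; rewrite qE in xj.
  have main p' q' : maxl p' -> maxl q' -> (p'.1 < q'.1)%N -> dyadic p' x -> dyadic q' x -> False.
    move=> [kp gp _] [_ _ nq] pq px qx; apply: (nq p' _ gp); first by rewrite kp.
    by apply: dyadic_sub (ltnW pq) _; exists x.
  case: (ltngtP p.1 q.1) => pq.
  - exact: main mp mq pq xi xj.
  - exact: main mq mp pq xj xi.
  move: ij; rewrite -pi -qj (_ : p = q) ?eqxx//.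
  rewrite (surjective_pairing p) (surjective_pairing q) pq; congr (_, _).
  by apply/rowP => l; rewrite -(xi l) -(xj l) pq.
apply: (@le_trans _ _ (\sum_(n <oo) (10 * m%:R * (3 ^ m)%:R / s)%:E * nu (B n))%E).
  apply: lee_nneseries => [n _ _|n _]; first exact: diam_ge0.
  have [E|[p [mp pn E]]] := selP nbd n.
    rewrite E diam0 mule_ge0// lee_fin; apply: mulr_ge0; last by rewrite invr_ge0 ltW.
    by rewrite mulr_ge0.
  by rewrite E /B -pn selE//; exact: nbd_le.
rewrite nneseriesZl//.
have Cge0 : 0 <= 10 * m%:R * (3 ^ m)%:R / s.
  by apply: mulr_ge0; [rewrite mulr_ge0|rewrite invr_ge0 ltW].
have mU : measurable (U : set HT) by exact: open_H_caratheodory.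
rewrite [leRHS]EFinM fineK; last by apply: fin_num_measure; exact: measurableI.
apply: lee_wpmul2l; first by rewrite lee_fin.
have mUB : measurable (\bigcup_n B n) by exact: bigcupT_measurable.
have -> : (\sum_(n <oo) nu (B n))%E = nu (\bigcup_n B n).
  by apply/cvg_lim => //; exact: measure_sigma_additive.
apply: le_measure; rewrite ?inE//; first exact: measurableI.
move=> x [n _ [Fx]]; have [->//|[p [[_ [_ pU] _] _ ->]] xp] := selP dyadic n.
by split => //; exact: pU.
Qed.

End weak_type.

End density_points.

Section tangent.
Context {R : realType} {m : nat}.
Local Notation V := 'rV[R]_m.
Local Notation H := (@hausdorff1 R m).
Local Notation HT := (H1type R m).
Local Notation mu := (H1 R m).

Definition density0 (nu : {finite_measure set HT -> \bar R}) (F : set HT) (x : V) :=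
  forall e, 0 < e -> exists2 d, 0 < d & forall r, 0 < r -> r < d ->
    fine (nu (F `&` cball x r)) <= e * r.

Variables (W : set V) (t : V -> R) (xi : V -> V).
Hypothesis mW : measurable (W : set HT).
Hypothesis rW : countably_1rectifiable W.
Hypothesis t0 : forall x, W x -> 0 < t x.
Hypothesis tloc : forall K : set V, compact K -> mu.-integrable (W `&` K) (EFin \o t).
Hypothesis itW : mu.-integrable setT (EFin \o (tW W t \_ setT)).
Local Notation nu := (tau_measure mW t0 tloc (@measurableT _ HT) itW).

Let nuE (A : set HT) : nu A = (\int[mu]_(x in A) (tW W t x)%:E)%E.
Proof.
apply: (etrans (finite_densityE _ _ itW A)); apply: eq_integral => x _.
by rewrite patch_setT.
Qed.

Let H_le_nu (A : set HT) K : measurable A -> 0 <= K -> (forall x, A x -> 1 <= K * tW W t x) ->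
  (H A <= K%:E * nu A)%E.
Proof.
move=> mA K0 AK; rewrite nuE.
have mt : measurable_fun A (EFin \o tW W t).
  apply/measurable_EFinP; apply: measurable_funTS; exact: measurable_tW.
have e1 : (\int[mu]_(x in A) (cst 1%E) x = H A)%E.
  by have := integral_cst mu mA 1; rewrite mul1e; exact.
have e2 : (\int[mu]_(x in A) (K%:E * (tW W t x)%:E) = K%:E * \int[mu]_(x in A) (tW W t x)%:E)%E.
  apply: (ge0_integralZl_EFin _ mA) => //.
  by move=> x _; rewrite lee_fin; exact: tW_ge0.
rewrite -e1 -e2; apply: (@ge0_le_integral _ _ _ mu A mA) => [x _|||x Ax].
- exact: lee01.
- exact: measurable_cst.
- by apply: measurable_funeM.
- by rewrite -EFinM lee_fin AK.
Qed.

Let dense (E : set HT) : measurable E -> approximable nu E.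
Proof. exact: tau_measure_dense. Qed.

(** The
bad points in an open set where [F] is small are few by the weak-type
inequality; there is such an open set up to a small measure. *)
Lemma density_null (F : set HT) : measurable F ->
  H [set x | [/\ W x, ~ F x & ~ density0 nu F x]] = 0%E.
Proof.
move=> mF; pose S n j : set V := [set x | [/\ W x, j.+1%:R^-1 <= t x, ~ F x &
  forall d, 0 < d -> exists r, [/\ 0 < r, r < d & n.+1%:R^-1 * r < fine (nu (F `&` cball x r))]]].
apply: (@H0S _ _ _ (\bigcup_n \bigcup_j S n j)).
  move=> x [Wx nFx nd].
  have [e e0 he] : exists2 e, 0 < e & forall d, 0 < d -> exists r, [/\ 0 < r, r < d &
      e * r < fine (nu (F `&` cball x r))].
    apply: contrapT => ne; apply: nd => e e0; apply: contrapT => nd; apply: ne.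
    exists e => // d d0; apply: contrapT => nr; apply: nd; exists d => // r r0 rd.
    by rewrite leNgt; apply/negP => lt; apply: nr; exists r.
  have [n ne] : exists n, n.+1%:R^-1 <= e.
    have [N _ NP] := near_infty_natSinv_lt (PosNum e0).
    by exists N; exact/ltW/(NP N)/leqnn.
  have [j jt] : exists j, j.+1%:R^-1 <= t x.
    have [N _ NP] := near_infty_natSinv_lt (PosNum (t0 Wx)).
    by exists N; exact/ltW/(NP N)/leqnn.
  exists n => //; exists j => //; split => // d d0; have [r [r0 rd er]] := he d d0.
  by exists r; split => //; apply: le_lt_trans er; rewrite ler_pM2r.
apply: H_bigcup0 => n; apply: H_bigcup0 => j; apply/eqP; rewrite eq_le H_ge0 andbT.
apply/lee_addgt0Pr => e e0; rewrite add0e.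
have s0 : 0 < n.+1%:R^-1 :> R by rewrite invr_gt0.
pose C : R := 10 * m%:R * (3 ^ m)%:R / n.+1%:R^-1.
have C0 : 0 <= C by apply: mulr_ge0; [rewrite mulr_ge0|rewrite invrK].
pose K : R := 2 * C + 2 * j.+1%:R.
have K0 : 0 < K by rewrite ltr_wpDl ?mulr_ge0// mulr_gt0.
have [f [tf f01 fF]] := dense mF (divr_gt0 e0 K0).
set eta := e / K in fF; have cf := smooth_continuous (proj1 tf).
pose U : set V := [set x | f x < 2^-1].
have oU : open U.
  rewrite (_ : U = f @^-1` `]-oo, 2^-1[%classic); last by apply/seteqP; split => x /=; rewrite /U in_itv.
  by move/continuousP : cf; apply; exact: interval_open.
have mU : measurable (U : set HT) by exact: open_H_caratheodory.
pose G : set HT := ~` U `\` F.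
have mG : measurable G by apply: measurableD => //; exact: measurableC.
have bd : bm (fun x : HT => `|f x - \1_F x|).
  exact: (bm_norm (bmB (bm_test tf) (bm_indic R mF))).
have small (A : set HT) : measurable A -> (forall x, A x -> 2^-1 <= `|f x - \1_F x|) ->
    fine (nu A) <= 2 * eta.
  move=> mA Af; rewrite -rint_indic//; apply: (@le_trans _ _ (rint nu (fun x => 2 * `|f x - \1_F x|))).
    apply: rint_le => [||x]; [exact: bm_indic|exact: bmZ|].
    rewrite indicE; have [/set_mem/Af xA|_] := boolP (x \in A); last by rewrite mulr_ge0.
    by rewrite -ler_pdivrMl// mulr1.
  by rewrite (rintZ nu 2 bd) ler_pM2l.
have sFU : fine (nu (F `&` U)) <= 2 * eta.
  apply: small => [|x [Fx Ux]]; first exact: measurableI.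
  rewrite indicE mem_set//= distrC; apply: le_trans (ler_norm _).
  by move: Ux; rewrite /U /=; lra.
have sG : fine (nu G) <= 2 * eta.
  apply: small => // x [nUx nFx]; rewrite indicE memNset//= subr0; apply: le_trans (ler_norm _).
  by rewrite leNgt; apply/negP.
pose Wj : set HT := [set x | j.+1%:R^-1 <= tW W t x].
have mWj : measurable Wj.
  have mt := measurable_tW mW tloc.
  rewrite -[X in measurable X]setTI (_ : Wj = tW W t @^-1` `[j.+1%:R^-1, +oo[%classic); first exact: mt.
  by apply/seteqP; split => x /=; rewrite /Wj /= in_itv/= andbT.
have h1 : (H (S n j `&` U) <= (C * (2 * eta))%:E)%E.
  have := @weak_type _ _ nu F U (S n j `&` U) n.+1%:R^-1 mF oU s0.
  move=> /(_ (@subIsetr _ _ _)) wt; apply: le_trans (wt _) _ => [x [[_ _ _ Sx] _]//|].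
  by rewrite lee_fin ler_wpM2l.
have h2 : (H (G `&` Wj) <= (j.+1%:R * (2 * eta))%:E)%E.
  have mGW : measurable (G `&` Wj) by exact: measurableI.
  apply: (le_trans (@H_le_nu _ j.+1%:R mGW _ _)) => //.
    by move=> x [_ Wjx]; rewrite -ler_pdivrMl// mulr1.
  rewrite EFinM; apply: lee_wpmul2l; first by rewrite lee_fin.
  have le1 : (nu (G `&` Wj) <= nu G)%E by apply: le_measure; rewrite ?inE.
  apply: (le_trans le1); rewrite -[X in (X <= _)%E]fineK ?lee_fin//.
  exact: fin_num_measure.
have cov : S n j `<=` (S n j `&` U) `|` (G `&` Wj).
  move=> x Sx; have [Ux|nUx] := pselect (U x); first by left.
  right; have [Wx tx nFx _] := Sx; split => //.
  by rewrite /Wj /= /tW patchE mem_set.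
apply: (le_trans (le_H cov)).
apply: (le_trans (outer_measureU2 (@hausdorff1 R m : {outer_measure set V -> \bar R}) _ _)).
apply: (le_trans (leeD h1 h2)); rewrite -EFinD lee_fin -mulrDl.
have -> : (C + j.+1%:R) * (2 * eta) = K * eta by rewrite /K; ring.
by rewrite /eta mulrCA mulfV ?mulr1// gt_eqF.
Qed.

Variable rho : HT -> R.
Hypothesis brho : bm rho.
Hypothesis rho0 : forall x, 0 <= rho x.

Local Notation W1 := (W `&` [set x | 0 < rho x]).

Let intW (g : HT -> R) : bm g -> \int[mu]_(y in W) (g y * t y) = rint nu g.
Proof.
move=> bg; apply/esym; apply: (etrans (rint_finite_density _ _ itW bg)).
rewrite [RHS]Rintegral_mkcond; apply: eq_Rintegral => x _.
by rewrite patch_setT /tW !patchE; case: ifP; rewrite ?mulr0.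
Qed.

Let intW1 (g : HT -> R) : bm g -> \int[mu]_(y in W1) (g y * (rho y * t y)) = rint nu (fun x => g x * rho x).
Proof.
move=> bg; apply/esym; apply: (etrans (rint_finite_density _ _ itW (bmM bg brho))).
rewrite [RHS]Rintegral_mkcond; apply: eq_Rintegral => x _.
rewrite patch_setT /tW !patchE in_setI; case: (x \in W) => /=; last by rewrite mulr0.
have [x0|x0] := boolP (x \in [set x | 0 < rho x]); first by rewrite mulrA.
suff -> : rho x = 0 by rewrite mulr0 mul0r.
by apply/eqP; rewrite eq_le rho0 andbT leNgt; apply: contra x0 => x0; rewrite inE.
Qed.

Let bm_blowup (f : V -> R) (x : V) l C : continuous f -> (forall y, `|f y| <= C) ->
  bm (fun y : HT => f (l *: ((y : V) - x))).
Proof.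
move=> cf fC; split; last by exists C => y; exact: fC.
apply: continuous_H1 => y.
apply: (@continuous_comp _ _ _ (fun y : V => l *: (y - x)) f); last exact: cf.
apply/(@cvgrPdist_le _ _ _ (nbhs y)) => e e0.
have l0 : 0 < `|l| + 1 by rewrite ltr_wpDl.
have : nbhs y (ball y (e / (`|l| + 1))) by apply: nbhsx_ballx; rewrite divr_gt0.
apply: filterS => y'; rewrite -ball_normE /= => yy.
rewrite -scalerBr normrZ opprB addrA subrK.
apply: (@le_trans _ _ ((`|l| + 1) * `|y - y'|)); first by rewrite ler_wpM2r// lerDl.
by rewrite mulrC -ler_pdivlMr// ltW.
Qed.

Let hat (y : V) : R := Num.max 0 (2 - `|y|).

Let hat_continuous : continuous hat.
Proof.
move=> y; apply/(@cvgrPdist_le _ _ _ (nbhs y)) => e e0.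
have : nbhs y (ball y e) by exact: nbhsx_ballx.
apply: filterS => y'; rewrite -ball_normE /= => yy; rewrite /hat.
have := ler_dist_dist y y'; move: (`|y|) (`|y'|) (`|y - y'|) yy => p q s.
rewrite !ler_norml => ? /andP[? ?].
by case: (leP 0 (2 - p)); case: (leP 0 (2 - q)) => ? ?; apply/andP; split; lra.
Qed.

Let compact_cball r : compact [set y : V | `|y| <= r].
Proof.
have -> : [set y : V | `|y| <= r] = closed_ball_ (fun y : V => `|y|) 0 r.
  by apply/seteqP; split => y; rewrite /closed_ball_ /= sub0r normrN.
apply: bounded_closed_compact; last exact: closed_closed_ball_.
exists r; split; first exact: num_real.
by move=> M rM y; rewrite /closed_ball_ /= sub0r normrN => /le_trans; apply; exact: ltW.
Qed.

Let hat_support : compact (closure [set y | hat y != 0]).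
Proof.
apply: (subclosed_compact _ (@compact_cball 2)); first exact: closed_closure.
have c2 := compact_closed (@norm_hausdorff _ _) (@compact_cball 2).
rewrite [X in _ `<=` X](closure_id _).1//; apply: closure_subset => y /=.
rewrite /hat; case: (leP 0 (2 - `|y|)) => [|_]; last by rewrite eqxx.
by rewrite subr_ge0.
Qed.

Let right_near (P : R -> Prop) : (\forall l \near 0^'+, P l) ->
  exists2 d, 0 < d & forall l, 0 < l -> l < d -> P l.
Proof.
move=> nP; have /nbhs_ballP[d /= d0 dP] : nbhs (0 : R) (fun l => 0 < l -> P l) by exact: nP.
exists d => // l l0 ld; apply: dP => //; rewrite -ball_normE /= sub0r normrN.
by rewrite gtr0_norm.
Qed.

(** Blowing up against a fixed function which is at least 1 on the unit ball. *)
Let upper_density (x v : V) : approx_tangent_line W t x v -> exists A d, [/\ 0 <= A, 0 < d &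
  forall r, 0 < r -> r < d -> fine (nu (cball x r)) <= A * r].
Proof.
move=> /(_ hat hat_continuous hat_support) /cvgrPdist_le /(_ 1 ltr01) /right_near[d d0 dP].
set L := t x * _ in dP; exists (`|L| + 1), d; split; [by rewrite addr_ge0|exact: d0|move=> r r0 rd].
have hat2 y : `|hat y| <= 2.
  rewrite /hat; case: (leP 0 (2 - `|y|)) => ?; last by rewrite normr0.
  by rewrite ger0_norm// gerBl.
have bh := @bm_blowup hat x r^-1 2 hat_continuous hat2.
have := dP r r0 rd; rewrite (intW bh) => h.
have {}h : r^-1 * rint nu (fun y : HT => hat (r^-1 *: ((y : V) - x))) <= `|L| + 1.
  have := ler_norm L; move: h; move: (r^-1 * _) => q; rewrite ler_norml => /andP[? _] ?; lra.
rewrite mulrC -ler_pdivrMl//; apply: le_trans h; rewrite ler_pM2l ?invr_gt0//.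
have mc := measurable_cball x r.
rewrite -rint_indic//; apply: rint_le => [||y]; [exact: bm_indic|exact: bh|].
rewrite indicE; have [/set_mem yx|_] := boolP (y \in _); last by rewrite le_max lexx.
rewrite le_max; apply/orP; right; rewrite normrZ gtr0_norm ?invr_gt0//=.
have : r^-1 * `|(y : V) - x| <= 1 by rewrite ler_pdivrMl// mulr1; exact: yx.
by move: (r^-1 * _) => q; lra.
Qed.

(** Up to sets of density 0, the values of [rho] near [x] are close to [rho x];
the blow-ups of the new current at [x] are then asymptotic to [rho x] times those
of the old one. *)
Lemma approx_tangent_density (x v : V) : approx_tangent_line W t x v ->
  (forall q : rat, ratr q < rho x -> density0 nu [set y | rho y <= ratr q] x) ->
  (forall q : rat, rho x < ratr q -> density0 nu [set y | ratr q <= rho y] x) ->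
  approx_tangent_line W1 (fun x => rho x * t x) x v.
Proof.
move=> tan lo hi f cf sf; have := tan f cf sf.
set Lam := \int[mu]_(y in range (fun r : R => r *: v)) f y => c0.
have [K0 fK0] : exists K0, forall y, `|f y| <= K0.
  have cI : compact (f @` closure [set x | f x != 0]).
    by apply: continuous_compact => //; exact: continuous_subspaceT.
  have [M [_ /(_ (M + 1))]] := compact_bounded cI; rewrite ltrDl => /(_ ltr01) MB.
  exists (Num.max 0 (M + 1)) => y; rewrite le_max.
  have [->|fy] := eqVneq (f y) 0; first by rewrite normr0 lexx.
  by apply/orP; right; apply: MB; exists y => //; exact: subset_closure.
have K00 : 0 <= K0 by exact: le_trans (normr_ge0 _) (fK0 0).
have [K Kp fK] : exists2 K, 0 < K & forall y, f y != 0 -> `|y| <= K.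
  have [M [_ /(_ (`|M| + 1))]] := compact_bounded sf.
  rewrite (le_lt_trans (ler_norm _)) ?ltrDl// => /(_ isT) MB.
  exists (`|M| + 1) => [|y fy]; first by rewrite ltr_wpDl.
  by apply: MB; exact: subset_closure.
pose fl l (y : HT) : R := f (l^-1 *: ((y : V) - x)).
have bfl l : bm (fl l) by exact: bm_blowup fK0.
have [mrho [C Crho]] := brho.
have C0 : 0 <= C by exact: le_trans (normr_ge0 _) (Crho x).
have [A [d0 [A0 d00 Ad]]] := upper_density tan.
pose E l := l^-1 * rint nu (fun y : HT => fl l y * (rho y - rho x)).
have bE l : bm (fun y : HT => fl l y * (rho y - rho x)).
  by apply: (fun h => bmM (bfl l) h); apply: bmB; [exact: brho|exact: bm_cst].
have E0 : E l @[l --> 0^'+] --> (0 : R).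
  apply/cvgr0Pnorm_le => e' e'0.
  pose B := K0 * K * (A + 4 * C) + 1.
  have B0 : 0 < B by rewrite ltr_wpDl// !mulr_ge0 ?addr_ge0 ?mulr_ge0// ltW.
  pose e := e' / B; have e0 : 0 < e by rewrite divr_gt0.
  have [q1] : exists q : rat, rho x - e < ratr q < rho x.
    have h : rho x - e < rho x by rewrite ltrBlDr ltrDl.
    by have [q] := rat_in_itvoo h; rewrite in_itv/= => qP; exists q.
  move=> /andP[q1e q1x].
  have [q2] : exists q : rat, rho x < ratr q < rho x + e.
    have h : rho x < rho x + e by rewrite ltrDl.
    by have [q] := rat_in_itvoo h; rewrite in_itv/= => qP; exists q.
  move=> /andP[q2x q2e].
  have [d1 d10 dP] := lo q1 q1x e e0; have [d2 d20 dQ] := hi q2 q2x e e0.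
  set P : set HT := [set y | rho y <= ratr q1] in dP; set Q : set HT := [set y | ratr q2 <= rho y] in dQ.
  have mP : measurable P.
    rewrite -[X in measurable X]setTI (_ : P = rho @^-1` `]-oo, ratr q1]%classic); first exact: mrho.
    by apply/seteqP; split => y /=; rewrite /P in_itv.
  have mQ : measurable Q.
    rewrite -[X in measurable X]setTI (_ : Q = rho @^-1` `[ratr q2, +oo[%classic); first exact: mrho.
    by apply/seteqP; split => y /=; rewrite /Q /= in_itv/= andbT.
  pose d := Num.min d0 (Num.min d1 d2).
  have dp : 0 < d / K by rewrite divr_gt0// !lt_min d00 d10.
  have main l : 0 < l -> l < d / K -> `|E l| <= e'.
    move=> l0; rewrite ltr_pdivlMr// !lt_min => /and3P[ld0 ld1 ld2].
    have lK0 : 0 < l * K by rewrite mulr_gt0.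
    have mB := measurable_cball x (l * K).
    have bB := bm_indic R mB.
    have bPB := bm_indic R (measurableI _ _ mP mB); have bQB := bm_indic R (measurableI _ _ mQ mB).
    pose g (y : HT) := K0 * (e * \1_(cball x (l * K)) y + 2 * C * (\1_(P `&` cball x (l * K)) y +
      \1_(Q `&` cball x (l * K)) y)).
    have bg1 := bmZ e bB; have bg2 := bmZ (2 * C) (bmD bPB bQB).
    have bg : bm g by exact: (bmZ K0 (bmD bg1 bg2)).
    have le y : `|fl l y * (rho y - rho x)| <= g y.
      have pq0 : 0 <= (\1_(P `&` cball x (l * K)) y : R) by rewrite indicE.
      have qq0 : 0 <= (\1_(Q `&` cball x (l * K)) y : R) by rewrite indicE.
      have [fy0|fy0] := eqVneq (fl l y) 0.
        have bq0 : 0 <= (\1_(cball x (l * K)) y : R) by rewrite indicE.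
        rewrite fy0 mul0r normr0 /g; apply: mulr_ge0 => //; apply: addr_ge0.
          exact: mulr_ge0 (ltW e0) bq0.
        by apply: mulr_ge0; [rewrite mulr_ge0|exact: addr_ge0].
      have yB : cball x (l * K) y.
        have := fK _ fy0; rewrite normrZ gtr0_norm ?invr_gt0//.
        by rewrite ler_pdivrMl.
      rewrite normrM /g; apply: ler_pM => //; first exact: fK0.
      rewrite !indicE !in_setI (mem_set yB) !andbT mulr1.
      have rr : `|rho y - rho x| <= 2 * C.
        by rewrite (le_trans (ler_normB _ _))//; have := Crho y; have := Crho x; lra.
      have C20 : 0 <= 2 * C by rewrite mulr_ge0.
      have [yP|yP] := boolP (y \in P).
        by rewrite mulrDr mulr1; have : 0 <= 2 * C * (y \in Q)%:R :> R by [rewrite mulr_ge0|]; move: rr (ltW e0); lra.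
      have [yQ|yQ] := boolP (y \in Q).
        by rewrite add0r mulr1; move: rr (ltW e0); lra.
      rewrite addr0 mulr0 addr0 ler_norml.
      have nP : ratr q1 < rho y by rewrite ltNge; apply: contra yP => yP; rewrite inE.
      have nQ : rho y < ratr q2 by rewrite ltNge; apply: contra yQ => yQ; rewrite inE.
      by apply/andP; split; lra.
    rewrite /E normrM (gtr0_norm (x := l^-1)) ?invr_gt0// ler_pdivrMl//.
    apply: (le_trans (rint_norm nu (bE l))); apply: (le_trans (rint_le nu (bm_norm (bE l)) bg le)).
    rewrite /g (rintZ nu K0 (bmD bg1 bg2)) (rintD nu bg1 bg2) (rintZ nu e bB) (rintZ nu (2 * C) (bmD bPB bQB)).
    rewrite (rintD nu bPB bQB) !rint_indic//; last 2 first.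
      exact: measurableI.
      exact: measurableI.
    have h0 := Ad _ lK0 ld0; have h1 := dP _ lK0 ld1; have h2 := dQ _ lK0 ld2.
    apply: (@le_trans _ _ (K0 * (e * (A * (l * K)) + 2 * C * (e * (l * K) + e * (l * K))))).
      apply: ler_wpM2l => //; apply: lerD; first by rewrite ler_pM2l.
      by apply: ler_wpM2l; [rewrite mulr_ge0|exact: lerD].
    have -> : K0 * (e * (A * (l * K)) + 2 * C * (e * (l * K) + e * (l * K))) =
      l * (e * (K0 * K * (A + 4 * C))) by ring.
    rewrite ler_pM2l//; apply: (@le_trans _ _ (e * B)); first by rewrite ler_pM2l// lerDl.
    by rewrite /e divfK// gt_eqF.
  near=> l; apply: main; first by near: l; exact: nbhs_right_gt.
  by near: l; exact: nbhs_right_lt.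
have cM : rho x * (l^-1 * \int[mu]_(y in W) (f (l^-1 *: (y - x)) * t y)) @[l --> 0^'+] -->
    rho x * (t x * Lam) by apply: cvgMr; exact: c0.
have := cvgD cM E0; rewrite addr0 mulrA => h.
suff fE : (fun l => l^-1 * \int[mu]_(y in W1) (f (l^-1 *: (y - x)) * (rho y * t y))) =
    (fun l => rho x * (l^-1 * \int[mu]_(y in W) (f (l^-1 *: (y - x)) * t y)) + E l).
  by rewrite fE; exact: h.
apply/funext => l; have e1 := intW1 (bfl l); have e2 := intW (bfl l).
rewrite /fl in e1 e2; rewrite e1 e2 /E mulrCA -mulrDr; congr (_ * _).
rewrite -(rintZ nu (rho x) (bfl l)) -(rintD nu (bmZ (rho x) (bfl l)) (bE l)).
by congr rint; apply/funext => y; rewrite /fl; ring.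
Unshelve. all: by end_near. Qed.

End tangent.

Section rectifiable_splitting.
Context {R : realType} {m : nat}.
Local Notation V := 'rV[R]_m.
Local Notation H := (@hausdorff1 R m).
Local Notation HT := (H1type R m).
Local Notation mu := (H1 R m).

(** The part has the density [rho] of [split_tau].  Almost every point is a point
of density 0 of each set [rho <= q] or [rho >= q], with [q] rational, which does
not contain it; there [approx_tangent_density] applies. *)
Theorem rectifiable_split (T T1 T2 : current1 R m) : rectifiable_current T ->
  current_linear T1 -> current_linear T2 -> (forall w, T w = T1 w + T2 w) ->
  (mass1 T < +oo)%E -> (mass1 T1 + mass1 T2 <= mass1 T)%E ->
  rectifiable_current T1.
Proof.
move=> [W [t [xi [[mW rW] [t0 tloc] [mxi xi1] tan ->]]]] l1 l2 TE Moo M12.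
have [rho [brho rho0 T1E]] := split_tau mW rW t0 tloc mxi xi1 l1 l2 TE Moo M12.
have itW := integrable_tW mW rW t0 tloc mxi xi1 l1 l2 TE Moo.
have itW' : mu.-integrable setT (EFin \o (tW W t \_ setT)) by rewrite patch_setT.
have [mrho _] := brho.
pose nu := tau_measure mW t0 tloc (@measurableT _ HT) itW'.
have mP (q : rat) : measurable ([set y | rho y <= ratr q] : set HT).
  rewrite -[X in measurable X]setTI (_ : [set y | _] = rho @^-1` `]-oo, ratr q]%classic); first exact: mrho.
  by apply/seteqP; split => y /=; rewrite in_itv.
have mQ (q : rat) : measurable ([set y | ratr q <= rho y] : set HT).
  rewrite -[X in measurable X]setTI (_ : [set y | _] = rho @^-1` `[ratr q, +oo[%classic); first exact: mrho.
  by apply/seteqP; split => y /=; rewrite in_itv/= andbT.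
have mr : measurable ([set x | 0 < rho x] : set HT).
  rewrite -[X in measurable X]setTI (_ : [set y | _] = rho @^-1` `]0, +oo[%classic); first exact: mrho.
  by apply/seteqP; split => y /=; rewrite in_itv/= andbT.
have m1 : measurable (W `&` [set x | 0 < rho x] : set HT) by exact: (measurableI _ _ mW mr).
exists (W `&` [set x | 0 < rho x]), (fun x => rho x * t x), xi; split => //.
- split => //; have [Z [g [Z0 lg WZ]]] := rW; exists Z, g; split => //.
  by move=> x [Wx _]; exact: WZ.
- split => [x [Wx rx]|K cK]; first by rewrite mulr_gt0// t0.
  have mK : measurable (K : set HT).
    by apply: Borel_H1; apply: closed_Rn; apply: compact_closed => //; exact: norm_hausdorff.
  have mWK : measurable (W `&` [set x | 0 < rho x] `&` K : set HT) by exact: (measurableI _ _ m1 mK).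
  have i1 := integrable_bm_density (measurable_tW mW tloc) (tW_ge0 t0) itW brho.
  have := @integrableS _ _ _ mu _ _ _ (@measurableT _ HT) mWK (@subsetT _ _) i1.
  apply: eq_integrable => // x /set_mem[[Wx _] _].
  by rewrite /= /tW patchE mem_set.
- split => [|x [Wx _]]; last exact: xi1.
  move=> _ B mB; rewrite -setIA (setIC _ (xi @^-1` B)) setIA.
  exact: (measurableI _ _ (mxi mW B mB) mr).
- pose badP (F : set HT) := [set x | [/\ W x, ~ F x & ~ density0 nu F x]].
  pose N := \bigcup_n (if unpickle n is Some q then
    badP [set y | rho y <= ratr q] `|` badP [set y | ratr q <= rho y] else set0).
  have HN : H N = 0%E.
    apply: H_bigcup0 => n; case: (unpickle n) => [q|]; last exact: outer_measure0.
    by apply: H_U0; apply: density_null.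
  have aeN : {ae mu, forall x, ~ N x} by exact: (H1_null_ae HN).
  apply: (@filterS2 _ _ (ae_filter_ringOfSetsType mu) _ _ _ _ tan aeN) => x tx nN [Wx rx].
  have inN (q : rat) : (badP [set y | rho y <= ratr q] `|` badP [set y | ratr q <= rho y]) x -> N x.
    by move=> b; exists (pickle q); [exact: Logic.I|rewrite pickleK; exact: b].
  have lo (q : rat) : ratr q < rho x -> density0 nu [set y | rho y <= ratr q] x.
    move=> qx; have [dq|nd] := pselect (density0 nu [set y | rho y <= ratr q] x); first exact: dq.
    have nF : ~ (rho x <= ratr q) by apply/negP; rewrite -ltNge.
    exfalso; exact: (nN (inN q (or_introl (And3 Wx nF nd)))).
  have hi (q : rat) : rho x < ratr q -> density0 nu [set y | ratr q <= rho y] x.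
    move=> qx; have [dq|nd] := pselect (density0 nu [set y | ratr q <= rho y] x); first exact: dq.
    have nF : ~ (ratr q <= rho x) by apply/negP; rewrite -ltNge.
    exfalso; exact: (nN (inN q (or_intror (And3 Wx nF nd)))).
  exact: (approx_tangent_density brho rho0 (tx Wx) lo hi).
Qed.

End rectifiable_splitting.

(** * Stair-shaped decompositions *)

Section lower_integral.
Local Open Scope ereal_scope.
Context d (T : measurableType d) (R : realType) (mu : {measure set T -> \bar R}).

(** The integral of a nonnegative function, measurable or not, is a supremum over
the simple functions below it. *)
Lemma integral_le_lower (f F : T -> \bar R) : (forall x, 0 <= F x) ->
  mu.-integrable setT f -> (forall x, f x <= F x) ->
  \int[mu]_x f x <= \int[mu]_x F x.
Proof.
move=> F0 fi fF; have fip := integrable_funepos measurableT fi.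
apply: (@le_trans _ _ (\int[mu]_x (f^\+ x))).
  apply: le_integral => // x _; rewrite funeposE le_max lexx//.
have fp0 x : 0 <= f^\+ x by exact: funepos_ge0.
rewrite !ge0_integralTE//; apply: ge_ereal_sup => _ [h hf <-].
apply: ereal_sup_ubound; exists h => // x; apply: le_trans (hf x) _.
by rewrite funeposE ge_max fF F0.
Qed.

Lemma measure_on (E S1 S2 : set T) : measurable E -> measurable S1 -> measurable S2 ->
  mu (~` E) = 0 -> S1 `&` E = S2 `&` E -> mu S1 = mu S2.
Proof.
move=> mE mS1 mS2 E0 SE.
have h (S : set T) : measurable S -> mu S = mu (S `&` E).
  move=> mS; rewrite -[in LHS](setUIDK S E) measureU//; last 3 first.
  - exact: measurableI.
  - exact: measurableD.
  - by rewrite setDE setIACA setICr setI0.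
  rewrite [X in _ + X](_ : _ = 0) ?adde0//; apply/eqP; rewrite eq_le measure_ge0 andbT.
  rewrite -E0; apply: le_measure; rewrite ?inE; [exact: measurableD|exact: measurableC|].
  by move=> x [].
by rewrite h// SE -h.
Qed.

End lower_integral.

Section staircase.
Variables (M N : option nat) (r c : nat -> nat).
Hypothesis rc : forall k, stair_step M N k -> (r k + c k = k)%N.
Hypothesis mono : forall k, stair_step M N k.+1 -> (r k <= r k.+1)%N /\ (c k <= c k.+1)%N.

Lemma stair_stepW k l : (k <= l)%N -> stair_step M N l -> stair_step M N k.
Proof. by rewrite /stair_step; case: M => [a|]; case: N => [b|]// kl; exact: leq_trans. Qed.

(** Every step is the last one in its row or in its column; the steps which are
the last ones in their rows are those of the first kind. *)
Definition row_end k := stair_step M N k /\ (stair_step M N k.+1 -> r k.+1 = (r k).+1).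
Definition col_end k := stair_step M N k /\ ~ row_end k.

Lemma stair_mono k l : (k <= l)%N -> stair_step M N l -> (r k <= r l)%N /\ (c k <= c l)%N.
Proof.
elim: l => [|l IH]; first by rewrite leqn0 => /eqP ->.
rewrite leq_eqVlt => /predU1P[->//|kl] sl; have [r1 c1] := IH kl (stair_stepW (leqnSn l) sl).
by have [r2 c2] := mono sl; split; [exact: leq_trans r2|exact: leq_trans c2].
Qed.

Lemma row_end_inj k l : row_end k -> row_end l -> r k = r l -> k = l.
Proof.
move=> [sk rk] [sl rl] E; case: (ltngtP k l) => // kl.
- have sk1 := stair_stepW kl sl; have [+ _] := stair_mono kl sl.
  by rewrite rk// E ltnn.
- have sl1 := stair_stepW kl sk; have [+ _] := stair_mono kl sk.
  by rewrite rl// E ltnn.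
Qed.

Lemma col_end_next k : col_end k -> stair_step M N k.+1 /\ c k.+1 = (c k).+1.
Proof.
move=> [sk nk]; have sk1 : stair_step M N k.+1.
  by apply: contrapT => nsk; apply: nk; split => // /nsk.
split=> //; have rn : r k.+1 <> (r k).+1 by move=> E; apply: nk; split.
have [r1 c1] := mono sk1; have e1 := rc sk; have e2 := rc sk1.
have : (r k.+1 + c k.+1 = (r k + c k).+1)%N by rewrite e1 e2.
move: r1; rewrite leq_eqVlt => /predU1P[<- /eqP|r1 e3]; first by rewrite -addnS eqn_add2l => /eqP.
exfalso; apply: rn; apply/eqP; rewrite eqn_leq r1 andbT.
by rewrite -(leq_add2r (c k)) addSn -e3 leq_add2l.
Qed.

Lemma col_end_inj k l : col_end k -> col_end l -> c k = c l -> k = l.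
Proof.
move=> ek el E; have [sk rk] := col_end_next ek; have [sl rl] := col_end_next el.
case: (ltngtP k l) => // kl.
- have [_] := stair_mono kl el.1; by rewrite rk E ltnn.
- have [_] := stair_mono kl ek.1; by rewrite rl E ltnn.
Qed.

End staircase.

Section selection.
Context {R : realType} {m : nat}.
Local Notation V := 'rV[R]_m.
Variables (C : nat -> Prop) (p q : nat -> V).
Hypothesis pinj : forall k l, C k -> C l -> p k = p l -> k = l.

(** The map [p k |-> q k] for [k] in [C], and the identity elsewhere. *)
Definition sel (u : V) : V :=
  if pselect (exists k, C k /\ p k = u) is left e then q (sval (cid e)) else u.

Lemma selE k : C k -> sel (p k) = q k.
Proof.
move=> Ck; rewrite /sel; case: pselect => [e|[]]; last by exists k.
by case: cid => l /= [Cl pl]; rewrite (pinj Cl Ck pl).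
Qed.

Lemma sel_out u : ~ (exists k, C k /\ p k = u) -> sel u = u.
Proof. by rewrite /sel; case: pselect. Qed.

Lemma measurable_sel : measurable_fun setT (sel : Rn R m -> Rn R m).
Proof.
move=> _ B mB; rewrite setTI.
pose D1 k : set (Rn R m) := if `[< C k /\ B (q k) >] then [set p k] else set0.
pose D2 k : set (Rn R m) := if `[< C k >] then [set p k] else set0.
have mD1 k : measurable (D1 k).
  by rewrite /D1; case: ifP => _; [exact: measurable_set1_Rn|exact: measurable0].
have mD2 k : measurable (D2 k).
  by rewrite /D2; case: ifP => _; [exact: measurable_set1_Rn|exact: measurable0].
have -> : sel @^-1` B = \bigcup_k D1 k `|` (B `&` ~` \bigcup_k D2 k).
  apply/seteqP; split => [u /= Bu|u [[k _]|[Bu nD]]].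
  - have [[k [Ck pk]]|ne] := pselect (exists k, C k /\ p k = u).
      left; exists k => //; rewrite /D1 asboolT ?pk//; split => //.
      by rewrite -(selE Ck) pk.
    right; rewrite (sel_out ne) in Bu; split => // -[k _]; rewrite /D2.
    by case: asboolP => // Ck uk; apply: ne; exists k.
  - by rewrite /D1; case: asboolP => // -[Ck Bq] ->; rewrite /= selE.
  - rewrite /= sel_out// => -[k [Ck pk]]; apply: nD; exists k => //.
    by rewrite /D2 asboolT.
apply: measurableU; first exact: bigcupT_measurable.
by apply: measurableI => //; apply: measurableC; exact: bigcupT_measurable.
Qed.

Lemma sel_image (X : set V) : (forall k, C k -> X (q k)) -> sel @` X `<=` X.
Proof.
move=> qX _ [u Xu <-]; rewrite /sel; case: pselect => // e.
by case: cid => k /= [Ck _]; exact: qX.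
Qed.

End selection.

Section curve_integrals.
Context {R : realType} {m : nat}.
Local Notation V := 'rV[R]_m.
Local Notation G := (Gamma R m).
Variable eta : {finite_measure set G -> \bar R}.
Hypothesis sn : {ae eta, forall g : G, simple g /\ nonconstant g}.
Hypothesis ic : forall w : testform R m,
  eta.-integrable setT (fun g : G => (curve_current g w)%:E).

Definition curve_integral : current1 R m := fun w => \int[eta]_g curve_current g w.

Lemma curve_integral_linear : current_linear curve_integral.
Proof.
split=> [w1 w2 w ww|k w1 w ww]; rewrite /curve_integral.
  rewrite -(RintegralD measurableT (ic w1) (ic w2)); congr fine.
  by apply: eq_integral => g _; rewrite (curve_currentD g ww).
rewrite -(RintegralZl k measurableT (ic w1)); congr fine.
by apply: eq_integral => g _; rewrite (curve_currentZ g ww).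
Qed.

Definition source_measure : finite_Borel R m := image_measure eta (@measurable_p0 R m).
Definition target_measure : finite_Borel R m := image_measure eta (@measurable_pinf R m).

Lemma curve_integral_boundary (f : testfun R m) : boundary curve_integral f =
  \int[target_measure]_x f x - \int[source_measure]_x f x.
Proof.
have tf : test f by split; [exact: testfun_smooth|exact: testfun_supp].
have [_ [C fC]] := bm_test tf.
have mf : measurable_fun setT (f : Rn R m -> R).
  by apply: continuous_Rn; exact: smooth_continuous (proj1 tf).
have mE : measurable_fun setT (EFin \o (f : Rn R m -> R)) by exact/measurable_EFinP.
have b0 : bm (fun g : G => f (p0 g)).
  by split; [exact: (measurableT_comp mf (@measurable_p0 R m))|exists C].
have b1 : bm (fun g : G => f (pinf g)).
  by split; [exact: (measurableT_comp mf (@measurable_pinf R m))|exists C].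
have -> : \int[target_measure]_x f x = rint eta (fun g => f (pinf g)).
  rewrite /rint /Rintegral; congr fine.
  exact: (integral_image (@measurable_pinf R m) mE (bm_int eta b1)).
have -> : \int[source_measure]_x f x = rint eta (fun g => f (p0 g)).
  rewrite /rint /Rintegral; congr fine.
  exact: (integral_image (@measurable_p0 R m) mE (bm_int eta b0)).
rewrite -(rintB eta b1 b0) /boundary /curve_integral /rint /Rintegral; congr fine.
have m1 := measurable_int _ (ic (differential f)).
have m2 := measurable_int _ (bm_int eta (bmB b1 b0)).
apply: (@ae_eq_integral _ _ _ eta setT _ _ measurableT m1 m2).
apply: (filterS _ sn) => g [sg ng] _; congr (_%:E).
exact: boundary_curve.
Qed.

Variables (phi : V -> V) (E : set G).
Hypothesis mphi : measurable_fun setT (phi : Rn R m -> Rn R m).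
Hypothesis mE : measurable E.
Hypothesis etaE : eta (~` E) = 0%E.
Hypothesis phiE : forall g, E g -> phi (p0 g) = pinf g.

(** The plan of a graph, read on the curves whose source determines their
target. *)
Lemma curve_plan (B : set (Rn R m * Rn R m)) : measurable B ->
  eta [set g : G | B (p0 g, phi (p0 g))] =
  (\int[eta]_g \d_((p0 g, pinf g) : Rn R m * Rn R m) B)%E.
Proof.
move=> mB; have m0 := @measurable_p0 R m; have m1 := @measurable_pinf R m.
have mS1 : measurable [set g : G | B (p0 g, phi (p0 g))].
  have mp : measurable_fun setT (fun g : G => (p0 g, phi (p0 g)) : Rn R m * Rn R m).
    by apply: measurable_fun_pair => //; exact: (measurableT_comp mphi m0).
  by rewrite -[X in measurable X]setTI; exact: mp.
have mS2 : measurable [set g : G | B (p0 g, pinf g)].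
  have mp : measurable_fun setT (fun g : G => (p0 g, pinf g) : Rn R m * Rn R m).
    exact: measurable_fun_pair.
  by rewrite -[X in measurable X]setTI; exact: mp.
have -> : (\int[eta]_g \d_((p0 g, pinf g) : Rn R m * Rn R m) B)%E =
    (\int[eta]_g (\1_[set g : G | B (p0 g, pinf g)] g)%:E)%E.
  apply: eq_integral => g _; rewrite diracE indicE; congr (_%:R%:E); congr nat_of_bool.
rewrite integral_indic// setIT; apply: (measure_on mE mS1 mS2 etaE).
by apply/seteqP; split => g /= [Bg Eg]; split => //; move: Bg; rewrite (phiE Eg).
Qed.

Lemma curve_transport (B : set (Rn R m)) : measurable B ->
  eta [set g : G | B (phi (p0 g))] = eta [set g : G | B (pinf g)].
Proof.
move=> mB; have m0 := @measurable_p0 R m; have m1 := @measurable_pinf R m.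
apply: (measure_on mE _ _ etaE).
- rewrite -[X in measurable X]setTI; exact: (measurableT_comp mphi m0).
- by rewrite -[X in measurable X]setTI; exact: m1.
by apply/seteqP; split => g /= [Bg Eg]; split => //; move: Bg; rewrite (phiE Eg).
Qed.

End curve_integrals.

Section decomposition_parts.
Context {R : realType} {m : nat}.
Local Notation V := 'rV[R]_m.
Local Notation G := (Gamma R m).
Variables (T : current1 R m) (eta : {finite_measure set G -> \bar R}).
Hypothesis rT : rectifiable_current T.
Hypothesis nT : normal_current T.
Hypothesis sn : {ae eta, forall g : G, simple g /\ nonconstant g}.
Hypothesis ic : is_current_integral T eta.
Hypothesis mT : (mass1 T = \int[eta]_g mass1 (curve_current g))%E.
Variable A : set G.
Hypothesis mA : measurable A.

Let fin (B : set G) : measurable B -> (eta B < +oo)%E.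
Proof. by move=> mB; rewrite ltey_eq fin_num_measure. Qed.

Definition part (B : set G) (mB : measurable B) : {finite_measure set G -> \bar R} :=
  mfrestr mB (fin mB).

Lemma partE B (mB : measurable B) S : part mB S = eta (S `&` B).
Proof. by []. Qed.

Lemma part_le B (mB : measurable B) S : measurable S -> (part mB S <= eta S)%E.
Proof.
move=> mS; rewrite partE; apply: le_measure; rewrite ?inE//; exact: measurableI.
Qed.

Lemma part_ae B (mB : measurable B) (P : G -> Prop) :
  {ae eta, forall g, P g} -> {ae part mB, forall g, P g}.
Proof.
move=> [N [mN N0 PN]]; exists N; split => //.
by apply/eqP; rewrite eq_le measure_ge0 andbT -N0; exact: part_le.
Qed.

Lemma part_integrable B (mB : measurable B) (w : testform R m) :
  (part mB).-integrable setT (fun g : G => (curve_current g w)%:E).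
Proof.
have [iw _] := ic w; apply: integrable_mfrestr; first exact: measurable_int iw.
exact: (integrableS measurableT mB (@subsetT _ B) iw).
Qed.

Lemma part_integral B (mB : measurable B) (w : testform R m) :
  curve_integral (part mB) w = \int[eta]_(g in B) curve_current g w.
Proof.
have [iw _] := ic w; rewrite /curve_integral /Rintegral; congr fine.
apply: integral_mfrestr; first exact: measurable_int iw.
exact: (integrableS measurableT mB (@subsetT _ B) iw).
Qed.

Let mCA : measurable (~` A). Proof. exact: measurableC. Qed.
Local Notation T1 := (curve_integral (part mA)).
Local Notation T2 := (curve_integral (part mCA)).

Lemma part_sum w : T w = T1 w + T2 w.
Proof.
have [iw ->] := ic w; rewrite !part_integral -[in LHS](setUv A).
apply: Rintegral_setU => //; first by rewrite setUv.
by apply/disj_setPS => g [].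
Qed.

Lemma part_linear B (mB : measurable B) : current_linear (curve_integral (part mB)).
Proof. by apply: curve_integral_linear; exact: part_integrable. Qed.

Let Tlin : current_linear T.
Proof.
split=> [w1 w2 w ww|k w1 w ww].
  by rewrite !part_sum ((part_linear mA).1 _ _ _ ww) ((part_linear mCA).1 _ _ _ ww) addrACA.
by rewrite !part_sum ((part_linear mA).2 _ _ _ ww) ((part_linear mCA).2 _ _ _ ww) mulrDr.
Qed.

(** The mass of the boundary is nonnegative, as the zero function shows. *)
Lemma part_mass_fin : (mass1 T < +oo)%E.
Proof.
rewrite ltey; apply/eqP => Too; move: nT; rewrite /normal_current Too.
pose f0 := TestFun (testZ 0 (@bump_test R m 0 0)).1 (testZ 0 (@bump_test R m 0 0)).2.
have : ((boundary T f0)%:E <= mass0 (boundary T))%E.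
  apply: ereal_sup_ubound; exists f0 => // x.
  by rewrite /= mul0r normr0.
by case: (mass0 (boundary T)) => [s||]//=.
Qed.

(** Testing [T1] and [T2] with two forms amounts to testing each curve with one
of the two, according to the part to which it belongs. *)
Lemma part_mass : (mass1 T1 + mass1 T2 <= mass1 T)%E.
Proof.
have m10 := mass1_ge0 (part_linear mA); have m20 := mass1_ge0 (part_linear mCA).
have key (w1 w2 : testform R m) : (forall x, enorm (w1 x) <= 1) -> (forall x, enorm (w2 x) <= 1) ->
    ((T1 w1)%:E + (T2 w2)%:E <= mass1 T)%E.
  move=> h1 h2; rewrite mT.
  have [i1 _] := ic w1; have [i2 _] := ic w2.
  pose f (g : G) : \bar R := (((fun g => (curve_current g w1)%:E) \_ A) g +
    ((fun g => (curve_current g w2)%:E) \_ (~` A)) g)%E.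
  have j1 : eta.-integrable setT ((fun g : G => (curve_current g w1)%:E) \_ A).
    by apply/(integrable_mkcond _ mA); exact: (integrableS measurableT mA (@subsetT _ A) i1).
  have j2 : eta.-integrable setT ((fun g : G => (curve_current g w2)%:E) \_ (~` A)).
    by apply/(integrable_mkcond _ mCA); exact: (integrableS measurableT mCA (@subsetT _ _) i2).
  have fE : (\int[eta]_g f g = (T1 w1)%:E + (T2 w2)%:E)%E.
    rewrite (integralD measurableT j1 j2) -!integral_mkcond !part_integral.
    have k1 := integrableS measurableT mA (@subsetT _ A) i1.
    have k2 := integrableS measurableT mCA (@subsetT _ (~` A)) i2.
    by rewrite /Rintegral !fineK//; exact: integrable_fin_num.
  rewrite -fE; apply: integral_le_lower.
  - move=> g; apply: ereal_sup_ubound; exists (@zero_form R m).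
      by move=> x; rewrite zero_formE enorm0.
    rewrite (@curve_currentZ R m g 0 (@zero_form R m)) ?mul0r// => x.
    by rewrite zero_formE scaler0.
  - exact: integrableD.
  move=> g; rewrite /f !patchE in_setC; case: (g \in A) => /=; rewrite ?adde0 ?add0e.
    exact: mass1_le.
  exact: mass1_le.
have Tfin : mass1 T \is a fin_num by rewrite ge0_fin_numE ?part_mass_fin// (mass1_ge0 Tlin).
have e2 (w2 : testform R m) : (forall x, enorm (w2 x) <= 1) -> (mass1 T1 <= mass1 T - (T2 w2)%:E)%E.
  move=> h2; apply: ge_ereal_sup => _ [w1 h1 <-]; rewrite leeBrDr//; exact: key.
have T1fin : mass1 T1 \is a fin_num.
  rewrite ge0_fin_numE//; apply: le_lt_trans (e2 (@zero_form R m) _) _.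
    by move=> x; rewrite zero_formE enorm0.
  by rewrite -(fineK Tfin) -EFinB ltry.
rewrite addeC -leeBrDr//; apply: ge_ereal_sup => _ [w2 h2 <-].
by rewrite leeBrDr// addeC -leeBrDr//; exact: e2.
Qed.

(** The reverse inequality is the subadditivity of the mass. *)
Lemma part_subcurrents : subcurrent T1 T /\ subcurrent T2 T.
Proof.
have e : (mass1 T1 + mass1 T2 = mass1 T)%E.
  apply/eqP; rewrite eq_le part_mass/=; apply: ge_ereal_sup => _ [w h <-].
  by rewrite part_sum EFinD leeD//; exact: mass1_le.
have TE1 : (T \- T1)%R = T2 by apply/funext => w /=; rewrite part_sum addrAC subrr add0r.
have TE2 : (T \- T2)%R = T1 by apply/funext => w /=; rewrite part_sum addrK.
by split; rewrite /subcurrent ?TE1 ?TE2 -?e// addeC.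
Qed.

Lemma part_rectifiable : rectifiable_current T1 /\ rectifiable_current T2.
Proof.
split; apply: (rectifiable_split rT (T2 := _) _ _ _ part_mass_fin).
- exact: (part_linear mA).
- exact: (part_linear mCA).
- exact: part_sum.
- exact: part_mass.
- exact: (part_linear mCA).
- exact: (part_linear mA).
- by move=> w; rewrite part_sum addrC.
- by rewrite addeC; exact: part_mass.
Qed.

Variables (X : set V) (mum mup : finite_Borel R m).
Hypothesis mX : measurable (X : set (Rn R m)).
Hypothesis mumX : concentrated X mum.
Hypothesis mupX : concentrated X mup.
Hypothesis sE : forall B : set (Rn R m), measurable B -> pushforward eta (@p0 R m : G -> Rn R m) B = mum B.
Hypothesis tE : forall B : set (Rn R m), measurable B -> pushforward eta (@pinf R m : G -> Rn R m) B = mup B.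

Let m0 (B : set (Rn R m)) : measurable B -> measurable ((@p0 R m : G -> Rn R m) @^-1` B).
Proof. by move=> mB; rewrite -[X in measurable X]setTI; exact: measurable_p0. Qed.

Let m1 (B : set (Rn R m)) : measurable B -> measurable ((@pinf R m : G -> Rn R m) @^-1` B).
Proof. by move=> mB; rewrite -[X in measurable X]setTI; exact: measurable_pinf. Qed.

Lemma part_path B (mB : measurable B) : rectifiable_current (curve_integral (part mB)) ->
  transport_path X (source_measure (part mB)) (target_measure (part mB)) (curve_integral (part mB)).
Proof.
move=> rB; have mCX : measurable (~` X : set (Rn R m)) by exact: measurableC.
split => //.
- apply/eqP; rewrite eq_le measure_ge0 andbT -mumX -(sE mCX).
  exact: (part_le mB (m0 mCX)).
- apply/eqP; rewrite eq_le measure_ge0 andbT -mupX -(tE mCX).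
  exact: (part_le mB (m1 mCX)).
- by move=> f; apply: curve_integral_boundary; [exact: part_ae|exact: part_integrable].
Qed.

Let split_eta (S : set G) : measurable S -> eta S = (part mA S + part mCA S)%E.
Proof.
move=> mS; rewrite !partE -[in LHS](setUIDK S A) measureU//.
- exact: measurableI.
- exact: measurableD.
- by rewrite setDE setIACA setICr setI0.
Qed.

Lemma part_source (B : set (Rn R m)) : measurable B ->
  mum B = (source_measure (part mA) B + source_measure (part mCA) B)%E.
Proof. by move=> mB; rewrite -(sE mB); exact: (split_eta (m0 mB)). Qed.

Lemma part_target (B : set (Rn R m)) : measurable B ->
  mup B = (target_measure (part mA) B + target_measure (part mCA) B)%E.
Proof. by move=> mB; rewrite -(tE mB); exact: (split_eta (m1 mB)). Qed.

End decomposition_parts.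

Theorem theorem6p8 (R : realType) (m : nat) (X : set 'rV[R]_m)
  (M N : option nat) (x y : nat -> 'rV[R]_m) (a b : nat -> R)
  (mum mup : finite_Borel R m) (T : current1 R m)
  (X_compact : compact X) (X_convex : convex_set X)
  (xX : forall i, below M i -> X (x i))
  (yX : forall j, below N j -> X (y j))
  (x_distinct : forall i i', below M i -> below M i' -> i <> i' -> x i <> x i')
  (y_distinct : forall j j', below N j -> below N j' -> j <> j' -> y j <> y j')
  (a_gt0 : forall i, below M i -> 0 < a i)
  (b_gt0 : forall j, below N j -> 0 < b j)
  (equal_mass : (\sum_(i <oo | below M i) (a i)%:E =
                 \sum_(j <oo | below N j) (b j)%:E)%E)
  (finite_mass : (\sum_(j <oo | below N j) (b j)%:E < +oo)%E)
  (mumE : is_atomic mum M a x) (mupE : is_atomic mup N b y)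
  (T_stair : stair_shaped_path X M N x y mum mup T) :
  exists (mum1 mum2 mup1 mup2 : finite_Borel R m) (T1 T2 : current1 R m),
    [/\ (forall A : set (Rn R m), measurable A -> mum A = (mum1 A + mum2 A)%E),
        (forall A : set (Rn R m), measurable A -> mup A = (mup1 A + mup2 A)%E),
        T = T1 \+ T2,
        [/\ subcurrent T1 T, subcurrent T2 T,
            transport_path X mum1 mup1 T1 & transport_path X mum2 mup2 T2]
      & exists phi psi : 'rV[R]_m -> 'rV[R]_m,
          [/\ transport_map X mum1 mup1 phi, transport_map X mup2 mum2 psi,
              compatible_map mum1 T1 phi & compatible_map mup2 (\- T2) psi]].

Proof.
have [[mumX mupX mass_eq rT _] [eta [gd sE tE [r [c [stepB rc mono A0]]]]]] := T_stair.
have [nT sn ic [mT _] _] := gd.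
have mX : measurable (X : set (Rn R m)).
  by apply: closed_Rn; apply: compact_closed => //; exact: norm_hausdorff.
pose Gk k : set (Gamma R m) := Gamma_between (x (r k)) (y (c k)).
have mGk k : measurable (Gk k) by exact: measurable_Gamma_between.
pose A : set (Gamma R m) := \bigcup_k (if `[< row_end M N r k >] then Gk k else set0).
have mA : measurable A.
  by apply: bigcupT_measurable => k; case: ifP => _; [exact: mGk|exact: measurable0].
pose F : set (Gamma R m) := \bigcup_k (if `[< stair_step M N k >] then Gk k else set0).
have mF : measurable F.
  by apply: bigcupT_measurable => k; case: ifP => _; [exact: mGk|exact: measurable0].
(* Off [F], a curve has an endpoint which is not an atom or belongs to an entry
of the matrix outside the staircase. *)
pose Dx : set (Rn R m) := \bigcup_i (if below M i then [set x i] else set0).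
pose Dy : set (Rn R m) := \bigcup_j (if below N j then [set y j] else set0).
have mDx : measurable Dx.
  by apply: bigcupT_measurable => i; case: ifP => _; [exact: measurable_set1_Rn|exact: measurable0].
have mDy : measurable Dy.
  by apply: bigcupT_measurable => j; case: ifP => _; [exact: measurable_set1_Rn|exact: measurable0].
have atoms (L : option nat) (w : nat -> R) (z : nat -> 'rV[R]_m) (mu : finite_Borel R m)
    (D : set (Rn R m)) : is_atomic mu L w z -> measurable D -> (forall i, below L i -> D (z i)) ->
    mu (~` D) = 0%E.
  move=> muE mD Dz; rewrite muE; last exact: measurableC.
  rewrite eseries0// => i _ Li; rewrite diracE memNset ?mule0// => nD.
  by apply: nD; exact: Dz.
have Dx0 : mum (~` Dx) = 0%E.
  by apply: (atoms _ _ _ _ _ mumE mDx) => i Mi; exists i => //; rewrite Mi.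
have Dy0 : mup (~` Dy) = 0%E.
  by apply: (atoms _ _ _ _ _ mupE mDy) => j Nj; exists j => //; rewrite Nj.
pose bad i j : set (Gamma R m) := if `[< [/\ below M i, below N j &
  forall k, stair_step M N k -> (i, j) <> (r k, c k)] >] then Gamma_between (x i) (y j) else set0.
have mbad i j : measurable (bad i j).
  by rewrite /bad; case: ifP => _; [exact: measurable_Gamma_between|exact: measurable0].
have bad0 i j : eta (bad i j) = 0%E.
  by rewrite /bad; case: asboolP => [[Mi Nj ij]|_]; [exact: A0|exact: measure0].
have mpre0 (B : set (Rn R m)) : measurable B -> measurable ((@p0 R m : Gamma R m -> Rn R m) @^-1` B).
  by move=> mB; rewrite -[X in measurable X]setTI; exact: measurable_p0.
have mpre1 (B : set (Rn R m)) : measurable B -> measurable ((@pinf R m : Gamma R m -> Rn R m) @^-1` B).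
  by move=> mB; rewrite -[X in measurable X]setTI; exact: measurable_pinf.
have F0 : eta (~` F) = 0%E.
  have n1 : eta.-negligible ((@p0 R m : Gamma R m -> Rn R m) @^-1` (~` Dx)).
    apply/negligibleP; first by apply: mpre0; exact: measurableC.
    by have := sE _ (measurableC mDx); rewrite Dx0.
  have n2 : eta.-negligible ((@pinf R m : Gamma R m -> Rn R m) @^-1` (~` Dy)).
    apply/negligibleP; first by apply: mpre1; exact: measurableC.
    by have := tE _ (measurableC mDy); rewrite Dy0.
  have n3 : eta.-negligible (\bigcup_i \bigcup_j bad i j).
    apply: negligible_bigcup => i; apply: negligible_bigcup => j.
    by apply/negligibleP; [exact: mbad|exact: bad0].
  apply/negligibleP; first exact: measurableC.
  apply: negligibleS (negligibleU (negligibleU n1 n2) n3) => g nFg.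
  apply: contrapT => /not_orP[/not_orP[/contrapT[i _ gi] /contrapT[j _ gj]] nb].
  move: gi gj; case: ifP => // Mi gi; case: ifP => // Nj gj.
  apply: nb; exists i => //; exists j => //; rewrite /bad asboolT//; split => // k sk [ir jc].
  by apply: nFg; exists k => //; rewrite asboolT// /Gk -ir -jc.
have mCA : measurable (~` A) by exact: measurableC.
pose eta1 := part eta mA; pose eta2 := part eta mCA.
pose phi := sel (row_end M N r) (x \o r) (y \o c).
pose psi := sel (col_end M N r) (y \o c) (x \o r).
have xinj k l : row_end M N r k -> row_end M N r l -> (x \o r) k = (x \o r) l -> k = l.
  move=> rk rl /= xx; apply: (row_end_inj mono rk rl); apply: contrapT => E.
  by apply: x_distinct E xx; [have [] := stepB k rk.1|have [] := stepB l rl.1].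
have yinj k l : col_end M N r k -> col_end M N r l -> (y \o c) k = (y \o c) l -> k = l.
  move=> rk rl /= yy; apply: (col_end_inj rc mono rk rl); apply: contrapT => E.
  by apply: y_distinct E yy; [have [] := stepB k rk.1|have [] := stepB l rl.1].
have mphi := measurable_sel (y \o c) xinj; have mpsi := measurable_sel (x \o r) yinj.
have phiX : phi @` X `<=` X.
  by apply: sel_image => k [sk _]; apply: yX; have [] := stepB k sk.
have psiX : psi @` X `<=` X.
  by apply: sel_image => k [sk _]; apply: xX; have [] := stepB k sk.
have phiA g : A g -> phi (p0 g) = pinf g.
  move=> [k _]; case: asboolP => // rk [g0 g1].
  by rewrite g0 g1; exact: (selE (y \o c) xinj rk).
have eta1A : eta1 (~` A) = 0%E by rewrite /eta1 partE setICl measure0.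
pose E2 : set (Gamma R m) := F `&` ~` A.
have mE2 : measurable E2 by exact: measurableI.
have psiE2 g : E2 g -> psi (pinf g) = p0 g.
  move=> [[k _] + nA]; case: asboolP => // sk [g0 g1].
  have ck : col_end M N r k.
    by split => // rk; apply: nA; exists k => //; rewrite asboolT.
  by rewrite g0 g1; exact: (selE (x \o r) yinj ck).
have eta2E : eta2 (~` E2) = 0%E.
  apply/eqP; rewrite /eta2 partE eq_le measure_ge0 andbT -F0.
  apply: le_measure; rewrite ?inE; first by apply: measurableI => //; exact: measurableC.
    exact: measurableC.
  by move=> g [nE nA] Fg; apply: nE.
pose T1 := curve_integral eta1; pose T2 := curve_integral eta2.
exists (source_measure eta1), (source_measure eta2), (target_measure eta1),
  (target_measure eta2), T1, T2.
have [rT1 rT2] := part_rectifiable rT nT ic mT mA.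
have [sT1 sT2] := part_subcurrents nT ic mT mA.
split.
- by move=> B mB; exact: (part_source mA sE mB).
- by move=> B mB; exact: (part_target mA tE mB).
- by apply/funext => w; exact: (part_sum ic mA w).
- split; [exact: sT1|exact: sT2| |].
    exact: (part_path sn ic mX mumX mupX sE tE (mB := mA) rT1).
  exact: (part_path sn ic mX mumX mupX sE tE (mB := mCA) rT2).
(* The reversed curves of the second part carry [- T2]. *)
pose eta' : {finite_measure set (Gamma R m) -> \bar R} := image_measure eta2 (@measurable_rev R m).
pose E' : set (Gamma R m) := (@rev_curve R m : Gamma R m -> Gamma R m) @^-1` E2.
have mE' : measurable E' by rewrite -[X in measurable X]setTI; exact: measurable_rev.
have eta'E (S : set (Gamma R m)) : eta' S = eta2 ((@rev_curve R m : Gamma R m -> Gamma R m) @^-1` S).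
  by [].
have eta'E0 : eta' (~` E') = 0%E.
  rewrite eta'E (_ : _ @^-1` _ = ~` E2)//.
  by apply/seteqP; split => g; rewrite /E' /= rev_curveK.
have psiE' g : E' g -> psi (p0 g) = pinf g.
  by move=> /psiE2; rewrite rev_p0 rev_pinf.
have sn1 := part_ae mA sn; have sn2 := part_ae mCA sn.
exists phi, psi; split.
- split => // B mB; exact: (curve_transport mphi mA eta1A phiA mB).
- split => // B mB.
  have := curve_transport mpsi mE' eta'E0 psiE' mB; rewrite !eta'E.
  move=> h; apply: etrans (etrans h _).
    have E3 : (@pinf R m : Gamma R m -> Rn R m) @^-1` (psi @^-1` B) =
        (@rev_curve R m : Gamma R m -> Gamma R m) @^-1` [set g | B (psi (p0 g))].
      by apply/funext => g; rewrite /preimage /mkset rev_p0.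
    by rewrite -E3.
  by congr (eta2 _); apply/funext => g; rewrite /= rev_pinf.
- exists eta1; split.
  + by apply: filterS sn1 => g [].
  + by move=> w; split; [exact: (part_integrable ic mA w)|].
  + by move=> B mB; exact: (curve_plan mphi mA eta1A phiA mB).
exists eta'; split.
- have [Nn [mNn Nn0 sNn]] := sn2.
  exists ((@rev_curve R m : Gamma R m -> Gamma R m) @^-1` Nn); split.
  + by rewrite -[X in measurable X]setTI; exact: measurable_rev.
  + rewrite eta'E (_ : _ @^-1` _ = Nn)//.
    by apply/seteqP; split => g; rewrite /= rev_curveK.
  + move=> g /= nsg; apply: sNn => /= -[sr _]; apply: nsg.
    by have := rev_simple sr; rewrite rev_curveK.
- have rev_w (w : testform R m) g : curve_current (rev_curve g) w = - curve_current g w.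
    have [sg|nsg] := pselect (simple g); first exact: rev_current.
    rewrite /curve_current !asboolF ?oppr0// => sr; apply: nsg.
    by have := rev_simple sr; rewrite rev_curveK.
  move=> w; have i2 := part_integrable ic mCA w.
  have [iw _] := ic w; have mw := measurable_int _ iw.
  have iN : eta2.-integrable setT ((fun g : Gamma R m => (curve_current g w)%:E) \o
      (@rev_curve R m : Gamma R m -> Gamma R m)).
    rewrite (_ : _ \o _ = fun g : Gamma R m => (- (curve_current g w)%:E)%E); last first.
      by apply/funext => g /=; rewrite rev_w.
    exact: integrableN.
  split; first exact: (integrable_image (@measurable_rev R m) mw iN).
  rewrite /T2 /curve_integral /Rintegral (integral_image (@measurable_rev R m) mw iN) /=.
  rewrite -fineN; congr fine; rewrite -integralN.
    by apply: eq_integral => g _; rewrite /= rev_w.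
  exact: integrable_add_def i2.
- move=> B mB; have := curve_plan mpsi mE' eta'E0 psiE' mB.
  have E3 : (@pinf R m : Gamma R m -> Rn R m) @^-1` ((fun u => (u, psi u)) @^-1` B) =
      (@rev_curve R m : Gamma R m -> Gamma R m) @^-1` [set g | B (p0 g, psi (p0 g))].
    by apply/funext => g; rewrite /preimage /mkset rev_p0.
  move=> <-; rewrite eta'E -E3.
  by [].
Qed.
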